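(* Let $T>0$, $d\in\mathbb{N}$, $\alpha\in(0,1)$ and $p\in(1,+\infty)$ with $\alpha>1/p$. Let $K$ be a closed subgroup of $\exp(W_{[1/\alpha]})$ and $X\in W^\alpha_p([0,T];G^{[1/\alpha]}(\mathbb{R}^d)/K)$. Then there exists a unique rough path lift $\mathbf{X}^*\in\mathcal{A}(X)$ of minimal inhomogeneous Sobolev norm $|||\cdot|||_{W^\alpha_p}$, i.e. $$|||\mathbf{X}^*|||_{W^\alpha_p}\le|||\mathbf{X}|||_{W^\alpha_p}\quad\text{for all }\mathbf{X}\in\mathcal{A}(X).$$ In particular, given a path $X\in W^\alpha_p([0,T];\mathbb{R}^d)$ for $\alpha\in(1/3,1/2)$, there exists a unique rough path lift $\mathbf{X}^*\in\mathcal{A}(X)$ (here $K=\exp(W_2)$ and $G^2(\mathbb{R}^d)/K\cong\mathbb{R}^d$) such that $|||\mathbf{X}^*|||_{W^\alpha_p}\le|||\mathbf{X}|||_{W^\alpha_p}$ for all $\mathbf{X}\in\mathcal{A}(X)$.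
   Context: $[r]$ denotes the largest integer $\le r$. For $N\in\mathbb{N}$, $T^N(\mathbb{R}^d)=\bigoplus_{k=0}^N(\mathbb{R}^d)^{\otimes k}$ is the truncated tensor algebra with product $\otimes$ and bracket $[a,b]=a\otimes b-b\otimes a$, and $\pi_i$ is the projection onto the $i$-th level; $\mathcal{G}^N(\mathbb{R}^d)=W_1\oplus\dots\oplus W_N$ with $W_1=\mathbb{R}^d$, $W_{i+1}=[\mathbb{R}^d,W_i]$, and $G^N(\mathbb{R}^d)=\exp(\mathcal{G}^N(\mathbb{R}^d))$ is the step-$N$ free nilpotent group (product $\otimes$). Every $g\in G^N(\mathbb{R}^d)$ is the step-$N$ signature of some bounded variation path $\gamma:[0,1]\to\mathbb{R}^d$, and the Carnot–Carathéodory norm $\|g\|$ is the infimum of the lengths of such $\gamma$; the metric is $d_{cc}(g,h)=\|g^{-1}\otimes h\|$. For a closed normal subgroup $K$ of $G=G^N(\mathbb{R}^d)$, $\pi_{G,G/K}$ is the canonical homomorphism, and $G/K$ carries the norm $\|gK\|_{G/K}=\inf_{k\in K}\|g\otimes k\|$ and the induced metric $d(x,y)=\|x^{-1}y\|_{G/K}$. For a metric space $(E,d)$, $W^\alpha_p([0,T];E)$ is the set of measurable paths $f:[0,T]\to E$ with $\iint_{[0,T]^2}\frac{d(f(s),f(t))^p}{|t-s|^{\alpha p+1}}\,ds\,dt<\infty$; since $\alpha>1/p$ its elements are taken to be continuous. For a $G^N(\mathbb{R}^d)$-valued path, $\mathbf{X}_{s,t}=\mathbf{X}_s^{-1}\otimes\mathbf{X}_t$.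 With $G=G^{[1/\alpha]}(\mathbb{R}^d)$, the admissible set is $$\mathcal{A}(X)=\{\mathbf{X}\in W^\alpha_p([0,T];G) : \pi_{G,G/K}(\mathbf{X})=X\}.$$ The inhomogeneous Sobolev norm is $$|||\mathbf{X}|||_{W^\alpha_p}=\sum_{i=1}^{[1/\alpha]}\Big(\iint_{[0,T]^2}\frac{|\pi_i(\mathbf{X}_{s,t})|^{p/i}}{|t-s|^{\alpha p+1}}\,ds\,dt\Big)^{i/p},$$ where $|\cdot|$ is the Euclidean norm on $(\mathbb{R}^d)^{\otimes i}$.
   Formalization: When 1/α is an integer, A(X) is assumed nonempty (it can be empty, e.g. α=1/2, K=exp(W_2)); uniqueness of X* means equality of all increments X*_{s,t}, since t↦X*_t⊗k with k∈K is also in A(X) with the same norm. *)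

(* Defs.v *)
From HB Require Import structures.
From mathcomp Require Import all_boot all_order all_algebra.
From mathcomp Require Import all_classical all_reals all_analysis.

Set Implicit Arguments.
Unset Strict Implicit.
Unset Printing Implicit Defensive.
Import Order.TTheory GRing.Theory Num.Theory.
Local Open Scope classical_set_scope.
Local Open Scope ring_scope.

(* T^N(R^d) in coordinates: one coefficient per word of length at most N over
   the alphabet 'I_d.  The words of length i index the canonical basis of
   (R^d)^{(x) i}. *)
Definition tensor (R : realType) (d N : nat) := {ffun N.-bseq 'I_d -> R^o}.

HB.instance Definition _ (R : realType) (d N : nat) :=
  Vector.copy (tensor R d N) {ffun N.-bseq 'I_d -> R^o}.

Section TensorAlgebra.
Context {R : realType} {d N : nat}.
Implicit Types (a b c g h : tensor R d N) (s : seq 'I_d).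

(* Meaningful only when size s <= N. *)
Definition tcoef a s : R := a (insub_bseq N s).

Definition tone : tensor R d N :=
  [ffun w : N.-bseq 'I_d => ((w : seq 'I_d) == [::])%:R : R^o].

(* Concatenation product, truncated above level N. *)
Definition tmul a b : tensor R d N :=
  [ffun w : N.-bseq 'I_d =>
     (\sum_(i < (size w).+1) tcoef a (take i w) * tcoef b (drop i w)) : R^o].

Lemma tcoef_val a (w : N.-bseq 'I_d) : tcoef a w = a w.
Proof. by rewrite /tcoef /insub_bseq valKd. Qed.

Lemma val_insub_bseq s : (size s <= N)%N -> insub_bseq N s = s :> seq 'I_d.
Proof. by move=> sN; rewrite /insub_bseq insubdK. Qed.

Lemma tensorP a b :
  (forall s, (size s <= N)%N -> tcoef a s = tcoef b s) -> a = b.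
Proof.
by move=> eqab; apply/ffunP => w; rewrite -!tcoef_val eqab ?size_bseq.
Qed.

Lemma tcoefD a b s : tcoef (a + b) s = tcoef a s + tcoef b s.
Proof. by rewrite /tcoef ffunE. Qed.

Lemma tcoefZ (k : R) a s : tcoef (k *: a) s = k * tcoef a s.
Proof. by rewrite /tcoef ffunE. Qed.

Lemma tcoef_one s : (size s <= N)%N -> tcoef tone s = (s == [::])%:R.
Proof. by move=> sN; rewrite /tcoef ffunE val_insub_bseq. Qed.

Lemma tcoef_mul a b s : (size s <= N)%N ->
  tcoef (tmul a b) s =
  \sum_(0 <= i < (size s).+1) tcoef a (take i s) * tcoef b (drop i s).
Proof. by move=> sN; rewrite /tcoef ffunE val_insub_bseq // big_mkord. Qed.

Lemma tmulA : associative tmul.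
Proof.
move=> a b c; apply: tensorP => s sN; rewrite !tcoef_mul //.
transitivity (\sum_(0 <= i < (size s).+1) \sum_(0 <= j < (size s).+1 | (i <= j)%N)
   tcoef a (take i s) * tcoef b (drop i (take j s)) * tcoef c (drop j s)).
  apply: eq_big_nat => i /andP[_ iS].
  rewrite tcoef_mul; last by rewrite size_drop (leq_trans (leq_subr _ _) sN).
  rewrite size_drop mulr_sumr [RHS]big_mkcond/=.
  rewrite [RHS](big_cat_nat (n := i)) //=; last exact: ltnW.
  rewrite [X in _ = X + _]big1_seq ?add0r; last first.
    by move=> j /=; rewrite mem_index_iota => /andP[_ ji]; rewrite leqNgt ji.
  have shift F : \sum_(i <= j < (size s).+1) F j =
      \sum_(0 <= j < (size s - i).+1) F (j + i)%N :> R.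
    by rewrite -{1}[i]add0n big_addn subSn.
  rewrite shift; apply: eq_big_nat => k _.
  by rewrite leq_addl mulrA take_drop drop_drop.
rewrite (exchange_big_dep predT) //=; apply: eq_big_nat => j /andP[_ jS].
have szt : size (take j s) = j by rewrite size_takel.
rewrite tcoef_mul ?szt; last exact: leq_trans sN.
rewrite mulr_suml (big_cat_nat (n := j.+1)) //=.
rewrite [X in _ + X]big1_seq ?addr0; last first.
  by move=> i; rewrite mem_index_iota => /andP[ij /andP[ji _]];
     move: ij; rewrite leqNgt ji.
rewrite big_mkcond; apply: eq_big_nat => i /andP[_ ij].
by rewrite -ltnS ij take_takel // -ltnS.
Qed.

Lemma tmul1l : left_id tone tmul.
Proof.
move=> a; apply: tensorP => s sN; rewrite tcoef_mul // big_nat_recl //=.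
rewrite take0 drop0 tcoef_one // eqxx mul1r big1_seq ?addr0 // => i.
rewrite mem_index_iota /= => iS.
rewrite tcoef_one; last by rewrite size_take_min geq_min sN orbT.
by case: s iS {sN} => //= x s _; rewrite mul0r.
Qed.

Lemma tmul1r : right_id tone tmul.
Proof.
move=> a; apply: tensorP => s sN; rewrite tcoef_mul // big_nat_recr //=.
rewrite take_size drop_size tcoef_one // eqxx mulr1 big1_seq ?add0r // => i.
rewrite mem_index_iota /= => iS.
rewrite tcoef_one ?mulr0 ?size_drop //; last exact: leq_trans (leq_subr _ _) sN.
by rewrite -size_eq0 size_drop subn_eq0 leqNgt iS mulr0.
Qed.

Lemma tmulDl : left_distributive tmul +%R.
Proof.
move=> a b c; apply: tensorP => s sN; rewrite tcoefD !tcoef_mul //.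
by rewrite -big_split; apply: eq_bigr => i _; rewrite tcoefD mulrDl.
Qed.

Lemma tmulDr : right_distributive tmul +%R.
Proof.
move=> a b c; apply: tensorP => s sN; rewrite tcoefD !tcoef_mul //.
by rewrite -big_split; apply: eq_bigr => i _; rewrite tcoefD mulrDr.
Qed.

Lemma tone_neq0 : tone != 0.
Proof.
apply/eqP => /ffunP/(_ [bseq]); rewrite !ffunE /= => /eqP.
by rewrite oner_eq0.
Qed.

HB.instance Definition _ := GRing.Zmodule_isNzRing.Build (tensor R d N)
  tmulA tmul1l tmul1r tmulDl tmulDr tone_neq0.

Lemma tscaleAl (k : R) a b : k *: (a * b) = (k *: a) * b.
Proof.
apply: tensorP => s sN; rewrite tcoefZ !tcoef_mul // mulr_sumr.
by apply: eq_bigr => i _; rewrite tcoefZ mulrA.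
Qed.

Lemma tscaleAr (k : R) a b : k *: (a * b) = a * (k *: b).
Proof.
apply: tensorP => s sN; rewrite tcoefZ !tcoef_mul // mulr_sumr.
by apply: eq_bigr => i _; rewrite tcoefZ mulrCA.
Qed.

HB.instance Definition _ :=
  GRing.Lmodule_isLalgebra.Build R (tensor R d N) tscaleAl.
HB.instance Definition _ :=
  GRing.Lalgebra_isAlgebra.Build R (tensor R d N) tscaleAr.

(* Euclidean norm |pi_i(a)| of the level-i component. *)
Definition level_norm (i : nat) a : R :=
  Num.sqrt (\sum_(w : N.-bseq 'I_d | size w == i) (a w : R) ^+ 2).

(* Exponential series; its terms of index above N vanish when the level-0
   component of a is zero. *)
Definition texp a : tensor R d N := \sum_(k < N.+1) (k`!%:R : R)^-1 *: a ^+ k.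

(* Neumann series: the inverse of g when the level-0 component of g is 1
   (see tmulV and tmulVl). *)
Definition tinv g : tensor R d N := \sum_(k < N.+1) (1 - g) ^+ k.

Lemma tcoef_expr0 a k s : tcoef a [::] = 0 -> (size s < k)%N ->
  (size s <= N)%N -> tcoef (a ^+ k) s = 0.
Proof.
move=> a0; elim: k s => // k IH s sk sN; rewrite exprS tcoef_mul //.
apply: big1_seq => i; rewrite mem_index_iota /= ltnS => iS.
case: i iS => [|i] iS; first by rewrite take0 a0 mul0r.
rewrite IH ?mulr0 // size_drop.
  by rewrite -ltnS (leq_trans _ sk) // ltnS ltn_subrL /= (leq_trans _ iS).
exact: leq_trans (leq_subr _ _) sN.
Qed.

Lemma texpr0 a : tcoef a [::] = 0 -> a ^+ N.+1 = 0.
Proof.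
move=> a0; apply: tensorP => s sN.
by rewrite (tcoef_expr0 a0) // /tcoef ffunE.
Qed.

Lemma tcoef_1B g : tcoef g [::] = 1 -> tcoef (1 - g) [::] = 0.
Proof.
by move=> g1; rewrite tcoefD tcoef_one // -scaleN1r tcoefZ g1 mulN1r subrr.
Qed.

Lemma tmulV g : tcoef g [::] = 1 -> g * tinv g = 1.
Proof.
move=> g1; have /eqP := subrX1 (1 - g) N.+1.
rewrite texpr0 ?tcoef_1B // sub0r addrAC subrr sub0r mulNr eqr_opp => /eqP.
by move=> <-.
Qed.

Lemma tmulVl g : tcoef g [::] = 1 -> tinv g * g = 1.
Proof.
move=> g1; rewrite -[RHS](tmulV g1) /tinv mulr_suml mulr_sumr.
apply: eq_bigr => k _; apply: commr_sym; apply: commrX.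
by apply: commrB; [exact: commr1|exact: commr_refl].
Qed.

Definition letter (j : 'I_d) : tensor R d N :=
  [ffun w : N.-bseq 'I_d => ((w : seq 'I_d) == [:: j])%:R : R^o].

Definition level1 (x : 'rV[R]_d) : tensor R d N :=
  \sum_(j < d) x ord0 j *: letter j.

(* [U, V]: the span of all brackets u v - v u; by bilinearity bases suffice. *)
Definition bracketv (U V : {vspace tensor R d N}) : {vspace tensor R d N} :=
  <<[seq u * v - v * u | u <- vbasis U, v <- vbasis V]>>%VS.

(* W_i for i >= 1 (the value at i = 0 is not used). *)
Definition W (i : nat) : {vspace tensor R d N} :=
  let W1 := <<[seq letter j | j <- enum 'I_d]>>%VS in
  iter i.-1 (bracketv W1) W1.

Definition lie_algebra : {vspace tensor R d N} := (\sum_(1 <= i < N.+1) W i)%VS.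

Definition Ggroup : set (tensor R d N) := [set texp a | a in [set` lie_algebra]].

Definition expW (i : nat) : set (tensor R d N) := [set texp a | a in [set` W i]].

End TensorAlgebra.

Section Paths.
Context {R : realType}.

Definition continuous_path (E : Type) (dist : E -> E -> R) (a b : R)
    (f : R -> E) : Prop :=
  forall t : R, t \in `[a, b] -> forall e : R, 0 < e ->
    exists2 r : R, 0 < r &
      forall s : R, s \in `[a, b] -> `|s - t| < r -> dist (f s) (f t) < e.

Definition eucl_norm (d : nat) (x : 'rV[R]_d) : R :=
  Num.sqrt (\sum_(j < d) x ord0 j ^+ 2).

Definition eucl_dist (d : nat) (x y : 'rV[R]_d) : R := eucl_norm (y - x).

(* Euclidean counterpart of numfun.variation and numfun.variations. *)
Definition path_variation (d : nat) (a b : R) (f : R -> 'rV[R]_d)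
    (s : seq R) : R :=
  let F := f \o nth b (a :: s) in \sum_(0 <= n < size s) eucl_norm (F n.+1 - F n).

Definition path_variations (d : nat) (a b : R) (f : R -> 'rV[R]_d) : set R :=
  [set path_variation a b f s | s in itv_partition a b].

Definition path_length (d : nat) (f : R -> 'rV[R]_d) : R :=
  sup (path_variations 0 1 f).

Definition bv_path (d : nat) : set (R -> 'rV[R]_d) :=
  [set f | continuous_path (@eucl_dist d) 0 1 f /\
           has_ubound (path_variations 0 1 f)].

(* v is the Riemann-Stieltjes integral of f against dg over [a, b]. *)
Definition is_RS_integral (f g : R -> R) (a b v : R) : Prop :=
  forall e : R, 0 < e -> exists2 r : R, 0 < r &
    forall (s : seq R) (xi : nat -> R), itv_partition a b s ->
      let x := nth b (a :: s) in
      (forall i, (i < size s)%N ->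
         x i <= xi i <= x i.+1 /\ x i.+1 - x i < r) ->
      `|\sum_(0 <= i < size s) f (xi i) * (g (x i.+1) - g (x i)) - v| < e.

(* g is the step-N signature of f over [0, 1]: the witness S is the signature
   over [0, t], given by the iterated integrals
   S_{s j}(t) = \int_0^t S_s(u) d f_j(u). *)
Definition is_signature (d N : nat) (f : R -> 'rV[R]_d) (g : tensor R d N)
    : Prop :=
  exists S : R -> tensor R d N,
    [/\ forall t : R, t \in `[0, 1] -> tcoef (S t) [::] = 1,
        forall t : R, t \in `[0, 1] -> forall (s : seq 'I_d) (j : 'I_d),
          (size s < N)%N ->
          is_RS_integral (fun u => tcoef (S u) s) (fun u => f u ord0 j) 0 t
            (tcoef (S t) (rcons s j)) &
        S 1 = g].

Definition cc_norm (d N : nat) (g : tensor R d N) : R :=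
  inf [set path_length f | f in [set f | bv_path f /\ is_signature f g]].

Definition cc_dist (d N : nat) (g h : tensor R d N) : R :=
  cc_norm (tinv g * h).

Definition closed_in (E : Type) (dist : E -> E -> R) (H K : set E) : Prop :=
  forall g, H g -> (forall e : R, 0 < e -> exists2 k, K k & dist g k < e) -> K g.

Definition closed_subgroup (d N : nat) (H K : set (tensor R d N)) : Prop :=
  [/\ K `<=` H, K 1,
      forall g h, K g -> K h -> K (g * h),
      forall g, K g -> K (tinv g) &
      closed_in (@cc_dist d N) H K].

(* G/K is the set of cosets gK, so its elements are subsets of G. *)
Definition coset (d N : nat) (K : set (tensor R d N)) (g : tensor R d N) :
    set (tensor R d N) := [set g * k | k in K].

Definition quotient (d N : nat) (K : set (tensor R d N)) :
    set (set (tensor R d N)) := [set coset K g | g in Ggroup].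

(* The elements of the coset gK are the g k, whence
   ||gK|| = inf_(k in K) ||g k||. *)
Definition quotient_norm (d N : nat) (x : set (tensor R d N)) : R :=
  inf [set cc_norm g | g in x].

(* The product x^{-1} y in G/K is the elementwise product of the cosets. *)
Definition quotient_dist (d N : nat) (x y : set (tensor R d N)) : R :=
  quotient_norm [set tinv g * h | g in x & h in y].

Definition double_integral (T b : R) (F : R -> R -> R) : \bar R :=
  (\int[(@lebesgue_measure R) \x (@lebesgue_measure R)]_(z in
      `[0%R, T] `*` `[0%R, T])
    (F z.1 z.2 / `|z.2 - z.1| `^ b)%:E)%E.

(* W^alpha_p([0, T]; (D, dist)), for alpha > 1 / p, so with continuous
   elements; only the restriction of f to [0, T] matters. *)
Definition sobolev (E : Type) (dist : E -> E -> R) (D : set E)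
    (T alpha p : R) : set (R -> E) :=
  [set f | [/\ forall t : R, t \in `[0, T] -> D (f t),
               continuous_path dist 0 T f &
               (double_integral T (alpha * p + 1)%R
                  (fun s t => dist (f s) (f t) `^ p)%R < +oo)%E]].

Definition increment (d N : nat) (X : R -> tensor R d N) (s t : R) :
  tensor R d N := tinv (X s) * X t.

(* Possibly infinite. *)
Definition sobolev_norm (d N : nat) (T alpha p : R) (X : R -> tensor R d N) :
    \bar R :=
  (\sum_(1 <= i < N.+1)
     poweR (double_integral T (alpha * p + 1)%R
              (fun s t => level_norm i (increment X s t) `^ (p / i%:R))%R)
           (i%:R / p)%R)%E.

Definition admissible (d N : nat) (K : set (tensor R d N)) (T alpha p : R)
    (X : R -> set (tensor R d N)) : set (R -> tensor R d N) :=
  [set Y | sobolev (@cc_dist d N) Ggroup T alpha p Y /\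
           forall t : R, t \in `[0, T] -> coset K (Y t) = X t].

Definition minimal_lift (d N : nat) (K : set (tensor R d N)) (T alpha p : R)
    (X : R -> set (tensor R d N)) : set (R -> tensor R d N) :=
  [set Y | admissible K T alpha p X Y /\
           forall Z, admissible K T alpha p X Z ->
             (sobolev_norm T alpha p Y <= sobolev_norm T alpha p Z)%E].

(* A rough path is determined by its increments Y_{s,t}.  The starting point is
   not: if Y lifts X, so does t |-> Y_t k for every k in K contained in
   exp(W_N), which is central, and the two lifts have the same increments. *)
Definition same_rough_path (d N : nat) (T : R) (Y Z : R -> tensor R d N) :
    Prop :=
  forall s t : R, s \in `[0, T] -> t \in `[0, T] ->
    increment Y s t = increment Z s t.

Definition unique_minimal_lift (d N : nat) (K : set (tensor R d N))
    (T alpha p : R) (X : R -> set (tensor R d N)) : Prop :=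
  exists2 Y, minimal_lift K T alpha p X Y &
    forall Z, minimal_lift K T alpha p X Z -> same_rough_path T Z Y.

End Paths.

(* Main.v *)
From HB Require Import structures.
Require Import Defs.
From mathcomp Require Import all_boot all_order all_algebra.
From mathcomp Require Import all_classical all_reals all_analysis.
From mathcomp Require Import measurable_realfun.
From mathcomp Require Import ring lra.
Set Implicit Arguments.
Unset Strict Implicit.
Unset Printing Implicit Defensive.
Import Order.TTheory GRing.Theory Num.Theory.
Local Open Scope classical_set_scope.
Local Open Scope ring_scope.

(** Write N for the integer part of 1 / alpha, q = p / N and a = alpha * p.
    As exp(W_N) = 1 + W_N is central and multiplying by 1 + w adds w, the
    subgroup K acts on lifts by adding elements of a closed additive subgroup
    logK of W_N.  Two lifts of X therefore differ by a continuous path with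
    values in logK ([lift_path]).  A closed subgroup of a vector space is
    discrete transversally to the largest vector space that it contains, so
    the increments of the difference lie in that space [lin] ([path_lin]):
    the lifts of X form an affine space over a vector space of paths w, up to
    constants that leave the increments unchanged.  Adding w changes only the
    level-N components of the increments.  Hence all terms of the Sobolev norm
    but the last are the same for all lifts, and the last is an increasing
    function of the energy
      E(w) = int int |pi_N(Y_{s,t}) + w_t - w_s|^q / |t - s|^(a + 1) ds dt
    of Y + w, where Y is a fixed lift ([lower_normE], [energyE]).

    Since alpha N <= 1 and a > 1, the exponent q exceeds 1, so E is uniformly
    convex ([uniform_convex], [energy_gap]).  A minimizing sequence is Cauchy
    for the seminorm of the differences, hence uniformly in time by an
    inequality of Garsia, Rodemich and Rumsey ([grr], [sup_bound]).  By the
    lemma of Fatou the limit is a minimizer ([minimizer]), and energy_gap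
    applied to two minimizers gives uniqueness ([minimal_from_lift]).  That
    Y + w is a lift when E(w) is finite rests on the comparison of the distance
    of G with the distance of G/K plus |pi_N|^(1/N) ([cc_dist_fibre]), a case
    of the ball-box estimate ([reach_top]).

    There remains the existence of one lift.  When alpha N < 1 it is built on
    dyadic times.  The new point between two neighbours is chosen in its coset
    so that the level-N increment is halved up to the N-th power of distances
    in G/K ([midpoint]).  Passing to the next scale essentially multiplies the
    weighted sum of the q-th powers of these increments by 2^a 2^(-q) < 1, up to
    a summable error ([grid_refine]), and the Sobolev seminorm is controlled by such
    dyadic sums and controls them ([sobolev_dyadic], [dyadic_sobolev]).  So the
    dyadic lift extends to a lift ([lift_exists]).  When 1 / alpha is an
    integer nothing contracts, and the lift is given.

    For the second statement, a Euclidean Sobolev path is one in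
    G^2 / exp(W_2), because exp(x)^-1 exp(y) differs from exp(y - x) by an
    element of W_2 only, and exp(y - x) is reached by a segment ([step2_dist]). *)

(** * The truncated tensor algebra and its group of exponentials *)

Section Graded.
Context {R : realType} {d N : nat}.
Local Notation A := (tensor R d N).
Implicit Types (a b c e g h : A) (s : seq 'I_d).

(** The projection pi_i, seen as an endomorphism of the tensor space. *)
Definition lev (i : nat) a : A :=
  [ffun w : N.-bseq 'I_d => (if size w == i then a w else 0) : R^o].

(** The descending filtration of the algebra.  It is multiplicative and reaches 0
    at level N.+1, which makes every construction by successive levels stop. *)
Definition vanish (k : nat) a : Prop := forall s, (size s < k)%N -> (size s <= N)%N -> tcoef a s = 0.

Lemma tcoef0 s : tcoef (0 : A) s = 0. Proof. by rewrite /tcoef ffunE. Qed.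

Lemma tcoefN a s : tcoef (- a) s = - tcoef a s.
Proof. by rewrite /tcoef ffunE. Qed.

Lemma tcoefB a b s : tcoef (a - b) s = tcoef a s - tcoef b s.
Proof. by rewrite tcoefD tcoefN. Qed.

Lemma tcoef_sum (I : Type) (r : seq I) (P : pred I) (F : I -> A) s :
  tcoef (\sum_(i <- r | P i) F i) s = \sum_(i <- r | P i) tcoef (F i) s.
Proof. by elim/big_rec2: _ => [|i y x _ <-]; rewrite ?tcoef0 ?tcoefD. Qed.

Lemma tcoef_lev i a s : (size s <= N)%N ->
  tcoef (lev i a) s = if size s == i then tcoef a s else 0.
Proof. by move=> sN; rewrite /tcoef ffunE val_insub_bseq. Qed.

Lemma lev_linear i : linear (lev i).
Proof.
move=> k a b; apply: tensorP => s sN.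
by rewrite !(tcoefD, tcoefZ, tcoef_lev) //; case: ifP; rewrite ?mulr0 ?addr0.
Qed.

HB.instance Definition _ i := GRing.isLinear.Build R A A *:%R (lev i) (lev_linear i).

Lemma lev_lev i j a : lev i (lev j a) = if i == j then lev j a else 0.
Proof.
apply: tensorP => s sN; rewrite tcoef_lev //; case: eqP => [<-|si].
  by case: eqP => [|/eqP] //; rewrite ?tcoef0 tcoef_lev // => /negPf ->.
case: eqP => [ij|]; last by rewrite tcoef0.
by rewrite tcoef_lev //; case: eqP => // sj; case: si; rewrite sj ij.
Qed.

Lemma sum_lev a : \sum_(i < N.+1) lev i a = a.
Proof.
apply: tensorP => s sN; rewrite tcoef_sum.
rewrite (bigD1 (Ordinal (sN : (size s < N.+1)%N))) //= tcoef_lev // eqxx.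
rewrite big1 ?addr0 // => i; rewrite tcoef_lev // -val_eqE /= eq_sym => /negPf.
by move->.
Qed.

Lemma tmulE a b s : (size s <= N)%N ->
  tcoef (a * b) s = \sum_(i < (size s).+1) tcoef a (take i s) * tcoef b (drop i s).
Proof. by move=> sN; rewrite tcoef_mul // big_mkord. Qed.

Lemma lev_mul k a b : lev k (a * b) = \sum_(i < k.+1) lev i a * lev (k - i) b.
Proof.
apply: tensorP => s sN; rewrite tcoef_lev // tcoef_sum.
have szd i : (size (drop i s) <= N)%N.
  by rewrite size_drop (leq_trans (leq_subr _ _) sN).
have szt i : (size (take i s) <= N)%N by rewrite size_take_min geq_min sN orbT.
case: (eqVneq (size s) k) => sk.
  subst k; rewrite tmulE //; apply: eq_bigr => i _; rewrite tmulE //.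
  rewrite (bigD1 i) //= big1 ?addr0.
    by rewrite !tcoef_lev // size_takel ?size_drop -1?ltnS // !eqxx.
  move=> j ji; rewrite tcoef_lev // size_takel -1?ltnS //.
  by rewrite val_eqE (negPf ji) mul0r.
rewrite big1 // => i _; rewrite tmulE // big1 // => j _.
rewrite !tcoef_lev // size_takel -1?ltnS //.
case: eqP => [ji|]; last by rewrite mul0r.
case: eqP; rewrite ?mulr0 // size_drop => E.
case/eqP: sk; have := ltn_ord j; have := ltn_ord i; rewrite !ltnS => ik js.
by rewrite -(subnK js) E ji subnK.
Qed.

Lemma vanishD k a b : vanish k a -> vanish k b -> vanish k (a + b).
Proof. by move=> ha hb s sk sN; rewrite tcoefD ha ?hb ?addr0. Qed.

Lemma vanishZ k (x : R) a : vanish k a -> vanish k (x *: a).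
Proof. by move=> ha s sk sN; rewrite tcoefZ ha ?mulr0. Qed.

Lemma vanishN k a : vanish k a -> vanish k (- a).
Proof. by rewrite -scaleN1r; exact: vanishZ. Qed.

Lemma vanishB k a b : vanish k a -> vanish k b -> vanish k (a - b).
Proof. by move=> ha hb; apply: vanishD => //; exact: vanishN. Qed.

Lemma vanish_sum k (I : Type) (r : seq I) (P : pred I) (F : I -> A) :
  (forall i, P i -> vanish k (F i)) -> vanish k (\sum_(i <- r | P i) F i).
Proof.
move=> hF; elim/big_rec: _ => [s _ _|i x Pi hx]; first exact: tcoef0.
by apply: vanishD => //; exact: hF.
Qed.

Lemma vanishW j k a : (j <= k)%N -> vanish k a -> vanish j a.
Proof. by move=> jk ha s sj sN; apply: ha => //; exact: leq_trans jk. Qed.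

Lemma vanish1 a : tcoef a [::] = 0 -> vanish 1 a.
Proof. by move=> a0 [|x s]. Qed.

Lemma vanish_top k a : (N < k)%N -> vanish k a -> a = 0.
Proof.
move=> Nk ha; apply: tensorP => s sN; rewrite tcoef0 ha //.
exact: leq_ltn_trans Nk.
Qed.

Lemma vanishM i j a b : vanish i a -> vanish j b -> vanish (i + j) (a * b).
Proof.
move=> ha hb s sk sN; rewrite tmulE // big1 // => k _.
have ks : (k <= size s)%N by rewrite -ltnS.
case: (ltnP k i) => ki.
  by rewrite ha ?mul0r // size_takel // (leq_trans ks).
rewrite hb ?mulr0 // size_drop ?(leq_trans (leq_subr _ _) sN) //.
by rewrite ltn_subLR // (leq_trans sk) // leq_add2r.
Qed.

Lemma vanishX n k a : vanish k a -> vanish (n * k) (a ^+ n).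
Proof.
move=> ha; elim: n => [|n IH]; first by rewrite mul0n.
by rewrite exprS mulSn; exact: vanishM.
Qed.

Lemma vanishX1 n a : vanish 1 a -> vanish n (a ^+ n).
Proof. by move/(vanishX (n := n)); rewrite muln1. Qed.

Lemma lev_vanish i k a : vanish k a -> (i < k)%N -> lev i a = 0.
Proof.
move=> ha ik; apply: tensorP => s sN; rewrite tcoef_lev // tcoef0.
by case: eqP => // si; rewrite ha // si.
Qed.

Lemma vanish_lev k a : (forall i, (i < k)%N -> lev i a = 0) -> vanish k a.
Proof.
move=> ha s sk sN; have := congr1 (fun x => tcoef x s) (ha _ sk).
by rewrite tcoef_lev // eqxx tcoef0.
Qed.

(** The terms of the product of total index above N are 0 by the filtration, so
    that truncated series multiply like power series. *)
Lemma cauchy_prod (u v : nat -> A) :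
  (forall i, vanish i (u i)) -> (forall i, vanish i (v i)) ->
  (\sum_(i < N.+1) u i) * (\sum_(j < N.+1) v j) =
  \sum_(k < N.+1) \sum_(j < k.+1) u (k - j)%N * v j.
Proof.
move=> hu hv.
pose F i j := if (i + j < N.+1)%N then u i * v j else 0.
transitivity (\sum_(i < N.+1) \sum_(j < N.+1) F i j).
  rewrite mulr_suml; apply: eq_bigr => i _; rewrite mulr_sumr.
  apply: eq_bigr => j _; rewrite /F; case: ltnP => // Nij.
  by apply: (vanish_top Nij); exact: vanishM.
under [RHS]eq_bigr => k _.
  rewrite (eq_bigr (fun j : 'I__ => F (k - j)%N j)); last first.
    by move=> j _; rewrite /F subnK ?ltn_ord // -ltnS.
  over.
rewrite exchange_big /=.
transitivity (\sum_(0 <= j < N.+1) \sum_(0 <= i < N.+1) F i j).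
  by rewrite big_mkord; apply: eq_bigr => j _; rewrite big_mkord.
transitivity (\sum_(0 <= k < N.+1) \sum_(0 <= j < N.+1 | (j <= k)%N) F (k - j)%N j);
  last first.
  rewrite big_mkord; apply: eq_bigr => k _.
  rewrite -(big_mkord (fun _ => true) (fun j => F (k - j)%N j)).
  rewrite (big_nat_widen 0 k.+1 N.+1) //.
rewrite [RHS](exchange_big_dep predT) //=; apply: eq_big_nat => j /andP[_ jN].
rewrite [RHS]big_mkcond /= [RHS](@big_cat_nat _ _ _ j) //=; last exact: ltnW.
rewrite [X in _ = X + _]big_nat_cond [X in _ = X + _]big1 ?add0r; last first.
  by move=> k /andP[/andP[_ kj] _]; rewrite leqNgt kj.
have shift G : \sum_(j <= i < N.+1) G i = \sum_(0 <= i < N.+1 - j) G (i + j)%N :> A.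
  by rewrite -{1}[j]add0n big_addn.
rewrite shift [LHS](@big_cat_nat _ _ _ (N.+1 - j)) ?leq_subr //=.
rewrite [X in _ + X]big_nat_cond [X in _ + X]big1 ?addr0; last first.
  move=> i /andP[/andP[ij _] _]; rewrite /F ltnNge.
  by move: ij; rewrite leq_subLR addnC => ->.
by apply: eq_big_nat => i _; rewrite leq_addl addnK.
Qed.

(** A derivation, by which an exponential can be tested for having a Lie
    logarithm; see [lie_of_logder]. *)
Definition levD a : A := [ffun w : N.-bseq 'I_d => ((size w)%:R * a w) : R^o].

Lemma tcoef_levD a s : (size s <= N)%N -> tcoef (levD a) s = (size s)%:R * tcoef a s.
Proof. by move=> sN; rewrite /tcoef ffunE val_insub_bseq. Qed.

Lemma levD_linear : linear levD.
Proof.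
move=> k a b; apply: tensorP => s sN.
by rewrite !(tcoefD, tcoefZ, tcoef_levD) // mulrDr mulrCA.
Qed.

HB.instance Definition _ := GRing.isLinear.Build R A A *:%R levD levD_linear.

Lemma levDM a b : levD (a * b) = levD a * b + a * levD b.
Proof.
apply: tensorP => s sN; rewrite tcoefD tcoef_levD // !tmulE // -big_split mulr_sumr.
apply: eq_bigr => i _; rewrite /= !tcoef_levD ?size_take_min ?size_drop; last 2 first.
- exact: leq_trans (leq_subr _ _) sN.
- by rewrite geq_min sN orbT.
have /minn_idPl -> : (i <= size s)%N by rewrite -ltnS.
rewrite -{1}(subnKC (_ : i <= size s)%N) -1?ltnS // natrD; ring.
Qed.

Lemma lev_levD i a : lev i (levD a) = i%:R *: lev i a.
Proof.
apply: tensorP => s sN; rewrite tcoefZ !tcoef_lev // tcoef_levD //.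
by case: eqP => [->|]; rewrite ?mulr0.
Qed.

Lemma vanish_levD k a : vanish k a -> vanish k (levD a).
Proof. by move=> ha s sk sN; rewrite tcoef_levD // ha ?mulr0. Qed.

Lemma levD1 a : tcoef (levD a) [::] = 0.
Proof. by rewrite tcoef_levD // mul0r. Qed.

Lemma tcoef0M a b : tcoef (a * b) [::] = tcoef a [::] * tcoef b [::].
Proof. by rewrite tmulE // big_ord_recl big_ord0 addr0. Qed.

(** The right iterated bracket [... [[x, a], a] ..., a]. *)
Fixpoint adn a (x : A) (n : nat) : A :=
  if n is m.+1 then adn a x m * a - a * adn a x m else x.

Lemma vanish_adn a x n k : vanish 1 a -> vanish k x -> vanish (k + n) (adn a x n).
Proof.
move=> ha hx; elim: n => [|n IH] /=; first by rewrite addn0.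
apply: vanishB; first by rewrite addnS -addn1; exact: vanishM.
by rewrite addnS -add1n; exact: vanishM.
Qed.

Lemma mulr_exp_adn a x k :
  x * a ^+ k = \sum_(j < k.+1) 'C(k, j)%:R *: (a ^+ (k - j) * adn a x j).
Proof.
elim: k => [|k IH]; first by rewrite big_ord1 /= scale1r mul1r mulr1.
rewrite exprSr mulrA IH mulr_suml.
have E (j : 'I_k.+1) : 'C(k, j)%:R *: (a ^+ (k - j) * adn a x j) * a =
   'C(k, j)%:R *: (a ^+ (k - j) * adn a x j.+1) +
   'C(k, j)%:R *: (a ^+ (k.+1 - j) * adn a x j).
  rewrite -scalerDr -scalerAl; congr (_ *: _).
  rewrite /= subSn -1?ltnS // exprSr -!mulrA -mulrDr subrK.
  by [].
rewrite (eq_bigr _ (fun j _ => E j)) big_split /= [RHS]big_ord_recl /=.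
rewrite [X in _ + X]big_ord_recl /= [in RHS](eq_bigr (fun j : 'I_k.+1 =>
   'C(k, j)%:R *: (a ^+ (k - j) * adn a x j.+1) +
   'C(k, j.+1)%:R *: (a ^+ (k - j) * adn a x j.+1))); last first.
  by move=> j _; rewrite /bump /= binS natrD scalerDl addrC subSS.
rewrite big_split /= addrCA; congr (_ + _).
  by rewrite !bin0 .
rewrite [X in _ = _ + X]big_ord_recr /= bin_small // scale0r addr0.
by congr (_ + _); apply: eq_bigr => j _; rewrite /bump /= subSS.
Qed.

Lemma texp_coef0 a : tcoef a [::] = 0 -> tcoef (texp a) [::] = 1.
Proof.
move=> a0; rewrite /texp tcoef_sum big_ord_recl /= tcoefZ expr0 tcoef_one //= invr1 mul1r.
rewrite big1 ?addr0 // => i _; rewrite tcoefZ.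
by rewrite (vanishX1 (vanish1 a0)) ?mulr0.
Qed.

Lemma texp0 : texp (0 : A) = 1.
Proof.
rewrite /texp big_ord_recl /= expr0 big1 ?addr0.
  by rewrite invr1 scale1r.
by move=> i _; rewrite exprS mul0r scaler0.
Qed.

Lemma fact_neq0 n : (n`!%:R : R) != 0.
Proof. by rewrite pnatr_eq0 -lt0n fact_gt0. Qed.

Lemma invf_bin k j : (j <= k)%N ->
  (k`!%:R : R)^-1 * 'C(k, j)%:R = ((k - j)`!%:R)^-1 * (j`!%:R)^-1.
Proof.
move=> jk; rewrite -(bin_fact jk) !natrM.
have := fact_neq0 j; have := fact_neq0 (k - j).
have : ('C(k, j)%:R : R) != 0 by rewrite pnatr_eq0 -lt0n bin_gt0.
by move=> h1 h2 h3; field; rewrite h1 h2 h3.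
Qed.

(** This is exp(-a) x exp(a) = exp(-ad a) x, which keeps conjugates inside a
    bracket-closed space. *)
Lemma mulr_texp a x : tcoef a [::] = 0 ->
  x * texp a = texp a * \sum_(j < N.+1) (j`!%:R : R)^-1 *: adn a x j.
Proof.
move=> /vanish1 a0; rewrite /texp.
rewrite (cauchy_prod (u := fun k => (k`!%:R : R)^-1 *: a ^+ k)
  (v := fun j => (j`!%:R : R)^-1 *: adn a x j)); last 2 first.
- by move=> i; apply: vanishZ; exact: vanishX1.
- by move=> i; apply: vanishZ; rewrite -[X in vanish X _]add0n; exact: vanish_adn.
rewrite mulr_sumr; apply: eq_bigr => k _.
rewrite -scalerAr mulr_exp_adn scaler_sumr; apply: eq_bigr => j _.
by rewrite scalerA -scalerAl -scalerAr scalerA invf_bin // -ltnS.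
Qed.

Lemma texpD a b : tcoef a [::] = 0 -> tcoef b [::] = 0 -> a * b = b * a ->
  texp (a + b) = texp a * texp b.
Proof.
move=> /vanish1 a0 /vanish1 b0 ab; rewrite {2 3}/texp.
rewrite (cauchy_prod (u := fun k => (k`!%:R : R)^-1 *: a ^+ k)
  (v := fun k => (k`!%:R : R)^-1 *: b ^+ k)); last 2 first.
- by move=> i; apply: vanishZ; exact: vanishX1.
- by move=> i; apply: vanishZ; exact: vanishX1.
apply: eq_bigr => k _; rewrite exprDn_comm // scaler_sumr; apply: eq_bigr => j _.
rewrite -[_ *+ 'C(k, j)]scaler_nat scalerA -scalerAl -scalerAr scalerA invf_bin //.
by rewrite -ltnS.
Qed.

Lemma texpNV a : tcoef a [::] = 0 -> texp (- a) * texp a = 1.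
Proof.
move=> a0; rewrite -texpD ?tcoefN ?a0 ?oppr0 //; last by rewrite mulNr mulrN.
by rewrite addNr texp0.
Qed.

Lemma tinv_uniq g h : tcoef g [::] = 1 -> g * h = 1 -> tinv g = h.
Proof.
by move=> g1 gh; rewrite -[h]mul1r -(tmulVl g1) -mulrA gh mulr1.
Qed.

Lemma tinv_texp a : tcoef a [::] = 0 -> tinv (texp a) = texp (- a).
Proof.
move=> a0; apply: tinv_uniq; first exact: texp_coef0.
by rewrite -{1}[a]opprK texpNV // tcoefN a0 oppr0.
Qed.

Lemma tcoef_tinv g : tcoef g [::] = 1 -> tcoef (tinv g) [::] = 1.
Proof.
move=> g1; have := congr1 (fun x => tcoef x [::]) (tmulV g1).
by rewrite /= tcoef0M g1 mul1r tcoef_one.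
Qed.

Lemma tinv_mul g h : tcoef g [::] = 1 -> tcoef h [::] = 1 ->
  tinv (g * h) = tinv h * tinv g.
Proof.
move=> g1 h1; apply: tinv_uniq; first by rewrite tcoef0M g1 h1 mul1r.
by rewrite mulrA -(mulrA g) tmulV // mulr1 tmulV.
Qed.

Lemma tinvK g : tcoef g [::] = 1 -> tinv (tinv g) = g.
Proof. by move=> g1; apply: tinv_uniq; rewrite ?tcoef_tinv // tmulVl. Qed.

Lemma levDX a k : levD (a ^+ k.+1) =
  \sum_(j < k.+1) 'C(k.+1, j.+1)%:R *: (a ^+ (k - j) * adn a (levD a) j).
Proof.
elim: k => [|k IH]; first by rewrite big_ord1 /= scale1r mul1r.
rewrite exprSr levDM IH mulr_suml.
have E (j : 'I_k.+1) : 'C(k.+1, j.+1)%:R *: (a ^+ (k - j) * adn a (levD a) j) * a =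
   'C(k.+1, j.+1)%:R *: (a ^+ (k - j) * adn a (levD a) j.+1) +
   'C(k.+1, j.+1)%:R *: (a ^+ (k.+1 - j) * adn a (levD a) j).
  rewrite -scalerDr -scalerAl; congr (_ *: _).
  rewrite /= subSn -1?ltnS // exprSr -!mulrA -mulrDr subrK.
  by [].
rewrite (eq_bigr _ (fun j _ => E j)) big_split /= [RHS]big_ord_recl /= subn0.
rewrite [X in _ + X + _]big_ord_recl /= [in RHS](eq_bigr (fun j : 'I_k.+1 =>
   'C(k.+1, j.+1)%:R *: (a ^+ (k - j) * adn a (levD a) j.+1) +
   'C(k.+1, j.+2)%:R *: (a ^+ (k - j) * adn a (levD a) j.+1))); last first.
  by move=> j _; rewrite /bump /= binS natrD scalerDl addrC subSS.
rewrite big_split /= subn0 -[LHS]addrA [RHS]addrCA; congr (_ + _).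
rewrite -[LHS]addrA [X in _ + X]addrC addrA; congr (_ + _).
  by rewrite !bin1 -[X in _ + X]scale1r -scalerDl natr1.
rewrite [RHS]big_ord_recr /= bin_small // scale0r addr0.
by apply: eq_bigr => j _; rewrite /bump /= subSS.
Qed.

Lemma levD1_0 : levD 1 = 0.
Proof.
apply: tensorP => s sN; rewrite tcoef_levD // tcoef_one // tcoef0.
by case: s sN => [|x s] sN; rewrite ?mul0r //= mulr0.
Qed.

(** The classical formula for the logarithmic derivative of the exponential. *)
Lemma levD_texp a : tcoef a [::] = 0 ->
  levD (texp a) = texp a * \sum_(j < N.+1) (j.+1`!%:R : R)^-1 *: adn a (levD a) j.
Proof.
move=> /vanish1 a0; have D0 : vanish 1 (levD a) by exact: vanish_levD.
rewrite [in RHS]/texp (cauchy_prod (u := fun k => (k`!%:R : R)^-1 *: a ^+ k)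
  (v := fun j => (j.+1`!%:R : R)^-1 *: adn a (levD a) j)); last 2 first.
- by move=> i; apply: vanishZ; exact: vanishX1.
- move=> i; apply: vanishZ; apply: (@vanishW _ (1 + i)) => //.
  exact: vanish_adn.
transitivity (levD (\sum_(k < N.+2) (k`!%:R : R)^-1 *: a ^+ k)).
  rewrite [in RHS]big_ord_recr /= [X in _ + _ *: X](@vanish_top N.+1) ?scaler0 ?addr0 //.
  exact: vanishX1.
rewrite linear_sum big_ord_recl /= linearZ /= expr0 levD1_0 scaler0 add0r.
apply: eq_bigr => k _; rewrite linearZ /= /bump /= add1n levDX scaler_sumr.
apply: eq_bigr => j _; rewrite scalerA invf_bin ?ltnS -1?ltnS //.
by rewrite subSS -scalerAl -scalerAr scalerA.
Qed.

(** To first order in the filtration, the exponential is a translation.  Hence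
    logarithms can be built and compared one level at a time. *)
Lemma vanish_texp_add k a e : vanish 1 a -> vanish k e -> (0 < k)%N ->
  vanish k.+1 (texp (a + e) - texp a - e).
Proof.
move=> a1 ek k0.
have e1 : vanish 1 e by exact: vanishW ek.
have H n : vanish (n + k) ((a + e) ^+ n.+1 - a ^+ n.+1).
  elim: n => [|n IH]; first by rewrite !expr1 addrAC subrr add0r.
  rewrite exprS mulrDl [a ^+ _.+2]exprS addrAC -mulrBr; apply: vanishD.
    by rewrite -add1n -addnA; exact: vanishM.
  rewrite addnC; apply: vanishM => //; apply: vanishX1; exact: vanishD.
rewrite /texp -sumrB big_ord_recl /= !expr0 subrr add0r.
rewrite -(big_mkord xpredT (fun i => (i.+1`!%:R : R)^-1 *: (a + e) ^+ i.+1 -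
  (i.+1`!%:R : R)^-1 *: a ^+ i.+1)).
case: (posnP N) => [N0|N0].
  by rewrite big_geq ?N0 // (@vanish_top k e) ?N0 // subrr => s _ _; exact: tcoef0.
rewrite big_ltn // !expr1 invr1 !scale1r [a + e]addrC addrK addrAC subrr add0r.
rewrite big_nat_cond; apply: vanish_sum => -[//|i] _.
rewrite -scalerBr; apply: vanishZ.
by rewrite [e + a]addrC; apply: vanishW (H _); rewrite addSn ltnS leq_addl.
Qed.

(** Adding to a the error g - texp a corrects one more level. *)
Lemma texp_surj g : tcoef g [::] = 1 -> exists2 a, tcoef a [::] = 0 & texp a = g.
Proof.
move=> g1.
suff H k : exists2 a, tcoef a [::] = 0 & vanish k.+1 (g - texp a).
  have [a a0 /(vanish_top (ltnSn N))/eqP] := H N.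
  by rewrite subr_eq0 => /eqP ->; exists a.
elim: k => [|k [a a0 H]].
  exists 0; first exact: tcoef0.
  by apply: vanish1; rewrite texp0 tcoefB g1 tcoef_one // subrr.
exists (a + (g - texp a)); first by rewrite tcoefD a0 H ?addr0.
have := vanish_texp_add (vanish1 a0) H isT.
move=> /vanishN; rewrite [X in vanish _ X](_ : _ = g - texp (a + (g - texp a))) //.
by rewrite !opprB; rewrite addrA subrK.
Qed.

Lemma vanish_log k a : tcoef a [::] = 0 -> vanish k (texp a - 1) -> vanish k a.
Proof.
move=> a0 H; elim: k H => // k IH H.
case: k IH H => [|k] IH H; first exact: vanish1.
have ak : vanish k.+1 a by apply: IH; exact: vanishW H.
have z1 : vanish 1 (0 : A) by move=> s _ _; exact: tcoef0.
have := vanish_texp_add z1 ak isT; rewrite add0r texp0 => /vanishN/vanishD/(_ H).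
by rewrite opprB addrNK.
Qed.

Lemma bracketv_ind (U V T : {vspace A}) :
  (forall u v, u \in U -> v \in V -> u * v - v * u \in T) -> (bracketv U V <= T)%VS.
Proof.
move=> H; apply/span_subvP => x /allpairsP[[u v] /= [uU vV ->]].
by apply: H; exact: vbasis_mem.
Qed.

Lemma mem_bracketv (U V : {vspace A}) u v : u \in U -> v \in V ->
  u * v - v * u \in bracketv U V.
Proof.
move=> /coord_vbasis -> /coord_vbasis ->.
rewrite mulr_suml mulr_sumr -sumrB; apply: memv_suml => i _.
rewrite mulr_sumr mulr_suml -sumrB; apply: memv_suml => j _.
rewrite -!scalerAl -!scalerAr !scalerA [X in _ - X *: _]mulrC -scalerBr.
apply: memvZ; apply: memv_span; apply/allpairsP.
by exists ((vbasis U)`_i, (vbasis V)`_j); rewrite /= !mem_nth ?size_tuple.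
Qed.

Local Notation Wd := (@W R d N).

Lemma lev_letter j : lev 1 (letter j) = letter j :> A.
Proof.
apply: tensorP => s sN; rewrite tcoef_lev // /tcoef ffunE val_insub_bseq //.
by case: s sN => [|x [|y s]] sN //=; case: eqP.
Qed.

Lemma WS i : Wd i.+2 = bracketv (Wd 1) (Wd i.+1).
Proof. by []. Qed.

Lemma W_homog i u : (0 < i)%N -> u \in Wd i -> lev i u = u.
Proof.
case: i => // i _; pose H k := fixedSpace (linfun (lev k : A -> A)).
have HP k v : (v \in H k) = (lev k v == v).
  by apply/fixedSpaceP/eqP; rewrite lfunE.
have H1 : (Wd 1 <= H 1%N)%VS.
  apply/span_subvP => x /mapP[j _ ->]; rewrite HP; apply/eqP; exact: lev_letter.
suff: (Wd i.+1 <= H i.+1)%VS by move=> /subvP/[apply]; rewrite HP => /eqP.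
elim: i => [//|i IH]; rewrite WS; apply: bracketv_ind => x y /(subvP H1) + /(subvP IH).
rewrite !HP => /eqP x1 /eqP y1; apply/eqP.
have P a b j k : lev j a = a -> lev k b = b -> lev (j + k) (a * b) = a * b.
  move=> ha hb; rewrite lev_mul.
  have jk : (j < (j + k).+1)%N by rewrite ltnS leq_addr.
  rewrite (bigD1 (Ordinal jk)) //= addKn ha hb big1 ?addr0 // => l.
  rewrite -val_eqE /= => lj; rewrite -ha lev_lev.
  by rewrite (negPf lj) mul0r.
by rewrite linearB /= -[X in lev X (x * y)]add1n -[X in lev X (y * x)]addn1 !P.
Qed.

Definition comm y : A -> A := fun z => z * y - y * z.

Lemma comm_linear y : linear (comm y).
Proof.
move=> k a b; rewrite /comm mulrDl mulrDr scalerBr -scalerAl -scalerAr.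
by rewrite opprD addrACA.
Qed.

HB.instance Definition _ y := GRing.isLinear.Build R A A *:%R (comm y) (comm_linear y).

Lemma bracketv_preim (U V T : {vspace A}) y :
  (forall u v, u \in U -> v \in V -> comm y (u * v - v * u) \in T) ->
  forall x, x \in bracketv U V -> comm y x \in T.
Proof.
move=> H x; suff /subvP/[apply] : (bracketv U V <= linfun (comm y) @^-1: T)%VS.
  by rewrite -memv_preim lfunE.
by apply: bracketv_ind => u v uU vV; rewrite -memv_preim lfunE; exact: H.
Qed.

(** The Jacobi identity. *)
Lemma comm_jacobi (x y z : A) :
  (x * y - y * x) * z - z * (x * y - y * x) =
  x * (y * z - z * y) - (y * z - z * y) * x
  - (y * (x * z - z * x) - (x * z - z * x) * y).
Proof.
rewrite !mulrBr !mulrBl !mulrA.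
by apply: tensorP => s _; rewrite !tcoefB; ring.
Qed.

(** As W_(i + 1) only contains brackets with W_1, the general bracket is obtained
    by induction on i through the Jacobi identity. *)
Lemma W_bracket i j x y : (0 < i)%N -> (0 < j)%N ->
  x \in Wd i -> y \in Wd j -> x * y - y * x \in Wd (i + j).
Proof.
case: i => // i _; case: j => // j _.
elim: i j x y => [|i IH] j x y.
  by rewrite add1n; exact: mem_bracketv.
move=> xi yj; rewrite -/(comm y x); move: xi; rewrite WS.
apply: bracketv_preim => u v u1 vi; rewrite /comm comm_jacobi; apply: memvB.
  by rewrite !addSn WS; apply: mem_bracketv => //; exact: IH.
by rewrite addSnnS; apply: IH => //; rewrite WS; exact: mem_bracketv.
Qed.

Local Notation lie := (@lie_algebra R d N).

Lemma lieE : lie = (\sum_(i < N) Wd i.+1)%VS.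
Proof. by rewrite /lie_algebra big_add1 big_mkord. Qed.

(** The W_i are homogeneous, so their sum is direct and is tested level by
    level. *)
Lemma lieP a : reflect (tcoef a [::] = 0 /\ forall i, (0 < i)%N -> lev i a \in Wd i)
  (a \in lie).
Proof.
have levW i j v : (0 < i)%N -> v \in Wd i -> lev j v = if j == i then v else 0.
  by move=> i0 vi; rewrite -(W_homog i0 vi) lev_lev.
rewrite lieE; apply: (iffP memv_sumP) => [[v vW ->]|[a0 aW]]; last first.
  exists (fun i => lev (nat_of_ord i).+1 a) => [i _|]; first exact: aW.
  rewrite -{1}(sum_lev a) big_ord_recl [X in X + _](@lev_vanish _ 1) ?add0r //.
  exact: vanish1.
split=> [|i i0].
  rewrite tcoef_sum big1 // => i _; rewrite -(W_homog _ (vW i isT)) //.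
  by rewrite tcoef_lev.
rewrite linear_sum; apply: memv_suml => j _ /=; rewrite (levW j.+1) ?vW //.
by case: eqP => [->|_]; [exact: vW|exact: mem0v].
Qed.

Lemma lie0 a : a \in lie -> tcoef a [::] = 0.
Proof. by case/lieP. Qed.

Lemma lie_bracket x y : x \in lie -> y \in lie -> x * y - y * x \in lie.
Proof.
move=> /lieP[x0 xW] /lieP[y0 yW]; apply/lieP; split=> [|k k0].
  by rewrite tcoefB !tcoef0M x0 y0 !mul0r subrr.
have Z : forall a, tcoef a [::] = 0 -> lev 0 a = 0.
  by move=> a /vanish1 ha; exact: lev_vanish ha _.
rewrite linearB /= !lev_mul [X in _ - X](reindex_inj rev_ord_inj) /= -sumrB.
apply: memv_suml => i _; rewrite subSS subKn -1?ltnS //.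
have [->|i0] := posnP i; first by rewrite Z // mul0r mulr0 subrr mem0v.
have [ki|ki] := posnP (k - i); first by rewrite ki [lev 0 y]Z // mul0r mulr0 subrr mem0v.
rewrite -[X in Wd X](subnKC (_ : i <= k)%N) -1?ltnS //.
by apply: W_bracket => //; [exact: xW|exact: yW].
Qed.

Lemma lie_adn a x n : a \in lie -> x \in lie -> adn a x n \in lie.
Proof. by move=> al xl; elim: n => //= n IH; exact: lie_bracket. Qed.

Lemma lie_levD a : a \in lie -> levD a \in lie.
Proof.
move=> /lieP[a0 aW]; apply/lieP; split=> [|i i0]; first exact: levD1.
by rewrite lev_levD; apply: memvZ; exact: aW.
Qed.

Lemma lie_logder a : a \in lie -> texp (- a) * levD (texp a) \in lie.
Proof.
move=> al; rewrite levD_texp ?lie0 // mulrA texpNV ?lie0 // mul1r.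
by apply: memv_suml => j _; apply: memvZ; apply: lie_adn => //; exact: lie_levD.
Qed.

Lemma lie_conj a x : a \in lie -> x \in lie -> texp (- a) * x * texp a \in lie.
Proof.
move=> al xl; rewrite -mulrA mulr_texp ?lie0 // mulrA texpNV ?lie0 // mul1r.
by apply: memv_suml => j _; apply: memvZ; exact: lie_adn.
Qed.

Lemma vanish_adnB k a b n : vanish 1 a -> vanish 1 b -> vanish k (a - b) ->
  vanish (k + n) (adn a (levD a) n - adn b (levD b) n).
Proof.
move=> a1 b1 ab; elim: n => [|n IH] /=.
  by rewrite addn0 -linearB; exact: vanish_levD.
set u := adn a _ n in IH *; set v := adn b _ n in IH *.
have v1 : vanish n.+1 v by rewrite -add1n; apply: vanish_adn => //; exact: vanish_levD.
have -> : u * a - a * u - (v * b - b * v) =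
   ((u - v) * a - a * (u - v)) + (v * (a - b) - (a - b) * v).
  rewrite !mulrBr !mulrBl; apply: tensorP => s _.
  by rewrite !(tcoefD, tcoefN); ring.
apply: vanishD; apply: vanishB.
- by rewrite addnS -addn1; exact: vanishM.
- by rewrite addnS -add1n; exact: vanishM.
- by rewrite addnC; apply: vanishM => //; exact: vanishW v1.
- by rewrite addnS -addnS; apply: vanishM.
Qed.

(** The criterion of Dynkin.  At level k the logarithmic derivative is k times
    lev k a plus brackets of lower levels of a, which are Lie by induction. *)
Lemma lie_of_logder a : tcoef a [::] = 0 -> texp (- a) * levD (texp a) \in lie ->
  a \in lie.
Proof.
move=> a0; rewrite levD_texp // mulrA texpNV // mul1r => /lieP[_ H].
have a1 := vanish1 a0.
apply/lieP; split=> // k; elim/ltn_ind: k => k IH k0.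
pose b := \sum_(i < k) lev i a.
have bl : b \in lie.
  apply/lieP; split=> [|i i0].
    by rewrite tcoef_sum big1 // => i _; rewrite tcoef_lev //; case: ifP.
  rewrite linear_sum; apply: memv_suml => j _ /=; rewrite lev_lev.
  by case: eqP => [ij|_]; [rewrite -ij; apply: IH; rewrite // ij|exact: mem0v].
have b1 : vanish 1 b by apply: vanish1; exact: lie0.
have ab : vanish k (a - b).
  apply: vanish_lev => i ik; rewrite linearB linear_sum /= (bigD1 (Ordinal ik)) //=.
  rewrite lev_lev eqxx big1 ?addr0 ?subrr // => j.
  by rewrite -val_eqE /= lev_lev eq_sym => /negPf ->.
have := H k k0; rewrite big_ord_recl /= invr1 scale1r linearD /= lev_levD.
set S := (X in _ + lev k X).
have SW : lev k S \in Wd k.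
  rewrite linear_sum; apply: memv_suml => j _ /=; rewrite linearZ /=; apply: memvZ.
  rewrite -[X in lev k X](subrK (adn b (levD b) (bump 0 j))) linearD /=.
  rewrite [X in X + _](@lev_vanish _ k.+1) ?add0r //.
    by have /lieP[_] := lie_adn (bump 0 j) bl (lie_levD bl); apply.
  rewrite add0n; have := @vanish_adnB k a b j.+1 a1 b1 ab.
  by apply: vanishW; rewrite addnS ltnS leq_addr.
rewrite rpredDr // => /(memvZ (k%:R^-1)); rewrite scalerA mulVf ?scale1r //.
by rewrite pnatr_eq0 -lt0n.
Qed.

Local Notation G := (@Ggroup R d N).

Lemma G_coef0 g : G g -> tcoef g [::] = 1.
Proof. by case=> a /= al <-; rewrite texp_coef0 // lie0. Qed.

(** With D = levD, the logarithmic derivative of g h is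
    h^-1 (g^-1 D g) h + h^-1 D h, which is Lie when those of g and h are.
    Together with the criterion of Dynkin this replaces the
    Campbell-Hausdorff formula. *)
Lemma G_mul g h : G g -> G h -> G (g * h).
Proof.
move=> Gg Gh; have g1 := G_coef0 Gg; have h1 := G_coef0 Gh.
have [c c0 cE] : exists2 c, tcoef c [::] = 0 & texp c = g * h.
  by apply: texp_surj; rewrite tcoef0M g1 h1 mulr1.
exists c => //=; apply: lie_of_logder => //.
rewrite -tinv_texp // cE tinv_mul //.
case: Gg g1 {cE} => a /= al <- g1; case: Gh h1 => b /= bl <- h1.
rewrite levDM mulrDr !tinv_texp ?lie0 //; apply: memvD.
  rewrite [_ * (levD _ * _)]mulrA -[_ * texp (- a) * _]mulrA.
  by apply: lie_conj => //; exact: lie_logder.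
rewrite -mulrA [texp (- a) * _]mulrA texpNV ?lie0 // mul1r; exact: lie_logder.
Qed.

Lemma G_inv g : G g -> G (tinv g).
Proof.
by case=> a /= al <-; rewrite tinv_texp ?lie0 //; exists (- a); rewrite //= rpredN.
Qed.

Lemma G_one : G 1.
Proof. by exists 0; [exact: mem0v|exact: texp0]. Qed.

Lemma G_vanish k g : G g -> vanish k (g - 1) ->
  exists2 a, a \in lie /\ vanish k a & g = texp a.
Proof.
by case=> a /= al <- H; exists a => //; split => //; exact: vanish_log (lie0 al) H.
Qed.

Lemma lev_lie i a : (0 < i)%N -> a \in lie -> lev i a \in Wd i.
Proof. by move=> i0 /lieP[_]; exact. Qed.

Lemma W_lie i w : (0 < i)%N -> w \in Wd i -> w \in lie.
Proof.
move=> i0 wi; apply/lieP; split=> [|j j0].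
  by rewrite -(W_homog i0 wi) tcoef_lev //; case: i i0 {wi}.
rewrite -(W_homog i0 wi) lev_lev W_homog //.
by case: eqP => [->|_]; [exact: wi|exact: mem0v].
Qed.

Lemma W_vanish i w : (0 < i)%N -> w \in Wd i -> vanish i w.
Proof.
move=> i0 wi s si sN; rewrite -(W_homog i0 wi) tcoef_lev //.
by case: eqP => // E; rewrite E ltnn in si.
Qed.

Lemma texp_top a : vanish N a -> (0 < N)%N -> texp a = 1 + a.
Proof.
move=> aN N0; have z1 : vanish 1 (0 : A) by move=> s _ _; exact: tcoef0.
have := vanish_top (ltnSn N) (vanish_texp_add z1 aN N0).
by rewrite add0r texp0 => /eqP; rewrite subr_eq0 subr_eq => /eqP ->; rewrite addrC.
Qed.

(** Positive levels multiply level N to 0.  With [top_mull], this makes 1 + w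
    central, and multiplication by it the addition of w. *)
Lemma top_mulr g w : tcoef g [::] = 1 -> vanish N w -> g * w = w.
Proof.
move=> g1 wN; have -> : g = (g - 1) + 1 by rewrite subrK.
rewrite mulrDl mul1r [X in X + _](@vanish_top N.+1) ?add0r //.
rewrite -add1n; apply: vanishM => //.
by apply: vanish1; rewrite tcoefB g1 tcoef_one // subrr.
Qed.

Lemma top_mull g w : tcoef g [::] = 1 -> vanish N w -> w * g = w.
Proof.
move=> g1 wN; have -> : g = (g - 1) + 1 by rewrite subrK.
rewrite mulrDr mulr1 [X in X + _](@vanish_top N.+1) ?add0r //.
rewrite -addn1; apply: vanishM => //.
by apply: vanish1; rewrite tcoefB g1 tcoef_one // subrr.
Qed.

End Graded.

(** * Signatures of paths of bounded variation *)

Section Euclid.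
Context {R : realType} (I : finType) (P : pred I).
Implicit Types F G : I -> R.

Lemma cauchy_schwarz_sum F G :
  (\sum_(i | P i) F i * G i) ^+ 2 <=
  (\sum_(i | P i) F i ^+ 2) * (\sum_(i | P i) G i ^+ 2).
Proof.
set a := \sum_(i | P i) F i ^+ 2; set b := \sum_(i | P i) G i ^+ 2.
set c := \sum_(i | P i) F i * G i.
have a0 : 0 <= a by apply: sumr_ge0 => i _; exact: sqr_ge0.
have [a00|a00] := eqVneq a 0.
  have F0 i : P i -> F i = 0.
    move=> Pi; have := psumr_eq0P (fun i (_ : P i) => sqr_ge0 (F i)) a00 Pi.
    by move/eqP; rewrite sqrf_eq0 => /eqP.
  rewrite [c]big1 ?expr0n ?a00 ?mul0r //.
  by move=> i Pi; rewrite F0 // mul0r.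
have : 0 <= \sum_(i | P i) (a * G i - c * F i) ^+ 2.
  by apply: sumr_ge0 => i _; exact: sqr_ge0.
have -> : \sum_(i | P i) (a * G i - c * F i) ^+ 2 = a * (a * b - c ^+ 2).
  rewrite (eq_bigr (fun i => a ^+ 2 * G i ^+ 2 - 2 * a * c * (F i * G i) +
    c ^+ 2 * F i ^+ 2)); last by move=> i _; ring.
  rewrite big_split sumrB /= -!mulr_sumr -/a -/b -/c; ring.
by rewrite pmulr_rge0 ?subr_ge0 // lt_def a00.
Qed.

Lemma l2_triangle F G :
  Num.sqrt (\sum_(i | P i) (F i + G i) ^+ 2) <=
  Num.sqrt (\sum_(i | P i) F i ^+ 2) + Num.sqrt (\sum_(i | P i) G i ^+ 2).
Proof.
set a := \sum_(i | P i) F i ^+ 2; set b := \sum_(i | P i) G i ^+ 2.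
have a0 : 0 <= a by apply: sumr_ge0 => i _; exact: sqr_ge0.
have b0 : 0 <= b by apply: sumr_ge0 => i _; exact: sqr_ge0.
have s0 : 0 <= Num.sqrt a + Num.sqrt b by rewrite addr_ge0 ?sqrtr_ge0.
rewrite -[leRHS]ger0_norm // -sqrtr_sqr; apply: ler_wsqrtr.
rewrite sqrrD !sqr_sqrtr //.
have -> : \sum_(i | P i) (F i + G i) ^+ 2 = a + (\sum_(i | P i) F i * G i) *+ 2 + b.
  by rewrite /a /b -sumrMnl -!big_split /=; apply: eq_bigr => i _; ring.
rewrite lerD2r lerD2l lerMn2r /= -sqrtrM //.
apply: le_trans (ler_norm _) _; rewrite -sqrtr_sqr; apply: ler_wsqrtr.
exact: cauchy_schwarz_sum.
Qed.

Lemma l2_scale (k : R) F :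
  Num.sqrt (\sum_(i | P i) (k * F i) ^+ 2) = `|k| * Num.sqrt (\sum_(i | P i) F i ^+ 2).
Proof.
under eq_bigr do rewrite exprMn.
by rewrite -mulr_sumr sqrtrM ?sqr_ge0 // sqrtr_sqr.
Qed.

Lemma l2_coord F i : P i -> `|F i| <= Num.sqrt (\sum_(i | P i) F i ^+ 2).
Proof.
move=> Pi; rewrite -sqrtr_sqr; apply: ler_wsqrtr; rewrite (bigD1 i) //=.
by rewrite lerDl; apply: sumr_ge0 => j _; exact: sqr_ge0.
Qed.

Lemma l2_le_l1 F : Num.sqrt (\sum_(i | P i) F i ^+ 2) <= \sum_(i | P i) `|F i|.
Proof.
have s0 : 0 <= \sum_(i | P i) `|F i| by apply: sumr_ge0.
rewrite -[leRHS]ger0_norm // -sqrtr_sqr; apply: ler_wsqrtr.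
rewrite expr2 mulr_suml; apply: ler_sum => i Pi.
rewrite -real_normK ?num_real // expr2 ler_wpM2l // (bigD1 i) //= lerDl.
exact: sumr_ge0.
Qed.

End Euclid.

Section EuclNorm.
Context {R : realType} {d : nat}.
Implicit Types x y : 'rV[R]_d.

Lemma eucl_norm_ge0 x : 0 <= eucl_norm x. Proof. exact: sqrtr_ge0. Qed.

Lemma eucl_normD x y : eucl_norm (x + y) <= eucl_norm x + eucl_norm y.
Proof. by rewrite /eucl_norm; under eq_bigr do rewrite mxE; exact: l2_triangle. Qed.

Lemma eucl_normZ k x : eucl_norm (k *: x) = `|k| * eucl_norm x.
Proof. by rewrite /eucl_norm; under eq_bigr do rewrite mxE; exact: l2_scale. Qed.

Lemma eucl_norm0 : eucl_norm (0 : 'rV[R]_d) = 0.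
Proof. by rewrite -(scale0r (0 : 'rV[R]_d)) eucl_normZ normr0 mul0r. Qed.

Lemma eucl_norm_coord x j : `|x ord0 j| <= eucl_norm x.
Proof. exact: (@l2_coord _ _ xpredT (fun j => x ord0 j)). Qed.

End EuclNorm.

Section Partitions.
Context {R : realType}.
Implicit Types (a b c r e v : R) (f g : R -> R) (x xi : nat -> R).

Definition chain n x := forall i, (i < n)%N -> x i <= x i.+1.

Lemma chain_le n x i j : chain n x -> (i <= j)%N -> (j <= n)%N -> x i <= x j.
Proof.
move=> xc; elim: j => [|j IH]; first by rewrite leqn0 => /eqP ->.
rewrite leq_eqVlt => /orP[/eqP -> //|ij jn].
by apply: le_trans (xc _ jn); apply: IH => //; exact: ltnW.
Qed.

(** The partitions of [itv_partition] are strictly increasing, whereas time changes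
    and concatenations produce degenerate cells.  These contribute 0 to sums of
    increments and can be dropped. *)
Lemma strictify n x xi a b (F : R -> R -> R -> R) (P : R -> R -> R -> Prop) :
  x 0%N = a -> x n = b -> chain n x -> (forall u z, F u u z = 0) ->
  (forall i, (i < n)%N -> P (x i) (x i.+1) (xi i)) ->
  exists s xi', [/\ itv_partition a b s,
    forall i, (i < size s)%N -> P (nth b (a :: s) i) (nth b (a :: s) i.+1) (xi' i) &
    \sum_(0 <= i < size s) F (nth b (a :: s) i) (nth b (a :: s) i.+1) (xi' i) =
    \sum_(0 <= i < n) F (x i) (x i.+1) (xi i)].
Proof.
move=> + + + F0; elim: n x xi a => [|n IH] x xi a x0 xn xc xP.
  exists [::], xi; split => //; last by rewrite !big_geq.
  by rewrite /itv_partition /= -x0 xn.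
have [||i ni|i ni|s [xi' [sp sP sE]]] := IH (x \o S) (xi \o S) (x 1%N) => //=.
- exact: xc.
- exact: xP.
have [ax|ax] := eqVneq a (x 1%N).
  exists s, xi'; split => //; [by rewrite ax|by rewrite ax|].
  by rewrite big_nat_recl // x0 -ax F0 add0r -sE ax.
exists (x 1%N :: s), (fun i => if i is j.+1 then xi' j else xi 0%N); split.
- case: sp => p1 p2; split => //=; rewrite p1 andbT lt_neqAle ax -x0; exact: xc.
- by case=> [|i] /= is_; [rewrite -x0; exact: xP|exact: sP].
- by rewrite /= big_nat_recl // [RHS]big_nat_recl //= -x0 sE.
Qed.

Lemma nth_chain a b s : itv_partition a b s -> chain (size s) (nth b (a :: s)).
Proof.
by move=> [/(pathP b) H _] i si; apply: ltW; exact: H.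
Qed.

Lemma nth_partition_last a b s : itv_partition a b s -> nth b (a :: s) (size s) = b.
Proof. by case=> _ /eqP lb; rewrite -[RHS]lb (last_nth b). Qed.

(** [is_RS_integral] with degenerate cells allowed, a form that is stable under
    time changes with flat pieces. *)
Definition RS f g a b v := forall e, 0 < e -> exists2 r, 0 < r &
  forall n x xi, x 0%N = a -> x n = b ->
    (forall i, (i < n)%N -> x i <= xi i <= x i.+1 /\ x i.+1 - x i < r) ->
    `|\sum_(0 <= i < n) f (xi i) * (g (x i.+1) - g (x i)) - v| < e.

Lemma RSP f g a b v : is_RS_integral f g a b v <-> RS f g a b v.
Proof.
split=> H e /H[r r0 hr]; exists r => //.
  move=> n x xi x0 xn xc.
  have [|||s [xi' [sp sP <-]]] := @strictify n x xi a b
    (fun u w z => f z * (g w - g u)) (fun u w z => u <= z <= w /\ w - u < r) x0 xn.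
  - by move=> i /xc[/andP[+ /(le_trans _)]]; move=> /[swap]/[apply].
  - by move=> u z; rewrite subrr mulr0.
  - exact: xc.
  exact: hr.
move=> s xi sp x hx; apply: hr => //; exact: nth_partition_last.
Qed.

Definition fine_chain n x xi r := forall i, (i < n)%N ->
  x i <= xi i <= x i.+1 /\ x i.+1 - x i < r.

Lemma fine_chainW n x xi r : fine_chain n x xi r -> chain n x.
Proof. by move=> H i /H[/andP[+ /(le_trans _)]] => /[swap]/[apply]. Qed.

Lemma fine_partition a b r : a <= b -> 0 < r ->
  exists n x, [/\ x 0%N = a, x n = b & fine_chain n x x r].
Proof.
move=> ab r0; pose n := (Num.truncn ((b - a) / r)).+1.
have n0 : (0 : R) < n%:R by rewrite ltr0n.
exists n, (fun i => a + (b - a) * (i%:R / n%:R)); split.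
- by rewrite mul0r mulr0 addr0.
- by rewrite divff ?mulr1 ?subrKC // gt_eqF.
move=> i _; have ba : 0 <= b - a by rewrite subr_ge0.
rewrite lexx /= lerD2l; split.
  rewrite ler_wpM2l // ler_wpM2r ?ler_nat ?leqnSn // invr_ge0; exact: ltW.
have -> : a + (b - a) * (i.+1%:R / n%:R) - (a + (b - a) * (i%:R / n%:R)) =
   (b - a) / n%:R by rewrite -natr1; field; rewrite gt_eqF.
by rewrite ltr_pdivrMr // mulrC -ltr_pdivrMr //; exact: truncnS_gt.
Qed.

Lemma RS_approx f g a b v r e : a <= b -> RS f g a b v -> 0 < r -> 0 < e ->
  exists n x, [/\ x 0%N = a, x n = b, fine_chain n x x r &
    `|\sum_(0 <= i < n) f (x i) * (g (x i.+1) - g (x i)) - v| < e].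
Proof.
move=> ab H r0 /H[r' r'0 Hr].
have rr : 0 < Num.min r r' by rewrite lt_min r0.
have [n [x [x0 xn xf]]] := fine_partition ab rr.
exists n, x; split => //.
- by move=> i /xf[-> h]; split => //; rewrite (lt_le_trans h) // ge_min lexx.
- apply: Hr => // i /xf[-> h]; split => //.
  by rewrite (lt_le_trans h) // ge_min lexx orbT.
Qed.

Lemma RS_bound f g a b v (M L : R) : a <= b -> RS f g a b v ->
  (forall z, a <= z <= b -> `|f z| <= M) ->
  (forall n x, x 0%N = a -> x n = b -> chain n x ->
    \sum_(0 <= i < n) `|g (x i.+1) - g (x i)| <= L) -> `|v| <= M * L.
Proof.
move=> ab Hv fM gL; apply/ler_addgt0Pr => /= e e0.
have [n [x [x0 xn xf xv]]] := RS_approx ab Hv (ltr01 : 0 < 1 :> R) e0.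
have xc := fine_chainW xf.
have M0 : 0 <= M by apply: le_trans (fM a _); rewrite ?lexx.
set S := \sum_(_ <= _ < _) _ in xv *.
have -> : v = S - (S - v) by ring.
apply: (le_trans (ler_normB _ _)); apply: lerD; last exact: ltW.
apply: (@le_trans _ _ (M * \sum_(0 <= i < n) `|g (x i.+1) - g (x i)|)); last first.
  by apply: ler_wpM2l => //; exact: gL.
apply: (le_trans (ler_norm_sum _ _ _)); rewrite mulr_sumr.
rewrite big_nat [leRHS]big_nat; apply: ler_sum => i /andP[_ ni].
rewrite normrM; apply: ler_wpM2r => //; apply: fM.
by rewrite -x0 -xn !(chain_le xc) // ltnW.
Qed.

Lemma RS_cst k g a b : RS (fun=> k) g a b (k * (g b - g a)).
Proof.
move=> e e0; exists 1 => // n x xi x0 xn _.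
by rewrite -mulr_sumr telescope_sumr // x0 xn subrr normr0.
Qed.

Lemma RSZ k f g a b v : RS f g a b v -> RS (fun z => k * f z) g a b (k * v).
Proof.
move=> H e e0; have k0 : 0 < `|k| + 1 by rewrite ltr_wpDl.
have [r r0 hr] := H _ (divr_gt0 e0 k0); exists r => // n x xi x0 xn xf.
have := hr n x xi x0 xn xf; rewrite ltr_pdivlMr //; apply: le_lt_trans.
under eq_bigr do rewrite -mulrA.
rewrite -mulr_sumr -mulrBr normrM mulrC; apply: ler_wpM2l => //.
by rewrite lerDl.
Qed.

Lemma RSZr k f g a b v : RS f g a b v -> RS f (fun z => k * g z) a b (k * v).
Proof.
move=> /(RSZ k) H e /H[r r0 hr]; exists r => // n x xi x0 xn xf.
rewrite (eq_bigr (fun i => k * f (xi i) * (g (x i.+1) - g (x i)))); first exact: hr.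
by move=> i _; ring.
Qed.

Lemma RSD f f' g a b v v' : RS f g a b v -> RS f' g a b v' ->
  RS (fun z => f z + f' z) g a b (v + v').
Proof.
move=> H H' e e0; have e2 : 0 < e / 2 by rewrite divr_gt0.
have [r r0 hr] := H _ e2; have [r' r'0 hr'] := H' _ e2.
exists (Num.min r r') => [|n x xi x0 xn xf]; first by rewrite lt_min r0.
under eq_bigr do rewrite mulrDl.
rewrite big_split /= opprD addrACA [e]splitr (le_lt_trans (ler_normD _ _)) //.
by apply: ltrD; [apply: hr|apply: hr'] => // i /xf[xi1 h]; split=> //;
  rewrite (lt_le_trans h) // ge_min lexx ?orbT.
Qed.

Lemma RSDr f g g' a b v v' : RS f g a b v -> RS f g' a b v' ->
  RS f (fun z => g z + g' z) a b (v + v').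
Proof.
move=> H H' e e0; have e2 : 0 < e / 2 by rewrite divr_gt0.
have [r r0 hr] := H _ e2; have [r' r'0 hr'] := H' _ e2.
exists (Num.min r r') => [|n x xi x0 xn xf]; first by rewrite lt_min r0.
under eq_bigr do rewrite opprD addrACA mulrDr.
rewrite big_split /= opprD addrACA [e]splitr (le_lt_trans (ler_normD _ _)) //.
by apply: ltrD; [apply: hr|apply: hr'] => // i /xf[xi1 h]; split=> //;
  rewrite (lt_le_trans h) // ge_min lexx ?orbT.
Qed.

Lemma RS_sum (I : Type) (s : seq I) (k : I -> R) (F : I -> R -> R) g a b (v : I -> R) :
  (forall i, RS (F i) g a b (v i)) ->
  RS (fun z => \sum_(i <- s) k i * F i z) g a b (\sum_(i <- s) k i * v i).
Proof.
move=> H; elim: s => [|i s IH].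
  have := @RS_cst 0 g a b; rewrite mul0r big_nil; congr RS.
  by apply/funext => z; rewrite big_nil.
have := RSD (RSZ (k i) (H i)) IH; rewrite big_cons; congr RS.
by apply/funext => z; rewrite big_cons.
Qed.

(** A fine partition of [a, b] is put before the given partition of [b, c]. *)
Lemma RS_right f g a b c v w : a <= b -> RS f g a b v -> RS f g a c w ->
  RS f g b c (w - v).
Proof.
move=> ab Hv Hw e e0; have e2 : 0 < e / 2 by rewrite divr_gt0.
have [r r0 hr] := Hw _ e2; exists r => // n x xi x0 xn xf.
have [m [y [y0 ym yf yv]]] := RS_approx ab Hv r0 e2.
pose z i := if (i < m)%N then y i else x (i - m)%N.
pose zi i := if (i < m)%N then y i else xi (i - m)%N.
have zx i : (m <= i)%N -> z i = x (i - m)%N by rewrite /z ltnNge => ->.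
have zy i : (i <= m)%N -> z i = y i.
  rewrite leq_eqVlt /z => /orP[/eqP ->|->] //.
  by rewrite ltnn subnn x0 ym.
have := hr (m + n)%N z zi _ _ _.
have shift G : \sum_(m <= i < m + n) G i = \sum_(0 <= i < n) G (i + m)%N :> R.
  by rewrite -{1}[m]add0n big_addn addKn.
rewrite (@big_cat_nat _ _ _ m) ?leq_addr //= shift.
have -> : \sum_(0 <= i < m) f (zi i) * (g (z i.+1) - g (z i)) =
  \sum_(0 <= i < m) f (y i) * (g (y i.+1) - g (y i)).
  by apply: eq_big_nat => i /andP[_ im]; rewrite !zy // ?[(i <= m)%N]ltnW // /zi im.
have -> : \sum_(0 <= i < n) f (zi (i + m)%N) * (g (z (i + m).+1) - g (z (i + m)%N)) =
  \sum_(0 <= i < n) f (xi i) * (g (x i.+1) - g (x i)).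
  apply: eq_big_nat => i _; rewrite !zx ?leq_addl ?leqW ?leq_addl //.
  by rewrite /zi ltnNge leq_addl /= subSn ?leq_addl // addnK.
set A := \sum_(_ <= _ < _) _ in yv *; set B := \sum_(_ <= _ < _) _.
move=> H; have -> : B - (w - v) = (A + B - w) - (A - v) by ring.
rewrite (le_lt_trans (ler_normB _ _)) // [e]splitr; apply: ltrD => //.
apply: H; first by rewrite zy.
  by rewrite zx ?leq_addr // addKn.
move=> i imn; case: (ltnP i m) => im.
  by rewrite !zy // ?[(i <= m)%N]ltnW // /zi im; exact: yf.
rewrite !zx // ?leqW // /zi ltnNge im /= subSn //; apply: xf.
by rewrite ltn_subLR.
Qed.

Lemma RS_rev f g a b c v : RS f g a b v ->
  RS (fun z => f (c - z)) (fun z => g (c - z)) (c - b) (c - a) (- v).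
Proof.
move=> H e /H[r r0 hr]; exists r => // n x xi x0 xn xf.
pose y i := c - x (n - i)%N; pose yi i := c - xi (n - i.+1)%N.
have -> : \sum_(0 <= i < n) f (c - xi i) * (g (c - x i.+1) - g (c - x i)) =
  - \sum_(0 <= i < n) f (yi i) * (g (y i.+1) - g (y i)).
  rewrite [in RHS]big_nat_rev /= add0n -sumrN; apply: eq_big_nat => i /andP[_ ni].
  by rewrite -mulrN opprB /y /yi -subSn // subSS !subKn // ltnW.
rewrite -opprD normrN; apply: hr => [||i ni].
- by rewrite /y subn0 xn; ring.
- by rewrite /y subnn x0; ring.
have ni' : (n - i.+1 < n)%N by rewrite ltn_subrL (leq_ltn_trans _ ni).
have [/andP[x1 x2] x3] := xf _ ni'; rewrite -subSn // subSS in x2 x3.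
by rewrite /y /yi; split; [apply/andP; split|]; lra.
Qed.

(** A Lipschitz monotone time change maps fine partitions to fine partitions. *)
Lemma RS_comp f g u (L : R) a b v : 0 < L -> (forall y z, y <= z -> 0 <= u z - u y <= L * (z - y)) ->
  RS f g (u a) (u b) v -> RS (f \o u) (g \o u) a b v.
Proof.
move=> L0 uL H e /H[r r0 hr]; exists (r / L) => [|n x xi x0 xn xf].
  by rewrite divr_gt0.
apply: (hr n (u \o x) (u \o xi)) => /=; rewrite ?x0 ?xn // => i /xf[/andP[h1 h2] h].
have /andP[u1 _] := uL _ _ h1; have /andP[u2 _] := uL _ _ h2.
have /andP[_ u3] := uL _ _ (le_trans h1 h2).
rewrite !subr_ge0 in u1 u2; rewrite u1 u2; split => //.
by apply: le_lt_trans u3 _; rewrite mulrC -ltr_pdivlMr.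
Qed.

Definition straddle c y z : R := ((y < c) && (c < z))%:R.

Lemma sum_straddle n x c : chain n x ->
  \sum_(0 <= i < n) straddle c (x i) (x i.+1) <= (c < x n)%R%:R.
Proof.
elim: n => [|n IH] xc; first by rewrite big_geq.
have xc' : chain n x by move=> i ni; apply: xc; rewrite ltnW.
rewrite big_nat_recr //=; have := IH xc'; have xS := xc n (ltnSn n); rewrite /straddle.
have [cx|cx] := ltP c (x n).
  by rewrite (lt_le_trans cx xS) ltNge (ltW cx) /= addr0.
move=> h; apply: le_trans (lerD h (lexx _)) _; rewrite add0r ler_nat.
by case: (c < x n.+1); rewrite ?andbF ?andbT //; case: (_ < _).
Qed.

(** In a cell that does not straddle c, either the integrands agree or g does not
    move.  At most one cell straddles c, and its contribution is small by
    continuity of g.  This glues the signatures of two pieces at the time c of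
    concatenation. *)
Lemma RS_straddle f f' g a b c v (M : R) :
  RS f g a b v ->
  (forall z, a <= z <= b -> `|f' z - f z| <= M) ->
  (forall x z y : R, a <= x -> x <= z -> z <= y -> y <= b ->
     ~~ ((x < c) && (c < y)) -> (f' z - f z) * (g y - g x) = 0) ->
  (forall e, 0 < e -> exists2 r, 0 < r & forall x y : R, a <= x -> x < c -> c < y -> y <= b ->
     y - x < r -> `|g y - g x| < e) ->
  RS f' g a b v.
Proof.
move=> H fM fg gc e e0.
have M0 : 0 < `|M| + 1 by rewrite ltr_wpDl.
have e2 : 0 < e / 2 by rewrite divr_gt0.
have [r r0 hr] := H _ e2.
have [r' r'0 hr'] := gc _ (divr_gt0 e2 M0).
exists (Num.min r r') => [|n x xi x0 xn xf]; first by rewrite lt_min r0.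
have xc : chain n x := fine_chainW xf.
have := hr n x xi x0 xn _; set S := \sum_(_ <= _ < _) _ => hS.
set S' := \sum_(_ <= _ < _) _.
have -> : S' - v = (S' - S) + (S - v) by ring.
rewrite (le_lt_trans (ler_normD _ _)) // [e]splitr; apply: ler_ltD; last first.
  apply: hS => i /xf[xi1 h]; split=> //.
  by rewrite (lt_le_trans h) // ge_min lexx.
rewrite -sumrB (le_trans (ler_norm_sum _ _ _)) //.
apply: (@le_trans _ _ ((e / 2) * \sum_(0 <= i < n) straddle c (x i) (x i.+1))); last first.
  rewrite -[leRHS]mulr1; apply: ler_wpM2l; first exact: ltW.
  apply: (le_trans (sum_straddle c xc)); case: (_ < _) => //=.
rewrite mulr_sumr big_nat [leRHS]big_nat; apply: ler_sum => i /andP[_ ni].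
rewrite -mulrBl /straddle.
have [/andP[x1 x2] x3] := xf i ni.
have ax : a <= x i by rewrite -x0 (chain_le xc) // ltnW.
have xb : x i.+1 <= b by rewrite -xn (chain_le xc).
case: (boolP (x i < c < x i.+1)) => st; last by rewrite fg // normr0 mulr0.
rewrite mulr1 normrM.
have h1 : `|f' (xi i) - f (xi i)| <= `|M| + 1.
  apply: (@le_trans _ _ M); last by rewrite (le_trans (ler_norm _)) // lerDl.
  by apply: fM; rewrite (le_trans ax x1) (le_trans x2 xb).
have h2 : `|g (x i.+1) - g (x i)| <= e / 2 / (`|M| + 1).
  have /andP[xic cxi] := st; apply/ltW/hr' => //.
  by rewrite (lt_le_trans x3) // ge_min lexx orbT.
apply: le_trans (ler_pM _ _ h1 h2) _ => //.
by rewrite mulrC divfK // gt_eqF.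
Qed.

End Partitions.

Section Reach.
Context {R : realType} {d N : nat}.
Local Notation A := (tensor R d N).
Implicit Types (g h : A) (f : R -> 'rV[R]_d) (S : R -> A) (l t : R).

Definition variation_le f l := forall n (x : nat -> R), x 0%N = 0 -> x n = 1 ->
  chain n x -> \sum_(0 <= i < n) eucl_norm (f (x i.+1) - f (x i)) <= l.

(** The data behind [reach], with sums over arbitrary finite chains of times. *)
Definition sigpath f S g l := [/\ continuous_path (@eucl_dist R d) 0 1 f,
  variation_le f l,
  forall t, 0 <= t <= 1 -> tcoef (S t) [::] = 1,
  forall t s j, 0 <= t <= 1 -> (size s < N)%N ->
    RS (fun u => tcoef (S u) s) (fun u => f u ord0 j) 0 t (tcoef (S t) (rcons s j)) &
  S 1 = g].

Definition reach g l := exists2 f, bv_path f /\ is_signature f g & path_length f <= l.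

Lemma variations_nonempty f : path_variations 0 1 f !=set0.
Proof.
exists (path_variation 0 1 f [:: 1]), [:: 1] => //.
by split => //=; rewrite ltr01.
Qed.

Lemma reachP g l : reach g l <-> exists f S, sigpath f S g l.
Proof.
split=> [[f [[fc fb] [S [S0 SR S1]]] fl]|[f [S [fc fv S0 SR S1]]]].
  exists f, S; suff fv : variation_le f l.
    split=> // t; last by move=> s j t01 sN; apply/RSP; apply: SR; rewrite ?in_itv.
  move=> n x x0 xn xc; apply: le_trans fl.
  have [||s [_ [sp _ <-]]] := @strictify R n x x 0 1
    (fun u w _ => eucl_norm (f w - f u)) (fun _ _ _ => True) x0 xn xc => //.
    by move=> u _; rewrite subrr eucl_norm0.
  by apply: sup_ubound => //; exists s.
have ub : ubound (path_variations 0 1 f) l.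
  move=> _ [s sp <-]; apply: fv; [by []|exact: nth_partition_last|exact: nth_chain].
exists f; last by apply: ge_sup => //; exact: variations_nonempty.
split; first by split=> //; exists l.
exists S; split=> // t; rewrite in_itv /= => t01 s j sN; apply/RSP; exact: SR.
Qed.

Lemma variation_prefix f l t n x : variation_le f l -> 0 <= t <= 1 ->
  x 0%N = 0 -> x n = t -> chain n x ->
  \sum_(0 <= i < n) eucl_norm (f (x i.+1) - f (x i)) <= l.
Proof.
move=> fv /andP[t0 t1] x0 xn xc.
have := fv n.+1 (fun i => if (i <= n)%N then x i else 1); rewrite /= ltnn => H.
apply: le_trans (H x0 erefl _) => [|i]; last first.
  rewrite ltnS => ni; rewrite ni; case: ltnP => // [|nj]; first exact: xc.
  by have /eqP -> : i == n; rewrite ?eqn_leq ?ni // xn.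
rewrite big_nat_recr //= leqnn ltnn.
rewrite -[leLHS]addr0; apply: lerD; last exact: eucl_norm_ge0.
rewrite [leLHS]big_nat [leRHS]big_nat; apply: ler_sum => i /andP[_ ni].
by rewrite ni ltnW.
Qed.

(** Each further letter is one integration against a coordinate of f, whose total
    variation is at most l. *)
Lemma sigpath_coef_le f S g l t s : sigpath f S g l -> 0 <= t <= 1 ->
  (size s <= N)%N -> `|tcoef (S t) s| <= l ^+ size s.
Proof.
move=> [fc fv S0 SR S1]; elim/last_ind: s t => [|s j IH] t t01.
  by rewrite S0 // normr1 expr0.
rewrite size_rcons => sN; rewrite exprSr.
have /andP[t0 t1] := t01.
apply: (RS_bound t0 (SR t s j t01 sN)) => [z /andP[z0 zt]|n x x0 xn xc].
  by apply: IH (ltnW sN); rewrite z0 (le_trans zt).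
apply: le_trans (variation_prefix fv t01 x0 xn xc).
by apply: ler_sum => i _; have := eucl_norm_coord (f (x i.+1) - f (x i)) j; rewrite !mxE.
Qed.

Lemma tcoef_mul_rcons (a b : A) s j : (size s < N)%N ->
  tcoef (a * b) (rcons s j) =
  \sum_(i < (size s).+1) tcoef a (take i s) * tcoef b (rcons (drop i s) j)
  + tcoef a (rcons s j) * tcoef b [::].
Proof.
move=> sN; rewrite tmulE ?size_rcons // big_ord_recr /=; congr (_ + _).
  apply: eq_bigr => i _; have is_ : (i <= size s)%N by rewrite -ltnS.
  rewrite -cats1 take_cat drop_cat; case: ltnP => si; first by rewrite cats1.
  have -> : nat_of_ord i = size s by apply/eqP; rewrite eqn_leq is_.
  by rewrite subnn take0 cats0 drop0 take_size drop_size.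
by rewrite -(size_rcons s j) take_size drop_size.
Qed.

Lemma sigpath_start f S g l : sigpath f S g l -> S 0 = 1.
Proof.
move=> fS; have [fc fv S0 SR S1] := fS.
have t0 : 0 <= (0 : R) <= 1.
  by rewrite lexx /=.
apply: tensorP => s sN; rewrite tcoef_one //.
case/lastP: s sN => [|s j]; first by rewrite S0.
rewrite size_rcons => sN.
have := RS_bound (lexx 0) (SR 0 s j t0 sN) (M := l ^+ size s) (L := 0).
rewrite mulr0 normr_le0 => H.
have -> : rcons s j == [::] = false by case: s {sN H}.
apply/eqP; apply: H => [z /andP[z0 z1]|n x x0 xn xc].
  have -> : z = 0 by apply/eqP; rewrite eq_le z0 z1.
  by apply: (sigpath_coef_le fS) => //; exact: ltnW.
rewrite big_nat big1 // => i /andP[_ ni].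
have E k : (k <= n)%N -> x k = 0.
  move=> kn; apply/eqP; rewrite eq_le; apply/andP; split.
    by rewrite -[leRHS]xn; exact: (chain_le xc).
  by rewrite -[leLHS]x0; exact: (chain_le xc).
by rewrite !E ?subrr ?normr0 // ltnW.
Qed.

Definition pcont f := forall c, 0 <= c <= 1 -> forall e : R, 0 < e ->
  exists2 r : R, 0 < r & forall s, 0 <= s <= 1 -> `|s - c| < r -> eucl_norm (f c - f s) < e.

Lemma pcontP f : continuous_path (@eucl_dist R d) 0 1 f <-> pcont f.
Proof.
split=> H c c01 e e0; have := H c _ e e0; rewrite ?in_itv /= => /(_ c01)[r r0 hr];
  exists r => // s s01; apply: hr; by rewrite ?in_itv // -in_itv.
Qed.

Lemma pcont_comp f (u : R -> R) (L : R) : pcont f -> 0 < L ->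
  (forall y, 0 <= y <= 1 -> 0 <= u y <= 1) ->
  (forall y z, `|u z - u y| <= L * `|z - y|) -> pcont (f \o u).
Proof.
move=> fc L0 u01 uL c c01 e e0; have [r r0 hr] := fc _ (u01 _ c01) e e0.
exists (r / L) => [|s s01 sc]; first by rewrite divr_gt0.
apply: hr; first exact: u01.
by apply: le_lt_trans (uL _ _) _; rewrite mulrC -ltr_pdivlMr.
Qed.

Lemma pcontD f f' : pcont f -> pcont f' -> pcont (fun t => f t + f' t).
Proof.
move=> fc gc c c01 e e0; have e2 : 0 < e / 2 by rewrite divr_gt0.
have [r r0 hr] := fc c c01 _ e2; have [r' r'0 hr'] := gc c c01 _ e2.
exists (Num.min r r') => [|s s01]; first by rewrite lt_min r0.
rewrite lt_min => /andP[sr sr'].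
rewrite opprD addrACA (le_lt_trans (eucl_normD _ _)) // [e]splitr.
by apply: ltrD; [exact: hr|exact: hr'].
Qed.

Lemma pcont_straddle f j (a b c : R) : pcont f -> 0 <= a -> b <= 1 ->
  forall e : R, 0 < e -> exists2 r, 0 < r &
    forall x y : R, a <= x -> x < c -> c < y -> y <= b ->
     y - x < r -> `|f y ord0 j - f x ord0 j| < e.
Proof.
move=> fc a0 b1 e e0.
have [c01|c01] := boolP (0 <= c <= 1); last first.
  exists 1 => // x y ax xc cy yb; case/negP: c01; apply/andP; split.
    exact: le_trans (le_trans a0 ax) (ltW xc).
  exact: le_trans (ltW cy) (le_trans yb b1).
have e2 : 0 < e / 2 by rewrite divr_gt0.
have [r r0 hr] := fc c c01 _ e2; exists r => // x y ax xc cy yb yx.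
have hx : eucl_norm (f c - f x) < e / 2.
  apply: hr; first lra.
  by rewrite ltr0_norm; lra.
have hy : eucl_norm (f c - f y) < e / 2.
  apply: hr; first lra.
  by rewrite gtr0_norm; lra.
have := eucl_norm_coord (f c - f x) j; have := eucl_norm_coord (f c - f y) j.
rewrite !mxE => h1 h2.
have -> : f y ord0 j - f x ord0 j = (f c ord0 j - f x ord0 j) - (f c ord0 j - f y ord0 j).
  by ring.
rewrite (le_lt_trans (ler_normB _ _)) // [e]splitr; apply: ltrD.
  exact: le_lt_trans hx.
exact: le_lt_trans hy.
Qed.

Lemma chain_comp n (x : nat -> R) (u : R -> R) :
  {homo u : y z / y <= z} -> chain n x -> chain n (u \o x).
Proof. by move=> uh xc i /xc; exact: uh. Qed.

(** The concatenation is f1 (u t) + f2 (v t), where u moves over the first half of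
    the time interval and v over the second.  By the identity of Chen its
    signature is S1 (u t) * S2 (v t). *)
Lemma reach_mul g h l m : reach g l -> reach h m -> reach (g * h) (l + m).
Proof.
move=> /reachP[f1 [S1 H1]] /reachP[f2 [S2 H2]]; apply/reachP.
have [c1 v1 i1 R1 e1] := H1; have [c2 v2 i2 R2 e2] := H2.
have s1 := sigpath_start H1; have s2 := sigpath_start H2.
pose u (t : R) := Num.min (2 * t) 1; pose v (t : R) := Num.max (2 * t - 1) 0.
have u_lip (y z : R) : y <= z -> 0 <= u z - u y <= 2 * (z - y).
  by move=> yz; rewrite /u; case: (leP (2 * y) 1) => ?; case: (leP (2 * z) 1) => ?; lra.
have v_lip (y z : R) : y <= z -> 0 <= v z - v y <= 2 * (z - y).
  by move=> yz; rewrite /v; case: (leP (2 * y - 1) 0) => ?; case: (leP (2 * z - 1) 0) => ?; lra.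
have u_le (t : R) : t <= 1 / 2 -> v t = 0 by rewrite /v; case: (leP (2 * t - 1) 0) => ?; lra.
have u_ge (t : R) : 1 / 2 <= t -> u t = 1 by rewrite /u; case: (leP (2 * t) 1) => ?; lra.
have u01 (t : R) : 0 <= t <= 1 -> 0 <= u t <= 1 by rewrite /u; case: (leP (2 * t) 1) => ?; lra.
have v01 (t : R) : 0 <= t <= 1 -> 0 <= v t <= 1 by rewrite /v; case: (leP (2 * t - 1) 0) => ?; lra.
have lip_abs (w : R -> R) : (forall y z, y <= z -> 0 <= w z - w y <= 2 * (z - y)) ->
    forall y z, `|w z - w y| <= 2 * `|z - y|.
  move=> wl y z; case: (leP y z) => yz.
    by rewrite !ger0_norm ?subr_ge0 //; have := wl _ _ yz; lra.
  by rewrite distrC [X in _ * X]distrC !ger0_norm; have := wl _ _ (ltW yz); lra.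
have u0 : u 0 = 0 by rewrite /u mulr0 minElt; case: ifP => //; lra.
have v0 : v 0 = 0 by rewrite u_le //; lra.
have u1 : u 1 = 1 by rewrite u_ge //; lra.
have v1E : v 1 = 1 by rewrite /v; case: (leP (2 * 1 - 1 : R) 0) => ?; lra.
have two0 : (0 : R) < 2 by lra.
have cu : pcont (f1 \o u).
  by apply: (pcont_comp _ two0 u01); [exact/pcontP|exact: lip_abs].
have cv : pcont (f2 \o v).
  by apply: (pcont_comp _ two0 v01); [exact/pcontP|exact: lip_abs].
have homo w : (forall y z : R, y <= z -> 0 <= w z - w y <= 2 * (z - y)) ->
    {homo w : y z / y <= z}.
  by move=> wl y z /wl/andP[+ _]; rewrite subr_ge0.
pose S t := S1 (u t) * S2 (v t).
have S_le t : t <= 1 / 2 -> S t = S1 (u t) by move=> th; rewrite /S u_le // s2 mulr1.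
exists (fun t => f1 (u t) + f2 (v t)), S; split.
- by apply/pcontP; exact: pcontD.
- move=> n x x0 xn xc.
  apply: le_trans (_ : \sum_(0 <= i < n) (eucl_norm (f1 (u (x i.+1)) - f1 (u (x i)))
     + eucl_norm (f2 (v (x i.+1)) - f2 (v (x i)))) <= _).
    by apply: ler_sum => i _; rewrite opprD addrACA; exact: eucl_normD.
  rewrite big_split; apply: lerD.
    apply: (v1 n (u \o x)); rewrite /= ?x0 ?xn //; apply: chain_comp => //; exact: homo.
  apply: (v2 n (v \o x)); rewrite /= ?x0 ?xn //; apply: chain_comp => //; exact: homo.
- by move=> t t01; rewrite tcoef0M i1 ?i2 ?mulr1 //; [exact: v01|exact: u01].
- move=> t s j t01 sN; have /andP[t0 t1] := t01.
  have sN' : (size s <= N)%N := ltnW sN.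
  have szt i : (size (take i s) <= N)%N by rewrite size_take_min geq_min sN' orbT.
  have szd i : (size (drop i s) <= N)%N by rewrite size_drop (leq_trans (leq_subr _ _)).
  have l0 : 0 <= l ^+ size s by apply: le_trans (sigpath_coef_le H1 (u01 _ t01) sN').
  pose B (s' : seq 'I_d) := \sum_(i < (size s).+1)
    l ^+ size (take i s) * m ^+ size (drop i s).
  have SB z : 0 <= z <= 1 -> `|tcoef (S z) s| <= B s.
    move=> z01; rewrite /S tmulE //; apply: (le_trans (ler_norm_sum _ _ _)).
    apply: ler_sum => i _; rewrite normrM; apply: ler_pM => //.
      exact: (sigpath_coef_le H1 (u01 _ z01)).
    exact: (sigpath_coef_le H2 (v01 _ z01)).
  have zr z : 0 <= z <= t -> 0 <= z <= 1 by move=> /andP[-> zt]; exact: le_trans t1.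
  have := R1 (u t) s j (u01 _ t01) sN; rewrite -[X in RS _ _ X]u0.
  move/(RS_comp two0 u_lip)/(RS_straddle (f' := fun z => tcoef (S z) s)
    (c := 1 / 2) (M := B s + l ^+ size s)) => D1.
  pose k (i : 'I_(size s).+1) := tcoef g (take i s).
  have szdN i : (size (drop i s) < N)%N by rewrite size_drop (leq_ltn_trans (leq_subr _ _)).
  have := RS_sum (index_enum 'I_(size s).+1) k
    (fun i => R2 (v t) (drop i s) j (v01 _ t01) (szdN i)).
  rewrite -[X in RS _ _ X]v0.
  move/(RS_comp two0 v_lip)/(RS_straddle (f' := fun z => tcoef (S z) s)
    (c := 1 / 2) (M := B s + B s)) => D2.
  have := RSDr (D1 _ _ _) (D2 _ _ _).
  have -> : tcoef (S1 (u t)) (rcons s j) +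
    \sum_i k i * tcoef (S2 (v t)) (rcons (drop i s) j) = tcoef (S t) (rcons s j).
    rewrite /S tcoef_mul_rcons // i2 ?v01 // mulr1 addrC; congr (_ + _).
    apply: eq_bigr => i _; rewrite /k.
    have [ht|ht] := leP t (1 / 2); last by rewrite u_ge ?e1 // ltW.
    rewrite u_le // s2 tcoef_one ?size_rcons // -size_eq0 size_rcons.
    by rewrite !mulr0.
  rewrite (_ : (fun z => (_ \o u) z + (_ \o v) z) =
     fun z => (f1 (u z) + f2 (v z)) ord0 j); last by apply/funext => z; rewrite mxE.
  apply.
  + move=> z /zr z01; apply: (le_trans (ler_normB _ _)); apply: lerD; first exact: SB.
    exact: (sigpath_coef_le H1 (u01 _ z01)).
  + move=> x z y ax xz zy yt; rewrite negb_and -!leNgt => /orP[hc|hc] /=.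
      by rewrite !u_ge ?subrr ?mulr0 // (le_trans hc) // (le_trans xz).
    by rewrite S_le ?subrr ?mul0r // (le_trans zy).
  + exact: (pcont_straddle j _ cu (lexx 0) t1).
  + move=> z /zr z01; apply: (le_trans (ler_normB _ _)); apply: lerD; first exact: SB.
    apply: (le_trans (ler_norm_sum _ _ _)); apply: ler_sum => i _.
    rewrite normrM; apply: ler_pM => //.
      by rewrite /k -e1; apply: (sigpath_coef_le H1) => //; lra.
    exact: (sigpath_coef_le H2 (v01 _ z01)).
  + move=> x z y ax xz zy yt; rewrite negb_and -!leNgt => /orP[hc|hc] /=.
      rewrite /S u_ge ?e1 ?tmulE ?subrr ?mul0r //.
      exact: le_trans xz.
    have hx : x <= 1 / 2 := le_trans xz (le_trans zy hc).
    by rewrite (u_le x) // (u_le y) // subrr mulr0.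
  + exact: (pcont_straddle j _ cv (lexx 0) t1).
- by rewrite /S u1 v1E e1 e2.
Qed.

Lemma reach_coef0 g l : reach g l -> tcoef g [::] = 1.
Proof.
by move=> /reachP[f [S [_ _ S0 _ <-]]]; apply: S0; rewrite ler01 lexx.
Qed.

Lemma reach_coef_le g l s : reach g l -> (size s <= N)%N -> `|tcoef g s| <= l ^+ size s.
Proof.
move=> /reachP[f [S fS]] sN; have [_ _ _ _ <-] := fS.
by apply: (sigpath_coef_le fS) => //; rewrite ler01 lexx.
Qed.

Lemma reach_ge0 g l : reach g l -> 0 <= l.
Proof.
move=> /reachP[f [S [_ fv _ _ _]]].
apply: le_trans (fv 1%N (fun i => i%:R) erefl erefl _); last by move=> i _; rewrite ler_nat.
by rewrite big_nat1; exact: eucl_norm_ge0.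
Qed.

Lemma reachW g l m : l <= m -> reach g l -> reach g m.
Proof. by move=> lm [f fg fl]; exists f => //; exact: le_trans lm. Qed.

(** The path run backwards has signature g^-1 S(1 - t) at time t. *)
Lemma reach_inv g l : reach g l -> reach (tinv g) l.
Proof.
move=> Hg; have g1 := reach_coef0 Hg.
have /reachP[f [S H]] := Hg; apply/reachP; have [fc fv S0 SR S1] := H.
have s0 := sigpath_start H.
have c01 t : 0 <= t <= 1 -> 0 <= 1 - t <= 1 by lra.
exists (fun t => f (1 - t)), (fun t => tinv g * S (1 - t)); split.
- apply/pcontP; apply: (@pcont_comp f (fun t => 1 - t) 1) => // y z; rewrite mul1r -normrN (_ : -
    (1 - z - (1 - y)) = z - y) //; ring.
- move=> n x x0 xn xc.
  have := fv n (fun i => 1 - x (n - i)%N).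
  rewrite subn0 xn subrr subnn x0 subr0 => /(_ erefl erefl _).
  rewrite big_nat_rev /= add0n => fv'.
  rewrite (eq_big_nat _ _ (F2 := fun i =>
    eucl_norm (f (1 - x (n - (n - i.+1).+1)%N) - f (1 - x (n - (n - i.+1))%N)))).
    apply: fv' => i ni; rewrite lerD2l lerN2.
    rewrite -[X in _ <= x X](_ : (n - i.+1).+1 = (n - i)%N); last by rewrite subnSK.
    by apply: xc; rewrite ltn_subrL /= (leq_ltn_trans (leq0n i) ni).
  move=> i /andP[_ ni]; rewrite -subSn // subSS !subKn //; last exact: ltnW.
  by rewrite -[in LHS]opprB -scaleN1r eucl_normZ normrN1 mul1r.
- by move=> t /c01 t01; rewrite tcoef0M S0 // tcoef_tinv // mulr1.
- move=> t s j t01 sN; have /andP[t0 t1] := t01.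
  have szdN i : (size (drop i s) < N)%N by rewrite size_drop (leq_ltn_trans (leq_subr _ _)).
  have o01 : 0 <= (1 : R) <= 1 by rewrite ler01 lexx.
  pose k (i : 'I_(size s).+1) := tcoef (tinv g) (take i s).
  have D := RS_sum (index_enum 'I_(size s).+1) k (fun i => RS_rev 1 (RS_right _
    (SR (1 - t) (drop i s) j (c01 _ t01) (szdN i)) (SR 1 (drop i s) j o01 (szdN i)))).
  have t1' : 0 <= 1 - t by rewrite subr_ge0.
  have {}D := D t1'; rewrite subrr (_ : 1 - (1 - t) = t) in D; last by ring.
  have E : tcoef (tinv g * S (1 - t)) (rcons s j) = \sum_(i < (size s).+1) k i *
     - (tcoef (S 1) (rcons (drop i s) j) - tcoef (S (1 - t)) (rcons (drop i s) j)).
    have := congr1 (fun x => tcoef x (rcons s j)) (tmulVl g1).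
    rewrite tcoef_one ?size_rcons // -size_eq0 size_rcons /=.
    rewrite !tcoef_mul_rcons // g1 S0 ?c01 // !mulr1.
    move/eqP; rewrite addr_eq0 => /eqP EE.
    rewrite -[X in _ + X]opprK -EE -sumrB; apply: eq_bigr => i _.
    by rewrite opprB mulrBr S1.
  rewrite E; move: D; congr RS; apply/funext => z.
  by rewrite tmulE ?(ltnW sN).
- by rewrite subrr s0 mulr1.
Qed.

Lemma tcoef_level1_X (x : 'rV[R]_d) k s : (size s <= N)%N ->
  tcoef (level1 x ^+ k : A) s = (size s == k)%:R * \prod_(j <- s) x ord0 j.
Proof.
elim: k s => [|k IH] s sN.
  rewrite expr0 tcoef_one //; case: s sN => [|y s] _ /=; last by rewrite mul0r.
  by rewrite big_nil mulr1.
have T w : (size w <= N)%N -> tcoef (level1 x : A) w =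
    (size w == 1%N)%:R * \prod_(j <- w) x ord0 j.
  move=> wN; rewrite /level1 tcoef_sum.
  transitivity (\sum_i (x ord0 i * (w == [:: i])%:R)).
    by apply: eq_bigr => i _; rewrite tcoefZ {1}/tcoef ffunE val_insub_bseq.
  case: w wN => [|y [|z w]] _ /=.
  - by rewrite mul0r big1 // => i _; rewrite mulr0.
  - rewrite big_seq1 mul1r (bigD1 y) //= eqxx mulr1 big1 ?addr0 // => i iy.
    by rewrite eqseq_cons andbT eq_sym (negPf iy) mulr0.
  - by rewrite mul0r big1 // => i _; rewrite eqseq_cons andbF mulr0.
rewrite exprS tmulE //; case: s sN => [|y s] sN.
  by rewrite big_ord1 T //= !mul0r.
rewrite big_ord_recl /= T //= !mul0r add0r big_ord_recl /= take0 drop0.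
rewrite (T [:: y]) ?(leq_ltn_trans (leq0n _) sN) // big_seq1 mul1r IH; last exact: ltnW.
rewrite [X in _ + X]big1 ?addr0.
  by rewrite eqSS big_cons mulrCA.
move=> i _; have sz : size (take i.+1 s) = i.+1 by rewrite size_takel.
by rewrite T /= ?sz /= ?mul0r //; rewrite (leq_trans _ sN) //= ltnS; exact: ltn_ord.
Qed.

Lemma tcoef_texp_level1 (x : 'rV[R]_d) s : (size s <= N)%N ->
  tcoef (texp (level1 x : A)) s = (size s)`!%:R^-1 * \prod_(j <- s) x ord0 j.
Proof.
move=> sN; rewrite /texp tcoef_sum (bigD1 (Ordinal (sN : (size s < N.+1)%N))) //=.
rewrite tcoefZ tcoef_level1_X // eqxx mul1r [X in _ + X]big1 ?addr0 // => i.
rewrite -val_eqE /= eq_sym => /negPf si.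
by rewrite tcoefZ tcoef_level1_X // si mul0r mulr0.
Qed.

Lemma diff_pow_bounds (y z : R) n : 0 <= y -> y <= z ->
  n.+1%:R * (y ^+ n * (z - y)) <= z ^+ n.+1 - y ^+ n.+1 <= n.+1%:R * (z ^+ n * (z - y)).
Proof.
move=> y0 yz; have z0 : 0 <= z := le_trans y0 yz.
have zy : 0 <= z - y by rewrite subr_ge0.
have yzn k : y ^+ k <= z ^+ k by rewrite lerXn2r ?nnegrE.
elim: n => [|n /andP[IH1 IH2]]; first by rewrite !expr0 !expr1 !mul1r lexx.
apply/andP; split.
  have -> : z ^+ n.+2 - y ^+ n.+2 = y * (z ^+ n.+1 - y ^+ n.+1) + z ^+ n.+1 * (z - y).
    by rewrite !exprS; ring.
  have -> : n.+2%:R * (y ^+ n.+1 * (z - y)) =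
     y * (n.+1%:R * (y ^+ n * (z - y))) + y ^+ n.+1 * (z - y).
    by rewrite -[n.+2%:R]natr1 exprS; ring.
  by apply: lerD; [apply: ler_wpM2l|apply: ler_wpM2r].
have -> : z ^+ n.+2 - y ^+ n.+2 = z * (z ^+ n.+1 - y ^+ n.+1) + y ^+ n.+1 * (z - y).
  by rewrite !exprS; ring.
have -> : n.+2%:R * (z ^+ n.+1 * (z - y)) =
   z * (n.+1%:R * (z ^+ n * (z - y))) + z ^+ n.+1 * (z - y).
  by rewrite -[n.+2%:R]natr1 exprS; ring.
by apply: lerD; [apply: ler_wpM2l|apply: ler_wpM2r].
Qed.

(** On each cell both the Riemann term and the increment of u^(n+1) / (n+1) lie
    between the values of u^n at the two ends, times the length of the cell. *)
Lemma RS_power n t : 0 <= t <= 1 ->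
  RS (fun u => u ^+ n) id 0 t (t ^+ n.+1 / n.+1%:R).
Proof.
move=> /andP[t0 t1] e e0; exists (e / 2); first by rewrite divr_gt0.
move=> m x xi x0 xm xf.
have xc : chain m x := fine_chainW xf.
have n0 : (0 : R) < n.+1%:R by rewrite ltr0n.
rewrite [X in _ - X](_ : _ = \sum_(0 <= i < m)
  (x i.+1 ^+ n.+1 / n.+1%:R - x i ^+ n.+1 / n.+1%:R)); last first.
  by rewrite telescope_sumr // x0 xm expr0n /= mul0r subr0.
rewrite -sumrB (le_lt_trans (ler_norm_sum _ _ _)) //.
apply: (@le_lt_trans _ _ (\sum_(0 <= i < m) (e / 2) * (x i.+1 ^+ n - x i ^+ n))).
  rewrite big_nat [leRHS]big_nat; apply: ler_sum => i /andP[_ im].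
  have [/andP[x1 x2] x3] := xf _ im.
  have xi0 : 0 <= x i by rewrite -x0 (chain_le xc) // ltnW.
  have /andP[d1 d2] := diff_pow_bounds n xi0 (le_trans x1 x2).
  have p1 : x i ^+ n <= xi i ^+ n by rewrite lerXn2r ?nnegrE // (le_trans xi0).
  have p2 : xi i ^+ n <= x i.+1 ^+ n.
    by rewrite lerXn2r ?nnegrE //; [exact: le_trans x1|exact: le_trans (le_trans x1 x2)].
  set D := x i.+1 - x i in x3 d1 d2 *.
  have D0 : 0 <= D by rewrite subr_ge0 (le_trans x1).
  rewrite -mulrBl; set Q := _ / _.
  have Q1 : x i ^+ n * D <= Q by rewrite ler_pdivlMr // mulrC.
  have Q2 : Q <= x i.+1 ^+ n * D by rewrite ler_pdivrMr // mulrC.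
  have D1 : (x i.+1 ^+ n - x i ^+ n) * D <= e / 2 * (x i.+1 ^+ n - x i ^+ n).
    by rewrite mulrC; apply: ler_wpM2r (ltW x3); lra.
  have m1 := ler_wpM2r D0 p1; have m2 := ler_wpM2r D0 p2.
  rewrite mulrBl in D1.
  by rewrite ler_norml; apply/andP; split; lra.
rewrite -mulr_sumr telescope_sumr // x0 xm.
have tn : t ^+ n <= 1 by rewrite exprn_ile1.
have t00 : 0 <= (0 : R) ^+ n by rewrite exprn_ge0.
apply: (@le_lt_trans _ _ (e / 2 * 1)); first by apply: ler_wpM2l; lra.
by rewrite mulr1; lra.
Qed.

(** The iterated integrals along the segment from 0 to x are monomials over
    factorials, the coefficients of the exponential. *)
Lemma reach_line (x : 'rV[R]_d) : reach (texp (level1 x)) (eucl_norm x).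
Proof.
apply/reachP; exists (fun t => t *: x), (fun t => texp (level1 (t *: x))); split.
- apply/pcontP => c c01 e e0; exists (e / (eucl_norm x + 1)).
    by rewrite divr_gt0 // ltr_wpDl ?eucl_norm_ge0.
  move=> s s01 sc; rewrite -scalerBl eucl_normZ distrC.
  rewrite ltr_pdivlMr in sc; last by rewrite ltr_wpDl ?eucl_norm_ge0.
  by apply: le_lt_trans sc; rewrite ler_wpM2l // lerDl.
- move=> n y y0 yn yc; rewrite (eq_big_nat _ _ (F2 := fun i =>
    (y i.+1 - y i) * eucl_norm x)).
    by rewrite -mulr_suml telescope_sumr // y0 yn subr0 mul1r.
  by move=> i /andP[_ ni]; rewrite -scalerBl eucl_normZ ger0_norm // subr_ge0 yc.
- by move=> t _; rewrite tcoef_texp_level1 // fact0 invr1 big_nil mulr1.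
- move=> t s j t01 sN.
  have E w z : (size w <= N)%N -> tcoef (texp (level1 (z *: x)) : A) w =
      (size w)`!%:R^-1 * (\prod_(j <- w) x ord0 j) * z ^+ size w.
    move=> wN; rewrite tcoef_texp_level1 // -mulrA; congr (_ * _).
    elim: w {wN} => [|i w IH]; first by rewrite !big_nil mulr1.
    by rewrite !big_cons IH mxE /= exprS; ring.
  have := RSZr (x ord0 j) (RSZ ((size s)`!%:R^-1 * \prod_(i <- s) x ord0 i)
    (RS_power (size s) t01)).
  have -> : tcoef (texp (level1 (t *: x)) : A) (rcons s j) =
    x ord0 j * ((size s)`!%:R^-1 * \prod_(i <- s) x ord0 i *
      (t ^+ (size s).+1 / (size s).+1%:R)).
    by rewrite E size_rcons // big_rcons /= factS natrM invfM; ring.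
  congr RS; apply/funext => z; first by rewrite E // ltnW.
  by rewrite mxE mulrC.
- by rewrite scale1r.
Qed.

End Reach.

(** * Reachable elements and the Carnot-Caratheodory norm *)

Section Chow.
Context {R : realType} {d N : nat}.
Local Notation A := (tensor R d N).
Local Notation Wd := (@W R d N).
Local Notation G := (@Ggroup R d N).
Implicit Types (g h w a b u v : A) (l : R).

Lemma level_norm_ge0 i a : 0 <= level_norm i a. Proof. exact: sqrtr_ge0. Qed.

Lemma level_normE i a : level_norm i a =
  Num.sqrt (\sum_(w : N.-bseq 'I_d | size w == i) tcoef a w ^+ 2).
Proof. by rewrite /level_norm; congr Num.sqrt; apply: eq_bigr => w _; rewrite tcoef_val. Qed.

Lemma level_normD i a b : level_norm i (a + b) <= level_norm i a + level_norm i b.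
Proof.
rewrite !level_normE; under eq_bigr do rewrite tcoefD.
exact: l2_triangle.
Qed.

Lemma level_normZ i (k : R) a : level_norm i (k *: a) = `|k| * level_norm i a.
Proof.
rewrite !level_normE; under eq_bigr do rewrite tcoefZ.
exact: l2_scale.
Qed.

Lemma level_norm0 i : level_norm i (0 : A) = 0.
Proof. by rewrite -(scale0r (0 : A)) level_normZ normr0 mul0r. Qed.

Lemma level_normN i a : level_norm i (- a) = level_norm i a.
Proof. by rewrite -scaleN1r level_normZ normrN1 mul1r. Qed.

Lemma level_normB i a b : level_norm i (a - b) <= level_norm i a + level_norm i b.
Proof. by rewrite -(level_normN i b); exact: level_normD. Qed.

Lemma level_norm_distC i a b : level_norm i (a - b) = level_norm i (b - a).
Proof. by rewrite -level_normN opprB. Qed.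

Lemma level_norm_coord a s : (size s <= N)%N -> `|tcoef a s| <= level_norm (size s) a.
Proof.
move=> sN; rewrite -{1}(val_insub_bseq sN) level_normE.
apply: (@l2_coord _ _ (fun t : N.-bseq 'I_d => size t == size s)
  (fun t : N.-bseq 'I_d => tcoef a t) (insub_bseq N s)).
by rewrite val_insub_bseq.
Qed.

Lemma level_norm_le i a (M : R) :
  (forall s, size s = i -> (i <= N)%N -> `|tcoef a s| <= M) ->
  level_norm i a <= (\sum_(w : N.-bseq 'I_d | size w == i) 1) * M.
Proof.
move=> aM; rewrite level_normE; apply: le_trans (l2_le_l1 _ _) _.
rewrite mulr_suml; apply: ler_sum => w /eqP wi; rewrite mul1r.
by apply: aM => //; rewrite -wi size_bseq.
Qed.

Lemma level_norm_lev i a b : lev i a = lev i b -> level_norm i a = level_norm i b.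
Proof.
move=> ab; rewrite /level_norm; congr Num.sqrt; apply: eq_bigr => w /eqP wi.
have := congr1 (fun x => tcoef x w) ab.
by rewrite !tcoef_lev ?size_bseq // wi eqxx !tcoef_val => ->.
Qed.

Lemma path_length_reach (f : R -> 'rV[R]_d) g :
  bv_path f -> is_signature f g -> reach g (path_length f).
Proof. by move=> fb fg; exists f. Qed.

Lemma cc_norm_ge0 g : 0 <= cc_norm g.
Proof.
rewrite /cc_norm; set X := image _ _; have [->|/set0P X0] := eqVneq X set0.
  by rewrite inf0.
apply: lb_le_inf => // _ [f [fb fg] <-].
exact: reach_ge0 (path_length_reach fb fg).
Qed.

Lemma cc_norm_le g l : reach g l -> cc_norm g <= l.
Proof.
move=> [f fg fl]; apply: le_trans fl; apply: inf_lbound; last by exists f.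
by exists 0 => _ [f' [fb' fg'] <-]; exact: reach_ge0 (path_length_reach fb' fg').
Qed.

Lemma cc_norm_reach g l (e : R) : reach g l -> 0 < e -> reach g (cc_norm g + e).
Proof.
move=> [f [fb fg] fl] e0.
have := @inf_adherent R [set path_length f | f in [set f | bv_path f /\ is_signature f g]] e e0.
case=> [|_ [f' fg' <-] /ltW]; last by exists f'.
split; first by exists (path_length f), f.
by exists 0 => _ [f' [fb' fg'] <-]; exact: reach_ge0 (path_length_reach fb' fg').
Qed.

Lemma cc_normM g h l m : reach g l -> reach h m ->
  cc_norm (g * h) <= cc_norm g + cc_norm h.
Proof.
move=> Hg Hh; apply/ler_addgt0Pr => e e0; have e2 : 0 < e / 2 by rewrite divr_gt0.
rewrite [e]splitr addrACA; apply: cc_norm_le.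
by apply: reach_mul; [exact: cc_norm_reach Hg e2|exact: cc_norm_reach Hh e2].
Qed.

Lemma cc_norm_inv g l : reach g l -> cc_norm (tinv g) = cc_norm g.
Proof.
move=> Hg; apply/eqP; rewrite eq_le; apply/andP; split; apply/ler_addgt0Pr => e e0.
  by apply: cc_norm_le; apply: reach_inv; exact: cc_norm_reach Hg e0.
apply: cc_norm_le; rewrite -{1}(tinvK (reach_coef0 Hg)); apply: reach_inv.
exact: cc_norm_reach (reach_inv Hg) e0.
Qed.

(** w is the leading term, at level i, of elements reached at cost C lam with
    speed lam^i.  The exponent i is what makes the norm of an element of level i
    comparable with the power 1 / i of its Euclidean norm. *)
Definition flow i w := exists2 C : R, 0 <= C & forall lam : R, 0 <= lam ->
  exists g, [/\ G g, reach g (C * lam) & vanish i.+1 (g - 1 - lam ^+ i *: w)].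

Lemma W1_level1 w : w \in Wd 1 -> w = level1 (\row_j tcoef w [:: j]).
Proof.
move=> w1; apply: tensorP => s sN; have := congr1 (fun x => tcoef x s) (W_homog (isT : (0 < 1)%N) w1).
rewrite tcoef_lev // -[level1 _]expr1 tcoef_level1_X //.
case: eqP => [|_ <-]; last by rewrite mul0r.
by case: s sN => [|x []] //= _ _; rewrite big_seq1 mul1r mxE.
Qed.

Lemma flow_W1 w : w \in Wd 1 -> flow 1 w.
Proof.
move=> w1; pose x := \row_j tcoef w [:: j] : 'rV[R]_d.
have wx : w = level1 x := W1_level1 w1.
have lZ (k : R) : level1 (k *: x) = k *: level1 x :> A.
  by rewrite /level1 scaler_sumr; apply: eq_bigr => j _; rewrite mxE scalerA.
exists (eucl_norm x) => [|lam l0]; first exact: eucl_norm_ge0.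
exists (texp (lam *: w)); split.
- have wl : w \in @lie_algebra R d N by exact: W_lie w1.
  by exists (lam *: w) => //=; exact: memvZ.
- by rewrite wx -lZ mulrC -[X in X * _]ger0_norm // -eucl_normZ; exact: reach_line.
have z1 : vanish 1 (0 : A) by move=> s _ _; exact: tcoef0.
have := @vanish_texp_add _ _ _ 1 0 (lam *: w) z1 _ isT; rewrite add0r texp0 expr1; apply.
by apply: vanishZ; exact: W_vanish.
Qed.

Lemma vanish_le i g w (lam : R) : vanish i w -> vanish i.+1 (g - 1 - lam *: w) ->
  vanish i (g - 1).
Proof.
move=> wi H; rewrite -[X in vanish i X](subrK (lam *: w)); apply: vanishD.
  exact: vanishW H.
exact: vanishZ.
Qed.

Lemma flowD i w w' : (0 < i)%N -> vanish i w -> vanish i w' ->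
  flow i w -> flow i w' -> flow i (w + w').
Proof.
move=> i0 wi wi' [C C0 H] [C' C0' H']; exists (C + C') => [|lam l0].
  exact: addr_ge0.
have [g [Gg gr gv]] := H lam l0; have [h [Gh hr hv]] := H' lam l0.
exists (g * h); split; [exact: G_mul|by rewrite mulrDl; exact: reach_mul|].
have g1 := vanish_le wi gv; have h1 := vanish_le wi' hv.
have -> : g * h - 1 - lam ^+ i *: (w + w') = (g - 1 - lam ^+ i *: w)
   + (h - 1 - lam ^+ i *: w') + (g - 1) * (h - 1).
  rewrite mulrBr mulr1 mulrBl mul1r scalerDr; apply: tensorP => s _.
  by rewrite !(tcoefD, tcoefN); ring.
apply: vanishD; first exact: vanishD.
by apply: vanishW (vanishM g1 h1); rewrite -addn1 leq_add2l.
Qed.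

Lemma reach1 : reach (1 : A) 0.
Proof.
have := @reach_line R d N 0; rewrite eucl_norm0.
rewrite (_ : level1 0 = 0) ?texp0 //.
by rewrite /level1 big1 // => j _; rewrite mxE scale0r.
Qed.

Lemma flow0 i : flow i 0.
Proof.
exists 0 => // lam l0; exists 1; split; first exact: G_one; last first.
  by rewrite subrr scaler0 subr0 => s _ _; exact: tcoef0.
by rewrite mul0r; exact: reach1.
Qed.

Lemma flowN i w : (0 < i)%N -> vanish i w -> flow i w -> flow i (- w).
Proof.
move=> i0 wi [C C0 H]; exists C => // lam l0.
have [g [Gg gr gv]] := H lam l0; have g1 := vanish_le wi gv.
exists (tinv g); split; [exact: G_inv|exact: reach_inv|].
have gg : tcoef g [::] = 1 := G_coef0 Gg.
have -> : tinv g - 1 - lam ^+ i *: - w = - (g - 1 - lam ^+ i *: w) + (tinv g - 1) * (1 - g).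
  rewrite mulrBr mulr1 mulrBl mul1r tmulVl // scalerN; apply: tensorP => s _.
  by rewrite !(tcoefD, tcoefN); ring.
apply: vanishD; first exact: vanishN.
rewrite -add1n; apply: vanishM.
  by apply: vanish1; rewrite tcoefB tcoef_tinv // tcoef_one // subrr.
by rewrite -[1 - g]opprB; exact: vanishN.
Qed.

Lemma flowZ i (k : R) w : (0 < i)%N -> vanish i w -> flow i w -> flow i (k *: w).
Proof.
move=> i0 wi; wlog k0 : k w wi / 0 <= k => [hw|] fw.
  have [k0|/ltW k0] := leP 0 k; first exact: hw.
  rewrite -[k]opprK scaleNr -scalerN; apply: hw; rewrite ?oppr_ge0 //.
    exact: vanishN.
  exact: flowN.
case: fw => C C0 H; exists (C * k `^ i%:R^-1) => [|lam l0].
  by rewrite mulr_ge0 ?powR_ge0.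
have [|g [Gg gr gv]] := H (k `^ i%:R^-1 * lam); first by rewrite mulr_ge0 ?powR_ge0.
exists g; split=> //; first by rewrite -mulrA.
move: gv; rewrite exprMn -[X in X * _]powR_mulrn ?powR_ge0 // -powRrM mulVf ?powRr1 //.
  by rewrite [k * _]mulrC -scalerA.
by rewrite pnatr_eq0 -lt0n.
Qed.

Lemma mulr_split1 (x y : A) : x * y = x + x * (y - 1).
Proof. by rewrite mulrBr mulr1 addrC subrK. Qed.

Lemma comm_sub1 (g h : A) : g * h - h * g = (g - 1) * (h - 1) - (h - 1) * (g - 1).
Proof.
rewrite !mulrBr !mulrBl !mul1r !mulr1.
by apply: tensorP => s _; rewrite !tcoefB; ring.
Qed.

Lemma comm_expand (a b u v : A) (k l : R) :
  a * b - b * a - (k * l) *: (u * v - v * u) =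
  ((a - k *: u) * b - b * (a - k *: u)) +
  (k *: u * (b - l *: v) - (b - l *: v) * (k *: u)).
Proof.
rewrite !mulrBr !mulrBl -!scalerAl -!scalerAr !scalerA [l * k]mulrC scalerBr.
by apply: tensorP => s _; rewrite !(tcoefD, tcoefN); ring.
Qed.

(** The group commutator of the two flows has the bracket as leading term. *)
Lemma flow_bracket i u v : (0 < i)%N -> vanish 1 u -> vanish i v ->
  flow 1 u -> flow i v -> flow i.+1 (u * v - v * u).
Proof.
move=> i0 u1 vi [C C0 H] [C' C0' H']; exists (C + C' + (C + C')) => [|lam l0].
  by rewrite !addr_ge0.
have [g [Gg gr gv]] := H lam l0; have [h [Gh hr hv]] := H' lam l0.
have g1 := G_coef0 Gg; have h1 := G_coef0 Gh.
exists ((g * h) * (tinv g * tinv h)); split.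
- by do !apply: G_mul => //; exact: G_inv.
- by rewrite mulrDl; apply: reach_mul; rewrite mulrDl; apply: reach_mul => //;
    exact: reach_inv.
have hgV : (h * g) * (tinv g * tinv h) = 1.
  by rewrite mulrA -(mulrA h) tmulV // mulr1 tmulV.
set V := tinv g * tinv h in hgV *.
have V1 : tcoef V [::] = 1 by rewrite tcoef0M !tcoef_tinv // mulr1.
pose a := g - 1; pose b := h - 1; pose a' := a - lam *: u; pose b' := b - lam ^+ i *: v.
have ga : vanish 1 a by exact: vanish_le u1 gv.
have hb : vanish i b by exact: vanish_le vi hv.
have E1 : g * h * V - 1 = (a * b - b * a) * V.
  by rewrite -{1}hgV -mulrBl (comm_sub1 g h).
have E2 : (a * b - b * a) * V = (a * b - b * a) + (a * b - b * a) * (V - 1).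
  exact: mulr_split1.
have E3 : a * b - b * a - lam ^+ i.+1 *: (u * v - v * u) =
  (a' * b - b * a') + (lam *: u * b' - b' * (lam *: u)).
  by rewrite exprS comm_expand.
rewrite E1 E2 addrAC E3; apply: vanishD; first (apply: vanishD; apply: vanishB).
- by rewrite -add2n; apply: vanishM => //; rewrite /a' -[lam]expr1.
- by rewrite -addn2; apply: vanishM => //; rewrite /a' -[lam]expr1.
- by rewrite -add1n; apply: vanishM => //; exact: vanishZ.
- by rewrite -addn1; apply: vanishM => //; exact: vanishZ.
rewrite -addn1; apply: vanishM.
  by apply: vanishB; [rewrite -add1n|rewrite -addn1]; exact: vanishM.
by apply: vanish1; rewrite tcoefB V1 tcoef_one // subrr.
Qed.

Lemma flow_span i (X : seq A) w : (0 < i)%N ->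
  (forall x, x \in X -> vanish i x /\ flow i x) -> w \in <<X>>%VS -> flow i w.
Proof.
move=> i0 HX wX; have : w \in <<in_tuple X>>%VS by [].
move/coord_span ->.
suff [] : vanish i (\sum_(j < size X) coord (in_tuple X) j w *: X`_j) /\
   flow i (\sum_(j < size X) coord (in_tuple X) j w *: X`_j) by [].
elim/big_ind: _ => [|x y [x1 x2] [y1 y2]|j _].
- by split; [move=> s _ _; exact: tcoef0|exact: flow0].
- by split; [exact: vanishD|exact: flowD].
- have [x1 x2] := HX _ (mem_nth 0 (ltn_ord j)).
  by split; [exact: vanishZ|exact: flowZ].
Qed.

Lemma flow_W i w : (0 < i)%N -> w \in Wd i -> flow i w.
Proof.
case: i => // i _; elim: i w => [|i IH] w; first exact: flow_W1.
rewrite WS => /flow_span; apply => // x /allpairsP[[u v] /= [uU vV ->]].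
have u1 := vbasis_mem uU; have v1 := vbasis_mem vV.
split; last by apply: flow_bracket => //; [exact: W_vanish|exact: W_vanish|exact: flow_W1|exact: IH].
apply: (@W_vanish _ _ _ i.+2) => //; rewrite WS; exact: mem_bracketv.
Qed.

(** The lowest level of g that is not trivial is removed by a flow, and the
    remaining factor has one level less. *)
Lemma chow g : G g -> exists l, reach g l.
Proof.
suff H k : (k <= N)%N -> forall g, G g -> vanish (N.+1 - k) (g - 1) -> exists l, reach g l.
  move=> Gg; apply: (H N) => //; rewrite subSnn; apply: vanish1.
  by rewrite tcoefB (G_coef0 Gg) tcoef_one // subrr.
elim: k => [|k IH] kN {}g Gg gv.
  move: gv; rewrite subn0 => /(vanish_top (ltnSn _))/eqP; rewrite subr_eq0 => /eqP ->.
  by exists 0; exact: reach1.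
have kN1 : (N.+1 - k.+1 = N - k)%N by rewrite subSS.
have k0 : (0 < N - k)%N by rewrite subn_gt0.
rewrite kN1 in gv; have [a [al av] ga] := G_vanish Gg gv.
have [C C0 /(_ 1 ler01)[h [Gh hr hv]]] := flow_W k0 (lev_lie k0 al).
rewrite expr1n scale1r in hv.
have lv : vanish (N - k).+1 (a - lev (N - k) a).
  apply: vanish_lev => j; rewrite ltnS leq_eqVlt linearB /= lev_lev => /orP[/eqP ->|jk].
    by rewrite eqxx subrr.
  by rewrite (lev_vanish av jk) ltn_eqF ?subrr.
have z1 : vanish 1 (0 : A) by move=> s _ _; exact: tcoef0.
have := vanish_texp_add z1 av k0; rewrite add0r texp0 -ga => gav.
have gh : vanish (N - k).+1 (g - h).
  have -> : g - h = (g - 1 - a) + (a - lev (N - k) a) - (h - 1 - lev (N - k) a).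
    by apply: tensorP => s _; rewrite !(tcoefD, tcoefN); ring.
  by apply: vanishB => //; exact: vanishD.
have [||l lr] := IH (ltnW kN) (tinv h * g).
- by apply: G_mul => //; exact: G_inv.
- rewrite -(tmulVl (G_coef0 Gh)) -mulrBr subSn ?(ltnW kN) // -[X in vanish X _]add0n.
  exact: vanishM.
exists (C * 1 + l); rewrite -[g]mul1r -(tmulV (G_coef0 Gh)) -mulrA.
exact: reach_mul.
Qed.

Definition delta_word (s : N.-bseq 'I_d) : A := [ffun w : N.-bseq 'I_d => (w == s)%:R : R^o].

Lemma sum_delta_word a : a = \sum_(s : N.-bseq 'I_d) tcoef a s *: delta_word s.
Proof.
apply/ffunP => w; rewrite sum_ffunE (bigD1 w) //= big1 ?addr0.
  by rewrite !ffunE eqxx tcoef_val [RHS]mulr1.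
by move=> s sw; rewrite !ffunE eq_sym (negPf sw) [LHS]mulr0.
Qed.

Lemma form_bound (phi : {scalar A}) i : exists2 M : R, 0 <= M &
  forall a, lev i a = a -> `|phi a| <= M * level_norm i a.
Proof.
exists (\sum_(s : N.-bseq 'I_d) `|phi (delta_word s)|) => [|a ai].
  by apply: sumr_ge0.
rewrite {1}(sum_delta_word a) linear_sum (le_trans (ler_norm_sum _ _ _)) //.
rewrite mulr_suml; apply: ler_sum => s _; rewrite linearZ normrM mulrC.
have [si|si] := eqVneq (size s) i.
  by apply: ler_wpM2l => //; rewrite -si; apply: level_norm_coord; rewrite size_bseq.
have -> : tcoef a s = 0.
  by rewrite -ai tcoef_lev ?size_bseq // (negPf si).
by rewrite normr0 mulr0 mulr_ge0 // level_norm_ge0.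
Qed.

Lemma top_mul1 w w' : (0 < N)%N -> vanish N w -> vanish N w' ->
  (1 + w) * (1 + w') = 1 + (w + w').
Proof.
move=> N0 wN wN'; rewrite mulrDr mulr1 top_mulr // ?addrA //.
by rewrite tcoefD tcoef_one // wN // addr0.
Qed.

(** At level N the leading term of a flow is exact, since nothing lies above.  So
    w is decomposed in a basis of W_N, and each coordinate c costs |c|^(1/N). *)
Lemma reach_top : (0 < N)%N -> exists2 C : R, 0 <= C &
  forall w, w \in Wd N -> reach (1 + w) (C * level_norm N w `^ N%:R^-1).
Proof.
move=> N0; pose X := vbasis (Wd N).
have XW k : (k < \dim (Wd N))%N -> X`_k \in Wd N.
  by move=> kd; apply: vbasis_mem; apply: mem_nth; rewrite size_tuple.
have topw (w : A) : w \in Wd N -> flow N w -> exists2 C, 0 <= C &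
    forall c, 0 <= c -> reach (1 + c *: w) (C * c `^ N%:R^-1).
  move=> wN [C C0 H]; exists C => // c c0.
  have [|g [_ gr gv]] := H (c `^ N%:R^-1); first exact: powR_ge0.
  move: gv; rewrite -powR_mulrn ?powR_ge0 // -powRrM mulVf ?powRr1 //; last first.
    by rewrite pnatr_eq0 -lt0n.
  move/(vanish_top (ltnSn _))/eqP; rewrite subr_eq0 subr_eq addrC => /eqP <-.
  by [].
have one k : (k < \dim (Wd N))%N -> exists2 C, 0 <= C &
  forall w, w \in Wd N -> forall kk : 'I_(\dim (Wd N)), k = kk ->
   reach (1 + coord X kk w *: X`_k) (C * level_norm N w `^ N%:R^-1).
  move=> kd; have xW := XW k kd.
  have [C C0 H] := topw _ xW (flow_W N0 xW).
  have nxW : - X`_k \in Wd N by rewrite rpredN.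
  have [C' C0' H'] := topw _ nxW (flow_W N0 nxW).
  have [M M0 HM] := form_bound (coord X (Ordinal kd)) N.
  exists ((C + C') * M `^ N%:R^-1); first by rewrite mulr_ge0 ?powR_ge0 // addr_ge0.
  move=> w wN kk kE; have <- : Ordinal kd = kk by apply: val_inj.
  have cM := HM w (W_homog N0 wN); set c := coord _ _ _ in cM *.
  have cP : `|c| `^ N%:R^-1 <= M `^ N%:R^-1 * level_norm N w `^ N%:R^-1.
    by rewrite -powRM ?level_norm_ge0 //; apply: ge0_ler_powR; rewrite ?nnegrE ?mulr_ge0
        ?level_norm_ge0 ?invr_ge0.
  rewrite -mulrA.
  have [c0|c0] := leP 0 c.
    apply: reachW (H _ c0); rewrite ger0_norm // in cP; apply: ler_pM; rewrite ?powR_ge0 //.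
    by rewrite lerDl.
  rewrite -[c]opprK scaleNr -scalerN.
  have c0' : 0 <= - c by rewrite oppr_ge0 ltW.
  apply: reachW (H' _ c0'); rewrite ltr0_norm // in cP; apply: ler_pM; rewrite ?powR_ge0 //.
  by rewrite lerDr.
have /choice[C HC] : forall k : 'I_(\dim (Wd N)), exists C, 0 <= C /\
  forall w, w \in Wd N -> reach (1 + coord X k w *: X`_k) (C * level_norm N w `^ N%:R^-1).
  by move=> k; have [C C0 H] := one k (ltn_ord k); exists C; split=> // w wN; exact: H.
exists (\sum_k C k) => [|w wN]; first by apply: sumr_ge0 => k _; case: (HC k).
rewrite [X in reach (1 + X) _](coord_vbasis wN) mulr_suml.
suff [] : vanish N (\sum_k coord X k w *: X`_k) /\
   reach (1 + \sum_k coord X k w *: X`_k) (\sum_k C k * level_norm N w `^ N%:R^-1) by [].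
elim/big_ind2: _ => [|x x' y y' [x1 x2] [y1 y2]|k _].
- by split; [move=> s _ _; exact: tcoef0|rewrite addr0; exact: reach1].
- by split; [exact: vanishD|rewrite -top_mul1 //; exact: reach_mul].
- split; last by have [_] := HC k; apply.
  by apply: vanishZ; apply: W_vanish => //; exact: XW.
Qed.

End Chow.

(** * The quotient by a subgroup of the top level *)

Section Pow.
Context {R : realType}.
Implicit Types a b c r x : R.

Lemma ler_powR2 a b r : 0 <= r -> 0 <= a -> a <= b -> a `^ r <= b `^ r.
Proof. by move=> r0 a0 ab; apply: ge0_ler_powR; rewrite ?nnegrE // (le_trans a0). Qed.

(** Both summands are at most the larger one. *)
Lemma powRD_le a b r : 0 <= r -> 0 <= a -> 0 <= b ->
  (a + b) `^ r <= 2 `^ r * (a `^ r + b `^ r).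
Proof.
move=> r0; wlog ab : a b / a <= b => [hw a0 b0|a0 b0].
  have [ab|ba] := leP a b; first exact: hw.
  by rewrite addrC [a `^ r + _]addrC; apply: hw => //; exact: ltW.
apply: (@le_trans _ _ ((2 * b) `^ r)); first by apply: ler_powR2; lra.
by rewrite powRM // ler_wpM2l ?powR_ge0 // lerDr powR_ge0.
Qed.

Lemma powR_natK x n : 0 <= x -> (0 < n)%N -> (x ^+ n) `^ n%:R^-1 = x.
Proof.
by move=> x0 n0; rewrite -powR_mulrn // -powRrM mulfV ?powRr1 // pnatr_eq0 -lt0n.
Qed.

Lemma powR_invnK x n : 0 <= x -> (0 < n)%N -> (x `^ n%:R^-1) ^+ n = x.
Proof.
by move=> x0 n0; rewrite -powR_mulrn ?powR_ge0 // -powRrM mulVf ?powRr1 // pnatr_eq0 -lt0n.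
Qed.

Lemma exp_le_limit x c n : 0 <= c -> (forall e, 0 < e -> x <= (c + e) ^+ n) -> x <= c ^+ n.
Proof.
move=> c0 H; case: n H => [|n] H; first exact: (H 1).
rewrite leNgt; apply/negP => cx.
have x0 : 0 <= x by apply: le_trans (ltW cx); rewrite exprn_ge0.
pose y := x `^ n.+1%:R^-1.
have yx : y ^+ n.+1 = x by exact: powR_invnK.
have y0 : 0 <= y := powR_ge0 _ _.
have cy : c < y by rewrite ltNge; apply/negP => yc; move: cx; rewrite -yx ltNge lerXn2r ?nnegrE.
have e0 : 0 < (y - c) / 2 by lra.
have := H _ e0; rewrite leNgt => /negP; apply; rewrite -yx ltrXn2r ?nnegrE //=; lra.
Qed.

End Pow.

Section CCnorm.
Context {R : realType} {d N : nat}.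
Local Notation A := (tensor R d N).
Local Notation Wd := (@W R d N).
Local Notation G := (@Ggroup R d N).
Implicit Types (g h a b u v w : A) (l : R).

Lemma cc_norm_coef g s : G g -> (size s <= N)%N -> `|tcoef g s| <= cc_norm g ^+ size s.
Proof.
move=> Gg sN; have [l gl] := chow Gg; apply: exp_le_limit; first exact: cc_norm_ge0.
by move=> e e0; apply: reach_coef_le => //; exact: cc_norm_reach gl e0.
Qed.

Lemma level_norm_cc g i : G g ->
  level_norm i g <= (\sum_(w : N.-bseq 'I_d | size w == i) 1) * cc_norm g ^+ i.
Proof.
by move=> Gg; apply: level_norm_le => s <- sN; exact: cc_norm_coef.
Qed.

Lemma cc_norm_mul g h : G g -> G h -> cc_norm (g * h) <= cc_norm g + cc_norm h.
Proof. by move=> /chow[l gl] /chow[m hm]; exact: cc_normM gl hm. Qed.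

Lemma cc_norm_tinv g : G g -> cc_norm (tinv g) = cc_norm g.
Proof. by move=> /chow[l gl]; exact: cc_norm_inv gl. Qed.

Lemma cc_norm1 : cc_norm (1 : A) = 0.
Proof. by apply/eqP; rewrite eq_le cc_norm_ge0 cc_norm_le //; exact: reach1. Qed.

Lemma cc_dist_tri g h u : G g -> G h -> G u -> cc_dist g u <= cc_dist g h + cc_dist h u.
Proof.
move=> Gg Gh Gu; rewrite /cc_dist.
have -> : tinv g * u = (tinv g * h) * (tinv h * u).
  by rewrite mulrA -(mulrA _ h) tmulV ?mulr1 // G_coef0.
by apply: cc_norm_mul; apply: G_mul => //; exact: G_inv.
Qed.

Lemma cc_dist_sym g h : G g -> G h -> cc_dist g h = cc_dist h g.
Proof.
move=> Gg Gh; rewrite /cc_dist -cc_norm_tinv; last by apply: G_mul => //; exact: G_inv.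
by rewrite tinv_mul ?tcoef_tinv ?G_coef0 // tinvK // G_coef0.
Qed.

Lemma cc_distxx g : G g -> cc_dist g g = 0.
Proof. by move=> Gg; rewrite /cc_dist tmulVl ?cc_norm1 // G_coef0. Qed.

Hypothesis N0 : (0 < N)%N.

Lemma texp_WN w : w \in Wd N -> texp w = 1 + w.
Proof. by move=> wN; apply: texp_top => //; exact: W_vanish. Qed.

Lemma G_top w : w \in Wd N -> G (1 + w).
Proof. by move=> wN; exists w; [exact: W_lie wN|exact: texp_WN]. Qed.

Lemma lev_inc g h w : tcoef g [::] = 1 -> vanish N w -> tinv g * (h + w) = tinv g * h + w.
Proof. by move=> g1 wN; rewrite mulrDr [_ * w]top_mulr // tcoef_tinv. Qed.

Lemma tinv_top w : vanish N w -> tinv (1 + w) = 1 - w.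
Proof.
move=> wN; apply: tinv_uniq; first by rewrite tcoefD tcoef_one // wN // addr0.
by rewrite top_mul1 ?subrr ?addr0 //; exact: vanishN.
Qed.

Lemma tinv_addr g w : tcoef g [::] = 1 -> vanish N w -> tinv (g + w) = tinv g - w.
Proof.
move=> g1 wN; have -> : g + w = g * (1 + w) by rewrite mulrDr mulr1 top_mulr.
rewrite tinv_mul //; last by rewrite tcoefD tcoef_one // wN // addr0.
by rewrite tinv_top // mulrBl mul1r top_mull // tcoef_tinv.
Qed.

Lemma inc_shift g h w w' : tcoef g [::] = 1 -> tcoef h [::] = 1 ->
  vanish N w -> vanish N w' -> tinv (g + w) * (h + w') = tinv g * h + (w' - w).
Proof.
move=> g1 h1 wN wN'; rewrite tinv_addr // mulrBl lev_inc // [w * _]top_mull //.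
  by rewrite addrA.
by rewrite tcoefD wN' // addr0.
Qed.

Section Quot.
Variable K : set A.
Hypothesis HK : closed_subgroup (expW N) K.

(** On W_N the exponential is w |-> 1 + w, so this is the logarithm of K. *)
Definition logK w := w \in Wd N /\ K (1 + w).

Lemma logK_W w : logK w -> w \in Wd N. Proof. by case. Qed.
Lemma logK_van w : logK w -> vanish N w.
Proof. by case=> wN _; exact: W_vanish wN. Qed.

Lemma logKP k : K k <-> exists2 w, logK w & k = 1 + w.
Proof.
case: HK => KW _ _ _ _; split => [Kk|[w [wN Kw] ->]] //.
by case: (KW _ Kk) => w /= wN wk; exists w; rewrite /logK -?texp_WN // wk.
Qed.

Lemma logK0 : logK 0.
Proof. by split; [exact: mem0v|rewrite addr0; case: HK]. Qed.

Lemma logKD u v : logK u -> logK v -> logK (u + v).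
Proof.
move=> Lu Lv; have uv := logK_van Lu; have vv := logK_van Lv.
case: Lu Lv => uN Ku [vN Kv]; split; first exact: memvD.
by rewrite -top_mul1 //; case: HK => _ _ KM _ _; exact: KM.
Qed.

Lemma logKN u : logK u -> logK (- u).
Proof.
move=> Lu; have uv := logK_van Lu; case: Lu => uN Ku; split; first by rewrite rpredN.
by rewrite -tinv_top //; case: HK => _ _ _ KI _; exact: KI.
Qed.

Lemma logKB u v : logK u -> logK v -> logK (u - v).
Proof. by move=> Lu Lv; apply: logKD => //; exact: logKN. Qed.

(** The Carnot-Caratheodory distance between 1 + w and 1 + v is at most a multiple
    of |w - v|^(1/N) by [reach_top], so that K is closed for the Euclidean norm. *)
Lemma logK_closed w : w \in Wd N ->
  (forall e : R, 0 < e -> exists2 v, logK v & level_norm N (w - v) < e) -> logK w.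
Proof.
move=> wN H; split=> //; case: HK => _ _ _ _; apply.
  by exists w; rewrite ?texp_WN.
move=> e e0; have [C C0 HC] := @reach_top R d N N0.
have C1 : 0 < C + 1 by rewrite ltr_wpDl.
have [v Lv vw] := H ((e / (C + 1)) ^+ N) (exprn_gt0 _ (divr_gt0 e0 C1)).
exists (1 + v); first by case: Lv.
rewrite /cc_dist tinv_top; last exact: W_vanish wN.
rewrite top_mul1 //; [|apply: vanishN; exact: W_vanish wN|exact: logK_van].
have := HC (- w + v); rewrite memvD ?rpredN ?(logK_W Lv) // => /(_ isT) /cc_norm_le.
move/le_lt_trans; apply; rewrite addrC level_norm_distC.
apply: (@le_lt_trans _ _ (C * (e / (C + 1)))).
  apply: ler_wpM2l => //; have ee : 0 <= e / (C + 1) by apply/ltW/divr_gt0.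
  rewrite -[leRHS](powR_natK ee N0).
  by apply: ler_powR2; rewrite ?invr_ge0 ?level_norm_ge0 //; exact: ltW.
by rewrite mulrCA -[ltRHS]mulr1 ltr_pM2l // ltr_pdivrMr // mul1r ltrDl.
Qed.

Lemma cosetP g x : tcoef g [::] = 1 -> coset K g x <-> exists2 w, logK w & x = g + w.
Proof.
move=> g1; split.
  by case=> k /logKP[w Lw ->] <-; exists w; rewrite // mulrDr mulr1 top_mulr //; exact: logK_van.
case=> w Lw ->; exists (1 + w); first by case: Lw.
by rewrite mulrDr mulr1 top_mulr //; exact: logK_van.
Qed.

Lemma coset_eq g w : tcoef g [::] = 1 -> logK w -> coset K (g + w) = coset K g.
Proof.
move=> g1 Lw; have gw : tcoef (g + w) [::] = 1 by rewrite tcoefD (logK_van Lw) // addr0.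
apply/seteqP; split => x /cosetP => /(_ _)[|v Lv ->] //; apply/cosetP => //.
  by exists (w + v); rewrite ?addrA //; exact: logKD.
by exists (v - w); [exact: logKB|rewrite addrACA subrr addr0].
Qed.

Lemma coset_inj g h : tcoef g [::] = 1 -> tcoef h [::] = 1 -> coset K g = coset K h ->
  exists2 w, logK w & h = g + w.
Proof.
move=> g1 h1 E; apply/cosetP => //; rewrite E; apply/cosetP => //.
by exists 0; [exact: logK0|rewrite addr0].
Qed.

Lemma quotient_setE g h : tcoef g [::] = 1 -> tcoef h [::] = 1 ->
  [set tinv x * y | x in coset K g & y in coset K h] = [set tinv g * h + w | w in logK].
Proof.
move=> g1 h1; apply/seteqP; split => [_ [x xg [y yh <-]]|_ [w Lw <-]].
  have [v Lv ->] := (cosetP x g1).1 xg; have [w Lw ->] := (cosetP y h1).1 yh.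
  exists (w - v); first exact: logKB.
  by rewrite inc_shift //; exact: logK_van.
exists g; first by apply/cosetP => //; exists 0; [exact: logK0|rewrite addr0].
exists (h + w); first by apply/cosetP => //; exists w.
by rewrite lev_inc //; exact: logK_van.
Qed.

Local Notation qd := (@quotient_dist R d N).

Lemma G_addr g w : G g -> logK w -> G (g + w).
Proof.
move=> Gg Lw; have -> : g + w = g * (1 + w).
  by rewrite mulrDr mulr1 top_mulr ?(G_coef0 Gg) //; exact: logK_van.
by apply: G_mul => //; apply: G_top; exact: logK_W.
Qed.

Lemma G_inc g h : G g -> G h -> G (tinv g * h).
Proof. by move=> Gg Gh; apply: G_mul => //; exact: G_inv. Qed.

Lemma qd_approx g h (e : R) : G g -> G h -> 0 < e ->
  exists2 w, logK w & cc_norm (tinv g * h + w) <= qd (coset K g) (coset K h) + e.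
Proof.
move=> Gg Gh e0; rewrite /quotient_dist quotient_setE ?G_coef0 // /quotient_norm.
have [] := @inf_adherent R [set cc_norm x | x in [set tinv g * h + w | w in logK]] e e0.
  split; first by exists (cc_norm (tinv g * h + 0)), (tinv g * h + 0) => //; exists 0; first
      exact: logK0.
  by exists 0 => _ [x _ <-]; exact: cc_norm_ge0.
by move=> _ [_ [w Lw <-] <-] /ltW H; exists w.
Qed.

Lemma qd_le g h w : G g -> G h -> logK w ->
  qd (coset K g) (coset K h) <= cc_norm (tinv g * h + w).
Proof.
move=> Gg Gh Lw; rewrite /quotient_dist quotient_setE ?G_coef0 // /quotient_norm.
apply: inf_lbound; last by exists (tinv g * h + w) => //; exists w.
by exists 0 => _ [x _ <-]; exact: cc_norm_ge0.
Qed.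

Lemma qd_ge0 g h : G g -> G h -> 0 <= qd (coset K g) (coset K h).
Proof.
move=> Gg Gh; apply/ler_addgt0Pr => e e0; have [w Lw] := qd_approx Gg Gh e0.
exact/le_trans/cc_norm_ge0.
Qed.

Lemma qd_le_cc g h : G g -> G h -> qd (coset K g) (coset K h) <= cc_dist g h.
Proof. by move=> Gg Gh; have := qd_le Gg Gh logK0; rewrite addr0. Qed.

Lemma qdxx g : G g -> qd (coset K g) (coset K g) = 0.
Proof.
by move=> Gg; apply/eqP; rewrite eq_le qd_ge0 // andbT -(cc_distxx Gg) qd_le_cc.
Qed.

Lemma qd_tri g h u : G g -> G h -> G u ->
  qd (coset K g) (coset K u) <= qd (coset K g) (coset K h) + qd (coset K h) (coset K u).
Proof.
move=> Gg Gh Gu; apply/ler_addgt0Pr => e e0; have e2 : 0 < e / 2 by rewrite divr_gt0.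
have [w Lw w1] := qd_approx Gg Gh e2; have [v Lv v1] := qd_approx Gh Gu e2.
rewrite [e]splitr addrACA; apply: le_trans (lerD w1 v1).
apply: le_trans (cc_norm_mul _ _); try (apply: G_addr => //; exact: G_inc).
have -> : (tinv g * h + w) * (tinv h * u + v) = tinv g * u + (w + v).
  have hu1 : tcoef (tinv h * u) [::] = 1 by rewrite tcoef0M tcoef_tinv ?G_coef0 ?mulr1.
  have gh1 : tcoef (tinv g * h) [::] = 1 by rewrite tcoef0M tcoef_tinv ?G_coef0 ?mulr1.
  have vv := logK_van Lv; have wv := logK_van Lw.
  rewrite mulrDr [_ * v]top_mulr ?tcoefD ?gh1 ?wv ?addr0 // mulrDl [w * _]top_mull //.
  by rewrite mulrA -(mulrA _ h) tmulV ?mulr1 ?G_coef0 // addrA.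
by apply: qd_le => //; exact: logKD.
Qed.

Lemma qd_symle g h : G g -> G h -> qd (coset K g) (coset K h) <= qd (coset K h) (coset K g).
Proof.
move=> Gg Gh; apply/ler_addgt0Pr => e e0; have [w Lw w1] := qd_approx Gh Gg e0.
apply: le_trans w1; rewrite -cc_norm_tinv; last by apply: G_addr => //; exact: G_inc.
have hg1 : tcoef (tinv h * g) [::] = 1 by rewrite tcoef0M tcoef_tinv ?G_coef0 ?mulr1.
rewrite tinv_addr //; last exact: logK_van.
rewrite tinv_mul ?tcoef_tinv ?G_coef0 // tinvK ?G_coef0 //.
by apply: qd_le => //; exact: logKN.
Qed.

Lemma qd_sym g h : G g -> G h -> qd (coset K g) (coset K h) = qd (coset K h) (coset K g).
Proof. by move=> Gg Gh; apply/eqP; rewrite eq_le !qd_symle. Qed.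

(** An element w of logK that almost realizes the distance in the quotient makes
    x + w short, where x = g^-1 h.  The correction 1 - w costs |w|^(1/N), and w
    is the difference of x + w and x, both controlled at level N. *)
Lemma cc_dist_fibre : exists2 C : R, 0 <= C & forall g h, G g -> G h ->
  cc_dist g h <= C * (qd (coset K g) (coset K h) + level_norm N (tinv g * h) `^ N%:R^-1).
Proof.
have [C C0 HC] := @reach_top R d N N0.
set B : R := \sum_(w : N.-bseq 'I_d | size w == N) 1.
have B0 : 0 <= B by apply: sumr_ge0.
set r : R := N%:R^-1; have r0 : 0 <= r by rewrite invr_ge0.
pose M := 1 + C * (2 `^ r * (1 + B `^ r)).
have Br : 0 <= 2 `^ r * (1 + B `^ r) by rewrite mulr_ge0 ?addr_ge0 ?powR_ge0.
exists M => [|g h Gg Gh]; first by rewrite addr_ge0 // mulr_ge0.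
set x := tinv g * h; set q := qd _ _; set y := level_norm N x `^ r.
have q0 : 0 <= q := qd_ge0 Gg Gh; have y0 : 0 <= y := powR_ge0 _ _.
have M0 : 0 < M + 1 by rewrite ltr_wpDl // addr_ge0 // mulr_ge0.
apply/ler_addgt0Pr => e e0.
have [w Lw] := qd_approx Gg Gh (divr_gt0 e0 M0); rewrite -/x -/q.
set c := cc_norm _ => cq.
have Gx : G x := G_inc Gg Gh; have Gxw : G (x + w) := G_addr Gx Lw.
have c0 : 0 <= c := cc_norm_ge0 _.
have wv := logK_van Lw.
have cx : cc_dist g h <= c + C * level_norm N w `^ r.
  rewrite /cc_dist -/x [X in cc_norm X](_ : x = (x + w) * (1 - w)); last first.
    by rewrite mulrBr mulr1 top_mulr ?G_coef0 // addrK.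
  apply: le_trans (cc_norm_mul _ _) _ => //.
    by apply: G_top; rewrite rpredN; exact: logK_W.
  rewrite lerD2l -[level_norm N w]level_normN; apply/cc_norm_le/HC.
  by rewrite rpredN; exact: logK_W.
have wle : level_norm N w <= B * c ^+ N + level_norm N x.
  rewrite -[X in level_norm N X](addKr x w) addrC.
  apply: le_trans (level_normB _ _ _) _; rewrite lerD2r; exact: level_norm_cc.
have wr : level_norm N w `^ r <= 2 `^ r * (B `^ r * c + y).
  apply: le_trans (ler_powR2 r0 (level_norm_ge0 _ _) wle) _.
  apply: le_trans (powRD_le r0 _ (level_norm_ge0 _ _)) _; first by rewrite mulr_ge0 ?exprn_ge0.
  by rewrite powRM ?exprn_ge0 // powR_natK.
have Cw := ler_wpM2l C0 wr.
apply: le_trans (le_trans cx (lerD (lexx c) Cw)) _.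
have cqy : c <= q + y + e / (M + 1) by lra.
apply: (@le_trans _ _ (M * (q + y + e / (M + 1)))).
  have -> : M * (q + y + e / (M + 1)) = (q + y + e / (M + 1)) +
     C * (2 `^ r * ((B `^ r * (q + y + e / (M + 1))) + (q + y + e / (M + 1)))).
    by rewrite /M; ring.
  apply: lerD => //; apply: ler_wpM2l => //; apply: ler_wpM2l; first exact: powR_ge0.
  apply: lerD; first by apply: ler_wpM2l => //; exact: powR_ge0.
  have : 0 <= e / (M + 1) by apply/ltW/divr_gt0.
  by lra.
rewrite mulrDr lerD2l mulrCA -[leRHS]mulr1; apply: ler_wpM2l; first exact: ltW.
by rewrite ler_pdivrMr // mul1r lerDl.
Qed.

End Quot.
End CCnorm.

Import numFieldNormedType.Exports.

(** * A Garsia-Rodemich-Rumsey inequality *)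

Section Pseudometric.
Context {R : realType}.
Implicit Types (rho : R -> R -> R) (a b p s t u : R).

(** A path f in a metric space enters only through rho s t = d(f s, f t).  This
    treats paths in the group, in its quotient, and differences of lifts at
    once. *)
Record pmetric rho : Prop := PMetric {
  pm_ge0 : forall s t, 0 <= rho s t;
  pm_sym : forall s t, rho s t = rho t s;
  pm_tri : forall s t u, rho s u <= rho s t + rho t u;
  pm_xx : forall t, rho t t = 0;
  pm_cont : forall t (e : R), 0 < e -> exists2 r : R, 0 < r &
    forall s, `|s - t| < r -> rho s t < e }.

Local Notation mu := (@lebesgue_measure R).
Local Notation mu2 := (mu \x mu)%E.

Lemma pm_ball_measurable rho (c : R) t : pmetric rho -> measurable [set s | rho s t < c].
Proof.
move=> pm; apply: open_measurable; rewrite openE => s /= sc.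
have c0 : 0 < c - rho s t by rewrite subr_gt0.
have [r r0 hr] := pm_cont pm s c0.
exists r => //= u; rewrite /ball_ /= distrC => /hr us.
by apply: le_lt_trans (pm_tri pm _ s _) _; lra.
Qed.

(** By continuity, rho < c holds exactly on a countable union of rectangles around
    rational points. *)
Lemma pm_measurable rho : pmetric rho ->
  measurable_fun [set: R * R] (fun z => rho z.1 z.2).
Proof.
move=> pm; apply: (measurability _ (RGenInftyO.measurableE R)) => //.
move=> _ [_ [c ->] <-]; rewrite setTI.
set P := [set z : R * R | rho z.1 z.2 < c].
rewrite (_ : _ @^-1` _ = P); last by apply/seteqP; split => z /=; rewrite in_itv.
rewrite (_ : P = \bigcup_(k : nat) \bigcup_(q : rat) \bigcup_(r : rat)
  (if rho (ratr q) (ratr r) + 2 * k.+1%:R^-1 < c then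
     [set s | rho s (ratr q) < k.+1%:R^-1] `*` [set s | rho s (ratr r) < k.+1%:R^-1]
   else set0)); last first.
  apply/seteqP; split => [[s t] /= st|[s t] [k _ [q _ [r _]]]]; last first.
    case: ifP => // hc [/= h1 h2]; rewrite /P /=.
    have t1 := pm_tri pm s (ratr q) t; have t2 := pm_tri pm (ratr q) (ratr r) t.
    rewrite (pm_sym pm (ratr r) t) in t2; move: h1 h2 hc; set e := k.+1%:R^-1; lra.
  have {}st : rho s t < c by [].
  have e0 : 0 < (c - rho s t) / 4 by lra.
  pose k := Num.truncn (((c - rho s t) / 4)^-1).
  have k0 : 0 < (k.+1%:R : R)^-1 by rewrite invr_gt0.
  have ke : (k.+1%:R : R)^-1 < (c - rho s t) / 4.
    by rewrite -[ltRHS]invrK ltf_pV2 ?posrE ?invr_gt0 //; exact: truncnS_gt.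
  have near u : exists q : rat, rho u (ratr q) < k.+1%:R^-1.
    have [r r0 hr] := pm_cont pm u k0.
    have [q] := @rat_in_itvoo R u (u + r) ltac:(lra).
    rewrite in_itv /= => /andP[q1 q2]; exists q; rewrite (pm_sym pm); apply: hr.
    by rewrite gtr0_norm; lra.
  have [q hq] := near s; have [r hr] := near t.
  exists k => //; exists q => //; exists r => //; case: ifPn => //; rewrite -leNgt => hc.
  have t1 := pm_tri pm (ratr q) s (ratr r); have t2 := pm_tri pm s t (ratr r).
  exfalso; rewrite (pm_sym pm (ratr q) s) in t1.
  by move: ke hq hr hc t1 t2; set e := k.+1%:R^-1; lra.
apply: bigcup_measurable => k _; apply: bigcupT_measurable_rat => q.
apply: bigcupT_measurable_rat => r; case: ifP => // _.
by apply: measurableX; exact: pm_ball_measurable.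
Qed.

(** The integrand of the Sobolev seminorm. *)
Definition density rho p b (z : R * R) : R := rho z.1 z.2 `^ p / `|z.2 - z.1| `^ b.

Lemma density_ge0 rho p b z : 0 <= density rho p b z.
Proof. by rewrite /density divr_ge0 ?powR_ge0. Qed.

Lemma measurable_dist_pow b : measurable_fun [set: R * R] (fun z => `|z.2 - z.1| `^ b).
Proof.
apply: (measurableT_comp (measurable_powR b)).
apply: (measurableT_comp (@normr_measurable R setT)).
by apply: measurable_funB; [exact: measurable_snd|exact: measurable_fst].
Qed.

Lemma measurable_density rho p b : pmetric rho -> measurable_fun [set: R * R] (density rho p b).
Proof.
move=> pm; have -> : density rho p b = fun z => rho z.1 z.2 `^ p * `|z.2 - z.1| `^ (- b).
  by apply/funext => z; rewrite powRN.
apply: measurable_funM; last exact: measurable_dist_pow.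
by apply: (measurableT_comp (measurable_powR p)); exact: pm_measurable.
Qed.

Lemma pm_measurable1 rho c : pmetric rho -> measurable_fun [set: R] (fun u => rho u c).
Proof.
move=> pm; apply: (measurability _ (RGenInftyO.measurableE R)) => //.
move=> _ [_ [x ->] <-]; rewrite setTI.
rewrite (_ : _ @^-1` _ = [set s | rho s c < x]); first exact: pm_ball_measurable.
by apply/seteqP; split => z /=; rewrite in_itv.
Qed.

Lemma tonelli_rect (A B : set R) (f : R * R -> \bar R) :
  measurable A -> measurable B -> measurable_fun setT f -> (forall z, (0 <= f z)%E) ->
  (\int[mu2]_(z in A `*` B) f z = \int[mu]_(x in A) \int[mu]_(y in B) f (x, y))%E.
Proof.
move=> mA mB mf f0; rewrite integral_mkcond fubini_tonelli1; last 2 first.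
- apply/(measurable_restrictT _ _).1; first exact: measurableX.
  exact: measurable_funS mf.
- by move=> z; rewrite patchE; case: ifP.
rewrite [RHS]integral_mkcond; apply: eq_integral => x _ /=.
rewrite patchE; case: ifPn => xA.
  rewrite [RHS]integral_mkcond; apply: eq_integral => y _; rewrite !patchE.
  by congr (if _ then _ else _); rewrite in_setX /= xA.
apply: integral0_eq => y _; rewrite patchE in_setX /= (negPf xA).
by [].
Qed.

Lemma integral_rect_fst (A B : set R) (f : R -> R) (h : R) :
  measurable A -> measurable B -> mu B = h%:E -> 0 <= h -> measurable_fun setT f ->
  (forall x, 0 <= f x) ->
  (\int[mu2]_(z in A `*` B) (f z.1)%:E = (\int[mu]_(x in A) (f x)%:E) * h%:E)%E.
Proof.
move=> mA mB Bh h0 mf f0; rewrite tonelli_rect //; last 2 first.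
- by apply/measurable_EFinP; apply: (measurableT_comp mf); exact: measurable_fst.
- by move=> z; rewrite lee_fin.
rewrite -ge0_integralZr //; last 2 first.
- by apply/measurable_EFinP; exact: measurable_funS mf.
- by move=> x _; rewrite lee_fin.
apply: eq_integral => x _ /=; rewrite (integral_cst mu mB (f x)%:E).
by congr (_ * _)%E; exact: Bh.
Qed.

Lemma integral_rect_snd (A B : set R) (f : R -> R) (h : R) :
  measurable A -> measurable B -> mu A = h%:E -> measurable_fun setT f ->
  (forall x, 0 <= f x) ->
  (\int[mu2]_(z in A `*` B) (f z.2)%:E = (\int[mu]_(x in B) (f x)%:E) * h%:E)%E.
Proof.
move=> mA mB Ah mf f0; rewrite tonelli_rect //; last 2 first.
- by apply/measurable_EFinP; apply: (measurableT_comp mf); exact: measurable_snd.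
- by move=> z; rewrite lee_fin.
by rewrite /= (integral_cst mu mA); congr (_ * _)%E; exact: Ah.
Qed.

(** Either x <= lam, or x = x^(1 - p) x^p <= lam^(1 - p) x^p.  Integrated, with the
    best lam, it plays the role of Jensen's inequality. *)
Lemma pow_split (x lam p : R) : 1 <= p -> 0 <= x -> 0 < lam ->
  x <= lam + lam `^ (1 - p) * x `^ p.
Proof.
move=> p1 x0 l0; have [xl|lx] := leP x lam.
  by rewrite -[leLHS]addr0 lerD // mulr_ge0 ?powR_ge0.
have x00 : 0 < x by exact: lt_trans lx.
apply: (@le_trans _ _ (x `^ (1 - p) * x `^ p)).
  by rewrite -powRD ?subrK ?powRr1 //; apply/implyP => _; rewrite gt_eqF.
rewrite -[leLHS]add0r; apply: lerD; first exact: ltW.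
rewrite ler_wpM2r ?powR_ge0 // -[1 - p]opprB !powRN lef_pV2 ?posrE ?powR_gt0 //.
by apply: ler_powR2; rewrite ?subr_ge0 // ltW.
Qed.

Lemma pow2_powR m (x : R) : (2 ^+ m) `^ x = (2 `^ x) ^+ m.
Proof.
rewrite -[2 ^+ m]powR_mulrn; last exact: ler0n.
by rewrite powRAC powR_mulrn // powR_ge0.
Qed.

Lemma div_pow2_powR (l : R) m (x : R) : 0 <= l ->
  (l / 2 ^+ m) `^ x = l `^ x * (2 `^ (- x)) ^+ m.
Proof.
move=> l0; rewrite powRM ?invr_ge0 ?exprn_ge0 //; congr (_ * _).
rewrite -[(2 ^+ m)^-1]powR_inv1 ?exprn_ge0 // -powRrM mulN1r.
by rewrite pow2_powR.
Qed.

Lemma gt1_powR (x : R) : 0 < x -> 1 < 2 `^ x.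
Proof.
move=> x0; have := @gt0_ltr_powR R x x0 1 2; rewrite powR1 !nnegrE; apply => //.
by rewrite ltr1n.
Qed.

Lemma dyadic_small (l r : R) : 0 < l -> 0 < r -> exists M, l / 2 ^+ M < r.
Proof.
move=> l0 r0; exists (Num.truncn (l / r)).+1; rewrite ltr_pdivrMr ?exprn_gt0 //.
rewrite mulrC -ltr_pdivrMr //; apply: lt_trans (truncnS_gt _) _.
by rewrite -natrX ltr_nat; exact: ltn_expl.
Qed.

Lemma geom_le (th : R) n : 0 <= th < 1 -> \sum_(0 <= j < n) th ^+ j <= (1 - th)^-1.
Proof.
move=> /andP[t0 t1]; have t1' : 0 < 1 - th by rewrite subr_gt0.
rewrite -[leRHS]mul1r ler_pdivlMr // mulrC big_mkord -[1 - th]opprB mulNr.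
by rewrite -subrX1 opprB lerBlDr lerDl exprn_ge0.
Qed.

Section Chain.
Variables (rho : R -> R -> R) (p g c l V : R) (J : nat -> set R).
Hypotheses (pm : pmetric rho) (p1 : 1 <= p) (g1 : 1 < g) (l0 : 0 < l) (V0 : 0 < V).
Hypotheses (mJ : forall m, measurable (J m))
  (muJ : forall m, mu (J m) = (l / 2 ^+ m)%:E) (subJ : forall m, J m `<=` J 0%N)
  (diamJ : forall m u v, J m u -> J m v -> `|v - u| <= l / 2 ^+ m)
  (incJ : forall m, J m.+1 `<=` J m)
  (cJ : forall m u, J m u -> `|u - c| <= l / 2 ^+ m)
  (IV : (\int[mu2]_(z in J 0%N `*` J 0%N) (density rho p (g + 1) z)%:E <= V%:E)%E).

Let lam m := ((l / 2 ^+ m) `^ (g - 1) * V) `^ p^-1.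
Let x m := (\int[mu]_(u in J m) (rho u c)%:E)%E.

Let h0 m : 0 < l / 2 ^+ m. Proof. by rewrite divr_gt0 // exprn_gt0. Qed.
Let p0 : 0 < p. Proof. exact: lt_le_trans p1. Qed.

Let lam_gt0 m : 0 < lam m.
Proof. by rewrite /lam powR_gt0 // mulr_gt0 // powR_gt0. Qed.

(** The triangle inequality for u, v, c is integrated over u in J m and v in
    J m.+1, and rho u v is split by [pow_split] at the level lam m, for which
    both terms of the bound are of the same order. *)
Lemma chain_step m (e : R) : (x m.+1 <= (l / 2 ^+ m.+1 * e)%:E)%E ->
  (x m <= (l / 2 ^+ m * (e + 3 * lam m))%:E)%E.
Proof.
move=> xe; set h := l / 2 ^+ m; have hp : 0 < h by exact: h0.
have h2 : l / 2 ^+ m.+1 = h / 2 by rewrite exprSr invfM mulrA.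
set k := lam m `^ (1 - p) * h `^ (g + 1).
have k0 : 0 <= k by rewrite mulr_ge0 ?powR_ge0.
have mr := pm_measurable1 c pm.
have mw := measurable_density p (g + 1) pm.
have mD : measurable (J m `*` J m.+1) by exact: measurableX.
have lm := lam_gt0 m.
have ineq : (\int[mu2]_(z in J m `*` J m.+1) (rho z.1 c)%:E <=
   \int[mu2]_(z in J m `*` J m.+1)
     ((rho z.2 c)%:E + ((lam m)%:E + (k * density rho p (g + 1) z)%:E)))%E.
  apply: ge0_le_integral => //.
  - by move=> z _; rewrite lee_fin; exact: pm_ge0.
  - apply/measurable_EFinP; apply: measurable_funTS; apply: (measurableT_comp mr); exact: measurable_fst.
  - apply/measurable_EFinP; apply: measurable_funTS; apply: measurable_funD.
      by apply: (measurableT_comp mr); exact: measurable_snd.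
    by apply: measurable_funD => //; apply: measurable_funM.
  move=> [u v] [/= Ju Jv]; rewrite -!EFinD lee_fin.
  have t1 := pm_tri pm u v c; have t2 := pow_split p1 (pm_ge0 pm u v) lm.
  suff t3 : lam m `^ (1 - p) * rho u v `^ p <= k * density rho p (g + 1) (u, v).
    by move: t1 t2 t3; set w := density _ _ _ _; lra.
  rewrite /k -mulrA ler_wpM2l ?powR_ge0 // /density /=.
  have [->|uv] := eqVneq u v.
    by rewrite (pm_xx pm) subrr normr0 !powR0 ?gt_eqF ?addr_gt0 ?(lt_trans _ g1) // mul0r mulr0.
  have vu : 0 < `|v - u| by rewrite normr_gt0 subr_eq0 eq_sym.
  rewrite mulrCA -[leLHS]mulr1 ler_wpM2l ?powR_ge0 // ler_pdivlMr ?powR_gt0 // mul1r.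
  apply: ler_powR2; rewrite ?addr_ge0 ?(le_trans _ (ltW g1)) //.
  by apply: diamJ => //; exact: incJ.
have h20 : 0 <= h / 2 by apply/ltW/divr_gt0.
have muJ' : mu (J m.+1) = (h / 2)%:E by rewrite -h2.
have I1 := integral_rect_fst (mJ m) (mJ m.+1) muJ' h20 mr (fun u => pm_ge0 pm u c).
have I2 := integral_rect_snd (mJ m) (mJ m.+1) (muJ m) mr (fun u => pm_ge0 pm u c).
have I3 : (\int[mu2]_(z in J m `*` J m.+1) (lam m)%:E = (lam m * (h * (h / 2)))%:E)%E.
  rewrite (integral_cst mu2 mD (lam m)%:E) [RHS]EFinM; congr (_ * _)%E.
  transitivity ((mu \x mu)%E (J m `*` J m.+1)) => //.
  rewrite (product_measure1E mu mu (mJ m) (mJ m.+1)) [RHS]EFinM.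
  by congr (_ * _)%E; [exact: muJ|exact: muJ'].
have I4 : (\int[mu2]_(z in J m `*` J m.+1) (k * density rho p (g + 1) z)%:E <= (k * V)%:E)%E.
  under eq_integral do rewrite EFinM.
  rewrite ge0_integralZl_EFin //; last 2 first.
  - by move=> z _; rewrite lee_fin density_ge0.
  - by apply/measurable_EFinP; exact: measurable_funTS.
  rewrite [leRHS]EFinM lee_wpmul2l ?lee_fin //; apply: le_trans IV.
  apply: ge0_subset_integral => //.
  - by apply: measurableX; exact: mJ.
  - by apply/measurable_EFinP; exact: measurable_funTS.
  - by move=> z _; rewrite lee_fin density_ge0.
  - by apply: setSX => //; exact: subJ.
move: ineq; rewrite ge0_integralD //; last 4 first.
- by move=> z _; rewrite lee_fin; exact: pm_ge0.
- apply/measurable_EFinP; apply: measurable_funTS; apply: (measurableT_comp mr); exact: measurable_snd.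
- by move=> z _; rewrite -EFinD lee_fin; apply: addr_ge0; [exact: ltW|rewrite mulr_ge0 ?density_ge0].
- apply/measurable_EFinP; apply: measurable_funTS; apply: measurable_funD => //; exact: measurable_funM.
rewrite ge0_integralD //; last 3 first.
- by move=> z _; rewrite lee_fin ltW.
- by move=> z _; rewrite lee_fin mulr_ge0 ?density_ge0.
- by apply/measurable_EFinP; apply: measurable_funTS; exact: measurable_funM.
rewrite I1 I2 I3 -/(x m) -/(x m.+1) => ineq.
have h20' : 0 < h / 2 by exact: divr_gt0.
have {}ineq : (x m * (h / 2)%:E <= (l / 2 ^+ m.+1 * e * h + (lam m * (h * (h / 2)) + k * V))%:E)%E.
  apply: le_trans ineq _; rewrite EFinD EFinD; apply: leeD; last exact: leeD.
  by rewrite [leRHS]EFinM; apply: lee_wpmul2r => //; rewrite lee_fin; exact: ltW.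
rewrite -lee_pdivlMr // in ineq; apply: le_trans ineq _; rewrite -EFinM lee_fin h2.
(* lam m is defined by lam m ^ p = h ^ (g - 1) V, for this equality to hold *)
have kV : k * V = lam m * h ^+ 2.
  have Hg : h `^ (g + 1) = h `^ (g - 1) * h ^+ 2.
    rewrite -powR_mulrn; last exact: ltW.
    rewrite -powRD; last by apply/implyP => _; rewrite gt_eqF.
    by congr (_ `^ _); ring.
  have lp : lam m `^ p = h `^ (g - 1) * V.
    by rewrite /lam -powRrM mulVf ?powRr1 ?gt_eqF // mulr_ge0 ?powR_ge0 // ltW.
  have Hl : lam m `^ (1 - p) * lam m `^ p = lam m.
    rewrite -powRD; last by apply/implyP => _; rewrite gt_eqF.
    by rewrite subrK powRr1 // ltW.
  by rewrite /k Hg -[in RHS]Hl lp; ring.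
rewrite kV; have -> : (h / 2 * e * h + (lam m * (h * (h / 2)) + lam m * h ^+ 2)) / (h / 2)
   = h * (e + 3 * lam m) by field; rewrite gt_eqF.
by [].
Qed.

Let th := 2 `^ (- ((g - 1) / p)).

Let gp : 0 < (g - 1) / p. Proof. by rewrite divr_gt0 // subr_gt0. Qed.

Let th1 : 0 < th < 1.
Proof.
rewrite powR_gt0 //= /th powRN invf_lt1 ?powR_gt0 //.
exact: gt1_powR.
Qed.

Lemma lam_geom m : lam m = lam 0 * th ^+ m.
Proof.
have l00 := ltW l0; have V00 := ltW V0.
rewrite /lam expr0 divr1 div_pow2_powR // mulrAC [LHS]powRM ?mulr_ge0 ?powR_ge0 ?exprn_ge0 ?powR_ge0 //.
congr (_ * _); rewrite -[in LHS]powR_mulrn ?powR_ge0 // powRAC powR_mulrn ?powR_ge0 //.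
by rewrite -powRrM mulNr.
Qed.

(** The sets J m shrink to c, where rho (., c) vanishes, and the errors of
    [chain_step] form a geometric series because g > 1. *)
Lemma chain_average : (x 0%N <= (l * (3 * lam 0 / (1 - th)))%:E)%E.
Proof.
suff H e : 0 < e -> (x 0%N <= (l * (e + 3 * lam 0 / (1 - th)))%:E)%E.
  apply/lee_addgt0Pr => e e0; have := H _ (divr_gt0 e0 l0).
  by rewrite -EFinD mulrDr mulrCA divff ?mulr1 ?gt_eqF // addrC.
move=> e0; have [r r0 hr] := pm_cont pm c e0.
have [M Mr] := dyadic_small l0 r0.
have rho_m1 := pm_measurable1 c pm.
have step k : (k <= M)%N ->
  (x (M - k) <= (l / 2 ^+ (M - k) * (e + \sum_(M - k <= j < M) 3 * lam j))%:E)%E.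
  elim: k => [|k IH] kM.
    rewrite subn0 big_geq // addr0 /x.
    apply: (@le_trans _ _ (\int[mu]_(u in J M) e%:E)%E).
      apply: ge0_le_integral; first exact: mJ.
      - by move=> u _; rewrite lee_fin pm_ge0.
      - by apply/measurable_EFinP; exact: measurable_funTS.
      - exact: measurable_cst.
      move=> u Ju; rewrite lee_fin; apply/ltW/hr.
      exact: le_lt_trans (cJ Ju) Mr.
    have -> : (\int[mu]_(u in J M) e%:E = (l / 2 ^+ M * e)%:E)%E.
      rewrite (integral_cst mu (mJ M) e%:E) muleC [RHS]EFinM.
      by congr (_ * _)%E; exact: muJ.
    by [].
  have MkS : (M - k = (M - k.+1).+1)%N by rewrite subnSK.
  have := IH (ltnW kM); rewrite MkS => /chain_step H.
  apply: le_trans H _; rewrite lee_fin [in leRHS]big_ltn; last by rewrite -MkS leq_subr.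
  by rewrite -[e + _ + _]addrA [X in e + X]addrC.
have := step M (leqnn M); rewrite subnn expr0 divr1 => H; apply: le_trans H _.
have l00 : 0 <= l := ltW l0; have lam00 := ltW (lam_gt0 0).
rewrite lee_fin ler_wpM2l // lerD2l -mulr_sumr -mulrA ler_wpM2l //.
under eq_bigr do rewrite lam_geom.
rewrite -mulr_sumr ler_wpM2l //; apply: geom_le.
by have /andP[/ltW -> ->] := th1.
Qed.

End Chain.

(** By the triangle inequality rho a b is at most the average over u in [a, b[ of
    rho u a plus that of rho u b.  Each average is estimated along intervals
    that shrink to the corresponding end. *)
Lemma grr p g : 1 <= p -> 1 < g -> exists2 C : R, 0 <= C &
  forall rho a b V, pmetric rho -> a < b -> 0 < V ->
  (\int[mu2]_(z in `[a, b[ `*` `[a, b[) (density rho p (g + 1) z)%:E <= V%:E)%E ->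
  rho a b <= C * ((b - a) `^ (g - 1) * V) `^ p^-1.
Proof.
move=> p1 g1; pose th : R := 2 `^ (- ((g - 1) / p)).
have p0 : 0 < p by exact: lt_le_trans p1.
have th1 : 0 < th < 1.
  have gp : 0 < (g - 1) / p by rewrite divr_gt0 // subr_gt0.
  by rewrite powR_gt0 //= /th powRN invf_lt1 ?powR_gt0 //; exact: gt1_powR.
exists (6 / (1 - th)); first by rewrite divr_ge0 //; lra.
move=> rho a b V pm ab V0 IV; set l := b - a.
have l0 : 0 < l by rewrite subr_gt0.
have h0 m : 0 < l / 2 ^+ m by rewrite divr_gt0 // exprn_gt0.
have l00 : 0 <= l := ltW l0.
have hl m : l / 2 ^+ m <= l.
  by rewrite ler_pdivrMr ?exprn_gt0 // ler_peMr // exprn_ege1 // ler1n.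
have hS m : l / 2 ^+ m.+1 <= l / 2 ^+ m.
  by rewrite exprSr invfM mulrA ler_pdivrMr // ler_peMr ?ler1n //; exact/ltW/h0.
pose J1 m : set R := `[a, a + l / 2 ^+ m[%classic.
pose J2 m : set R := `[b - l / 2 ^+ m, b[%classic.
have J10 : J1 0%N = `[a, b[%classic by rewrite /J1 expr0 divr1 /l subrKC.
have J20 : J2 0%N = `[a, b[%classic by rewrite /J2 expr0 divr1 /l subKr.
have A1 := @chain_average rho p g a l V J1 pm p1 g1 l0 V0.
have A2 := @chain_average rho p g b l V J2 pm p1 g1 l0 V0.
have {}A1 : (\int[mu]_(u in `[a, b[) (rho u a)%:E <=
   (l * (3 * (l `^ (g - 1) * V) `^ p^-1 / (1 - th)))%:E)%E.
  move: A1; rewrite J10 expr0 divr1; apply => //.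
  - by move=> m; exact: measurable_itv.
  - by move=> m; rewrite /J1 lebesgue_measure_itv /= lte_fin ltrDl h0 -EFinB addrAC subrr add0r.
  - move=> m u; rewrite /J1 /= !in_itv /= => /andP[-> /=]; move/lt_le_trans; apply.
    by rewrite /l in hl *; have := hl m; lra.
  - by move=> m u v; rewrite /J1 /= !in_itv /= => /andP[u1 u2] /andP[v1 v2]; rewrite ler_norml;
      apply/andP; split; lra.
  - move=> m u; rewrite /J1 /= !in_itv /= => /andP[-> /=]; move/lt_le_trans; apply.
    by rewrite lerD2l.
  - by move=> m u; rewrite /J1 /= !in_itv /= => /andP[u1 u2]; rewrite ler_norml; apply/andP;
      split; have := h0 m; lra.
have {}A2 : (\int[mu]_(u in `[a, b[) (rho u b)%:E <=
   (l * (3 * (l `^ (g - 1) * V) `^ p^-1 / (1 - th)))%:E)%E.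
  move: A2; rewrite J20 expr0 divr1; apply => //.
  - by move=> m; exact: measurable_itv.
  - by move=> m; rewrite /J2 lebesgue_measure_itv /= lte_fin ltrBlDr ltrDl h0 -EFinB opprB addrC subrK.
  - move=> m u; rewrite /J2 /= !in_itv /= => /andP[u1 ->]; rewrite andbT.
    by rewrite /l in hl u1; have := hl m; lra.
  - by move=> m u v; rewrite /J2 /= !in_itv /= => /andP[u1 u2] /andP[v1 v2]; rewrite ler_norml;
      apply/andP; split; lra.
  - by move=> m u; rewrite /J2 /= !in_itv /= => /andP[u1 ->]; rewrite andbT; have := hS m; lra.
  - by move=> m u; rewrite /J2 /= !in_itv /= => /andP[u1 u2]; rewrite ler_norml; apply/andP;
      split; have := h0 m; lra.
have mI : measurable (`[a, b[%classic : set R) by [].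
have muI : mu `[a, b[%classic = l%:E by rewrite lebesgue_measure_itv /= lte_fin ab -EFinB.
have H : ((rho a b)%:E * l%:E <= \int[mu]_(u in `[a, b[) (rho u a)%:E +
   \int[mu]_(u in `[a, b[) (rho u b)%:E)%E.
  rewrite -ge0_integralD //; last 4 first.
  - by move=> u _; rewrite lee_fin pm_ge0.
  - by apply/measurable_EFinP; apply: measurable_funTS; exact: pm_measurable1.
  - by move=> u _; rewrite lee_fin pm_ge0.
  - by apply/measurable_EFinP; apply: measurable_funTS; exact: pm_measurable1.
  rewrite -[X in (_ * X)%E]muI -(integral_cst mu mI (rho a b)%:E).
  apply: ge0_le_integral => //.
  - by move=> u _; rewrite lee_fin pm_ge0.
  - apply/measurable_EFinP; apply: measurable_funTS; apply: measurable_funD; exact: pm_measurable1.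
  - move=> u _; rewrite -EFinD lee_fin (pm_sym pm u a); exact: pm_tri.
have {}H := le_trans H (leeD A1 A2); rewrite -EFinM -EFinD lee_fin in H.
rewrite -(ler_pM2r l0); apply: le_trans H _.
by rewrite le_eqVlt; apply/orP; left; apply/eqP; ring.
Qed.

End Pseudometric.

(** * Sobolev seminorms and dyadic sums *)

Section Dyadic.
Context {R : realType}.
Implicit Types (rho : R -> R -> R) (p a b s t u : R).
Local Notation mu := (@lebesgue_measure R).
Local Notation mu2 := (mu \x mu)%E.

(** The integral of a nonnegative function is a supremum over the simple functions
    below it. *)
Lemma ge0_le_integralW d (X : measurableType d) (m : {measure set X -> \bar R}) (D : set X)
    (f1 f2 : X -> \bar R) : (forall x, D x -> (0 <= f1 x)%E) ->
  (forall x, D x -> (f1 x <= f2 x)%E) ->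
  (\int[m]_(x in D) f1 x <= \int[m]_(x in D) f2 x)%E.
Proof.
move=> f10 f12; rewrite !(integral_mkcond D).
have g10 x : (0 <= (f1 \_ D) x)%E by apply: erestrict_ge0.
have g12 x : ((f1 \_ D) x <= (f2 \_ D) x)%E.
  by rewrite !patchE; case: ifPn => //; rewrite inE => /f12.
have g20 x : (0 <= (f2 \_ D) x)%E by apply: le_trans (g12 x).
rewrite !ge0_integralTE //; apply: le_ereal_sup => _ [h /= hf <-].
by exists h => // x; apply: le_trans (hf x) _.
Qed.

Lemma grr_pow p g : 1 <= p -> 1 < g -> exists2 C : R, 0 < C &
  forall rho a b, pmetric rho -> a < b ->
  ((rho a b `^ p)%:E <= (C * (b - a) `^ (g - 1))%:E *
    \int[mu2]_(z in `[a, b[ `*` `[a, b[) (density rho p (g + 1) z)%:E)%E.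
Proof.
move=> p1 g1; have [C C0 HC] := grr p1 g1.
have p0 : 0 < p by exact: lt_le_trans p1.
exists (C `^ p + 1) => [|rho s t pm st]; first by rewrite ltr_wpDl ?powR_ge0.
set I := (\int[mu2]_(z in _) _)%E.
have I0 : (0 <= I)%E by apply: integral_ge0 => z _; rewrite lee_fin density_ge0.
have l0 : 0 < (t - s) `^ (g - 1) by rewrite powR_gt0 ?subr_gt0.
have C1 : 0 < (C `^ p + 1) * (t - s) `^ (g - 1).
  by rewrite mulr_gt0 // ltr_wpDl ?powR_ge0.
have [Ifin|] := boolP (I \is a fin_num); last first.
  clearbody I; case: I I0 => // _ _; rewrite gt0_muley ?leey //.
rewrite -(fineK Ifin) -EFinM lee_fin.
have I00 : 0 <= fine I by rewrite fine_ge0.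
apply/ler_addgt0Pr => e e0.
set V := fine I + e / ((C `^ p + 1) * (t - s) `^ (g - 1)).
have V0 : 0 < V by rewrite ltr_wpDl // divr_gt0.
have /HC H : (I <= V%:E)%E by rewrite -(fineK Ifin) lee_fin lerDl ltW // divr_gt0.
have {}H := H pm st V0.
have H2 : rho s t `^ p <= C `^ p * ((t - s) `^ (g - 1) * V).
  have H3 : 0 <= (t - s) `^ (g - 1) * V by rewrite mulr_ge0 // ltW.
  apply: le_trans (ler_powR2 (ltW p0) (pm_ge0 pm s t) H) _.
  by rewrite [leLHS]powRM ?powR_ge0 // -powRrM mulVf ?gt_eqF // powRr1.
apply: le_trans H2 _.
apply: (@le_trans _ _ ((C `^ p + 1) * ((t - s) `^ (g - 1) * V))).
  by rewrite ler_wpM2r ?mulr_ge0 ?(ltW V0) ?(ltW l0) // lerDl.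
rewrite mulrA /V mulrDr lerD2l mulrC divfK ?gt_eqF //.
Qed.

Definition dy (T : R) (n k : nat) : R := T * k%:R / 2 ^+ n.

Definition dyI T n k : set R := `[dy T n k, dy T n k.+1[%classic.

Lemma dyS T n k : dy T n k.+1 - dy T n k = T / 2 ^+ n.
Proof. by rewrite /dy -mulrBl -mulrBr -natrB // subSnn mulr1. Qed.

Lemma dy_ltS T n k : 0 < T -> dy T n k < dy T n k.+1.
Proof. by move=> T0; rewrite -subr_gt0 dyS divr_gt0 // exprn_gt0. Qed.

Lemma ler_dy T n j k : 0 < T -> (dy T n j <= dy T n k) = (j <= k)%N.
Proof. by move=> T0; rewrite /dy ler_pM2r ?invr_gt0 ?exprn_gt0 // ler_pM2l // ler_nat. Qed.

Lemma ltr_dy T n j k : 0 < T -> (dy T n j < dy T n k) = (j < k)%N.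
Proof. by move=> T0; rewrite !ltNge ler_dy // -ltnNge. Qed.

Lemma dy0 T n : dy T n 0 = 0.
Proof. by rewrite /dy mulr0 mul0r. Qed.

Lemma dyT T n : dy T n (2 ^ n) = T.
Proof. by rewrite /dy natrX mulfK // expf_neq0. Qed.

Lemma dy_double T n k : dy T n.+1 k.*2 = dy T n k.
Proof. rewrite /dy -muln2 natrM exprSr; field; by rewrite expf_neq0. Qed.

Lemma dyI_uniq T n j k s : 0 < T -> dyI T n j s -> dyI T n k s -> j = k.
Proof.
move=> T0; rewrite /dyI /= !in_itv /= => /andP[a1 a2] /andP[b1 b2].
have := le_lt_trans a1 b2; have := le_lt_trans b1 a2.
rewrite !ltr_dy // !ltnS => kj jk; apply/eqP; by rewrite eqn_leq jk kj.
Qed.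

Lemma dyI_cover T n s : 0 < T -> 0 <= s -> exists k, dyI T n k s.
Proof.
move=> T0 s0; exists (Num.truncn (2 ^+ n * s / T)).
have h0 : 0 <= 2 ^+ n * s / T by rewrite divr_ge0 ?mulr_ge0 ?exprn_ge0 // ltW.
have := truncn_itv h0; set k := Num.truncn _ => /andP[k1 k2].
have e0 : 0 < (2 ^+ n : R) by rewrite exprn_gt0.
rewrite /dyI /= in_itv /= /dy; apply/andP; split.
  by rewrite ler_pdivrMr // mulrC [s * _]mulrC -ler_pdivlMr.
by rewrite ltr_pdivlMr // [T * _]mulrC [s * _]mulrC -ltr_pdivrMr.
Qed.

Lemma dyI_range T n k s : 0 < T -> dyI T n k s -> s <= T -> (k <= 2 ^ n)%N.
Proof.
move=> T0; rewrite /dyI /= in_itv /= => /andP[k1 _] sT.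
by rewrite -(ler_dy n _ _ T0) dyT (le_trans k1).
Qed.

Lemma dyI_sub T n k : 0 < T -> (k < 2 ^ n)%N -> dyI T n k `<=` `[0, T].
Proof.
move=> T0 kn s; rewrite /dyI /= !in_itv /= => /andP[k1 k2]; apply/andP; split.
  by apply: le_trans k1; rewrite -(dy0 T n) ler_dy.
by apply/ltW/(lt_le_trans k2); rewrite -[leRHS](dyT T n) ler_dy.
Qed.

Lemma measurable_dyI T n k : measurable (dyI T n k).
Proof. exact: measurable_itv. Qed.

Lemma geom_cut (th y k : R) n0 : 0 < k -> th = 2 `^ k -> 0 <= y ->
  \sum_(0 <= n < n0) th ^+ n * ((2 ^+ n <= y)%R)%:R <= th / (th - 1) * y `^ k.
Proof.
move=> k0 -> y0; set th' := 2 `^ k.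
have th1 : 1 < th' by exact: gt1_powR.
have th0 : 0 < th' - 1 by rewrite subr_gt0.
have cut n : \sum_(0 <= j < n) th' ^+ j = (th' ^+ n - 1) / (th' - 1).
  by rewrite subrX1 mulrC mulKf ?gt_eqF // big_mkord.
elim: n0 => [|n IH].
  by rewrite big_geq // mulr_ge0 ?powR_ge0 // divr_ge0 ?powR_ge0 // ltW.
have [ny|yn] := leP (2 ^+ n) y; last first.
  by rewrite big_nat_recr //= (lt_geF yn) mulr0 addr0.
apply: (@le_trans _ _ (\sum_(0 <= j < n.+1) th' ^+ j)).
  apply: ler_sum => j _; rewrite -[leRHS]mulr1 ler_wpM2l ?exprn_ge0 ?powR_ge0 //.
  by rewrite -[leRHS]/(1%:R) ler_nat leq_b1.
rewrite cut [leRHS]mulrAC ler_pM2r ?invr_gt0 //.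
have : th' ^+ n <= y `^ k.
  rewrite /th' -pow2_powR; apply: ler_powR2 => //; exact: ltW.
move=> H; have : th' * th' ^+ n <= th' * y `^ k by rewrite ler_pM2l // (lt_trans ltr01).
rewrite -exprS; lra.
Qed.

Lemma sum_dyI T n K z (c : R) : 0 < T -> 0 <= c ->
  \sum_(0 <= k < K) \1_(dyI T n k `*` dyI T n k) z * c <=
  ((`|z.2 - z.1| <= T / 2 ^+ n)%R)%:R * c.
Proof.
move=> T0 c0; rewrite -mulr_suml ler_wpM2r //.
have [[k /andP[kK hk]]|no] := pselect (exists k, (k < K)%N && (z \in dyI T n k `*` dyI T n k)).
  rewrite (bigD1_seq k) ?mem_index_iota ?iota_uniq //= big1_seq ?addr0.
    rewrite indicE hk /=; move: hk; rewrite inE /dyI /= !in_itv /= => -[/andP[a1 a2] /andP[b1 b2]].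
    have e := dyS T n k.
    suff -> : `|z.2 - z.1| <= T / 2 ^+ n by [].
    by rewrite -e ler_norml; apply/andP; split; lra.
  move=> j /andP[jk _]; rewrite indicE memNset // => -[/= j1 _].
  move: hk; rewrite inE => -[/= k1 _]; move/eqP: jk; apply; exact: dyI_uniq T0 j1 k1.
rewrite big1_seq ?ler0n // => j; rewrite mem_index_iota => /= jK.
rewrite indicE; apply/eqP; case: (boolP (_ \in _)) => // hj; case: no; exists j.
by rewrite jK hj.
Qed.

(** [grr] is applied in each dyadic interval with an exponent g below a.  A pair
    (s, t) is then counted only at scales with 2^n <= T / |t - s|, and the sum of
    the weights over these scales turns g into a. *)
Lemma sobolev_dyadic rho T p a : 1 <= p -> 1 < a -> 0 < T -> pmetric rho ->
  (\int[mu2]_(z in `[0%R, T] `*` `[0%R, T]) (density rho p (a + 1) z)%:E < +oo)%E ->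
  exists2 B : R, 0 <= B & forall n0, \sum_(0 <= n < n0) (2 ^+ n) `^ (a - 1) *
    \sum_(0 <= k < 2 ^ n) rho (dy T n k) (dy T n k.+1) `^ p <= B.
Proof.
move=> p1 a1 T0 pm fin.
(* g is halfway between 1 and a, so that g - 1 = a - g = k *)
set g := (1 + a) / 2; set k := (a - 1) / 2.
have g1 : 1 < g by rewrite /g; lra.
have k0 : 0 < k by rewrite /k; lra.
have [C C0 HC] := grr_pow p1 g1.
set Q : set (R * R) := (`[0%R, T] `*` `[0%R, T])%classic.
have mQ : measurable Q by apply: measurableX; exact: measurable_itv.
set th : R := 2 `^ k.
have th1 : 1 < th by exact: gt1_powR.
have th0 : 0 < th - 1 by rewrite subr_gt0.
set C1 := C * T `^ k; have C10 : 0 <= C1 by rewrite mulr_ge0 ?powR_ge0 // ltW.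
set C2 := C1 * (th / (th - 1) * T `^ k).
have C20 : 0 <= C2 by rewrite /C2 !mulr_ge0 ?powR_ge0 ?invr_ge0 // ltW.
set V := (\int[mu2]_(z in Q) (density rho p (a + 1) z)%:E)%E.
have V0 : (0 <= V)%E by apply: integral_ge0 => z _; rewrite lee_fin density_ge0.
have Vfin : V \is a fin_num by rewrite ge0_fin_numE.
exists (C2 * fine V) => [|n0]; first by rewrite mulr_ge0 // fine_ge0.
rewrite -lee_fin [leRHS]EFinM (fineK Vfin).
pose F n j z := C1 * th ^+ n * (\1_(dyI T n j `*` dyI T n j) z * density rho p (g + 1) z).
have mI n j : measurable (dyI T n j `*` dyI T n j).
  by apply: measurableX; exact: measurable_dyI.
have mF n j : measurable_fun setT (F n j).
  by apply: measurable_funM => //; apply: measurable_funM; [exact: measurable_indic|exact: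
      measurable_density].
have F0 n j z : 0 <= F n j z.
  by rewrite /F !mulr_ge0 ?exprn_ge0 ?powR_ge0 ?density_ge0 // ltW.
apply: (@le_trans _ _ (\int[mu2]_(z in Q)
   (\sum_(0 <= n < n0) \sum_(0 <= j < 2 ^ n) F n j z)%:E)%E).
  under eq_integral do rewrite -sumEFin.
  rewrite ge0_integral_sum //; last 2 first.
  - move=> n; apply/measurable_EFinP; apply: measurable_funTS.
    by apply: measurable_sum => j; exact: mF.
  - by move=> n z _; rewrite lee_fin sumr_ge0.
  rewrite -sumEFin; apply: lee_sum => n _.
  under eq_integral do rewrite -sumEFin.
  rewrite ge0_integral_sum //; last 2 first.
  - by move=> j; apply/measurable_EFinP; apply: measurable_funTS; exact: mF.
  - by move=> j z _; rewrite lee_fin.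
  rewrite mulr_sumr -sumEFin big_seq [leRHS]big_seq; apply: lee_sum => j.
  rewrite mem_index_iota => /= jn.
  have H := HC rho _ _ pm (dy_ltS n j T0).
  rewrite EFinM; apply: le_trans (lee_wpmul2l _ H) _; first by rewrite lee_fin powR_ge0.
  rewrite muleA -EFinM.
  have -> : (2 ^+ n) `^ (a - 1) * (C * (dy T n j.+1 - dy T n j) `^ (g - 1)) = C1 * th ^+ n.
    rewrite dyS; have -> : g - 1 = k by rewrite /g /k; lra.
    rewrite div_pow2_powR ?(ltW T0) // /C1 /th -!pow2_powR.
    rewrite (_ : a - 1 = k + k); last by rewrite /k; lra.
    rewrite powRD; last by apply/implyP => _; rewrite gt_eqF // exprn_gt0.
    rewrite powRN.
    have q0 : (2 ^+ n) `^ k != 0 by rewrite gt_eqF // powR_gt0 // exprn_gt0.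
    by field.
  under [leRHS]eq_integral do rewrite EFinM.
  have m1 : measurable_fun Q (fun z => (\1_(dyI T n j `*` dyI T n j) z * density rho p (g + 1) z)%:E).
    apply/measurable_EFinP; apply: measurable_funTS; apply: measurable_funM.
      exact: measurable_indic.
    exact: measurable_density.
  rewrite ge0_integralZl_EFin //; last 2 first.
  - by move=> z _; rewrite lee_fin mulr_ge0 ?density_ge0.
  - by rewrite mulr_ge0 // exprn_ge0 // powR_ge0.
  apply: lee_wpmul2l; first by rewrite lee_fin mulr_ge0 // exprn_ge0 // powR_ge0.
  have sub := setSX (dyI_sub T0 jn) (dyI_sub T0 jn).
  apply: (@le_trans _ _ (\int[mu2]_(z in dyI T n j `*` dyI T n j)
      (\1_(dyI T n j `*` dyI T n j) z * density rho p (g + 1) z)%:E)%E).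
    rewrite le_eqVlt; apply/orP; left; apply/eqP; apply: eq_integral => z zI; rewrite indicE zI mul1r //.
  apply: ge0_subset_integral => //; last by move=> z _; rewrite lee_fin mulr_ge0 ?density_ge0.
  exact: mI.
have -> : (C2%:E * V = \int[mu2]_(z in Q) (C2 * density rho p (a + 1) z)%:E)%E.
  under [RHS]eq_integral do rewrite EFinM.
  rewrite ge0_integralZl_EFin //.
  - by move=> z _; rewrite lee_fin density_ge0.
  - by apply/measurable_EFinP; apply: measurable_funTS; exact: measurable_density.
apply: ge0_le_integral => //.
- by move=> z _; rewrite lee_fin !sumr_ge0 // => n _; rewrite sumr_ge0.
- apply/measurable_EFinP; apply: measurable_funTS; apply: measurable_sum => n.
  by apply: measurable_sum => j; exact: mF.
- apply/measurable_EFinP; apply: measurable_funTS; apply: measurable_funM => //.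
  exact: measurable_density.
move=> z _; rewrite lee_fin.
have [zz|zz] := eqVneq z.1 z.2.
  rewrite big1 => [|n _]; first by rewrite (mulr_ge0 C20) ?density_ge0.
  rewrite big1 // => j _.
  by rewrite /F /density zz pm_xx // powR0 ?gt_eqF ?mul0r ?mulr0 // (lt_le_trans _ p1).
have r0 : 0 < `|z.2 - z.1| by rewrite normr_gt0 subr_eq0 eq_sym.
set r := `|z.2 - z.1| in r0.
have -> : density rho p (a + 1) z = density rho p (g + 1) z / r `^ k.
  rewrite /density -/r (_ : a + 1 = g + 1 + k); last by rewrite /g /k; lra.
  by rewrite powRD ?invfM ?mulrA //; apply/implyP => _; rewrite gt_eqF.
apply: (@le_trans _ _ (\sum_(0 <= n < n0) C1 * density rho p (g + 1) z *
     (th ^+ n * ((2 ^+ n <= T / r)%R)%:R))).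
  apply: ler_sum => n _.
  rewrite /F -mulr_sumr.
  have w0 := density_ge0 rho p (g + 1) z.
  apply: le_trans (ler_wpM2l _ (sum_dyI n _ z T0 w0)) _.
    by rewrite mulr_ge0 ?exprn_ge0 // ltW // (lt_trans ltr01).
  have -> : (2 ^+ n <= T / r) = (`|z.2 - z.1| <= T / 2 ^+ n).
    by rewrite -/r !ler_pdivlMr ?exprn_gt0 // mulrC.
  by rewrite le_eqVlt; apply/orP; left; apply/eqP; ring.
rewrite -mulr_sumr.
have h := geom_cut n0 k0 (erefl : th = 2 `^ k) (ltW (divr_gt0 T0 r0)).
apply: le_trans (ler_wpM2l _ h) _; first by rewrite mulr_ge0 ?density_ge0.
rewrite /C2 powRM ?invr_ge0 ?(ltW T0) ?(ltW r0) // -[r^-1]powR_inv1 ?(ltW r0) //.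
rewrite -powRrM mulN1r powRN.
by rewrite le_eqVlt; apply/orP; left; apply/eqP; ring.
Qed.

(** Each weighted term is bounded by the whole sum S, so that
    c m <= w^(-(m - n) / p) S^(1 / p), a geometric sequence. *)
Lemma sum_powR_weight p (w : R) (c : nat -> R) n M : 0 < p -> 1 < w -> (forall m, 0 <= c m) ->
  \sum_(n <= m < M) c m <=
  (1 - w `^ (- p^-1))^-1 * (\sum_(n <= m < M) w ^+ (m - n) * c m `^ p) `^ p^-1.
Proof.
move=> p0 w1 c0; have w0 : 0 < w := lt_trans ltr01 w1.
set th := w `^ (- p^-1); set S := \sum_(_ <= _ < _) w ^+ _ * _.
have th1 : 0 <= th < 1.
  rewrite powR_ge0 /= /th powRN invf_lt1 ?powR_gt0 //.
  have : 1 `^ p^-1 < w `^ p^-1.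
    by apply: gt0_ltr_powR; rewrite ?invr_gt0 ?nnegrE ?ler01 // ltW.
  by rewrite powR1.
have S0 m : 0 <= w ^+ (m - n) * c m `^ p by rewrite mulr_ge0 ?powR_ge0 // exprn_ge0 // ltW.
have each m : (n <= m < M)%N -> c m <= th ^+ (m - n) * S `^ p^-1.
  move=> mM; have : w ^+ (m - n) * c m `^ p <= S.
    rewrite /S (bigD1_seq m) ?mem_index_iota ?iota_uniq //= lerDl.
    by apply: sumr_ge0 => i _.
  have pi0 : 0 <= p^-1 by rewrite invr_ge0 ltW.
  move/(ler_powR2 pi0 (S0 m)); rewrite powRM ?powR_ge0 ?exprn_ge0 ?(ltW w0) //.
  rewrite -[(c m `^ p) `^ _]powRrM divff ?gt_eqF // powRr1 // => H.
  rewrite /th powRN exprVn -ler_pdivrMl; last by rewrite invr_gt0 exprn_gt0 ?powR_gt0.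
  rewrite invrK; apply: le_trans H; rewrite ler_wpM2r //.
  rewrite le_eqVlt; apply/orP; left; apply/eqP.
  by rewrite -(powR_mulrn _ (powR_ge0 w p^-1)) powRAC powR_mulrn // ltW.
apply: (@le_trans _ _ (\sum_(n <= m < M) th ^+ (m - n) * S `^ p^-1)).
  by rewrite big_nat_cond [leRHS]big_nat_cond; apply: ler_sum => m /andP[/each].
rewrite -mulr_suml ler_wpM2r ?powR_ge0 //.
rewrite -{1}[n]add0n big_addn; under eq_bigr do rewrite addnK.
exact: geom_le.
Qed.

Lemma tonelli_rect' (A B : set R) (f : R * R -> \bar R) :
  measurable A -> measurable B -> measurable_fun setT f -> (forall z, (0 <= f z)%E) ->
  (\int[mu2]_(z in A `*` B) f z = \int[mu]_(y in B) \int[mu]_(x in A) f (x, y))%E.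
Proof.
move=> mA mB mf f0; rewrite integral_mkcond fubini_tonelli2; last 2 first.
- apply/(measurable_restrictT _ _).1; first exact: measurableX.
  exact: measurable_funS mf.
- by move=> z; rewrite patchE; case: ifP.
rewrite [RHS]integral_mkcond; apply: eq_integral => y _ /=.
rewrite patchE; case: ifPn => yB.
  rewrite [RHS]integral_mkcond; apply: eq_integral => x _; rewrite !patchE.
  by congr (if _ then _ else _); rewrite in_setX /= yB andbT.
by apply: integral0_eq => x _; rewrite patchE in_setX /= (negPf yB) andbF.
Qed.

Definition band (h : R) : set (R * R) := [set z | `|z.2 - z.1| <= h].

Lemma measurable_band h : measurable (band h).
Proof.
have mf : measurable_fun [set: R * R] (fun z => `|z.2 - z.1|).
  apply: (measurableT_comp (@normr_measurable R setT)).
  by apply: measurable_funB; [exact: measurable_snd|exact: measurable_fst].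
have := mf measurableT `]-oo, h]%classic (measurable_itv _); rewrite setTI.
by rewrite (_ : _ @^-1` _ = band h) //; apply/seteqP; split => z /=; rewrite in_itv.
Qed.

Lemma integral_band1 (T h x : R) : 0 <= h ->
  (\int[mu]_(y in `[0%R, T]) (\1_(band h) (x, y))%:E <= (2 * h)%:E)%E.
Proof.
move=> h0; have E y : \1_(band h) (x, y) = \1_(`[x - h, x + h]%classic) y :> R.
  rewrite !indicE; congr ((nat_of_bool _)%:R); apply/idP/idP; rewrite !inE /band /= in_itv /= ler_norml.
    by move=> /andP[? ?]; apply/andP; split; lra.
  by move=> /andP[? ?]; apply/andP; split; lra.
under eq_integral do rewrite E.
have mI : measurable (`[0%R, T]%classic : set R) by exact: measurable_itv.
have mJ : measurable (`[x - h, x + h]%classic : set R) by exact: measurable_itv.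
rewrite integral_indic //; apply: (@le_trans _ _ (mu `[x - h, x + h]%classic)).
  by apply: le_measure; rewrite ?inE //; exact: measurableI.
rewrite lebesgue_measure_itv /=; case: ifP => _; last by rewrite lee_fin mulr_ge0.
by rewrite -EFinB lee_fin; lra.
Qed.

Lemma integral_band (T h : R) (f : R -> R) : 0 <= h -> measurable_fun setT f -> (forall x, 0 <= f x) ->
  (\int[mu2]_(z in `[0%R, T] `*` `[0%R, T]) (\1_(band h) z * (f z.1 + f z.2))%:E <=
    (4 * h)%:E * \int[mu]_(x in `[0%R, T]) (f x)%:E)%E.
Proof.
move=> h0 mf f0.
have mI : measurable (`[0%R, T]%classic : set R) by exact: measurable_itv.
have mb : measurable_fun setT (\1_(band h) : R * R -> R).
  by apply: measurable_indic; exact: measurable_band.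
have m1 : measurable_fun [set: R * R] (fun z => \1_(band h) z * f z.1).
  by apply: measurable_funM => //; apply: (measurableT_comp mf); exact: measurable_fst.
have m2 : measurable_fun [set: R * R] (fun z => \1_(band h) z * f z.2).
  by apply: measurable_funM => //; apply: (measurableT_comp mf); exact: measurable_snd.
have b0 z : 0 <= \1_(band h) z :> R by rewrite indicE ler0n.
have i1 : (\int[mu2]_(z in `[0%R, T] `*` `[0%R, T]) (\1_(band h) z * f z.1)%:E <=
    (2 * h)%:E * \int[mu]_(x in `[0%R, T]) (f x)%:E)%E.
  rewrite tonelli_rect //; last 2 first.
  - exact/measurable_EFinP.
  - by move=> z; rewrite lee_fin mulr_ge0.
  rewrite -ge0_integralZl_EFin //; last 3 first.
  - by move=> x _; rewrite lee_fin.
  - by apply/measurable_EFinP; exact: measurable_funTS.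
  - by rewrite mulr_ge0.
  apply: ge0_le_integralW => x _ /=.
    by apply: integral_ge0 => y _; rewrite lee_fin mulr_ge0.
  under eq_integral do rewrite mulrC EFinM.
  rewrite ge0_integralZl_EFin //; last first.
  - apply/measurable_EFinP; apply: measurable_funTS.
    by apply: (measurableT_comp mb); exact: measurable_pair1.
  by rewrite muleC; apply: lee_wpmul2r; [rewrite lee_fin|exact: integral_band1].
have i2 : (\int[mu2]_(z in `[0%R, T] `*` `[0%R, T]) (\1_(band h) z * f z.2)%:E <=
    (2 * h)%:E * \int[mu]_(x in `[0%R, T]) (f x)%:E)%E.
  rewrite tonelli_rect' //; last 2 first.
  - exact/measurable_EFinP.
  - by move=> z; rewrite lee_fin mulr_ge0.
  rewrite -ge0_integralZl_EFin //; last 3 first.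
  - by move=> x _; rewrite lee_fin.
  - by apply/measurable_EFinP; exact: measurable_funTS.
  - by rewrite mulr_ge0.
  apply: ge0_le_integralW => y _ /=.
    by apply: integral_ge0 => x _; rewrite lee_fin mulr_ge0.
  have sw x : \1_(band h) (x, y) = \1_(band h) (y, x) :> R.
    by rewrite !indicE /band; congr ((nat_of_bool _)%:R); apply/idP/idP; rewrite !inE /= distrC.
  under eq_integral do rewrite sw mulrC EFinM.
  rewrite ge0_integralZl_EFin //; last first.
  - apply/measurable_EFinP; apply: measurable_funTS.
    by apply: (measurableT_comp mb); exact: measurable_pair1.
  by rewrite muleC; apply: lee_wpmul2r; [rewrite lee_fin|exact: integral_band1].
under eq_integral do rewrite mulrDr EFinD.
rewrite ge0_integralD //; last 5 first.
- by apply: measurableX.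
- by move=> z _; rewrite lee_fin mulr_ge0.
- by apply/measurable_EFinP; exact: measurable_funTS.
- by move=> z _; rewrite lee_fin mulr_ge0.
- by apply/measurable_EFinP; exact: measurable_funTS.
have -> : 4 * h = 2 * h + 2 * h by ring.
rewrite EFinD ge0_muleDl; last 2 first.
- by rewrite lee_fin mulr_ge0.
- by rewrite lee_fin mulr_ge0.
exact: leeD.
Qed.

Section DyadicSobolev.
Variables (rho : R -> R -> R) (T p a : R) (b : nat -> R -> R) (B : R).
Hypotheses (p1 : 1 <= p) (a0 : 0 < a) (T0 : 0 < T) (pm : pmetric rho).
Hypotheses (mb : forall m, measurable_fun setT (b m)) (b0 : forall m s, 0 <= b m s).
Hypothesis Bb : forall m0, (\sum_(0 <= m < m0)
  ((2 ^+ m) `^ a)%:E * \int[mu]_(s in `[0%R, T]) (b m s `^ p)%:E <= B%:E)%E.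
Hypothesis rhob : forall s t n e, s \in `[0, T] -> t \in `[0, T] ->
  `|t - s| <= T / 2 ^+ n -> 0 < e ->
  exists M, rho s t <= e + \sum_(n <= m < M) (b m s + b m t).

Let w : R := 2 `^ (a / 2).
Let w1 : 1 < w. Proof. by apply: gt1_powR; rewrite divr_gt0. Qed.
Let w0 : 0 < w. Proof. exact: lt_trans w1. Qed.
Let p0 : 0 < p. Proof. exact: lt_le_trans p1. Qed.
Let D := (1 - w `^ (- p^-1))^-1.
Let bp m (z : R * R) := b m z.1 `^ p + b m z.2 `^ p.
Let F m (z : R * R) := \sum_(0 <= n < m.+1)
  ((2 ^+ n) `^ (a + 1) * w ^+ (m - n)) * (\1_(band (T / 2 ^+ n)) z * bp m z).

Let bp0 m z : 0 <= bp m z. Proof. by rewrite /bp addr_ge0 ?powR_ge0. Qed.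

Let c0 m n : 0 <= (2 ^+ n) `^ (a + 1) * w ^+ (m - n).
Proof. by rewrite mulr_ge0 ?powR_ge0 // exprn_ge0 // ltW. Qed.

Let G0 m n z : 0 <= \1_(band (T / 2 ^+ n)) z * bp m z.
Proof. by rewrite mulr_ge0 // indicE ler0n. Qed.

Let F0 m z : 0 <= F m z.
Proof. by apply: sumr_ge0 => n _; rewrite mulr_ge0. Qed.

Let mG m n : measurable_fun setT (fun z => \1_(band (T / 2 ^+ n)) z * bp m z).
Proof.
apply: measurable_funM; first by apply: measurable_indic; exact: measurable_band.
apply: measurable_funD; apply: (measurableT_comp (measurable_powR p));
  apply: (measurableT_comp (mb m)); [exact: measurable_fst|exact: measurable_snd].
Qed.

Let D0 : 0 < D.
Proof.
have : 1 `^ p^-1 < w `^ p^-1.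
  by apply: gt0_ltr_powR; rewrite ?invr_gt0 ?nnegrE ?ler01 // ltW.
by rewrite powR1 => h; rewrite /D invr_gt0 subr_gt0 powRN invf_lt1 // powR_gt0.
Qed.

Let pointwise n s t : s \in `[0, T] -> t \in `[0, T] -> `|t - s| <= T / 2 ^+ n ->
  ((rho s t `^ p)%:E <= ((2 * D) `^ p / (2 ^+ n) `^ (a + 1))%:E * \sum_(m <oo) (F m (s, t))%:E)%E.
Proof.
move=> sT tT rn.
have S0 : (0 <= \sum_(m <oo) (F m (s, t))%:E)%E by apply: nneseries_ge0 => m _ _; rewrite lee_fin.
have d0 : 0 < (2 ^+ n : R) `^ (a + 1) by rewrite powR_gt0 // exprn_gt0.
have k0 : 0 < (2 * D) `^ p / (2 ^+ n) `^ (a + 1) by rewrite divr_gt0 // powR_gt0 // mulr_gt0.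
have F0E m z : (0 <= (F m z)%:E)%E by rewrite lee_fin.
have lim M := @nneseries_lim_ge R (fun m => (F m (s, t))%:E) xpredT 0 M
   (fun m _ _ => F0E m (s, t)).
set S := (\sum_(m <oo) _)%E in S0 lim *.
have [Sfin|] := boolP (S \is a fin_num); last first.
  clearbody S; case: S S0 {lim} => // _ _; rewrite gt0_muley ?leey //.
rewrite -(fineK Sfin) -EFinM lee_fin.
have {}lim M : \sum_(0 <= m < M) F m (s, t) <= fine S.
  by rewrite -lee_fin (fineK Sfin) -sumEFin.
have S00 : 0 <= fine S by rewrite fine_ge0.
set S' := fine S / (2 ^+ n) `^ (a + 1).
have S'0 : 0 <= S' by rewrite divr_ge0 // ltW.
have bs m : 0 <= b m s + b m t by rewrite addr_ge0.
have part M : \sum_(n <= m < M) w ^+ (m - n) * (b m s + b m t) `^ p <= 2 `^ p * S'.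
  apply: (@le_trans _ _ (2 `^ p * \sum_(n <= m < M) w ^+ (m - n) * bp m (s, t))).
    rewrite mulr_sumr; apply: ler_sum => m _; rewrite mulrCA ler_wpM2l ?exprn_ge0 ?(ltW w0) //.
    by apply: powRD_le => //; exact: ltW.
  rewrite ler_wpM2l ?powR_ge0 // /S' ler_pdivlMr // mulrC mulr_sumr.
  have [nM|Mn] := leqP n M; last by rewrite big_geq // ltnW.
  apply: le_trans (lim M); rewrite [leRHS](big_cat_nat (n := n)) //= ler_wpDl ?sumr_ge0 //.
  rewrite big_nat_cond [leRHS]big_nat_cond; apply: ler_sum => m /andP[/andP[nm _] _].
  rewrite /F (bigD1_seq n) ?mem_index_iota ?iota_uniq //= mulrA.
  rewrite indicE mem_set // mul1r lerDl; apply: sumr_ge0 => i _.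
  by rewrite mulr_ge0.
have main : rho s t <= 2 * D * S' `^ p^-1.
  apply/ler_addgt0Pr => e e0.
  have [M hM] := rhob sT tT rn e0; apply: le_trans hM _; rewrite addrC lerD2r.
  apply: le_trans (sum_powR_weight n M p0 w1 bs) _; rewrite -/D [2 * D]mulrC -mulrA.
  rewrite ler_wpM2l ?(ltW D0) //.
  have pi0 : 0 <= p^-1 by rewrite invr_ge0 ltW.
  apply: le_trans (ler_powR2 pi0 _ (part M)) _.
    by apply: sumr_ge0 => m _; rewrite mulr_ge0 ?powR_ge0 // exprn_ge0 // ltW.
  by rewrite powRM ?powR_ge0 // -powRrM divff ?gt_eqF // powRr1.
have DD : 0 <= 2 * D by rewrite mulr_ge0 // ltW.
apply: le_trans (ler_powR2 (ltW p0) (pm_ge0 pm s t) main) _.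
rewrite powRM ?powR_ge0 // -powRrM mulVf ?gt_eqF // powRr1 // /S'.
by rewrite le_eqVlt; apply/orP; left; apply/eqP; ring.
Qed.

Let integralF m : (\int[mu2]_(z in `[0%R, T] `*` `[0%R, T]) (F m z)%:E <=
  (4 * T * (w / (w - 1)))%:E * (((2 ^+ m) `^ a)%:E * \int[mu]_(s in `[0%R, T]) (b m s `^ p)%:E))%E.
Proof.
have mQ : measurable (`[0%R, T] `*` `[0%R, T] : set (R * R)).
  by apply: measurableX; exact: measurable_itv.
set I := (\int[mu]_(s in _) _)%E.
have I0 : (0 <= I)%E by apply: integral_ge0 => s _; rewrite lee_fin powR_ge0.
under eq_integral do rewrite /F -sumEFin.
rewrite ge0_integral_sum //; last 2 first.
- move=> n; apply/measurable_EFinP; apply: measurable_funTS.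
  by apply: measurable_funM => //; exact: mG.
- by move=> n z _; rewrite lee_fin mulr_ge0.
apply: (@le_trans _ _ (\sum_(0 <= n < m.+1)
   ((2 ^+ n) `^ (a + 1) * w ^+ (m - n) * (4 * (T / 2 ^+ n)))%:E * I)%E).
  apply: lee_sum => n _.
  under eq_integral do rewrite EFinM.
  rewrite ge0_integralZl_EFin //; last 2 first.
  - by move=> z _; rewrite lee_fin.
  - by apply/measurable_EFinP; apply: measurable_funTS; exact: mG.
  rewrite [X in (_ <= X * _)%E]EFinM -[leRHS]muleA; apply: lee_wpmul2l; first by rewrite lee_fin.
  have := @integral_band T (T / 2 ^+ n) (fun s => b m s `^ p).
  apply; last by move=> s; rewrite powR_ge0.
    by rewrite divr_ge0 ?exprn_ge0 // ltW.
  exact: (measurableT_comp (measurable_powR p)).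
rewrite -ge0_sume_distrl; last first.
  move=> n _; rewrite lee_fin mulr_ge0 // mulr_ge0 // divr_ge0 ?exprn_ge0 //.
  exact: ltW.
rewrite muleA; apply: lee_wpmul2r => //; rewrite sumEFin -EFinM lee_fin.
have w11 : 0 < w - 1 by rewrite subr_gt0.
have wa n : (2 ^+ n) `^ a = w ^+ n * w ^+ n.
  rewrite pow2_powR -exprD addnn -mul2n exprM; congr (_ ^+ _).
  by rewrite /w expr2 -powRD ?[a / 2 + a / 2]addrC; [congr (_ `^ _); field|apply/implyP => _;
      rewrite gt_eqF].
have step n : (n <= m)%N -> (2 ^+ n) `^ (a + 1) * w ^+ (m - n) * (4 * (T / 2 ^+ n)) =
   4 * T * w ^+ m * w ^+ n.
  move=> nm; have q0 : (2 ^+ n : R) != 0 by rewrite expf_neq0.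
  rewrite powRD; last by apply/implyP => _; rewrite gt_eqF // addr_gt0.
  rewrite powRr1 ?exprn_ge0 // wa -[in RHS](subnK nm) exprD.
  by field.
rewrite big_nat_cond (eq_bigr (fun n => 4 * T * w ^+ m * w ^+ n)); last first.
  by move=> n /andP[/andP[_ nm] _]; exact: step.
rewrite -big_nat_cond -mulr_sumr wa.
have -> : \sum_(0 <= i < m.+1) w ^+ i = (w ^+ m.+1 - 1) / (w - 1).
  by rewrite subrX1 mulrC mulKf ?gt_eqF // big_mkord.
have -> : 4 * T * (w / (w - 1)) * (w ^+ m * w ^+ m) = 4 * T * w ^+ m * (w ^+ m.+1 / (w - 1)).
  by rewrite exprS; ring.
rewrite ler_wpM2l //; last by rewrite ler_pM2r ?invr_gt0 // gerBl.
by rewrite mulr_ge0 ?exprn_ge0 ?(ltW w0) // mulr_ge0 // ltW.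
Qed.

(** A chaining bound implies finiteness of the seminorm.  For |t - s| close to
    T / 2^n only the jumps b m with m >= n enter.  The weight w^(m - n), where
    w = 2^(a / 2), bounds their sum by a sum of p-th powers, and
    after integration over the band |t - s| <= T / 2^n and summation over n the
    jump of scale m keeps the weight 2^(m a). *)
Lemma dyadic_sobolev :
  (\int[mu2]_(z in `[0%R, T] `*` `[0%R, T]) (density rho p (a + 1) z)%:E < +oo)%E.
Proof.
have mQ : measurable (`[0%R, T] `*` `[0%R, T] : set (R * R)).
  by apply: measurableX; exact: measurable_itv.
set C := (2 * D) `^ p * (2 / T) `^ (a + 1).
have C0 : 0 <= C by rewrite mulr_ge0 ?powR_ge0.
have w11 : 0 < w - 1 by rewrite subr_gt0.
have le1 : (\int[mu2]_(z in `[0%R, T] `*` `[0%R, T]) (density rho p (a + 1) z)%:E <=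
  \int[mu2]_(z in `[0%R, T] `*` `[0%R, T]) (\sum_(m <oo) (C * F m z)%:E))%E.
  apply: ge0_le_integralW => [z _|[s t] [/= sT tT]]; first by rewrite lee_fin density_ge0.
  have S0 : (0 <= \sum_(m <oo) (F m (s, t))%:E)%E by apply: nneseries_ge0 => m _ _; rewrite lee_fin.
  have [->|st] := eqVneq s t.
    have -> : density rho p (a + 1) (t, t) = 0 by rewrite /density /= pm_xx // powR0 ?gt_eqF // mul0r.
    by apply: nneseries_ge0 => m _ _; rewrite lee_fin mulr_ge0.
  set r := `|t - s|; have r0 : 0 < r by rewrite normr_gt0 subr_eq0 eq_sym.
  have [n n1 n2] : exists2 n, r <= T / 2 ^+ n & T / 2 ^+ n.+1 < r.
    have ex := dyadic_small T0 r0.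
    case: (ex_minnP ex) => -[|n] hn mn.
      move: hn; rewrite expr0 divr1 ltNge; case/negP.
      by move: sT tT; rewrite /= !in_itv /= => /andP[? ?] /andP[? ?]; rewrite /r ler_norml;
          apply/andP; split; lra.
    by exists n => //; rewrite leNgt; apply/negP => /mn; rewrite ltnn.
  have -> : (\sum_(m <oo) (C * F m (s, t))%:E = C%:E * \sum_(m <oo) (F m (s, t))%:E)%E.
    under eq_eseriesr do rewrite EFinM.
    by rewrite nneseriesZl // => m _; rewrite lee_fin.
  rewrite /density /= -/r EFinM.
  apply: (@le_trans _ _ (((2 * D) `^ p / (2 ^+ n) `^ (a + 1))%:E * (\sum_(m <oo) (F m (s, t))%:E)
      * ((r `^ (a + 1))^-1)%:E)%E).
    apply: lee_wpmul2r; first by rewrite lee_fin invr_ge0 powR_ge0.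
    exact: pointwise.
  rewrite muleAC; apply: lee_wpmul2r => //; rewrite -EFinM lee_fin /C -mulrA.
  rewrite ler_wpM2l ?powR_ge0 // -invfM -powRM ?exprn_ge0 ?(ltW r0) //.
  have rr : 0 < 2 ^+ n * r by rewrite mulr_gt0 // exprn_gt0.
  have a10 : 0 <= a + 1 by rewrite addr_ge0 // ltW.
  have -> : (2 / T) `^ (a + 1) = ((T / 2) `^ (a + 1))^-1.
    by rewrite -[in LHS]invf_div -[(T / 2)^-1]powR_inv1 ?divr_ge0 ?(ltW T0) // -powRrM mulN1r powRN.
  rewrite lef_pV2 ?posrE ?powR_gt0 ?divr_gt0 //; apply: ler_powR2 => //.
    by rewrite divr_ge0 // ltW.
  move: n2; rewrite exprS invfM mulrA ltr_pdivrMr ?exprn_gt0 // mulrC => /ltW; by rewrite mulrC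
      [_ * r]mulrC.
apply: le_lt_trans le1 _.
have mF m : measurable_fun setT (F m).
  by apply: measurable_sum => n; apply: measurable_funM => //; exact: mG.
rewrite integral_nneseries //; last 2 first.
- by move=> m; apply/measurable_EFinP; apply: measurable_funTS; apply: measurable_funM => //; exact: mF.
- by move=> m z _; rewrite lee_fin mulr_ge0.
apply: (@le_lt_trans _ _ (C%:E * (4 * T * (w / (w - 1)) * B)%:E)%E); last by rewrite -EFinM ltry.
have K0 : 0 <= 4 * T * (w / (w - 1)).
  by rewrite mulr_ge0 ?divr_ge0 ?mulr_ge0 // ltW.
apply: lime_le.
  by apply: is_cvg_nneseries => m _ _; apply: integral_ge0 => z _; rewrite lee_fin mulr_ge0.
apply: nearW => m0.
apply: (@le_trans _ _ (\sum_(0 <= m < m0) (C%:E * ((4 * T * (w / (w - 1)))%:E *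
   (((2 ^+ m) `^ a)%:E * \int[mu]_(s in `[0%R, T]) (b m s `^ p)%:E))))%E).
  apply: lee_sum => m _; under eq_integral do rewrite EFinM.
  rewrite ge0_integralZl_EFin //; last 2 first.
  - by move=> z _; rewrite lee_fin.
  - by apply/measurable_EFinP; apply: measurable_funTS; exact: mF.
  by apply: lee_wpmul2l; [rewrite lee_fin|exact: integralF].
have I0 m : (0 <= ((2 ^+ m) `^ a)%:E * \int[mu]_(s in `[0%R, T]) (b m s `^ p)%:E)%E.
  apply: mule_ge0; first by rewrite lee_fin powR_ge0.
  by apply: integral_ge0 => z _; rewrite lee_fin powR_ge0.
rewrite -ge0_sume_distrr; last by move=> m _; rewrite mule_ge0.
rewrite -ge0_sume_distrr; last by move=> m _.
by apply: lee_wpmul2l; [rewrite lee_fin|rewrite [leRHS]EFinM; apply: lee_wpmul2l].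
Qed.

End DyadicSobolev.
End Dyadic.

(** * Closed subgroups of the top level and dyadic midpoints *)

Section Linear.
Context {R : realType} {d N : nat}.
Local Notation A := (tensor R d N).
Local Notation Wd := (@W R d N).
Local Notation G := (@Ggroup R d N).
Implicit Types (g h a b u v w x y : A) (l e c : R).
Hypothesis N0 : (0 < N)%N.

(** The theorem of Bolzano and Weierstrass, in coordinates. *)
Lemma tensor_cluster (e : nat -> A) : (forall n s, (size s <= N)%N -> `|tcoef (e n) s| <= 1) ->
  exists x, forall (eps : R) M, 0 < eps ->
  exists2 n, (M <= n)%N & forall s, (size s <= N)%N -> `|tcoef (e n) s - tcoef x s| < eps.
Proof.
move=> e1; pose wd (j : 'I_#|{: N.-bseq 'I_d}|) : N.-bseq 'I_d := enum_val j.
pose r k := \row_j (tcoef (e k) (wd j)).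
have cI (j : 'I_#|{: N.-bseq 'I_d}|) : compact (`[- 1, 1]%classic : set R) by exact: segment_compact.
have cQ := rV_compact cI.
have FF : ProperFilter (r @ \oo) by exact: fmap_proper_filter.
have rQ : (r @ \oo) [set v : 'rV[R]_#|{: N.-bseq 'I_d}| | forall j, `[- 1, 1]%classic (v ord0 j)].
  exists 0%N => // k _ j /=; rewrite mxE in_itv /= -ler_norml e1 // size_bseq //.
have [v [_ cv]] := cQ _ FF rQ.
exists [ffun s => v ord0 (enum_rank s) : R^o] => eps M eps0.
have [_ [[n Mn <-] /= hB]] := cv [set r n | n in [set n | (M <= n)%N]] (ball v eps)
  ltac:(by exists M => // n /= Mn; exists n) (nbhsx_ballx v eps eps0).
exists n => // s sN; have [_ hB'] := hB.
have := hB' ord0 (enum_rank (insub_bseq N s)).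
rewrite /ball /= mxE /wd enum_rankK val_insub_bseq // distrC.
by rewrite [tcoef [ffun _ => _] s]/tcoef ffunE.
Qed.

Lemma lev_levN x : lev N (lev N x) = lev N x.
Proof. by rewrite lev_lev eqxx. Qed.

(** W_N is the common kernel of the coordinates of a projection, which are bounded
    forms. *)
Lemma W_closed x : lev N x = x ->
  (forall e : R, 0 < e -> exists2 v, v \in Wd N & level_norm N (x - v) < e) -> x \in Wd N.
Proof.
move=> xN H; pose P := (\1 - projv (Wd N))%VF.
suff Px : P x = 0.
  move: Px; rewrite /P lfunE /= id_lfunE opp_lfunE => /eqP; rewrite subr_eq0 => /eqP ->.
  exact: memv_proj.
apply: tensorP => s sN; rewrite tcoef0.
pose phi0 (y : A) : R^o := tcoef (P y) s.
have phi_lin : linear phi0.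
  by move=> k u v; rewrite /phi0 linearP tcoefD tcoefZ.
pose phi := HB.pack_for {scalar A} phi0 (GRing.isLinear.Build _ _ _ _ phi0 phi_lin).
have [M M0 HM] := form_bound phi N.
apply/eqP; rewrite -normr_eq0 eq_le normr_ge0 andbT; apply/ler_addgt0Pr => e e0.
have M1 : 0 < M + 1 by rewrite ltr_wpDl.
have [v vN vx] := H (e / (M + 1)) (divr_gt0 e0 M1).
have -> : tcoef (P x) s = phi (x - v).
  rewrite /phi /= /phi0 linearB /=; suff -> : P v = 0 by rewrite subr0.
  by rewrite /P lfunE /= id_lfunE opp_lfunE projv_id // subrr.
rewrite add0r; apply: le_trans (HM _ _) _.
  by rewrite linearB /= xN (W_homog N0 vN).
apply: (@le_trans _ _ (M * (e / (M + 1)))); first by rewrite ler_wpM2l // ltW.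
by rewrite mulrCA -[leRHS]mulr1 ler_pM2l // ler_pdivrMr // mul1r lerDl.
Qed.

Section Lat.
Variable K : set A.
Hypothesis HK : closed_subgroup (expW N) K.
Local Notation logK := (logK K).
Local Notation nm := (level_norm N).

Lemma logK_closed' x : lev N x = x ->
  (forall e : R, 0 < e -> exists2 v, logK v & nm (x - v) < e) -> logK x.
Proof.
move=> xN H; apply: (logK_closed N0 HK) => //.
by apply: W_closed => // e /H[v Lv]; exists v => //; exact: logK_W Lv.
Qed.

Lemma logK_lev x : logK x -> lev N x = x.
Proof. by move/(@logK_W _ _ _ _ _)/(W_homog N0). Qed.

Lemma logKMn x n : logK x -> logK (n%:R *: x).
Proof.
move=> Lx; elim: n => [|n IH]; first by rewrite scale0r; exact: (logK0 HK).
by rewrite -natr1 scalerDl scale1r; apply: (logKD N0 HK).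
Qed.

(** The largest vector space inside logK.  Lifts can only move along it,
    see [path_lin]. *)
Definition lin x := forall c, logK (c *: x).

Lemma lin_logK x : lin x -> logK x.
Proof. by move=> /(_ 1); rewrite scale1r. Qed.

Lemma lin0 : lin 0.
Proof. by move=> c; rewrite scaler0; exact: (logK0 HK). Qed.

Lemma linD x y : lin x -> lin y -> lin (x + y).
Proof. by move=> lx ly c; rewrite scalerDr; apply: (logKD N0 HK). Qed.

Lemma linZ c x : lin x -> lin (c *: x).
Proof. by move=> lx c'; rewrite scalerA. Qed.

Lemma lin_closed x : lev N x = x ->
  (forall e : R, 0 < e -> exists2 v, lin v & nm (x - v) < e) -> lin x.
Proof.
move=> xN H c; apply: logK_closed'; first by rewrite linearZ /= xN.
move=> e e0; have c1 : 0 < `|c| + 1 by rewrite ltr_wpDl.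
have [v lv hv] := H (e / (`|c| + 1)) (divr_gt0 e0 c1); exists (c *: v) => //.
rewrite -scalerBr level_normZ; apply: (@le_lt_trans _ _ (`|c| * (e / (`|c| + 1)))).
  by rewrite ler_wpM2l // ltW.
by rewrite mulrCA -[ltRHS]mulr1 ltr_pM2l // ltr_pdivrMr // mul1r ltrDl.
Qed.

(** An almost best approximation of x by elements of lin is subtracted. *)
Lemma almost_orthogonal x : logK x -> ~ lin x -> exists y,
  [/\ logK y, 0 < nm y, nm y <= 2 * nm x & forall v, lin v -> nm y <= 2 * nm (y - v)].
Proof.
move=> Lx nx; pose D := [set nm (x - v) | v in lin].
have D0 : has_lbound D by exists 0 => _ [v _ <-]; exact: level_norm_ge0.
have Dne : D !=set0 by exists (nm (x - 0)); exists 0 => //; exact: lin0.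
have infD : has_inf D by [].
have dle v : lin v -> inf D <= nm (x - v) by move=> lv; apply: ge_inf => //; exists v.
have d0 : 0 < inf D.
  rewrite lt_neqAle lb_le_inf ?andbT //; last by move=> _ [v _ <-]; exact: level_norm_ge0.
  apply/eqP => dd; apply: nx; apply: lin_closed; first exact: logK_lev.
  move=> e e0; have [_ [v lv <-] h] := inf_adherent e0 infD.
  by exists v => //; move: h; rewrite -dd add0r.
have [_ [v lv <-] h] := inf_adherent d0 infD.
exists (x - v); split.
- by apply: (logKB N0 HK) => //; exact: lin_logK.
- exact: lt_le_trans d0 (dle v lv).
- have := dle 0 lin0; rewrite subr0; lra.
- move=> u lu; have := dle (v + u) (linD lv lu); rewrite opprD addrA; lra.
Qed.

(** Otherwise there are arbitrarily small vectors y n of logK almost orthogonal to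
    lin.  Integer multiples of them come close to any multiple of a limit
    direction x, so x lies in lin because logK is closed; but then the
    directions cannot stay away from lin. *)
Lemma small_lin : exists2 eps : R, 0 < eps & forall x, logK x -> nm x < eps -> lin x.
Proof.
apply: contrapT => H.
have {}H k : exists y, [/\ logK y, 0 < nm y, nm y <= 2 * k.+1%:R^-1 &
    forall v, lin v -> nm y <= 2 * nm (y - v)].
  apply: contrapT => H1; apply: H; exists k.+1%:R^-1; first by rewrite invr_gt0.
  move=> x Lx xk; apply: contrapT => nx; apply: H1.
  have [y [y1 y2 y3 y4]] := almost_orthogonal Lx nx; exists y; split=> //.
  by apply: le_trans y3 _; rewrite ler_pM2l // ltW.
have {H}[y Hy] := choice H.
pose e n := (nm (y n))^-1 *: y n.
have nme n : nm (e n) = 1.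
  have [_ y0 _ _] := Hy n; rewrite /e level_normZ ger0_norm ?invr_ge0 ?(ltW y0) //.
  by rewrite mulVf ?gt_eqF.
have leve n : lev N (e n) = e n.
  by have [Ly _ _ _] := Hy n; rewrite /e linearZ /= (logK_lev Ly).
have e1 n s : (size s <= N)%N -> `|tcoef (e n) s| <= 1.
  move=> sN; rewrite -leve tcoef_lev //; case: eqP => [sz|_]; last by rewrite normr0 ler01.
  by rewrite -(nme n); have := @level_norm_coord _ _ _ (e n) s sN; rewrite sz.
have [x0 Hx0] := tensor_cluster e1.
pose x := lev N x0.
have Hx (eps : R) M : 0 < eps -> exists2 n, (M <= n)%N & nm (e n - x) < eps.
  move=> eps0; pose B : R := \sum_(w : N.-bseq 'I_d | size w == N) 1.
  have B0 : 0 < B + 1 by rewrite ltr_wpDl // /B sumr_ge0.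
  have [n Mn hn] := Hx0 (eps / (B + 1)) M (divr_gt0 eps0 B0).
  exists n => //; apply: (@le_lt_trans _ _ (B * (eps / (B + 1)))).
    apply: level_norm_le => s sz _; have sN : (size s <= N)%N by rewrite sz.
    by rewrite tcoefB tcoef_lev // sz eqxx ltW // hn.
  by rewrite mulrCA -[ltRHS]mulr1 ltr_pM2l // ltr_pdivrMr // mul1r ltrDl.
have levx : lev N x = x by exact: lev_levN.
(* c x is close to m%:R y n, where m is the integer part of c / |y n| *)
have pos c : 0 <= c -> logK (c *: x).
  move=> c0; apply: logK_closed'; first by rewrite linearZ /= levx.
  move=> eps eps0.
  have c1 : 0 < c + 1 by rewrite ltr_wpDl.
  have [n nM hn] := Hx (eps / 2 / (c + 1)) (Num.truncn (4 / eps)) ltac:(by rewrite !divr_gt0).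
  have [Ly y0 yk _] := Hy n; pose m := Num.truncn (c / nm (y n)).
  exists (m%:R *: y n); first exact: logKMn.
  have -> : c *: x - m%:R *: y n = (c *: (x - e n)) + (c / nm (y n) - m%:R) *: y n.
    by rewrite /e scalerBr scalerBl scalerA addrA subrK.
  apply: le_lt_trans (level_normD _ _ _) _; rewrite !level_normZ ger0_norm //.
  have h0 : 0 <= c / nm (y n) by rewrite divr_ge0 // ltW.
  have /andP[m1 m2] := truncn_itv h0; rewrite -/m in m1 m2.
  have k1 : `|c / nm (y n) - m%:R| <= 1.
    rewrite -natr1 in m2; rewrite ger0_norm; lra.
  have k2 : nm (y n) < eps / 2.
    apply: le_lt_trans yk _; rewrite ltr_pdivrMr //.
    have := truncnS_gt (4 / eps); rewrite ltr_pdivrMr // => h.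
    have h' : (Num.truncn (4 / eps)).+1%:R <= n.+1%:R :> R by rewrite ler_nat.
    have := ler_wpM2r (ltW eps0) h'; lra.
  have k3 : c * nm (x - e n) < eps / 2.
    apply: (@le_lt_trans _ _ (c * (eps / 2 / (c + 1)))).
      by rewrite ler_wpM2l // level_norm_distC ltW.
    by rewrite mulrCA -[ltRHS]mulr1 ltr_pM2l ?divr_gt0 // ltr_pdivrMr // mul1r ltrDl.
  have k4 : `|c / nm (y n) - m%:R| * nm (y n) <= nm (y n).
    by rewrite -[leRHS]mul1r ler_wpM2r // ltW.
  lra.
have lx : lin x.
  move=> c; have [c0|c0] := leP 0 c; first exact: pos.
  by rewrite -[c]opprK scaleNr; apply: (logKN N0 HK); apply: pos; rewrite oppr_ge0 ltW.
have [n _ hn] := Hx 2^-1 0%N ltac:(by []).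
have [Ly y0 _ yv] := Hy n; have := yv _ (linZ (nm (y n)) lx).
have -> : y n - nm (y n) *: x = nm (y n) *: (e n - x).
  by rewrite scalerBr /e scalerA divff ?gt_eqF // scale1r.
rewrite level_normZ ger0_norm ?(ltW y0) // mulrCA -{1}[nm (y n)]mulr1 ler_pM2l //.
lra.
Qed.

(** By [small_lin] the path moves along lin as long as its increments are small,
    and the connectedness of the interval, in the form of a supremum, does the
    rest. *)
Lemma path_lin (T : R) (w : R -> A) : 0 <= T -> (forall t, 0 <= t <= T -> logK (w t)) ->
  (forall t, 0 <= t <= T -> forall e : R, 0 < e -> exists2 r : R, 0 < r &
     forall s, 0 <= s <= T -> `|s - t| < r -> nm (w s - w t) < e) ->
  lin (w T - w 0).
Proof.
move=> T0 Lw cw; have [eps eps0 Heps] := small_lin.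
pose S := [set t | 0 <= t <= T /\ lin (w t - w 0)].
have S0 : S 0 by split; [rewrite lexx T0|rewrite subrr; exact: lin0].
have ubS : ubound S T by move=> t [/andP[]].
have supS : has_sup S by split; [exists 0|exists T].
have s1 : 0 <= sup S by apply: ub_le_sup => //; exists T.
have s2 : sup S <= T by apply: ge_sup => //; exists 0.
set s := sup S in s1 s2; have sT : 0 <= s <= T by rewrite s1.
have [r r0 Hr] := cw s sT _ (divr_gt0 eps0 (ltr0Sn R 1)).
have [t [tT lt] ts] := sup_adherent r0 supS; rewrite -/s in ts.
have tle : t <= s by apply: ub_le_sup => //; exists T.
have near (u : R) : 0 <= u <= T -> `|u - s| < r -> lin (w u - w 0).
  move=> uT us; have -> : w u - w 0 = (w u - w t) + (w t - w 0) by rewrite addrA subrK.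
  apply: linD => //; apply: Heps; first by apply: (logKB N0 HK); exact: Lw.
  have -> : w u - w t = (w u - w s) - (w t - w s) by rewrite opprB addrA subrK.
  apply: le_lt_trans (level_normB _ _ _) _.
  have h1 := Hr _ uT us; have h2 := Hr _ tT ltac:(by rewrite ler0_norm; lra); lra.
have [sT'|sT'] := leP T (s + r / 2).
  by apply: near; rewrite ?T0 ?lexx // ger0_norm; lra.
suff : s + r / 2 <= s by lra.
apply: ub_le_sup; first by exists T.
have h : 0 <= s + r / 2 <= T by apply/andP; split; lra.
by split=> //; apply: near => //; rewrite ger0_norm; lra.
Qed.

Local Notation qd := (@quotient_dist R d N).

Lemma inc_mul x y z : tcoef y [::] = 1 -> tinv x * y * (tinv y * z) = tinv x * z.
Proof. by move=> y1; rewrite mulrA -(mulrA (tinv x)) tmulV // mulr1. Qed.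

(** Within their cosets x^-1 z and z^-1 y can be made short, hence small at
    level N.  The correction w needed at level N to recover x^-1 y lies in logK
    and is small, hence lies in lin: it can be halved and divided evenly
    between the two sides of z. *)
Lemma midpoint : exists2 C : R, 0 <= C & exists2 eps : R, 0 < eps &
  forall x y z (d1 d2 : R), G x -> G y -> G z ->
  qd (coset K x) (coset K z) < d1 -> qd (coset K z) (coset K y) < d2 ->
  exists z', [/\ G z', coset K z' = coset K z &
    nm (tinv x * y) + C * (d1 + d2) ^+ N < eps ->
    nm (tinv x * z') <= nm (tinv x * y) / 2 + C * (d1 + d2) ^+ N /\
    nm (tinv z' * y) <= nm (tinv x * y) / 2 + C * (d1 + d2) ^+ N].
Proof.
pose B : R := \sum_(w : N.-bseq 'I_d | size w == N) 1.
have B0 : 0 <= B by rewrite /B sumr_ge0.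
have [eps eps0 Heps] := small_lin.
exists (2 * B); first by rewrite mulr_ge0.
exists eps => // x y z d1 d2 Gx Gy Gz h1 h2.
have x1 := G_coef0 Gx; have y1 := G_coef0 Gy; have z1 := G_coef0 Gz.
have q1 := qd_ge0 N0 HK Gx Gz; have q2 := qd_ge0 N0 HK Gz Gy.
have [a La ha] := qd_approx N0 HK Gx Gz (e := d1 - qd (coset K x) (coset K z)) ltac:(lra).
have [b Lb hb] := qd_approx N0 HK Gz Gy (e := d2 - qd (coset K z) (coset K y)) ltac:(lra).
rewrite subrKC in ha; rewrite subrKC in hb.
have va := logK_van N0 La; have vb := logK_van N0 Lb.
(* the level-N correction of the product of the two short increments, see xyw *)
pose w := - b - a; have Lw : logK w by apply: (logKB N0 HK) => //; exact: (logKN N0 HK).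
have vw := logK_van N0 Lw.
have n0 : 0 <= (d1 + d2) ^+ N by rewrite exprn_ge0 // addr_ge0; lra.
have G1 : G (tinv x * z + a) := G_addr N0 (G_inc Gx Gz) La.
have G2 : G (tinv z * y + b) := G_addr N0 (G_inc Gz Gy) Lb.
have u1 : nm (tinv x * z + a) <= B * (d1 + d2) ^+ N.
  apply: le_trans (level_norm_cc _ G1) _; rewrite ler_wpM2l //.
  by rewrite lerXn2r ?nnegrE ?cc_norm_ge0 ?addr_ge0; lra.
have u2 : nm (tinv z * y + b) <= B * (d1 + d2) ^+ N.
  apply: le_trans (level_norm_cc _ G2) _; rewrite ler_wpM2l //.
  by rewrite lerXn2r ?nnegrE ?cc_norm_ge0 ?addr_ge0; lra.
have u3 : nm ((tinv x * z + a) * (tinv z * y + b)) <= B * (d1 + d2) ^+ N.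
  apply: le_trans (level_norm_cc _ (G_mul G1 G2)) _; rewrite ler_wpM2l //.
  have := cc_norm_mul G1 G2 => h; rewrite lerXn2r ?nnegrE ?cc_norm_ge0 ?addr_ge0; lra.
have xyw : tinv x * y = (tinv x * z + a) * (tinv z * y + b) + w.
  rewrite -(inc_mul x y z1) mulrDl !mulrDr.
  have txz : tcoef (tinv x * z) [::] = 1 by exact: G_coef0 (G_inc _ _).
  have tzy : tcoef (tinv z * y) [::] = 1 by exact: G_coef0 (G_inc _ _).
  rewrite (top_mulr txz vb) (top_mull tzy va).
  rewrite (_ : a * b = 0) ?addr0; last first.
    apply: (@vanish_top _ _ _ (N + N)); last exact: vanishM.
    by rewrite -addn1 leq_add2l.
  by rewrite /w -!addrA [a + _]addrC !addrA subrK addrK.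
have hw : nm w <= nm (tinv x * y) + B * (d1 + d2) ^+ N.
  have -> : w = tinv x * y - (tinv x * z + a) * (tinv z * y + b) by rewrite xyw addrC addKr.
  apply: le_trans (level_normB _ _ _) _; lra.
have [h|nh] := boolP (nm (tinv x * y) + 2 * B * (d1 + d2) ^+ N < eps); last first.
  by exists z; split=> // h; rewrite h in nh.
have p0 : 0 <= B * (d1 + d2) ^+ N by rewrite mulr_ge0.
have lw : logK (2^-1 *: w) by apply: Heps => //; lra.
have Lz : logK (a + 2^-1 *: w) by apply: (logKD N0 HK).
exists (z + (a + 2^-1 *: w)); split.
- exact: G_addr Lz.
- exact: (coset_eq N0 HK).
move=> _; have nw2 : nm (2^-1 *: w) <= nm w / 2.
  by rewrite level_normZ ger0_norm ?invr_ge0 // mulrC.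
have vz := logK_van N0 Lz.
have E2 : tinv (z + (a + 2^-1 *: w)) * y = tinv z * y + b + 2^-1 *: w.
  rewrite -[in LHS](addr0 y) inc_shift //; last by move=> s _ _; rewrite tcoef0.
  rewrite -addrA; congr (_ + _); rewrite /w; apply: tensorP => s _.
  by rewrite !(tcoefD, tcoefN, tcoefZ, tcoef0); field.
split.
  rewrite lev_inc // addrA; apply: le_trans (level_normD _ _ _) _; lra.
rewrite E2; apply: le_trans (level_normD _ _ _) _; lra.
Qed.

End Lat.
End Linear.

(** * Lifts along dyadic grids *)

Section Clamp.
Context {R : realType}.
Implicit Types (T s t : R).

(** Paths are considered on [0, T] only.  Freezing them outside gives pseudometrics
    on the whole line. *)
Definition clamp T t : R := if t <= 0 then 0 else if t <= T then t else T.

Lemma clampP T t : 0 <= T -> 0 <= clamp T t <= T.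
Proof.
move=> T0; rewrite /clamp; case: (leP t 0) => h1; case: (leP t T) => h2;
  apply/andP; split; lra.
Qed.

Lemma clamp_id T t : 0 <= t <= T -> clamp T t = t.
Proof.
by move=> /andP[t0 tT]; rewrite /clamp tT; case: (leP t 0) => // h; apply/eqP; rewrite eq_le t0 h.
Qed.

Lemma clamp_lip T s t : 0 <= T -> `|clamp T s - clamp T t| <= `|s - t|.
Proof.
move=> T0; wlog st : s t / s <= t => [H|].
  have [/H //|/ltW/H] := leP s t.
  by rewrite distrC [leRHS]distrC.
rewrite [leRHS]distrC (@ger0_norm _ (t - s)) ?subr_ge0 // /clamp.
case: (leP s 0) => h1; case: (leP s T) => h2; case: (leP t 0) => h3; case: (leP t T) => h4;
  rewrite ler_norml; apply/andP; split; lra.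
Qed.

Lemma pmetric_clamp T (D : R -> R -> R) : 0 <= T ->
  (forall s t, 0 <= s <= T -> 0 <= t <= T -> 0 <= D s t) ->
  (forall s t, 0 <= s <= T -> 0 <= t <= T -> D s t = D t s) ->
  (forall s t u, 0 <= s <= T -> 0 <= t <= T -> 0 <= u <= T -> D s u <= D s t + D t u) ->
  (forall t, 0 <= t <= T -> D t t = 0) ->
  (forall t, 0 <= t <= T -> forall e : R, 0 < e -> exists2 r : R, 0 < r &
     forall s, 0 <= s <= T -> `|s - t| < r -> D s t < e) ->
  pmetric (fun s t => D (clamp T s) (clamp T t)).
Proof.
move=> T0 h1 h2 h3 h4 h5; have c t := clampP t T0; split.
- by move=> s t; exact: h1.
- by move=> s t; exact: h2.
- by move=> s t u; exact: h3.
- by move=> t; exact: h4.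
- move=> t e e0; have [r r0 hr] := h5 _ (c t) e e0; exists r => // s st.
  by apply: hr => //; apply: le_lt_trans (clamp_lip s t T0) st.
Qed.

End Clamp.

Section Sums.
Context {R : realType}.
Implicit Types (p a q x y : R).

Lemma sum_double (F : nat -> R) n :
  \sum_(0 <= j < n.*2) F j = \sum_(0 <= k < n) (F k.*2 + F k.*2.+1).
Proof.
elim: n => [|n IH]; first by rewrite !big_geq.
by rewrite doubleS !big_nat_recr //= IH addrA.
Qed.

Lemma sum_shift (F : nat -> R) n m :
  \sum_(n <= i < n + m) F i = \sum_(0 <= i < m) F (n + i)%N.
Proof. by rewrite -{1}(add0n n) big_addn addKn; apply: eq_bigr => i _; rewrite addnC. Qed.

Lemma sum_tail_le (F : nat -> R) n m : (forall i, 0 <= F i) ->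
  \sum_(0 <= i < m) F (n + i)%N <= \sum_(0 <= i < n + m) F i.
Proof.
move=> F0; rewrite -sum_shift [leRHS](big_cat_nat (n := n)) ?leq_addr //= lerDr.
by apply: sumr_ge0.
Qed.

Lemma contract_sum (Z E : nat -> R) (lam B : R) : 0 <= lam < 1 -> (forall m, 0 <= Z m) ->
  (forall m, Z m.+1 <= lam * Z m + E m) -> (forall m0, \sum_(0 <= m < m0) E m <= B) ->
  forall m0, \sum_(0 <= m < m0) Z m <= (Z 0%N + B) / (1 - lam).
Proof.
move=> /andP[l0 l1] Z0 HZ HE; have l1' : 0 < 1 - lam by rewrite subr_gt0.
have B0 : 0 <= B by have := HE 0%N; rewrite big_geq.
elim=> [|m0 IH]; first by rewrite big_geq // divr_ge0 ?(ltW l1') ?addr_ge0.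
rewrite big_nat_recl // ler_pdivlMr //.
move: IH; rewrite ler_pdivlMr // => IH.
have : \sum_(0 <= i < m0) Z i.+1 <= lam * \sum_(0 <= i < m0) Z i + B.
  apply: le_trans (_ : \sum_(0 <= i < m0) (lam * Z i + E i) <= _).
    by apply: ler_sum => i _; exact: HZ.
  by rewrite big_split /= -mulr_sumr lerD2l; exact: HE.
set S1 := \sum_(0 <= i < m0) Z i.+1; set S := \sum_(0 <= i < m0) Z i in IH *.
have S0 : 0 <= S by apply: sumr_ge0.
move=> h; have {}h : S1 * (1 - lam) <= (lam * S + B) * (1 - lam) by rewrite ler_pM2r.
have h2 : lam * (S * (1 - lam)) <= lam * (Z 0%N + B) by rewrite ler_wpM2l.
have -> : (Z 0%N + S1) * (1 - lam) = Z 0%N * (1 - lam) + S1 * (1 - lam) by ring.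
apply: (le_trans (lerD (lexx _) h)).
have -> : Z 0%N * (1 - lam) + (lam * S + B) * (1 - lam) =
  Z 0%N * (1 - lam) + B * (1 - lam) + lam * (S * (1 - lam)) by ring.
apply: (le_trans (lerD (lexx _) h2)).
by rewrite le_eqVlt; apply/orP; left; apply/eqP; ring.
Qed.

(** Either y <= k x or x <= y / k.  The factor of x^q can be taken as close to 1 as
    desired, which keeps the contraction in [grid_refine]. *)
Lemma powRD_split q k x y : 0 < q -> 0 < k -> 0 <= x -> 0 <= y ->
  (x + y) `^ q <= (1 + k) `^ q * x `^ q + (1 + k^-1) `^ q * y `^ q.
Proof.
move=> q0 k0 x0 y0; have kk : 0 <= k^-1 by rewrite invr_ge0 ltW.
have k1 : 0 <= 1 + k by rewrite addr_ge0 // ltW.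
have k2 : 0 <= 1 + k^-1 by rewrite addr_ge0.
have xy : 0 <= x + y by rewrite addr_ge0.
have [yx|xy'] := leP y (k * x).
  apply: (@le_trans _ _ (((1 + k) * x) `^ q)); first by apply: ler_powR2; rewrite ?(ltW q0) //; lra.
  by rewrite powRM // lerDl mulr_ge0 ?powR_ge0.
apply: (@le_trans _ _ (((1 + k^-1) * y) `^ q)).
  apply: ler_powR2; rewrite ?(ltW q0) //.
  have : x <= k^-1 * y by rewrite ler_pdivlMl // ltW.
  lra.
by rewrite powRM // lerDr mulr_ge0 ?powR_ge0.
Qed.

Lemma dyadic_decay p a (B : R) (b : nat -> nat -> R) : 0 < p ->
  (forall n k, 0 <= b n k) ->
  (forall n0, \sum_(0 <= n < n0) (2 ^+ n) `^ (a - 1) * \sum_(0 <= k < 2 ^ n) b n k `^ p <= B) ->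
  forall n k, (k < 2 ^ n)%N -> b n k <= B `^ p^-1 * (2 `^ (- ((a - 1) / p))) ^+ n.
Proof.
move=> p0 b0 HB n k kn.
have pos m : 0 <= (2 ^+ m) `^ (a - 1) * \sum_(0 <= k < 2 ^ m) b m k `^ p.
  by rewrite mulr_ge0 ?powR_ge0 // sumr_ge0 // => i _; rewrite powR_ge0.
have d0 : 0 < (2 ^+ n : R) `^ (a - 1) by rewrite powR_gt0 // exprn_gt0.
have h : (2 ^+ n) `^ (a - 1) * b n k `^ p <= B.
  apply: le_trans (HB n.+1); rewrite big_nat_recr //= -[leLHS]add0r lerD ?sumr_ge0 //.
  rewrite ler_pM2l // (bigD1_seq k) ?mem_index_iota ?iota_uniq //= lerDl.
  by rewrite sumr_ge0 // => i _; rewrite powR_ge0.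
have h' : b n k `^ p <= B / (2 ^+ n) `^ (a - 1) by rewrite ler_pdivlMr // mulrC.
have pi0 : 0 <= p^-1 by rewrite invr_ge0 ltW.
have B0 : 0 <= B by have := HB 0%N; rewrite big_geq.
have := ler_powR2 pi0 (powR_ge0 _ _) h'.
rewrite -powRrM divff ?gt_eqF // powRr1 // powRM ?invr_ge0 ?powR_ge0 // => {}h.
apply: le_trans h _; rewrite ler_wpM2l ?powR_ge0 //.
by rewrite -powRN -powRrM pow2_powR mulNr.
Qed.

Lemma geom_small (C th e : R) : 0 <= th < 1 -> 0 < e -> exists n0, forall n, (n0 <= n)%N ->
  C * th ^+ n < e.
Proof.
move=> /andP[t0 t1] e0.
have := @cvg_geometric R C th ltac:(by rewrite ger0_norm).
move=> /cvgrPdist_lt /(_ _ e0) [n0 _ H]; exists n0 => n /H /=.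
rewrite sub0r normrN; apply: le_lt_trans; exact: ler_norm.
Qed.

End Sums.

Section DyadicGrid.
Context {R : realType}.
Local Notation mu := (@lebesgue_measure R).
Local Notation mu2 := (mu \x mu)%E.

Lemma dyI_half (T : R) n j s : 0 < T -> dyI T n.+1 j s -> dyI T n j./2 s.
Proof.
move=> T0; rewrite /dyI /= !in_itv /= => /andP[h1 h2].
rewrite -(dy_double T n j./2) -(dy_double T n j./2.+1) doubleS.
have jj := odd_double_half j.
apply/andP; split; first by apply: le_trans h1; rewrite ler_dy // -{2}jj leq_addl.
have j2 : (j <= j./2.*2.+1)%N by rewrite -{1}jj -add1n leq_add2r; case: (odd j).
by apply: lt_le_trans h2 _; rewrite ler_dy.
Qed.

(** The jumps are step functions on the dyadic intervals. *)
Lemma dyadic_sobolev_grid (rho : R -> R -> R) (T p a B : R) (bt : nat -> nat -> R)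
    (ka : nat -> R -> nat) : 1 <= p -> 0 < a -> 0 < T -> pmetric rho ->
  (forall m k, 0 <= bt m k) ->
  (forall n0, \sum_(0 <= n < n0) (2 ^+ n) `^ (a - 1) *
     \sum_(0 <= k < (2 ^ n).+1) bt n k `^ p <= B) ->
  (forall m s, 0 <= s <= T -> dyI T m (ka m s) s) ->
  (forall s t n e, 0 <= s <= T -> 0 <= t <= T -> `|t - s| <= T / 2 ^+ n -> 0 < e ->
     exists M, rho s t <= e + \sum_(n <= m < M) (bt m (ka m s) + bt m (ka m t))) ->
  (\int[mu2]_(z in `[0%R, T] `*` `[0%R, T]) (density rho p (a + 1) z)%:E < +oo)%E.
Proof.
move=> p1 a0 T0 pm bt0 HB Hka Hch; have p0 : 0 < p by exact: lt_le_trans p1.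
pose b m s := \sum_(0 <= k < (2 ^ m).+1) bt m k * \1_(dyI T m k) s.
have bE (F : nat -> R) m s : 0 <= s <= T ->
    \sum_(0 <= k < (2 ^ m).+1) F k * \1_(dyI T m k) s = F (ka m s).
  move=> sT; have hs := Hka m s sT.
  have kr : (ka m s < (2 ^ m).+1)%N by rewrite ltnS; case/andP: sT => _; exact: dyI_range T0 hs.
  rewrite (bigD1_seq (ka m s)) ?mem_index_iota ?iota_uniq //= indicE mem_set // mulr1.
  rewrite big1 ?addr0 // => k kk; rewrite indicE memNset ?mulr0 // => hk.
  by move/eqP: kk; apply; exact: dyI_uniq T0 hk hs.
have mI : measurable (`[0, T]%classic : set R) by exact: measurable_itv.
apply: (@dyadic_sobolev R rho T p a b (T * B)) => //.
- move=> m; apply: measurable_sum => k; apply: measurable_funM => //.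
  by apply: measurable_indic; exact: measurable_dyI.
- by move=> m s; apply: sumr_ge0 => k _; rewrite mulr_ge0 // indicE ler0n.
- move=> m0; apply: (@le_trans _ _ (\sum_(0 <= m < m0) (T * ((2 ^+ m) `^ (a - 1) *
     \sum_(0 <= k < (2 ^ m).+1) bt m k `^ p))%:E)%E); last first.
    by rewrite sumEFin lee_fin -mulr_sumr ler_wpM2l // ltW.
  apply: lee_sum => m _.
  have -> : (\int[mu]_(s in `[0%R, T]) (b m s `^ p)%:E = \sum_(0 <= k < (2 ^ m).+1)
      (bt m k `^ p)%:E * \int[mu]_(s in `[0%R, T]) (\1_(dyI T m k) s)%:E)%E.
    under [RHS]eq_bigr => k _.
      rewrite -ge0_integralZl_EFin //; last 2 first.
      - apply/measurable_EFinP; apply: measurable_funTS; apply: measurable_indic.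
        exact: measurable_dyI.
      - exact: powR_ge0.
      over.
    rewrite -ge0_integral_sum //; last 2 first.
    - move=> k; apply/measurable_EFinP; apply: measurable_funTS; apply: measurable_funM => //.
      by apply: measurable_indic; exact: measurable_dyI.
    - by move=> k s _; rewrite -EFinM lee_fin mulr_ge0 ?powR_ge0 // indicE ler0n.
    apply: eq_integral => s; rewrite inE /= in_itv /= => sT.
    by rewrite sumEFin (bE (fun k => bt m k `^ p) m s sT) /b (bE (bt m) m s sT).
  apply: (@le_trans _ _ (((2 ^+ m) `^ a)%:E * \sum_(0 <= k < (2 ^ m).+1)
      (bt m k `^ p)%:E * (T / 2 ^+ m)%:E)%E).
    apply: lee_wpmul2l; first by rewrite lee_fin powR_ge0.
    apply: lee_sum => k _; apply: lee_wpmul2l; first by rewrite lee_fin powR_ge0.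
    rewrite integral_indic //; last exact: measurable_dyI.
    apply: (@le_trans _ _ (mu (dyI T m k))).
      by apply: le_measure; rewrite ?inE //; [apply: measurableI => //|]; exact: measurable_dyI.
    by rewrite lebesgue_measure_itv /= lte_fin dy_ltS // -EFinB dyS.
  under eq_bigr do rewrite -EFinM.
  rewrite sumEFin -EFinM lee_fin -mulr_suml.
  have q0 : 0 < (2 ^+ m : R) by rewrite exprn_gt0.
  have -> : (2 ^+ m) `^ a = (2 ^+ m) `^ (a - 1) * 2 ^+ m :> R.
    rewrite -[X in _ * X]powRr1 ?(ltW q0) // -powRD ?subrK //.
    by apply/implyP => _; rewrite gt_eqF.
  rewrite le_eqVlt; apply/orP; left; apply/eqP; field; exact: lt0r_neq0.
- move=> s t n e; rewrite !in_itv /= => sT tT st e0.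
  have [M HM] := Hch s t n e sT tT st e0; exists M; apply: le_trans HM _.
  rewrite lerD2l; apply: ler_sum => m _.
  by rewrite /b (bE (bt m) m s sT) (bE (bt m) m t tT).
Qed.

End DyadicGrid.

Section Lift.
Context {R : realType} {d N : nat}.
Local Notation A := (tensor R d N).
Local Notation G := (@Ggroup R d N).
Local Notation nm := (@level_norm R d N N).
Local Notation qd := (@quotient_dist R d N).
Local Notation mu := (@lebesgue_measure R).
Local Notation mu2 := (mu \x mu)%E.
Variables (K : set A) (T alpha p : R) (X : R -> set A).
Hypotheses (N0 : (0 < N)%N) (HK : closed_subgroup (expW N) K).
Hypotheses (T0 : 0 < T) (p1 : 1 < p) (a1 : 1 < alpha * p).
Hypothesis SX : sobolev qd (quotient K) T alpha p X.
Local Notation a := (alpha * p).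
Local Notation cl := (clamp T).
Local Notation logK := (logK K).

Let T0' : 0 <= T. Proof. exact: ltW. Qed.
Let p0 : 0 < p. Proof. exact: lt_trans p1. Qed.

Lemma pointwise_section : exists g : R -> A, forall t, G (g t) /\ coset K (g t) = X (cl t).
Proof.
have [SX1 _ _] := SX.
have H t : exists g, G g /\ coset K g = X (cl t).
  have := SX1 (cl t); rewrite in_itv /= clampP // => /(_ isT) [g Gg gX].
  by exists g.
by have [g Hg] := choice H; exists g.
Qed.

Definition base_dist s t := qd (X (cl s)) (X (cl t)).

Lemma base_dist_pmetric : pmetric base_dist.
Proof.
have [g Hg] := pointwise_section; have [_ SX2 _] := SX.
apply: (@pmetric_clamp R T (fun s t => qd (X s) (X t))) => //.
- move=> s t sT tT; have [G1 E1] := Hg s; have [G2 E2] := Hg t.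
  by rewrite -(clamp_id sT) -(clamp_id tT) -E1 -E2 (qd_ge0 N0 HK).
- move=> s t sT tT; have [G1 E1] := Hg s; have [G2 E2] := Hg t.
  by rewrite -(clamp_id sT) -(clamp_id tT) -E1 -E2 (qd_sym N0 HK).
- move=> s t u sT tT uT; have [G1 E1] := Hg s; have [G2 E2] := Hg t.
  have [G3 E3] := Hg u; rewrite -(clamp_id sT) -(clamp_id tT) -(clamp_id uT) -E1 -E2 -E3.
  exact: (qd_tri N0 HK).
- by move=> t tT; have [G1 E1] := Hg t; rewrite -(clamp_id tT) -E1 (qdxx N0 HK).
Qed.

Lemma base_dist_integral :
  (\int[mu2]_(z in `[0%R, T] `*` `[0%R, T]) (density base_dist p (a + 1) z)%:E < +oo)%E.
Proof.
have [_ _ SX3] := SX; apply: le_lt_trans SX3; rewrite le_eqVlt; apply/orP; left.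
apply/eqP; apply: eq_integral => -[s t]; rewrite inE /= !in_itv /= => -[sT tT].
by rewrite /density /base_dist /= !clamp_id.
Qed.

(** The second term leaves room for choices in a coset that are only nearly
    optimal.  It satisfies the same summability as the first because p > 1. *)
Definition base_step n k := base_dist (dy T n k) (dy T n k.+1) + ((2 ^+ n) `^ a)^-1.

Lemma base_step_gt n k : base_dist (dy T n k) (dy T n k.+1) < base_step n k.
Proof. by rewrite /base_step ltrDl invr_gt0 powR_gt0 // exprn_gt0. Qed.

Lemma base_step_ge0 n k : 0 <= base_step n k.
Proof. apply/ltW/(le_lt_trans _ (base_step_gt n k)); exact: pm_ge0 base_dist_pmetric _ _. Qed.

Lemma base_step_sum : exists2 B : R, 0 <= B & forall n0,
  \sum_(0 <= n < n0) (2 ^+ n) `^ (a - 1) * \sum_(0 <= k < 2 ^ n) base_step n k `^ p <= B.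
Proof.
have [B B0 HB] := sobolev_dyadic (ltW p1) a1 T0 base_dist_pmetric base_dist_integral.
set th : R := 2 `^ (a * (1 - p)).
have th1 : 0 <= th < 1.
  rewrite powR_ge0 /= /th -[a * _]opprK powRN invf_lt1 ?powR_gt0 //; apply: gt1_powR.
  rewrite -mulrN opprB mulr_gt0 ?subr_gt0 //; exact: lt_trans a1.
have th2 : 0 < 1 - th by case/andP: th1; rewrite subr_gt0.
exists (2 `^ p * (B + (1 - th)^-1)) => [|n0].
  by rewrite mulr_ge0 ?powR_ge0 // addr_ge0 // invr_ge0 ltW.
apply: (@le_trans _ _ (2 `^ p * (\sum_(0 <= n < n0) (2 ^+ n) `^ (a - 1) *
   \sum_(0 <= k < 2 ^ n) base_dist (dy T n k) (dy T n k.+1) `^ p + \sum_(0 <= n < n0) th ^+ n)));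
       last first.
  by rewrite ler_wpM2l ?powR_ge0 // lerD // geom_le.
rewrite -big_split /= mulr_sumr; apply: ler_sum => n _.
set e := ((2 ^+ n) `^ a)^-1; have e0 : 0 <= e by rewrite invr_ge0 powR_ge0.
have -> : th ^+ n = (2 ^+ n) `^ (a - 1) * \sum_(0 <= k < 2 ^ n) e `^ p.
  rewrite sumr_const_nat subn0 -[X in _ * X]mulr_natl natrX mulrA.
  have q0 : 0 < (2 ^+ n : R) by rewrite exprn_gt0.
  rewrite -[X in _ * X * _]powRr1 ?(ltW q0) // -powRD; last by apply/implyP => _; rewrite gt_eqF.
  rewrite subrK /e -powRN -powRrM -powRD; last by apply/implyP => _; rewrite gt_eqF.
  by rewrite /th -pow2_powR; congr (_ `^ _); ring.
rewrite -mulrDr mulrCA ler_wpM2l ?powR_ge0 // -big_split /= mulr_sumr; apply: ler_sum => k _.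
by rewrite /base_step; apply: powRD_le => //; [exact: ltW|exact: pm_ge0 base_dist_pmetric _ _].
Qed.

Let B1 : R := \sum_(w : N.-bseq 'I_d | size w == N) 1.
Let B10 : 0 <= B1. Proof. by rewrite /B1 sumr_ge0. Qed.

(** One walks along the grid and takes each new point at nearly minimal distance
    from the last one. *)
Lemma grid_start n : exists S : nat -> A, forall k,
  [/\ G (S k), coset K (S k) = X (cl (dy T n k)) &
      nm (tinv (S k) * S k.+1) <= B1 * base_step n k ^+ N].
Proof.
have [g Hg] := pointwise_section.
have next (xk : A * nat) : exists z, G xk.1 -> coset K xk.1 = X (cl (dy T n xk.2)) ->
   [/\ G z, coset K z = X (cl (dy T n xk.2.+1)) & cc_norm (tinv xk.1 * z) <= base_step n xk.2].
  case: xk => x k /=; have [Gx|] := pselect (G x); last by exists 0.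
  have [xX|] := pselect (coset K x = X (cl (dy T n k))); last by exists 0.
  have [Gu uX] := Hg (dy T n k.+1); set u := g _ in Gu uX.
  have e0 : 0 < ((2 ^+ n : R) `^ a)^-1 by rewrite invr_gt0 powR_gt0 // exprn_gt0.
  have [w Lw hw] := qd_approx N0 HK Gx Gu e0.
  exists (u + w) => _ _; split; first exact: (G_addr N0 Gu Lw).
    by rewrite (coset_eq N0 HK) ?uX //; exact: G_coef0.
  rewrite (lev_inc _ (G_coef0 Gx) (logK_van N0 Lw)).
  by move: hw; rewrite xX uX.
have [nx Hnx] := choice next.
pose S := fix S k := if k is k'.+1 then nx (S k', k') else g (dy T n 0).
have HS k : G (S k) /\ coset K (S k) = X (cl (dy T n k)).
  elim: k => [|k [IH1 IH2]] /=; first exact: Hg.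
  by have [] := Hnx (S k, k) IH1 IH2.
exists S => k; have [G1 C1] := HS k; split=> //.
have [G2 _ h] := Hnx (S k, k) G1 C1; rewrite /= -/S in G2 h.
apply: le_trans (level_norm_cc _ (G_inc G1 G2)) _; rewrite ler_wpM2l //.
by rewrite lerXn2r ?nnegrE ?cc_norm_ge0 ?base_step_ge0.
Qed.

Hypothesis aN : alpha * N%:R < 1.
Local Notation q := (p / N%:R).

Let Nr0 : 0 < (N%:R : R). Proof. by rewrite ltr0n. Qed.
Let aq : a < q.
Proof. by rewrite ltr_pdivlMr // mulrAC -[ltRHS]mul1r ltr_pM2r. Qed.
Let q1 : 1 < q. Proof. exact: lt_trans aq. Qed.

(** Going from scale m to scale m.+1, [midpoint] divides q-th powers of level-N
    increments by 2^q, whereas their number and the weight grow by 2^a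
    altogether.  As a < q the sums Z m contract, with an error of N q = p-th
    powers of distances in the quotient.  At the start level all increments are
    small enough for [midpoint] to apply, and they remain so. *)
Lemma grid_refine : exists n0 (S : nat -> nat -> A) (C B : R), [/\ 0 <= C,
  forall m k, G (S m k) /\ coset K (S m k) = X (cl (dy T (n0 + m) k)),
  forall m k, S m.+1 k.*2 = S m k &
  forall m0, \sum_(0 <= m < m0) (2 ^+ (n0 + m)) `^ (a - 1) *
     \sum_(0 <= k < 2 ^ (n0 + m)) nm (tinv (S m k) * S m k.+1) `^ q <= B].
Proof.
have [C C0 [eps eps0 HC]] := midpoint N0 HK.
have [B B0 HB] := base_step_sum; have [g Hg] := pointwise_section.
have dec := dyadic_decay p0 base_step_ge0 HB.
set th : R := 2 `^ (- ((a - 1) / p)) in dec.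
have th1 : 0 <= th < 1.
  rewrite powR_ge0 /= /th powRN invf_lt1 ?powR_gt0 //; apply: gt1_powR.
  by rewrite divr_gt0 // subr_gt0.
pose M := B1 + C + 1.
have CM : C <= M by rewrite /M; move: B10; lra.
have BM : B1 <= M by rewrite /M; lra.
have M0 : 0 < M by rewrite ltr_wpDl // addr_ge0.
(* if the steps in the quotient are at most eta, both the increments of the
   start grid and all later errors r are at most eps / 4 *)
pose eta : R := Num.min 1 (eps / 4 / M / 2 ^+ N).
have eta0 : 0 < eta by rewrite lt_min ltr01 !divr_gt0 ?exprn_gt0.
have [n0 Hn0] := geom_small (B `^ p^-1) th1 eta0.
have dsmall n k : (n0 <= n)%N -> (k < 2 ^ n)%N -> base_step n k <= eta.
  by move=> nn kn; apply: le_trans (dec n k kn) _; apply/ltW/Hn0.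
have etaN (x : R) : 0 <= x -> x <= 2 * eta -> M * x ^+ N <= eps / 4.
  move=> x0 xe; apply: (@le_trans _ _ (M * (2 * eta) ^+ N)).
    rewrite ler_wpM2l ?(ltW M0) // lerXn2r ?nnegrE //; lra.
  have e1 : eta <= 1 by rewrite ge_min lexx.
  have e2 : eta <= eps / 4 / M / 2 ^+ N by rewrite ge_min lexx orbT.
  have e3 : eta ^+ N <= eta.
    by rewrite -[leRHS]expr1; apply: ler_wiXn2l => //; exact: ltW.
  rewrite exprMn -ler_pdivlMl // mulrC -ler_pdivlMr ?exprn_gt0 //.
  by apply: le_trans e3 _; rewrite [_^-1 * _]mulrC.
pose n' m := (n0 + m).+1.
pose r m k := C * (base_step (n' m) k.*2 + base_step (n' m) k.*2.+1) ^+ N.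
pose Inv m (S : nat -> A) := forall k, G (S k) /\ coset K (S k) = X (cl (dy T (n0 + m) k)).
pose z (S : nat -> A) k := nm (tinv (S k) * S k.+1).
have next (mS : nat * (nat -> A)) : exists S', Inv mS.1 mS.2 ->
    [/\ Inv mS.1.+1 S', forall k, S' k.*2 = mS.2 k &
     forall k, z mS.2 k + r mS.1 k < eps ->
       z S' k.*2 <= z mS.2 k / 2 + r mS.1 k /\ z S' k.*2.+1 <= z mS.2 k / 2 + r mS.1 k].
  case: mS => m S /=; have [IS|nI] := pselect (Inv m S); last by exists S.
  have mid k : exists v, [/\ G v, coset K v = X (cl (dy T (n' m) k.*2.+1)) &
      z S k + r m k < eps -> nm (tinv (S k) * v) <= z S k / 2 + r m k /\
         nm (tinv v * S k.+1) <= z S k / 2 + r m k].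
    have [G1 E1] := IS k; have [G2 E2] := IS k.+1.
    have [Gu Eu] := Hg (dy T (n' m) k.*2.+1).
    have := HC (S k) (S k.+1) (g (dy T (n' m) k.*2.+1)) (base_step (n' m) k.*2) (base_step (n' m)
        k.*2.+1) G1 G2 Gu.
    rewrite E1 E2 Eu -(dy_double T (n0 + m) k) -(dy_double T (n0 + m) k.+1) doubleS.
    by apply; exact: base_step_gt.
  have [v Hv] := choice mid.
  exists (fun j => if odd j then v j./2 else S j./2) => _.
  have o2 k : odd k.*2 = false by rewrite odd_double.
  split.
  - move=> j; rewrite addnS -/(n' m); case oj : (odd j).
      have [Gv Ev _] := Hv j./2; split=> //; rewrite Ev; congr (X (cl (dy T _ _))).
      by rewrite -[in RHS](odd_double_half j) oj.
    have [Gs Es] := IS j./2; split=> //; rewrite Es -dy_double; congr (X (cl (dy T _ _))).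
    by rewrite -[in RHS](odd_double_half j) oj.
  - by move=> k; rewrite o2 doubleK.
  - move=> k; have [_ _ H] := Hv k => /H [h1 h2]; split; rewrite /z.
      by rewrite o2 /= o2 /= uphalf_double doubleK.
    by rewrite /= o2 /= uphalf_double doubleK.
have [nx Hnx] := choice next.
have [S0 HS0] := grid_start n0.
pose S := fix S m := if m is m'.+1 then nx (m', S m') else S0.
have IS m : Inv m (S m).
  elim: m => [|m IH]; first by move=> k; rewrite addn0; have [] := HS0 k.
  by have [] := Hnx (m, S m) IH.
have step m := Hnx (m, S m) (IS m).
pose D n := (2 ^+ n) `^ (a - 1) * \sum_(0 <= k < 2 ^ n) base_step n k `^ p.
have D0 n : 0 <= D n by rewrite mulr_ge0 ?powR_ge0 // sumr_ge0 // => k _; rewrite powR_ge0.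
have z0 m k : 0 <= z (S m) k by exact: level_norm_ge0.
have r0 m k : 0 <= r m k by rewrite mulr_ge0 // exprn_ge0 // addr_ge0 // base_step_ge0.
have rsmall m k : (k < 2 ^ (n0 + m))%N -> r m k <= eps / 4.
  move=> km; have d1 := base_step_ge0 (n' m) k.*2; have d2 := base_step_ge0 (n' m) k.*2.+1.
  have e1 : base_step (n' m) k.*2 <= eta.
    by apply: dsmall; rewrite ?expnS ?mul2n ?ltn_double // /n' -addnS leq_addr.
  have e2 : base_step (n' m) k.*2.+1 <= eta.
    by apply: dsmall; rewrite ?expnS ?mul2n ?ltn_Sdouble // /n' -addnS leq_addr.
  have dd : 0 <= base_step (n' m) k.*2 + base_step (n' m) k.*2.+1 by rewrite addr_ge0.
  apply: le_trans (etaN _ dd _); last by lra.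
  by rewrite /r ler_wpM2r // exprn_ge0.
have zsmall m k : (k < 2 ^ (n0 + m))%N -> z (S m) k <= eps / 2.
  elim: m k => [|m IH] k km.
    have [_ _ h] := HS0 k; rewrite /z /=; apply: le_trans h _.
    have d1 := base_step_ge0 n0 k; rewrite addn0 in km.
    have e1 : base_step n0 k <= eta by exact: dsmall.
    apply: (@le_trans _ _ (eps / 4)); last lra.
    apply: le_trans (etaN _ d1 _); last lra.
    by rewrite ler_wpM2r // exprn_ge0.
  have k2 : (k./2 < 2 ^ (n0 + m))%N.
    rewrite -ltn_double; apply: leq_ltn_trans (_ : (k < (2 ^ (n0 + m)).*2)%N).
      by rewrite -{2}(odd_double_half k) leq_addl.
    by rewrite -mul2n -expnS -addnS.
  have := IH _ k2; have := rsmall m _ k2; set k' := k./2 => h1 h2.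
  have [_ _ H] := step m; have [] := H k' _ => /=; first lra.
  have := odd_double_half k; rewrite -/k'; case: (odd k) => /= <- h3 h4; lra.
have q0 : 0 < q by exact: lt_trans q1.
(* (1 + kp)^q = 2^((q - a) / 2) gives away half of the gain 2^(q - a) *)
pose kp : R := 2 `^ ((q - a) / (2 * q)) - 1.
have kp0 : 0 < kp by rewrite subr_gt0; apply: gt1_powR; rewrite divr_gt0 ?subr_gt0 // mulr_gt0.
pose lam : R := 2 `^ (- ((q - a) / 2)).
have lam1 : 0 <= lam < 1.
  by rewrite powR_ge0 /= /lam powRN invf_lt1 ?powR_gt0 //; apply: gt1_powR; rewrite divr_gt0 ?subr_gt0.
pose Z m := (2 ^+ (n0 + m)) `^ (a - 1) * \sum_(0 <= k < 2 ^ (n0 + m)) z (S m) k `^ q.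
have Z0 m : 0 <= Z m by rewrite mulr_ge0 ?powR_ge0 // sumr_ge0 // => k _; rewrite powR_ge0.
pose C2 : R := 2 * (1 + kp^-1) `^ q * C `^ q * 2 `^ p.
have C20 : 0 <= C2 by rewrite /C2 !mulr_ge0 ?powR_ge0.
have ZS m : Z m.+1 <= lam * Z m + C2 * D (n' m).
  have e2 : 2 ^+ (n0 + m.+1) = 2 * 2 ^+ (n0 + m) :> R by rewrite addnS exprS.
  have c0 : 0 <= (2 ^+ (n0 + m.+1) : R) `^ (a - 1) by exact: powR_ge0.
  have q00 : 0 <= q := ltW q0.
  have r_q k : r m k `^ q <= C `^ q * (2 `^ p * (base_step (n' m) k.*2 `^ p + base_step (n' m)
      k.*2.+1 `^ p)).
    have dd : 0 <= base_step (n' m) k.*2 + base_step (n' m) k.*2.+1 by rewrite addr_ge0 // base_step_ge0.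
    rewrite /r powRM ?exprn_ge0 // ler_wpM2l ?powR_ge0 //.
    rewrite -powR_mulrn // -powRrM mulrCA divff ?mulr1; last by rewrite gt_eqF.
    by apply: powRD_le; rewrite ?base_step_ge0 // ltW.
  have half x : 0 <= x -> (x / 2) `^ q = 2 `^ (- q) * x `^ q.
    by move=> x0; rewrite powRM ?invr_ge0 // -[2^-1]powR_inv1 // -powRrM mulN1r mulrC.
  have each k : (k < 2 ^ (n0 + m))%N ->
     z (S m.+1) k.*2 `^ q + z (S m.+1) k.*2.+1 `^ q <=
     2 * ((1 + kp) `^ q * (2 `^ (- q) * z (S m) k `^ q)) +
     C2 * (base_step (n' m) k.*2 `^ p + base_step (n' m) k.*2.+1 `^ p).
    move=> km; have h1 := zsmall _ _ km; have h2 := rsmall _ _ km.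
    have [_ _ H] := step m; have [|b1 b2] := H k _ => /=; first lra.
    rewrite /= -/(S m) -/(r m k) in b1 b2.
    have zz := z0 m k; have zz2 : 0 <= z (S m) k / 2 by rewrite divr_ge0.
    have BB := powRD_split q0 kp0 zz2 (r0 m k).
    have b1' := le_trans (ler_powR2 q00 (z0 m.+1 _) b1) BB.
    have b2' := le_trans (ler_powR2 q00 (z0 m.+1 _) b2) BB.
    apply: le_trans (lerD b1' b2') _; rewrite half // /C2.
    have := ler_wpM2l (powR_ge0 (1 + kp^-1) q) (r_q k); set u := _ `^ q * r m k `^ q.
    set v := (1 + kp) `^ q * _; set w' := base_step _ _ `^ p + _ => hu.
    have -> : 2 * (1 + kp^-1) `^ q * C `^ q * 2 `^ p * w' =
      2 * ((1 + kp^-1) `^ q * (C `^ q * (2 `^ p * w'))) by ring.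
    have -> : v + u + (v + u) = 2 * v + 2 * u by ring.
    by rewrite lerD2l ler_pM2l.
  rewrite /Z /D /n' -addnS [X in (2 ^ X)%N]addnS expnS mul2n sum_double.
  rewrite sum_double.
  apply: (@le_trans _ _ ((2 ^+ (n0 + m.+1)) `^ (a - 1) * \sum_(0 <= k < 2 ^ (n0 + m))
     (2 * ((1 + kp) `^ q * (2 `^ (- q) * z (S m) k `^ q)) +
     C2 * (base_step (n' m) k.*2 `^ p + base_step (n' m) k.*2.+1 `^ p)))).
    rewrite ler_wpM2l // big_nat_cond [leRHS]big_nat_cond; apply: ler_sum => k /andP[/andP[_ km] _].
    exact: each.
  rewrite big_split /= -!mulr_sumr mulrDr /n' -addnS [C2 * (_ * _)]mulrCA lerD2r e2.
  rewrite powRM ?exprn_ge0 //.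
  have lamE : lam = 2 `^ (a - 1) * (2 * ((1 + kp) `^ q * 2 `^ (- q))).
    rewrite /kp subrKC -powRrM -{2}[2]powRr1 //.
    rewrite -!powRD; try by apply/implyP => _; rewrite gt_eqF.
    have hq x : x != 0 -> (x - a) / (2 * x) * x = (x - a) / 2 by move=> x0; field.
    rewrite hq ?gt_eqF //.
    by rewrite /lam; congr (_ `^ _); move: (q) => x; field.
  by rewrite lamE le_eqVlt; apply/orP; left; apply/eqP; ring.
have SE m0 : \sum_(0 <= m < m0) C2 * D (n' m) <= C2 * B.
  rewrite -mulr_sumr; apply: ler_wpM2l; first exact: C20.
  have HB' k : \sum_(0 <= n < k) D n <= B by exact: HB.
  apply: le_trans (HB' (n0.+1 + m0)%N); move: (D) D0 => D' D'0.
  have DE i : D' (n0.+1 + i)%N = D' (n' i) by rewrite addSn.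
  have := @sum_tail_le R D' n0.+1 m0 D'0.
  by rewrite (eq_bigr _ (fun i _ => DE i)).
have SZ := @contract_sum R Z (fun m => C2 * D (n' m)) lam (C2 * B) lam1 Z0 ZS SE.
exists n0, S, C, ((Z 0%N + C2 * B) / (1 - lam)); split; first exact: C0.
- exact: IS.
- by move=> m k; have [_ H _] := step m; exact: H.
- exact: SZ.
Qed.

(** Below the start level of [grid_refine] the points are read off from the finer
    grid.  [cc_dist_fibre] turns distances in the quotient and level-N
    increments into distances in the group. *)
Lemma dyadic_lift : exists (Y : nat -> nat -> A) (B : R), [/\
  forall n k, G (Y n k) /\ coset K (Y n k) = X (cl (dy T n k)),
  forall n k, Y n.+1 k.*2 = Y n k &
  forall n0, \sum_(0 <= n < n0) (2 ^+ n) `^ (a - 1) *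
     \sum_(0 <= k < 2 ^ n) cc_dist (Y n k) (Y n k.+1) `^ p <= B].
Proof.
have [n0 [S [_ [B [_ S1 S2 S3]]]]] := grid_refine.
have [BX BX0 HBX] := sobolev_dyadic (ltW p1) a1 T0 base_dist_pmetric base_dist_integral.
have [C C0 HC] := cc_dist_fibre N0 HK.
pose Y n k := if (n < n0)%N then S 0%N (k * 2 ^ (n0 - n))%N else S (n - n0)%N k.
have YX n k : G (Y n k) /\ coset K (Y n k) = X (cl (dy T n k)).
  rewrite /Y; case: ltnP => nn; last by have := S1 (n - n0)%N k; rewrite subnKC.
  have [h1 h2] := S1 0%N (k * 2 ^ (n0 - n))%N; split=> //; rewrite h2 addn0; congr (X (cl _)).
  rewrite /dy natrM natrX -{2}(subnKC (ltnW nn)) exprD.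
  by field; rewrite !expf_neq0.
pose F n := (2 ^+ n) `^ (a - 1) * \sum_(0 <= k < 2 ^ n) cc_dist (Y n k) (Y n k.+1) `^ p.
have F0 n : 0 <= F n by rewrite mulr_ge0 ?powR_ge0 // sumr_ge0 // => k _; rewrite powR_ge0.
pose C1 := C `^ p * 2 `^ p; have C10 : 0 <= C1 by rewrite mulr_ge0 ?powR_ge0.
pose U n := (2 ^+ n) `^ (a - 1) * \sum_(0 <= k < 2 ^ n) base_dist (dy T n k) (dy T n k.+1) `^ p.
pose V m := (2 ^+ (n0 + m)) `^ (a - 1) *
     \sum_(0 <= k < 2 ^ (n0 + m)) nm (tinv (S m k) * S m k.+1) `^ q.
have FS m : F (n0 + m)%N <= C1 * (U (n0 + m)%N + V m).
  have YE k : Y (n0 + m)%N k = S m k by rewrite /Y ltnNge leq_addr addKn.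
  rewrite /F /U /V -mulrDr mulrCA ler_wpM2l ?powR_ge0 // -big_split /= mulr_sumr.
  apply: ler_sum => k _; rewrite !YE.
  have [G1 E1] := S1 m k; have [G2 E2] := S1 m k.+1.
  have := HC _ _ G1 G2; rewrite E1 E2 -/(base_dist _ _); set u := nm _.
  set x := base_dist _ _ => h.
  have x0 : 0 <= x by exact: pm_ge0 base_dist_pmetric _ _.
  have u0 : 0 <= u by exact: level_norm_ge0.
  apply: le_trans (ler_powR2 (ltW p0) (cc_norm_ge0 _) h) _.
  rewrite powRM ?addr_ge0 ?powR_ge0 // /C1 -mulrA ler_wpM2l ?powR_ge0 //.
  apply: le_trans (powRD_le (ltW p0) x0 (powR_ge0 _ _)) _.
  by rewrite -powRrM [_^-1 * p]mulrC.
exists Y, (\sum_(0 <= n < n0) F n + C1 * (BX + B)); split=> //.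
  move=> n k; rewrite /Y; have [nn|nn] := ltnP n n0; last first.
    by rewrite ltnNge (leqW nn) /= subSn // S2.
  case: ltnP => nn'; first by rewrite -(subnSK nn) expnS mulnA muln2.
  have -> : n0 = n.+1 by apply/eqP; rewrite eqn_leq nn nn'.
  by rewrite subnn subSnn muln2.
move=> m0; apply: (@le_trans _ _ (\sum_(0 <= n < n0 + m0) F n)).
  by rewrite [leRHS](big_cat_nat (n := m0)) ?leq_addl //= lerDl sumr_ge0.
rewrite (big_cat_nat (n := n0)) ?leq_addr //= lerD2l.
rewrite sum_shift.
apply: (@le_trans _ _ (\sum_(0 <= m < m0) C1 * (U (n0 + m)%N + V m))).
  by apply: ler_sum => m _; exact: FS.
rewrite -mulr_sumr ler_wpM2l // big_split /= lerD //.
apply: le_trans (HBX (n0 + m0)%N); apply: (@sum_tail_le R U n0 m0) => n.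
by rewrite mulr_ge0 ?powR_ge0 // sumr_ge0 // => k _; rewrite powR_ge0.
Qed.
End Lift.

(** * From dyadic times to all times *)

Lemma walk_arith (R : realFieldType) (x0 x1 x2 x3 u1 u2 u3 u4 u5 e s1 s2 b1 b2 : R) :
  x0 <= u1 + x1 -> x1 <= u2 + x2 -> x2 <= u3 + x3 -> x3 <= u4 + u5 ->
  u1 <= e / 2 -> u2 <= s1 -> u3 <= b1 + b2 -> u4 <= s2 -> u5 <= e / 2 ->
  x0 <= e + (b1 + b2 + (s1 + s2)).
Proof. by lra. Qed.

Section Extend.
Context {R : realType} {d N : nat}.
Local Notation A := (tensor R d N).
Local Notation Wd := (@W R d N).
Local Notation G := (@Ggroup R d N).
Local Notation nm := (@level_norm R d N N).
Local Notation qd := (@quotient_dist R d N).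
Hypothesis N0 : (0 < N)%N.

Lemma level_norm_top1D (v : A) : nm (1 + v) = nm v.
Proof.
apply: level_norm_lev; rewrite linearD /= [lev N 1](_ : _ = 0) ?add0r //.
apply: tensorP => s sN; rewrite tcoef0 tcoef_lev //; case: eqP => // sz.
by rewrite [tcoef 1 s](tcoef_one sN); case: s sz sN => //= sz; move: N0; rewrite -sz.
Qed.

Lemma inc_fibre (g w w' : A) : tcoef g [::] = 1 -> vanish N w -> vanish N w' ->
  tinv (g + w) * (g + w') = 1 + (w' - w).
Proof. by move=> g1 vw vw'; rewrite inc_shift // tmulVl. Qed.

Lemma cc_top : exists2 C : R, 0 <= C & forall w, w \in Wd N ->
  cc_norm (1 + w) <= C * nm w `^ N%:R^-1.
Proof.
have [C C0 HC] := @reach_top R d N N0.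
by exists C => // w /HC/cc_norm_le.
Qed.

(** A cluster point of a Cauchy sequence is its limit. *)
Lemma tensor_complete (w : nat -> A) : (forall n, lev N (w n) = w n) ->
  (forall e : R, 0 < e -> exists M, forall n m, (M <= n)%N -> (M <= m)%N -> nm (w n - w m) < e) ->
  exists2 x, lev N x = x & forall e : R, 0 < e -> exists M, forall n, (M <= n)%N -> nm (x - w n) < e.
Proof.
move=> wN cw; have [M1 HM1] := cw 1 ltr01.
pose L := nm (w M1) + 1.
have L0 : 0 < L by rewrite ltr_wpDl // level_norm_ge0.
have bd n : (M1 <= n)%N -> nm (w n) <= L.
  move=> Mn; rewrite -(subrK (w M1) (w n)); apply: le_trans (level_normD _ _ _) _.
  by rewrite /L addrC lerD2l ltW // HM1.
pose e n := L^-1 *: w (M1 + n)%N.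
have e1 n s : (size s <= N)%N -> `|tcoef (e n) s| <= 1.
  move=> sN; rewrite /e tcoefZ normrM ger0_norm ?invr_ge0 ?(ltW L0) // ler_pdivrMl // mulr1.
  rewrite -wN tcoef_lev //; case: eqP => [sz|_]; last by rewrite normr0 ltW.
  apply: le_trans (bd (M1 + n)%N (leq_addr _ _)).
  by have := @level_norm_coord _ _ _ (w (M1 + n)%N) s sN; rewrite sz.
have [x0 Hx0] := tensor_cluster e1.
exists (L *: lev N x0); first by rewrite linearZ /= lev_levN.
move=> eps eps0; have eps2 : 0 < eps / 2 by exact: divr_gt0.
have [M HM] := cw _ eps2; exists M => n Mn.
pose B : R := \sum_(w : N.-bseq 'I_d | size w == N) 1.
have B0 : 0 < B + 1 by rewrite ltr_wpDl // /B sumr_ge0.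
have e20 : 0 < eps / 2 / L / (B + 1) by rewrite !divr_gt0.
have [m Mm hm] := Hx0 _ M e20.
have h1 : nm (w (M1 + m)%N - w n) < eps / 2.
  by apply: HM => //; apply: leq_trans Mm (leq_addl _ _).
have h2 : nm (e m - lev N x0) <= B * (eps / 2 / L / (B + 1)).
  apply: level_norm_le => s sz _; have sN : (size s <= N)%N by rewrite sz.
  by rewrite tcoefB tcoef_lev // sz eqxx ltW // hm.
have h3 : nm (L *: lev N x0 - w (M1 + m)%N) <= eps / 2.
  have -> : w (M1 + m)%N = L *: e m by rewrite /e scalerA divff ?scale1r // gt_eqF.
  rewrite -scalerBr level_normZ ger0_norm ?(ltW L0) // level_norm_distC mulrC -ler_pdivlMr //.
  apply: le_trans h2 _; rewrite mulrCA -[leRHS]mulr1 ler_wpM2l ?ler_pdivrMr ?mul1r ?lerDl //.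
  by rewrite divr_ge0 ?(ltW eps2) // ltW.
rewrite -[_ - w n](subrKA (w (M1 + m)%N)).
by apply: le_lt_trans (level_normD _ _ _) _; lra.
Qed.

Variables (K : set A) (T alpha p : R) (X : R -> set A).
Hypotheses (HK : closed_subgroup (expW N) K).
Hypotheses (T0 : 0 < T) (p1 : 1 < p) (a1 : 1 < alpha * p).
Hypothesis SX : sobolev qd (quotient K) T alpha p X.
Local Notation a := (alpha * p).
Local Notation cl := (clamp T).
Local Notation logK := (logK K).
Local Notation base_dist := (base_dist T X).
Variables (Y : nat -> nat -> A) (B : R).
Hypothesis YX : forall n k, G (Y n k) /\ coset K (Y n k) = X (cl (dy T n k)).
Hypothesis Y2 : forall n k, Y n.+1 k.*2 = Y n k.
Hypothesis YB : forall n0, \sum_(0 <= n < n0) (2 ^+ n) `^ (a - 1) *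
  \sum_(0 <= k < 2 ^ n) cc_dist (Y n k) (Y n k.+1) `^ p <= B.

Let T0' : 0 <= T := ltW T0.
Let p0 : 0 < p := lt_trans ltr01 p1.

Let Dl n k : R := if (k < 2 ^ n)%N then cc_dist (Y n k) (Y n k.+1) else 0.
Let bt n k := Dl n k + Dl n k.-1.

Let Dl0 n k : 0 <= Dl n k.
Proof. by rewrite /Dl; case: ifP => // _; exact: cc_norm_ge0. Qed.

Let bt0 n k : 0 <= bt n k. Proof. by rewrite addr_ge0. Qed.

Let bt_sum n0 : \sum_(0 <= n < n0) (2 ^+ n) `^ (a - 1) *
  \sum_(0 <= k < (2 ^ n).+1) bt n k `^ p <= 2 `^ p * 3 * B.
Proof.
apply: (@le_trans _ _ (2 `^ p * 3 * \sum_(0 <= n < n0) (2 ^+ n) `^ (a - 1) *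
  \sum_(0 <= k < 2 ^ n) cc_dist (Y n k) (Y n k.+1) `^ p)); last first.
  by rewrite ler_wpM2l // mulr_ge0 ?powR_ge0.
rewrite mulr_sumr; apply: ler_sum => n _; rewrite mulrCA ler_wpM2l ?powR_ge0 //.
set S := \sum_(0 <= k < 2 ^ n) _.
have DS : \sum_(0 <= k < 2 ^ n) Dl n k `^ p = S.
  by rewrite /S big_nat_cond [RHS]big_nat_cond; apply: eq_bigr => k /andP[/andP[_ kn] _]; rewrite /Dl kn.
have S1 : \sum_(0 <= k < (2 ^ n).+1) Dl n k `^ p = S.
  by rewrite big_nat_recr //= DS /Dl ltnn powR0 ?addr0 // gt_eqF.
have S0 : 0 <= S by apply: sumr_ge0 => k _; exact: powR_ge0.
have S2 : \sum_(0 <= k < (2 ^ n).+1) Dl n k.-1 `^ p <= 2 * S.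
  rewrite big_nat_recl //= DS mulr_natl mulr2n lerD2r -DS.
  rewrite (bigD1_seq 0%N) ?mem_index_iota ?iota_uniq ?expn_gt0 //= lerDl.
  by apply: sumr_ge0 => k _; exact: powR_ge0.
apply: (@le_trans _ _ (\sum_(0 <= k < (2 ^ n).+1) 2 `^ p * (Dl n k `^ p + Dl n k.-1 `^ p))).
  by apply: ler_sum => k _; apply: powRD_le => //; exact: ltW.
rewrite -mulr_sumr -[leRHS]mulrA; apply: ler_wpM2l; first exact: powR_ge0.
rewrite big_split S1.
have -> : 3 * S = S + 2 * S by ring.
by rewrite lerD2l.
Qed.

Let C1 := B `^ p^-1.
Let th : R := 2 `^ (- ((a - 1) / p)).
Let th1 : 0 <= th < 1.
Proof.
rewrite powR_ge0 /= /th powRN invf_lt1 ?powR_gt0 //; apply: gt1_powR.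
by rewrite divr_gt0 // subr_gt0.
Qed.

Let C10 : 0 <= C1. Proof. exact: powR_ge0. Qed.

Let Dl_le n k : Dl n k <= C1 * th ^+ n.
Proof.
have /andP[t0 _] := th1; rewrite /Dl; case: ifP => [kn|_]; last by rewrite mulr_ge0 ?exprn_ge0.
exact: (@dyadic_decay R p a B (fun n k => cc_dist (Y n k) (Y n k.+1)) p0
  (fun n k => cc_norm_ge0 _) YB).
Qed.

Let tail n := 2 * C1 * th ^+ n / (1 - th).

Let bt_tail n M (k : nat -> nat) : \sum_(n <= m < M) bt m (k m) <= tail n.
Proof.
apply: (@le_trans _ _ (\sum_(n <= m < M) 2 * C1 * th ^+ m)).
  apply: ler_sum => m _; have h1 := Dl_le m (k m); have h2 := Dl_le m (k m).-1.
  rewrite /bt; lra.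
rewrite -mulr_sumr /tail -[leRHS]mulrA ler_wpM2l ?mulr_ge0 //.
rewrite -{1}[n]add0n big_addn; under eq_bigr do rewrite exprD mulrC.
have /andP[t0 _] := th1.
by rewrite -mulr_sumr ler_wpM2l ?exprn_ge0 //; exact: geom_le.
Qed.

Let tail_small (e : R) : 0 < e -> exists M, forall n, (M <= n)%N -> tail n < e.
Proof.
move=> e0; have [M HM] := geom_small (2 * C1 / (1 - th)) th1 e0; exists M => n /HM.
by rewrite /tail [_ * th ^+ n / _]mulrAC.
Qed.

Lemma grid_index : exists ka : nat -> R -> nat, forall n t, dyI T n (ka n t) (cl t).
Proof.
have H (nt : nat * R) : exists k, dyI T nt.1 k (cl nt.2).
  by apply: dyI_cover => //; have /andP[] := clampP nt.2 T0'.
by have [ka Hka] := choice H; exists (fun n t => ka (n, t)) => n t; exact: Hka (n, t).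
Qed.

Section Index.
Variable ka : nat -> R -> nat.
Hypothesis Hka : forall n t, dyI T n (ka n t) (cl t).

Let tau n t := dy T n (ka n t).
Let yy n t := Y n (ka n t).

Let ka_range n t : (ka n t <= 2 ^ n)%N.
Proof. by apply: dyI_range T0 (Hka n t) _; have /andP[] := clampP t T0'. Qed.

Let ka_half n t : (ka n.+1 t)./2 = ka n t.
Proof. exact: dyI_uniq T0 (dyI_half T0 (Hka n.+1 t)) (Hka n t). Qed.

Let tau_near n t : `|tau n t - cl t| < T / 2 ^+ n.
Proof.
have := Hka n t; rewrite /dyI /= in_itv /= => /andP[h1 h2]; have h3 := dyS T n (ka n t).
rewrite /tau ler0_norm; lra.
Qed.

Let Gy n t : G (yy n t). Proof. exact: (YX _ _).1. Qed.

Let link0 n j : (j <= 2 ^ n.+1)%N -> cc_dist (Y n j./2) (Y n.+1 j) <= bt n.+1 j.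
Proof.
have := odd_double_half j; set k := j./2; case: (odd j) => /= <-; rewrite ?add1n ?add0n => jr.
  by rewrite -Y2 /bt {2}/Dl jr lerDr.
by rewrite -Y2 cc_distxx ?addr_ge0 //; exact: (YX _ _).1.
Qed.

Let link n t : cc_dist (yy n t) (yy n.+1 t) <= bt n.+1 (ka n.+1 t).
Proof. by rewrite /yy -(ka_half n t); exact: link0. Qed.

Let chain n M t : (n <= M)%N ->
  cc_dist (yy n t) (yy M t) <= \sum_(n.+1 <= m < M.+1) bt m (ka m t).
Proof.
elim: M => [|M IH]; first by rewrite leqn0 => /eqP ->; rewrite cc_distxx ?big_geq.
rewrite leq_eqVlt => /orP[/eqP -> |nM]; first by rewrite cc_distxx ?big_geq.
rewrite big_nat_recr //=.
apply: le_trans (cc_dist_tri (Gy n t) (Gy M t) (Gy M.+1 t)) _.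
by apply: lerD; [exact: IH|exact: link].
Qed.

Let adjacent n s t : `|cl t - cl s| <= T / 2 ^+ n ->
  cc_dist (yy n s) (yy n t) <= bt n (ka n s) + bt n (ka n t).
Proof.
wlog st : s t / (ka n s <= ka n t)%N => [H|].
  have [/H //|/ltnW ts] := leqP (ka n s) (ka n t).
  by move=> hn; rewrite cc_dist_sym // [leRHS]addrC; apply: H => //; rewrite distrC.
move=> near; move: st; rewrite leq_eqVlt => /orP[/eqP E|st].
  by rewrite /yy E cc_distxx ?addr_ge0 //; exact: (YX _ _).1.
have E : ka n t = (ka n s).+1.
  apply/eqP; rewrite eqn_leq st andbT -ltnS -(ltr_dy n _ _ T0).
  have := Hka n s; have := Hka n t; rewrite /dyI /= !in_itv /= => /andP[h1 h2] /andP[h3 h4].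
  have h5 := dyS T n (ka n s).+1; move: near; rewrite ler_norml => /andP[_ near].
  lra.
have sr : (ka n s < 2 ^ n)%N by rewrite -ltnS -E ltnS ka_range.
rewrite /yy E /bt {1}/Dl sr -addrA lerDl !addr_ge0 //.
Qed.

(** Near-optimal elements g t + w n t of the coset X t, seen from the points of the
    grids next to t, form a Cauchy sequence: the points of the grids do by
    summability, and their distance to the coset tends to 0.  The limit of
    w n t stays in logK, which is closed. *)
Lemma limit_lift : exists Z : R -> A, (forall t, G (Z t) /\ coset K (Z t) = X (cl t)) /\
  (forall t (e : R), 0 < e -> exists M, forall n, (M <= n)%N -> cc_dist (yy n t) (Z t) < e).
Proof.
have [g Hg] := pointwise_section T0 SX.
have pm := base_dist_pmetric N0 HK T0 SX.
have step (nt : nat * R) : exists w, logK w /\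
    cc_dist (yy nt.1 nt.2) (g nt.2 + w) <= base_dist (tau nt.1 nt.2) nt.2 + 2^-1 ^+ nt.1.
  case: nt => n t /=; have [Gt Xt] := Hg t.
  have e0 : 0 < (2^-1 : R) ^+ n by rewrite exprn_gt0 // invr_gt0.
  have [w Lw hw] := qd_approx N0 HK (Gy n t) Gt e0.
  exists w; split=> //; rewrite /cc_dist (lev_inc _ (G_coef0 (Gy n t)) (logK_van N0 Lw)).
  by move: hw; rewrite Xt (YX _ _).2.
have [w0 Hw0] := choice step; pose w n t := w0 (n, t).
have Lw n t : logK (w n t) := (Hw0 (n, t)).1.
pose eps n t : R := base_dist (tau n t) t + 2^-1 ^+ n.
have hw n t : cc_dist (yy n t) (g t + w n t) <= eps n t := (Hw0 (n, t)).2.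
have eps_small t (e : R) : 0 < e -> exists M, forall n, (M <= n)%N -> eps n t < e.
  move=> e0; have e20 : 0 < e / 2 by exact: divr_gt0.
  have [r r0 Hr] := pm_cont pm (cl t) e20.
  have [M1 HM1] := dyadic_small T0 r0.
  have h2 : 0 <= (2^-1 : R) < 1 by rewrite invr_ge0 ler0n invf_lt1 // ltr1n.
  have [M2 HM2] := geom_small 1 h2 e20.
  exists (maxn M1 M2) => n; rewrite geq_max => /andP[n1 n2].
  have := HM2 n n2; rewrite mul1r => h3.
  have clcl : cl (cl t) = cl t by rewrite clamp_id // clampP.
  have : base_dist (tau n t) (cl t) < e / 2.
    apply: Hr; apply: lt_le_trans (tau_near n t) _; apply/ltW; apply: le_lt_trans HM1.
    by rewrite ler_pM2l // lef_pV2 ?posrE ?exprn_gt0 // ler_eXn2l // ltr1n.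
  rewrite /base_dist clcl /eps; lra.
have Gh n t : G (g t + w n t) by exact: (G_addr N0 (Hg t).1 (Lw n t)).
pose B1 : R := \sum_(w : N.-bseq 'I_d | size w == N) 1.
have B10 : 0 < B1 + 1 by rewrite ltr_wpDl // /B1 sumr_ge0.
have wdist n m t : nm (w m t - w n t) <= B1 * cc_dist (g t + w n t) (g t + w m t) ^+ N.
  have := level_norm_cc N (G_inc (Gh n t) (Gh m t)).
  by rewrite /cc_dist (inc_fibre (G_coef0 (Hg t).1) (logK_van N0 (Lw n t)) (logK_van N0 (Lw m
      t))) level_norm_top1D.
have hdist n m t : (n <= m)%N ->
    cc_dist (g t + w n t) (g t + w m t) <= eps n t + tail n.+1 + eps m t.
  move=> nm'; apply: le_trans (cc_dist_tri (Gh n t) (Gy m t) (Gh m t)) _.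
  apply: lerD; last exact: hw.
  apply: le_trans (cc_dist_tri (Gh n t) (Gy n t) (Gy m t)) _.
  apply: lerD; first by rewrite cc_dist_sym.
  apply: le_trans (chain t nm') _; exact: bt_tail.
have lim t : exists w', logK w' /\ forall e : R, 0 < e -> exists M, forall n, (M <= n)%N -> nm
    (w' - w n t) < e.
  have wN n : lev N (w n t) = w n t by exact: logK_lev N0 _ _ (Lw n t).
  have cw (e : R) : 0 < e -> exists M, forall n m, (M <= n)%N -> (M <= m)%N -> nm (w n t - w m t) < e.
    move=> e0; pose c : R := Num.min 1 (e / (B1 + 1)).
    have c0 : 0 < c by rewrite lt_min ltr01 divr_gt0.
    have c30 : 0 < c / 3 by rewrite divr_gt0.
    have [M1 HM1] := eps_small t _ c30; have [M2 HM2] := tail_small c30.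
    exists (maxn M1 M2) => n m; wlog le_nm : n m / (n <= m)%N => [H|].
      have [/H //|/ltnW mn] := leqP n m.
      by move=> h1 h2; rewrite level_norm_distC; exact: H.
    rewrite !geq_max => /andP[n1 n2] /andP[m1 m2]; rewrite level_norm_distC.
    have h := hdist n m t le_nm; have h1 := HM1 n n1; have h2 := HM1 m m1.
    have h3 := HM2 n.+1 (leqW n2).
    set u := cc_dist _ _ in h.
    have uc : u < c by lra.
    have u0 : 0 <= u by exact: cc_norm_ge0.
    apply: le_lt_trans (wdist n m t) _; rewrite -/u.
    have cle : c <= 1 by rewrite ge_min lexx.
    have uN : u ^+ N <= u.
      by rewrite -[leRHS]expr1; apply: ler_wiXn2l => //; lra.
    have ce : c <= e / (B1 + 1) by rewrite ge_min lexx orbT.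
    apply: (@le_lt_trans _ _ (B1 * (e / (B1 + 1)))).
      by rewrite ler_wpM2l; [|rewrite /B1 sumr_ge0|lra].
    by rewrite mulrCA -[ltRHS]mulr1 ltr_pM2l // ltr_pdivrMr // mul1r ltrDl.
  have [x xN Hx] := tensor_complete wN cw; exists x; split=> //.
  apply: (logK_closed' N0 HK) => // e e0; have [M HM] := Hx e e0.
  by exists (w M t); [exact: Lw|exact: HM].
have [wl Hwl] := choice lim.
have ZG t : G (g t + wl t) by exact: (G_addr N0 (Hg t).1 (Hwl t).1).
exists (fun t => g t + wl t); split=> [t|t e e0].
  split; first exact: ZG.
  by rewrite (coset_eq N0 HK) ?(Hg t).2 //; [exact: G_coef0 (Hg t).1|exact: (Hwl t).1].
have e20 : 0 < e / 2 by exact: divr_gt0.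
have [C C0 HC] := cc_top.
have c0 : 0 < (e / 2 / (C + 1)) ^+ N by rewrite exprn_gt0 // !divr_gt0 // ltr_wpDl.
have [M1 HM1] := eps_small t _ e20; have [M2 HM2] := (Hwl t).2 _ c0.
exists (maxn M1 M2) => n; rewrite geq_max => /andP[n1 n2].
apply: le_lt_trans (cc_dist_tri (Gy n t) (Gh n t) (ZG t)) _.
have h1 := HM1 n n1; have h2 := HM2 n n2; have h3 := hw n t.
have h4 : cc_dist (g t + w n t) (g t + wl t) <= e / 2.
  rewrite /cc_dist (inc_fibre (G_coef0 (Hg t).1) (logK_van N0 (Lw n t)) (logK_van N0 (Hwl t).1)).
  apply: le_trans (HC _ _) _.
    by apply: logK_W; apply: (logKB N0 HK); [exact: (Hwl t).1|exact: Lw].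
  have C1' : 0 < C + 1 by rewrite ltr_wpDl.
  have b0 : 0 <= e / 2 / (C + 1) by rewrite divr_ge0 // ltW.
  apply: (@le_trans _ _ (C * (e / 2 / (C + 1)))).
    rewrite ler_wpM2l // -[leRHS](powR_natK b0 N0).
    by apply: ler_powR2; rewrite ?invr_ge0 ?level_norm_ge0 ?ler0n // ltW.
  by rewrite mulrCA -[leRHS]mulr1 ler_wpM2l ?(ltW e20) // ler_pdivrMr // mul1r lerDl.
lra.
Qed.

(** One goes from Z s to the grid of scale n, crosses at most one cell, and
    returns to Z t: this is the chaining bound of [dyadic_sobolev_grid]. *)
Lemma extend_along : exists Z, admissible K T alpha p X Z.
Proof.
have [Z [HZ Zlim]] := limit_lift.
have GZ t := (HZ t).1; exists Z.
have walk s t n (e : R) : `|cl t - cl s| <= T / 2 ^+ n -> 0 < e -> exists M,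
    cc_dist (Z s) (Z t) <= e + \sum_(n <= m < M) (bt m (ka m s) + bt m (ka m t)).
  move=> near e0; have e20 : 0 < e / 2 by exact: divr_gt0.
  have [M1 HM1] := Zlim s _ e20; have [M2 HM2] := Zlim t _ e20.
  pose M := maxn n (maxn M1 M2); exists M.+1.
  have nM : (n <= M)%N by rewrite leq_maxl.
  have h1 : cc_dist (Z s) (yy M s) <= e / 2.
    by rewrite cc_dist_sym //; apply/ltW/HM1; rewrite !leq_max leqnn orbT.
  have h2 : cc_dist (yy M t) (Z t) <= e / 2 by apply/ltW/HM2; rewrite !leq_max leqnn !orbT.
  have h3 := chain s nM; have h4 := chain t nM; have h5 := adjacent near.
  rewrite big_ltn // big_split /=.
  have t1 := cc_dist_tri (GZ s) (Gy M s) (GZ t).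
  have t2 := cc_dist_tri (Gy M s) (Gy n s) (GZ t).
  have t3 := cc_dist_tri (Gy n s) (Gy n t) (GZ t).
  have t4 := cc_dist_tri (Gy n t) (Gy M t) (GZ t).
  rewrite (cc_dist_sym (Gy M s) (Gy n s)) in t2.
  exact: walk_arith t1 t2 t3 t4 h1 h3 h5 h4 h2.
have pm : pmetric (fun s t => cc_dist (Z s) (Z t)).
  split.
  - by move=> s t; exact: cc_norm_ge0.
  - by move=> s t; exact: cc_dist_sym.
  - by move=> s t u; exact: cc_dist_tri.
  - by move=> t; exact: cc_distxx.
  - move=> t e e0; have e30 : 0 < e / 3 by rewrite divr_gt0.
    have [n Hn] := tail_small e30; exists (T / 2 ^+ n); first by rewrite divr_gt0 // exprn_gt0.
    move=> s st; have near : `|cl t - cl s| <= T / 2 ^+ n.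
      by rewrite distrC; apply/ltW/(le_lt_trans _ st); exact: clamp_lip.
    have [M HM] := walk s t n _ near e30; apply: le_lt_trans HM _.
    rewrite big_split /=.
    have h1 := bt_tail n M (fun m => ka m s); have h2 := bt_tail n M (fun m => ka m t).
    have h3 := Hn n (leqnn n); lra.
have inI t : t \in `[0, T] -> cl t = t by rewrite in_itv /= => tT; rewrite clamp_id.
split; last by move=> t /inI tT; rewrite (HZ t).2 tT.
split.
- by move=> t _; exact: GZ.
- move=> t _ e e0; have [r r0 Hr] := pm_cont pm t e0; exists r => // s _; exact: Hr.
have := @dyadic_sobolev_grid R (fun s t => cc_dist (Z s) (Z t)) T p a _ bt ka (ltW p1)
  (lt_trans ltr01 a1) T0 pm bt0 bt_sum.
apply.
- by move=> m s sT; have := Hka m s; rewrite clamp_id.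
- by move=> s t n e sT tT st e0; apply: walk => //; rewrite !clamp_id.
Qed.

End Index.

Lemma extend_lift : exists Z, admissible K T alpha p X Z.
Proof. by have [ka Hka] := grid_index; exact: extend_along Hka. Qed.

End Extend.

(** The inequality alpha N < 1 is what makes the refinement of grids a
    contraction. *)
Theorem lift_exists (R : realType) (d N : nat) (K : set (tensor R d N)) (T alpha p : R)
    (X : R -> set (tensor R d N)) : (0 < N)%N -> closed_subgroup (expW N) K ->
  0 < T -> 1 < p -> 1 < alpha * p -> alpha * N%:R < 1 ->
  sobolev (@quotient_dist R d N) (quotient K) T alpha p X ->
  exists Z, admissible K T alpha p X Z.
Proof.
move=> N0 HK T0 p1 a1 aN SX.
have [Y [B [YX Y2 YB]]] := dyadic_lift N0 HK T0 p1 a1 SX aN.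
exact: (extend_lift N0 HK T0 p1 a1 SX YX Y2 YB).
Qed.

(** * Uniform convexity of powers of a Hilbert norm *)

Section Convex.
Context {R : realType}.
Implicit Types (q t u v w x y : R).

Lemma powR_conv q t x y : 1 <= q -> 0 <= t <= 1 -> 0 <= x -> 0 <= y ->
  (t * x + (1 - t) * y) `^ q <= t * x `^ q + (1 - t) * y `^ q.
Proof.
move=> q1 /andP[t0 t1] x0 y0.
by apply: (convex_powR q1 (Itv01 t0 t1)); rewrite inE /= in_itv /= andbT.
Qed.

Lemma powR_mid q x y : 1 <= q -> 0 <= x -> 0 <= y ->
  ((x + y) / 2) `^ q <= (x `^ q + y `^ q) / 2.
Proof.
move=> q1 x0 y0; have := @powR_conv q 2^-1 x y q1 ltac:(by lra) x0 y0.
have -> : 2^-1 * x + (1 - 2^-1) * y = (x + y) / 2 by field.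
by have -> : 2^-1 * x `^ q + (1 - 2^-1) * y `^ q = (x `^ q + y `^ q) / 2 by field.
Qed.

Lemma powR_lt1 q x : 0 < q -> 0 <= x < 1 -> x `^ q < 1.
Proof.
move=> q0 /andP[x0 x1]; have := @gt0_ltr_powR R q q0 x 1.
by rewrite powR1; apply; rewrite ?nnegrE.
Qed.

Lemma powR_ltself q x : 1 < q -> 0 < x < 1 -> x `^ q < x.
Proof.
move=> q1 /andP[x0 x1]; have q10 : 0 < q - 1 by rewrite subr_gt0.
have -> : x `^ q = x * x `^ (q - 1).
  by rewrite -{2}[x]powRr1 ?(ltW x0) // -powRD ?subrKC //; apply/implyP => _; rewrite gt_eqF.
by rewrite -[ltRHS]mulr1 ltr_pM2l //; apply: powR_lt1; rewrite ?(ltW x0).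
Qed.

(** The defect of convexity at the middle of 1 and v. *)
Definition gap q v : R := (1 + v `^ q) / 2 - ((1 + v) / 2) `^ q.

(** With F = w^q < w, convexity between w and 1, at the point (1 + w^2) / 2, bounds
    the defect at w^2 from below by (1 - F) (w - F) / 2. *)
Lemma gap_gt0 q w : 1 < q -> 0 < w < 1 -> 0 < gap q (w * w).
Proof.
move=> q1 w01; have [w0 w1] := andP w01.
have F1 := powR_ltself q1 w01; have F2 : 0 <= w `^ q := powR_ge0 _ _.
have FF : (w * w) `^ q = w `^ q * w `^ q by rewrite powRM // ltW.
have t01 : 0 <= (1 + w) / 2 <= 1 by apply/andP; split; lra.
have := powR_conv (ltW q1) t01 (ltW w0) ler01; rewrite powR1.
have -> : (1 + w) / 2 * w + (1 - (1 + w) / 2) * 1 = (1 + w * w) / 2 by field.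
rewrite /gap FF; set F := w `^ q in F1 F2 *; set M := _ `^ q => h.
have : 0 < (1 - F) * (w - F) by rewrite mulr_gt0 // subr_gt0 //; lra.
have -> : (1 - F) * (w - F) = w - F - F * w + F * F by ring.
have e : (1 + w) / 2 * F + (1 - (1 + w) / 2) * 1 = (F + F * w) / 2 + (1 - w) / 2 by field.
rewrite e in h; move: h; set FW := F * w; set F3 := F * F; lra.
Qed.

(** w lies between v and 1, and (1 + v) / 2 between v and (1 + w) / 2, so both
    values of the power are estimated by convexity. *)
Lemma gap_mono q v w : 1 <= q -> 0 <= v <= w -> w < 1 -> gap q w / 2 <= gap q v.
Proof.
move=> q1 /andP[v0 vw] w1; have w0 : 0 <= w := le_trans v0 vw.
have v1 : v < 1 := le_lt_trans vw w1.
pose l := (1 - w) / (1 - v); pose s := (1 - l) / (2 - l).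
have v10 : 0 < 1 - v by rewrite subr_gt0.
have l0 : 0 <= l by rewrite divr_ge0 // subr_ge0 ltW.
have l1 : l <= 1 by rewrite ler_pdivrMr // mul1r; lra.
have l2 : 0 < 2 - l by lra.
have s0 : 0 <= s by rewrite divr_ge0 // ?(ltW l2) // subr_ge0.
have s1 : s <= 2^-1 by rewrite ler_pdivrMr //; lra.
have gw : 0 <= gap q w by rewrite subr_ge0; have := powR_mid q1 ler01 w0; rewrite powR1.
have h1 := @powR_conv q l v 1 q1 ltac:(by apply/andP) v0 ler01.
have h2 := @powR_conv q s v ((1 + w) / 2) q1 ltac:(by apply/andP; split; lra) v0 ltac:(lra).
rewrite powR1 (_ : l * v + (1 - l) * 1 = w) in h1; last first.
  by rewrite /l; field; rewrite gt_eqF.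
rewrite (_ : s * v + (1 - s) * ((1 + w) / 2) = (1 + v) / 2) in h2; last first.
  have -> : w = l * v + (1 - l) by rewrite /l; field; rewrite gt_eqF.
  by rewrite /s; field; rewrite gt_eqF.
have h3 : gap q v - (1 - s) * gap q w >= 0.
  rewrite /gap; set F := v `^ q in h1 h2 *; set W := w `^ q in h1 *.
  set M := ((1 + w) / 2) `^ q in h2 *; set V := ((1 + v) / 2) `^ q in h2 *.
  apply: (@le_trans _ _ ((1 + F) / 2 - (s * F + (1 - s) * M) - (1 - s) * ((1 + (l * F + (1 - l) *
      1)) / 2 - M))).
    rewrite le_eqVlt; apply/orP; left; apply/eqP; rewrite /s; field; rewrite gt_eqF //.
  apply: lerB; first by apply: lerB.
  by rewrite ler_wpM2l //; lra.
have h4 : gap q w / 2 <= (1 - s) * gap q w by rewrite mulrC ler_wpM2r //; lra.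
lra.
Qed.

(** Here u, v, m, de stand for the norms of x, y, (x + y) / 2, x - y in a Hilbert
    space, and the last hypothesis is a consequence of the parallelogram law.
    By homogeneity u = 1 >= v.  If v is away from 1, the defect of convexity is
    bounded from below.  If v is close to 1, a de which is not small forces m
    away from 1 by the parallelogram law. *)
Lemma uniform_convex q : 1 < q -> forall eps : R, 0 < eps -> exists2 C : R, 0 < C &
  forall u v m de, 0 <= u -> 0 <= v -> 0 <= m -> 0 <= de -> 2 * m <= u + v -> de <= u + v ->
  4 * m ^+ 2 + de ^+ 2 <= 2 * u ^+ 2 + 2 * v ^+ 2 ->
  de `^ q <= eps * (u `^ q + v `^ q) + C * ((u `^ q + v `^ q) / 2 - m `^ q).
Proof.
move=> q1 eps eps0; have q0 : 0 < q := lt_trans ltr01 q1; have q00 := ltW q0.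
pose e' := Num.min 1 (eps `^ q^-1).
have e'0 : 0 < e' by rewrite lt_min ltr01 powR_gt0.
have e'1 : e' <= 1 by rewrite ge_min lexx.
pose s := 1 - e' ^+ 2 / 4.
have e2 : 0 < e' ^+ 2 <= 1 by rewrite exprn_gt0 //= exprn_ile1 // ltW.
have s01 : 0 < s < 1 by rewrite /s; case/andP: e2 => ? ?; apply/andP; split; lra.
(* m ^+ 2 <= s will read m <= w * w *)
pose w := s `^ (4^-1).
have w01 : 0 < w < 1.
  by case/andP: s01 => ? ?; rewrite powR_gt0 // powR_lt1 // ltW.
have ww : (w * w) `^ 2 = s.
  case/andP: s01 => s0 _; rewrite powRM ?powR_ge0 // -powRrM -powRD; last by apply/implyP => _;
      rewrite gt_eqF.
  have -> : 4^-1 * 2 + 4^-1 * 2 = 1 :> R by field.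
  by rewrite powRr1 // ltW.
have ww1 : 0 < w * w < 1.
  by case/andP: w01 => ? ?; rewrite mulr_gt0 //= -[ltRHS]mulr1 ltr_pM // ltW.
pose mu := (w * w) `^ q.
have mu1 : mu < 1 by apply: powR_lt1 => //; case/andP: ww1 => /ltW -> ->.
have g0 := gap_gt0 q1 w01.
pose c := Num.min (gap q (w * w) / 2) ((1 - mu) / 2).
have c0 : 0 < c by rewrite lt_min !divr_gt0 // subr_gt0.
have hom v m de : 0 <= v <= 1 -> 0 <= m -> 0 <= de -> 2 * m <= 1 + v -> de <= 1 + v ->
   4 * m ^+ 2 + de ^+ 2 <= 2 + 2 * v ^+ 2 ->
   de `^ q <= eps * (1 + v `^ q) + 2 `^ q / c * ((1 + v `^ q) / 2 - m `^ q).
  move=> /andP[v0 v1] m0 de0 mv dv par; have vq := powR_ge0 v q.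
  have Cc : 0 <= 2 `^ q / c by rewrite divr_ge0 ?powR_ge0 // ltW.
  have mm : m `^ q <= ((1 + v) / 2) `^ q by apply: ler_powR2; lra.
  have gp : gap q v <= (1 + v `^ q) / 2 - m `^ q by rewrite /gap lerD2l lerN2.
  have gv : 0 <= gap q v.
    by rewrite subr_ge0; have := powR_mid (ltW q1) ler01 v0; rewrite powR1.
  have eps1 : 0 <= eps * (1 + v `^ q) by rewrite mulr_ge0 ?addr_ge0 // ltW.
  have [dsm|dlg] := leP de (eps `^ q^-1).
    apply: (@le_trans _ _ (eps * (1 + v `^ q))); last first.
      by rewrite lerDl mulr_ge0 // (le_trans gv).
    apply: (@le_trans _ _ eps).
      apply: le_trans (ler_powR2 q00 de0 dsm) _.
      by rewrite -powRrM mulVf ?gt_eqF // powRr1 // ltW.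
    by rewrite -[leLHS]mulr1 ler_wpM2l ?(ltW eps0) // lerDl.
  suff cg : c <= (1 + v `^ q) / 2 - m `^ q.
    apply: (@le_trans _ _ (2 `^ q / c * ((1 + v `^ q) / 2 - m `^ q))); last by rewrite lerDr.
    apply: (@le_trans _ _ (2 `^ q / c * c)); last by rewrite ler_wpM2l.
    by rewrite divfK ?gt_eqF //; apply: ler_powR2; lra.
  have [vw|wv] := leP v (w * w).
    have g1 : gap q (w * w) / 2 <= gap q v.
      by apply: gap_mono; [exact: ltW|rewrite v0|case/andP: ww1].
    by apply: le_trans gp; apply: le_trans g1; rewrite /c ge_min lexx.
  have de2 : e' <= de by apply/ltW/(le_lt_trans _ dlg); rewrite ge_min lexx orbT.
  have de3 : e' ^+ 2 <= de ^+ 2 by rewrite lerXn2r ?nnegrE // ltW.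
  have v2 : v ^+ 2 <= 1 by rewrite exprn_ile1.
  have m2 : m ^+ 2 <= s by rewrite /s; lra.
  have m3 : m <= w * w.
    case/andP: ww1 => ww0 _; rewrite -(@ler_pXn2r _ 2) ?nnegrE ?(ltW ww0) //.
    by rewrite -[leRHS]powR_mulrn ?(ltW ww0) // ww.
  have m4 : m `^ q <= mu by apply: ler_powR2.
  have v4 : mu <= v `^ q by case/andP: ww1 => ww0 _; apply: ler_powR2; rewrite ?(ltW ww0) // ltW.
  have c2 : c <= (1 - mu) / 2 by rewrite ge_min lexx orbT.
  lra.
exists (2 `^ q / c); first by rewrite divr_gt0 ?powR_gt0.
move=> u v m de; wlog vu : u v / v <= u => [H|].
  have [/H //|/ltW uv] := leP v u => u0 v0 m0 d0 h1 h2 h3.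
  rewrite [u `^ q + _]addrC; rewrite [u + v]addrC in h1 h2; rewrite [2 * u ^+ 2 + _]addrC in h3.
  exact: H.
move=> u0 v0 m0 d0 h1 h2 h3.
have [u00|u00] := eqVneq u 0.
  have v00 : v = 0 by apply/eqP; rewrite eq_le v0 -{1}u00 vu.
  have m00 : m = 0 by apply/eqP; rewrite eq_le m0; lra.
  have d00 : de = 0 by apply/eqP; rewrite eq_le d0; lra.
  by rewrite u00 v00 m00 d00 !powR0 ?gt_eqF // addr0 mul0r subr0 !mulr0 addr0.
have up : 0 < u by rewrite lt_neqAle eq_sym u00.
have upi : 0 <= u^-1 by rewrite invr_ge0.
have uq : 0 < u `^ q by rewrite powR_gt0.
have sc x : 0 <= x -> x `^ q = u `^ q * (x / u) `^ q.
  by move=> x0; rewrite -powRM ?divr_ge0 // mulrC divfK.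
rewrite (sc de d0) (sc v v0) (sc m m0).
have H : (de / u) `^ q <= eps * (1 + (v / u) `^ q) + 2 `^ q / c * ((1 + (v / u) `^ q) / 2 - (m /
    u) `^ q).
  have sq x : (x / u) ^+ 2 * u ^+ 2 = x ^+ 2 by rewrite -exprMn divfK.
  apply: hom; rewrite ?divr_ge0 //.
  - by rewrite ler_pdivrMr // mul1r.
  - by rewrite mulrA ler_pdivrMr // [leRHS]mulrDl mul1r divfK.
  - by rewrite ler_pdivrMr // [leRHS]mulrDl mul1r divfK.
  - rewrite -(ler_pM2r (exprn_gt0 2 up)); move: h3; rewrite -(sq m) -(sq de) -(sq v).
    by move: ((m / u) ^+ 2) ((de / u) ^+ 2) ((v / u) ^+ 2) (u ^+ 2) => x1 x2 x3 x4; lra.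
have := ler_wpM2l (ltW uq) H; set D := _ `^ q; set V := (v / u) `^ q; set M := (m / u) `^ q.
set C := 2 `^ q / c; set U := u `^ q => {}H.
apply: le_trans H _; rewrite le_eqVlt; apply/orP; left; apply/eqP.
by clearbody C U D V M; field.
Qed.
End Convex.

(** * The energy of a lift and its minimizers *)

Lemma sub4 (V : zmodType) (x y z t : V) : (x - y) - (z - t) = (x - z) - (y - t).
Proof. by rewrite !opprB addrACA [RHS]addrACA [- z + _]addrC. Qed.

Section Measurability.
Context {R : realType}.

Lemma eps_measurable (f : R -> R) :
  (forall t e : R, 0 < e -> exists2 r : R, 0 < r & forall s, `|s - t| < r -> `|f s - f t| < e) ->
  measurable_fun setT f.
Proof.
move=> cf; apply: (measurability _ (RGenInftyO.measurableE R)) => //.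
move=> _ [_ [c ->] <-]; rewrite setTI; apply: open_measurable; rewrite openE => s /=.
rewrite in_itv /= => sc; have c0 : 0 < c - f s by rewrite subr_gt0.
have [r r0 hr] := cf s _ c0; exists r => //= u; rewrite /ball_ /= distrC => /hr.
by rewrite /= in_itv /= ltr_norml => /andP[_]; lra.
Qed.

Lemma limn_einf_ge (u : nat -> \bar R) (l : \bar R) :
  (forall c : R, (c%:E < l)%E -> exists M, forall n, (M <= n)%N -> (c%:E <= u n)%E) ->
  (l <= limn_einf u)%E.
Proof.
move=> H; rewrite limn_einf_lim.
have K c : (c%:E < l)%E -> (c%:E <= limn (einfs u))%E.
  move=> /H[M HM]; apply: lime_ge; first exact: is_cvg_einfs.
  exists M => // n /= Mn; apply: le_ereal_inf_tmp => _ [m /= nm <-]; apply: HM.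
  exact: leq_trans Mn nm.
case: l {H} K => [l||] K; last by rewrite leNye.
  apply/lee_addgt0Pr => e e0; rewrite -leeBlDr // -EFinB; apply: K.
  by rewrite lte_fin ltrBlDr ltrDl.
rewrite leye_eq; apply/eqP/eqyP => c _; apply: K; exact: ltry.
Qed.

Context {d N : nat} {D : measure_display} {X : measurableType D}.
Local Notation A := (tensor R d N).
Implicit Types (f g : X -> A).

(** Measurability of all coordinates.  It passes through the operations of the
    algebra, which are polynomial in the coordinates. *)
Definition tmeas f := forall s, (size s <= N)%N -> measurable_fun setT (fun x => tcoef (f x) s).

Lemma tmeas_cst (c : A) : tmeas (fun _ => c).
Proof. by move=> s _; exact: measurable_cst. Qed.

Lemma tmeasD f g : tmeas f -> tmeas g -> tmeas (fun x => f x + g x).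
Proof.
move=> mf mg s sN; under eq_fun do rewrite tcoefD.
by apply: measurable_funD; [exact: mf|exact: mg].
Qed.

Lemma tmeasN f : tmeas f -> tmeas (fun x => - f x).
Proof.
move=> mf s sN; under eq_fun do rewrite tcoefN -mulN1r.
by apply: measurable_funM => //; exact: mf.
Qed.

Lemma tmeasM f g : tmeas f -> tmeas g -> tmeas (fun x => f x * g x).
Proof.
move=> mf mg s sN; under eq_fun do rewrite tcoef_mul //.
apply: measurable_sum => i; apply: measurable_funM; [apply: mf|apply: mg].
  by apply: leq_trans sN; rewrite size_take_min geq_minr.
by rewrite size_drop (leq_trans (leq_subr _ _)).
Qed.

Lemma tmeas_sum n (F : nat -> X -> A) : (forall i, tmeas (F i)) ->
  tmeas (fun x => \sum_(i < n) F i x).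
Proof.
move=> mF s sN; under eq_fun do rewrite tcoef_sum.
by apply: measurable_sum => i; exact: mF.
Qed.

Lemma tmeasX f n : tmeas f -> tmeas (fun x => f x ^+ n).
Proof.
move=> mf; elim: n => [|n IH]; first by under eq_fun do rewrite expr0; exact: tmeas_cst.
by under eq_fun do rewrite exprS; exact: tmeasM.
Qed.

Lemma tmeas_tinv f : tmeas f -> tmeas (fun x => tinv (f x)).
Proof.
move=> mf; apply: (@tmeas_sum _ (fun i x => (1 - f x) ^+ i)) => i; apply: tmeasX.
by apply: tmeasD; [exact: tmeas_cst|exact: tmeasN].
Qed.

Lemma tmeas_norm i f : tmeas f -> measurable_fun setT (fun x => level_norm i (f x)).
Proof.
move=> mf; under eq_fun do rewrite level_normE big_mkcond /=.
apply: (measurableT_comp (continuous_measurable_fun (@sqrt_continuous R))).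
apply: measurable_sum => w; case: eqP => _; last exact: measurable_cst.
by apply: measurable_funX; apply: mf; rewrite size_bseq.
Qed.

End Measurability.

Lemma tmeas_comp (R : realType) (d N : nat) (D D' : measure_display) (X : measurableType D)
    (Y : measurableType D') (h : Y -> X) (f : X -> tensor R d N) :
  measurable_fun setT h -> tmeas f -> tmeas (f \o h).
Proof. by move=> mh mf s sN; apply: (measurableT_comp (mf s sN)). Qed.

Section CoefCont.
Context {R : realType} {d N : nat}.
Local Notation A := (tensor R d N).
Local Notation G := (@Ggroup R d N).

(** The coordinates of Y u = Y t (Y t^-1 Y u) differ from those of Y t by terms
    with a coordinate of Y t^-1 Y u as a factor, which is small. *)
Lemma continuous_tmeas (Y : R -> A) : (forall t, G (Y t)) ->
  (forall t (e : R), 0 < e -> exists2 r : R, 0 < r & forall s, `|s - t| < r -> cc_dist (Y s) (Y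
      t) < e) ->
  tmeas Y.
Proof.
move=> GY cY s sN; apply: eps_measurable => t e e0.
pose M : R := \sum_(0 <= i < size s) `|tcoef (Y t) (take i s)|.
have M0 : 0 <= M by apply: sumr_ge0 => i _.
have M1 : 0 < M + 1 by rewrite ltr_wpDl.
have c0 : 0 < Num.min 1 (e / (M + 1)) by rewrite lt_min ltr01 divr_gt0.
have [r r0 Hr] := cY t _ c0; exists r => // u /Hr; rewrite cc_dist_sym //.
set c := cc_dist _ _; rewrite lt_min => /andP[c1 ce].
have cc0 : 0 <= c by exact: cc_norm_ge0.
pose x := tinv (Y t) * Y u; have Gx : G x by exact: G_inc.
have -> : Y u = Y t * x by rewrite /x mulrA tmulV ?mul1r //; exact: G_coef0.
rewrite tcoef_mul // big_nat_recr //= take_size drop_size (G_coef0 Gx) mulr1 addrK.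
apply: (@le_lt_trans _ _ (M * (e / (M + 1)))); last first.
  by rewrite mulrCA -[ltRHS]mulr1 ltr_pM2l // ltr_pdivrMr // mul1r ltrDl.
apply: le_trans (ler_norm_sum _ _ _) _; rewrite mulr_suml.
rewrite big_nat_cond [leRHS]big_nat_cond; apply: ler_sum => i /andP[/andP[_ iS] _].
rewrite normrM ler_wpM2l //.
have dS : (size (drop i s) <= N)%N by rewrite size_drop (leq_trans (leq_subr _ _)).
apply: le_trans (cc_norm_coef Gx dS) _; rewrite -/c size_drop.
apply: (@le_trans _ _ c); last exact: ltW.
by rewrite -[leRHS]expr1; apply: ler_wiXn2l; rewrite ?subn_gt0 // ltW.
Qed.

End CoefCont.

Lemma limn_einf_le (R : realType) (u : nat -> \bar R) (l : R) :
  (forall e : R, 0 < e -> exists M, forall n, (M <= n)%N -> (u n <= (l + e)%:E)%E) ->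
  (limn_einf u <= l%:E)%E.
Proof.
move=> H; rewrite limn_einf_lim; apply/lee_addgt0Pr => e e0; rewrite -EFinD.
have [M HM] := H e e0; apply: lime_le; first exact: is_cvg_einfs.
apply: nearW => n; apply: le_trans (HM (maxn n M) (leq_maxr _ _)).
by apply: ereal_inf_lbound; exists (maxn n M) => //=; exact: leq_maxl.
Qed.

Lemma eq_lee (R : realType) (x y : \bar R) : x = y -> (x <= y)%E.
Proof. by move=> ->. Qed.

Section NormConvex.
Context {R : realType} {d N : nat}.
Local Notation A := (tensor R d N).
Local Notation nm := (@level_norm R d N N).
Implicit Types (x y : A).

Lemma nm_sqr x : nm x ^+ 2 = \sum_(w : N.-bseq 'I_d | size w == N) tcoef x w ^+ 2.
Proof. by rewrite level_normE sqr_sqrtr // sumr_ge0 // => w _; exact: sqr_ge0. Qed.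

Lemma nm_parallelogram x y :
  4 * nm (2^-1 *: (x + y)) ^+ 2 + nm (x - y) ^+ 2 = 2 * nm x ^+ 2 + 2 * nm y ^+ 2.
Proof.
rewrite !nm_sqr !mulr_sumr -!big_split /=; apply: eq_bigr => w _.
by rewrite tcoefZ tcoefB tcoefD; field.
Qed.

Lemma nm_convex (q eps : R) : 1 < q -> 0 < eps -> exists2 C : R, 0 < C &
  forall x y, nm (x - y) `^ q + C * nm (2^-1 *: (x + y)) `^ q <=
    (eps + C / 2) * (nm x `^ q + nm y `^ q).
Proof.
move=> q1 eps0; have [C C0 HC] := uniform_convex q1 eps0; exists C => // x y.
have h : 2 * nm (2^-1 *: (x + y)) <= nm x + nm y.
  rewrite level_normZ ger0_norm ?invr_ge0 // mulrA divff // mul1r.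
  exact: level_normD.
have := HC (nm x) (nm y) (nm (2^-1 *: (x + y))) (nm (x - y)) (level_norm_ge0 _ _)
  (level_norm_ge0 _ _) (level_norm_ge0 _ _) (level_norm_ge0 _ _) h (level_normB _ _ _).
rewrite nm_parallelogram => /(_ (lexx _)).
move: (nm (x - y) `^ q) (nm (2^-1 *: (x + y)) `^ q) (nm x `^ q) (nm y `^ q) => D M u v.
rewrite [in X in X -> _]mulrBr => H; rewrite mulrDl.
have -> : C / 2 * (u + v) = C * ((u + v) / 2) by field.
lra.
Qed.

Lemma nm_eq0 x : lev N x = x -> nm x = 0 -> x = 0.
Proof.
move=> xN x0; apply: tensorP => s sN; rewrite tcoef0 -xN tcoef_lev //.
case: eqP => // sz; have := level_norm_coord x sN; rewrite sz x0 normr_le0 => /eqP.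
exact.
Qed.

End NormConvex.

Section Admissible.
Context {R : realType} {d N : nat}.
Local Notation A := (tensor R d N).
Local Notation G := (@Ggroup R d N).
Local Notation nm := (@level_norm R d N N).
Local Notation mu := (@lebesgue_measure R).
Local Notation mu2 := (mu \x mu)%E.
Variables (K : set A) (T alpha p : R) (X : R -> set A).
Hypotheses (N0 : (0 < N)%N) (HK : closed_subgroup (expW N) K).
Hypotheses (T0 : 0 < T) (p1 : 1 < p) (a1 : 1 < alpha * p).
Local Notation a := (alpha * p).
Local Notation cl := (clamp T).
Local Notation logK := (logK K).
Local Notation Q := (`[0%R, T] `*` `[0%R, T])%classic.

Let T0' : 0 <= T := ltW T0.
Let p0 : 0 < p := lt_trans ltr01 p1.

Lemma integral_finD (D : set (R * R)) (f g : R * R -> R) (c1 c2 : R) : measurable D ->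
  measurable_fun setT f -> measurable_fun setT g -> 0 <= c1 -> 0 <= c2 ->
  (forall z, 0 <= f z) -> (forall z, 0 <= g z) ->
  (\int[mu2]_(z in D) (c1 * f z + c2 * g z)%:E =
   c1%:E * \int[mu2]_(z in D) (f z)%:E + c2%:E * \int[mu2]_(z in D) (g z)%:E)%E.
Proof.
move=> mD mf mg c10 c20 f0 g0.
have mcf : measurable_fun setT (fun z => c1 * f z) by exact: measurable_funM.
have mcg : measurable_fun setT (fun z => c2 * g z) by exact: measurable_funM.
under eq_integral do rewrite EFinD.
rewrite ge0_integralD //; last 4 first.
- by move=> z _; rewrite lee_fin mulr_ge0.
- by apply/measurable_EFinP; exact: measurable_funTS.
- by move=> z _; rewrite lee_fin mulr_ge0.
- by apply/measurable_EFinP; exact: measurable_funTS.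
congr (_ + _)%E; under eq_integral do rewrite EFinM.
  rewrite ge0_integralZl_EFin //.
  - by move=> z _; rewrite lee_fin.
  - by apply/measurable_EFinP; exact: measurable_funTS.
rewrite ge0_integralZl_EFin //.
- by move=> z _; rewrite lee_fin.
- by apply/measurable_EFinP; exact: measurable_funTS.
Qed.

Lemma measurable_Q : measurable (Q : set (R * R)).
Proof. by apply: measurableX; exact: measurable_itv. Qed.

Lemma inQ z : Q z -> 0 <= z.1 <= T /\ 0 <= z.2 <= T.
Proof. by case: z => s t [/=]; rewrite !in_itv. Qed.

Section OneLift.
Variable Y : R -> A.
Hypothesis HY : admissible K T alpha p X Y.

Lemma lift_G t : G (Y (cl t)).
Proof. by case: HY => -[GY _ _] _; apply: GY; rewrite in_itv /= clampP. Qed.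

Lemma lift_X t : coset K (Y (cl t)) = X (cl t).
Proof. by case: HY => _; apply; rewrite in_itv /= clampP. Qed.

Definition cc_path s t := cc_dist (Y (cl s)) (Y (cl t)).

Lemma cc_path_pmetric : pmetric cc_path.
Proof.
have GY t : 0 <= t <= T -> G (Y t) by move=> tT; rewrite -(clamp_id tT); exact: lift_G.
apply: (@pmetric_clamp R T (fun s t => cc_dist (Y s) (Y t))) => //.
- by move=> s t _ _; exact: cc_norm_ge0.
- by move=> s t sT tT; apply: cc_dist_sym; exact: GY.
- by move=> s t u sT tT uT; apply: cc_dist_tri; exact: GY.
- by move=> t tT; apply: cc_distxx; exact: GY.
- case: HY => -[_ cY _] _ t tT e e0; have := cY t; rewrite in_itv /= => /(_ tT e e0) [r r0 Hr].
  by exists r => // s sT; apply: Hr; rewrite in_itv.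
Qed.

Lemma cc_path_integral : (\int[mu2]_(z in Q) (density cc_path p (a + 1) z)%:E < +oo)%E.
Proof.
case: HY => -[_ _ fin] _; apply: le_lt_trans fin; rewrite le_eqVlt; apply/orP; left.
apply/eqP; apply: eq_integral => z; rewrite inE => /inQ[z1 z2].
by rewrite /density /cc_path !clamp_id.
Qed.

Lemma lift_tmeas : tmeas (fun t => Y (cl t)).
Proof.
apply: continuous_tmeas; first exact: lift_G.
exact: pm_cont cc_path_pmetric.
Qed.

(** |pi_i(g)|^(1 / i) is at most a multiple of the norm of g. *)
Lemma level_integral i : (0 < i)%N ->
  (double_integral T (a + 1)%R (fun s t => level_norm i (increment Y s t) `^ (p / i%:R))%R < +oo)%E.
Proof.
move=> i0; pose B : R := (\sum_(w : N.-bseq 'I_d | size w == i) 1) `^ (p / i%:R).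
have S0 : 0 <= \sum_(w : N.-bseq 'I_d | size w == i) (1 : R) by rewrite sumr_ge0.
have pi0 : 0 <= p / i%:R by rewrite divr_ge0 // ltW.
apply: (@le_lt_trans _ _ (\int[mu2]_(z in Q) (B%:E * (density cc_path p (a + 1) z)%:E))%E).
  apply: ge0_le_integralW => z Qz; first by rewrite lee_fin divr_ge0 ?powR_ge0.
  have [z1 z2] := inQ Qz; rewrite -EFinM lee_fin /density /cc_path !clamp_id // mulrA.
  rewrite ler_wpM2r ?invr_ge0 ?powR_ge0 //.
  have Gi : G (increment Y z.1 z.2).
    have G1 : G (Y z.1) by rewrite -(clamp_id z1); exact: lift_G.
    have G2 : G (Y z.2) by rewrite -(clamp_id z2); exact: lift_G.
    exact: G_inc.
  apply: le_trans (ler_powR2 pi0 (level_norm_ge0 _ _) (level_norm_cc i Gi)) _.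
  rewrite powRM ?exprn_ge0 ?cc_norm_ge0 // /B ler_wpM2l ?powR_ge0 //.
  rewrite -powR_mulrn ?cc_norm_ge0 // -powRrM mulrCA divff ?mulr1 //.
  by rewrite pnatr_eq0 -lt0n.
rewrite ge0_integralZl_EFin //; last 4 first.
- exact: measurable_Q.
- by move=> z _; rewrite lee_fin density_ge0.
- by apply/measurable_EFinP; apply: measurable_funTS; apply: measurable_density; exact: cc_path_pmetric.
- exact: powR_ge0.
have := cc_path_integral; set I := (\int[_]_(_ in _) _)%E => If.
have I0 : (0 <= I)%E by apply: integral_ge0 => z _; rewrite lee_fin density_ge0.
by apply: lte_mul_pinfty => //; rewrite ?lee_fin ?powR_ge0.
Qed.

End OneLift.

Variable Y0 : R -> A.
Hypothesis HY0 : admissible K T alpha p X Y0.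
Hypothesis aN : alpha * N%:R <= 1.
Local Notation q := (p / N%:R).

Let Nr0 : 0 < (N%:R : R). Proof. by rewrite ltr0n. Qed.
Let aq : a <= q.
Proof. by rewrite ler_pdivlMr // mulrAC -[leRHS]mul1r ler_pM2r. Qed.
Let q1 : 1 < q. Proof. exact: lt_le_trans aq. Qed.
Let q0 : 0 < q := lt_trans ltr01 q1.

Let GY t : G (Y0 (cl t)). Proof. exact: lift_G HY0 t. Qed.
Let Y01 t : tcoef (Y0 (cl t)) [::] = 1. Proof. exact: G_coef0. Qed.

(** The norm of the level-N component of an increment of Y0 + w. *)
Definition top_inc (w : R -> A) (z : R * R) : R :=
  nm (tinv (Y0 (cl z.1)) * Y0 (cl z.2) + (w z.2 - w z.1)).

Definition top_dens w z := top_inc w z `^ q / `|z.2 - z.1| `^ (a + 1).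

Definition top_energy w := (\int[mu2]_(z in Q) (top_dens w z)%:E)%E.

(** The paths w for which Y0 + w is a lift, normalized at time 0 because constants
    in logK leave all increments unchanged. *)
Record shift_adm (w : R -> A) : Prop := ShiftAdm {
  shift_lin : forall t, lin K (w t);
  shift_clamp : forall t, w t = w (cl t);
  shift_0 : w 0 = 0;
  shift_cont : forall t (e : R), 0 < e -> exists2 r : R, 0 < r &
    forall s, `|s - t| < r -> nm (w s - w t) < e;
  shift_fin : (top_energy w < +oo)%E }.

Let clcl t : cl (cl t) = cl t. Proof. by rewrite clamp_id // clampP. Qed.

Lemma adm_logK w t : shift_adm w -> logK (w t).
Proof. by move=> aw; apply: lin_logK; exact: shift_lin. Qed.

Lemma adm_van w t : shift_adm w -> vanish N (w t).
Proof. by move=> aw; apply: (logK_van N0); exact: adm_logK. Qed.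

Lemma adm_tmeas w : shift_adm w -> tmeas w.
Proof.
move=> aw s sN; apply: eps_measurable => t e e0.
have [r r0 Hr] := shift_cont aw t e0; exists r => // u /Hr; apply: le_lt_trans.
have wN v : lev N (w v) = w v by apply: (logK_lev N0); exact: adm_logK.
rewrite -tcoefB; have [sz|sz] := eqVneq (size s) N.
  by have := level_norm_coord (w u - w t) sN; rewrite {1}sz.
have -> : w u - w t = lev N (w u - w t) by rewrite linearB /= !wN.
by rewrite tcoef_lev // (negPf sz) normr0 level_norm_ge0.
Qed.

Lemma top_dens_ge0 w z : 0 <= top_dens w z.
Proof. by rewrite divr_ge0 ?powR_ge0. Qed.

Lemma measurable_top_dens w : tmeas w -> measurable_fun setT (top_dens w).
Proof.
move=> mw; have -> : top_dens w = fun z => top_inc w z `^ q * `|z.2 - z.1| `^ (- (a + 1)).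
  by apply/funext => z; rewrite /top_dens powRN.
apply: measurable_funM; last exact: measurable_dist_pow.
apply: (measurableT_comp (measurable_powR q)); apply: tmeas_norm.
have mY := lift_tmeas HY0.
apply: tmeasD.
  apply: tmeasM.
    apply: (tmeas_tinv (f := fun z : R * R => Y0 (cl z.1))).
    exact: (tmeas_comp (h := fst) measurable_fst mY).
  exact: (tmeas_comp (h := snd) measurable_snd mY).
apply: tmeasD; first exact: (tmeas_comp (h := snd) measurable_snd mw).
by apply: tmeasN; exact: (tmeas_comp (h := fst) measurable_fst mw).
Qed.

Lemma top_energy_ge0 w : (0 <= top_energy w)%E.
Proof. by apply: integral_ge0 => z _; rewrite lee_fin top_dens_ge0. Qed.

Let B1 : R := \sum_(w : N.-bseq 'I_d | size w == N) 1.
Let B10 : 0 <= B1. Proof. by rewrite /B1 sumr_ge0. Qed.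

Definition energy Y := double_integral T (a + 1) (fun s t => nm (increment Y s t) `^ q).

Lemma energyE Y w k : (forall t, 0 <= t <= T -> Y t = Y0 t + (w t + k)) ->
  (forall t, vanish N (w t)) -> vanish N k -> energy Y = top_energy w.
Proof.
move=> HY vw vk; apply: eq_integral => z; rewrite inE => /inQ[z1 z2].
have c1 : tcoef (Y0 z.1) [::] = 1 by rewrite -(clamp_id z1).
have c2 : tcoef (Y0 z.2) [::] = 1 by rewrite -(clamp_id z2).
rewrite /top_dens /top_inc /increment (HY _ z1) (HY _ z2) (clamp_id z1) (clamp_id z2).
rewrite (inc_shift N0 c1 c2 (vanishD (vw _) vk) (vanishD (vw _) vk)).
by rewrite opprD addrACA subrr addr0.
Qed.

(** Equal cosets at each time give a difference in logK, and [path_lin] confines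
    its increments to lin. *)
Lemma lift_path Y : admissible K T alpha p X Y -> exists w k, [/\ shift_adm w, logK k &
  forall t, 0 <= t <= T -> Y t = Y0 t + (w t + k)].
Proof.
move=> HY; have GZ := lift_G HY.
have diff t : exists v, logK v /\ Y (cl t) = Y0 (cl t) + v.
  have [v Lv Yv] := coset_inj N0 HK (Y01 t) (G_coef0 (GZ t)) (etrans (lift_X HY0 t) (esym (lift_X
      HY t))).
  by exists v.
have [v0 Hv0] := choice diff; pose v t := v0 (cl t).
have Lv t : logK (v t) := (Hv0 (cl t)).1.
have Yv t : Y (cl t) = Y0 (cl t) + v t by rewrite -(clcl t); exact: (Hv0 (cl t)).2.
have vcl t : v (cl t) = v t by rewrite /v clcl.
have vv t := logK_van N0 (Lv t).
have cv t (e : R) : 0 < e -> exists2 r : R, 0 < r & forall s, `|s - t| < r -> nm (v s - v t) < e.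
  move=> e0; pose c : R := Num.min 1 (e / (2 * (B1 + 1))).
  have B11 : 0 < 2 * (B1 + 1) by rewrite mulr_gt0 // ltr_wpDl.
  have c0 : 0 < c by rewrite lt_min ltr01 divr_gt0.
  have pm := cc_path_pmetric HY; have pm0 := cc_path_pmetric HY0.
  have [r1 r10 H1] := pm_cont pm t c0; have [r2 r20 H2] := pm_cont pm0 t c0.
  exists (Num.min r1 r2) => [|s]; first by rewrite lt_min r10.
  rewrite lt_min => /andP[/H1 h1 /H2 h2].
  have E1 : tinv (Y (cl t)) * Y (cl s) = tinv (Y0 (cl t)) * Y0 (cl s) + (v s - v t).
    by rewrite !Yv inc_shift.
  have -> : v s - v t = tinv (Y (cl t)) * Y (cl s) - tinv (Y0 (cl t)) * Y0 (cl s).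
    by rewrite E1 [X in _ = X - _]addrC addrK.
  have small (Z : R -> A) : (forall t, G (Z (cl t))) -> cc_path Z s t < c ->
     nm (tinv (Z (cl t)) * Z (cl s)) <= B1 * (e / (2 * (B1 + 1))).
    move=> GG h; apply: le_trans (level_norm_cc N (G_inc (GG t) (GG s))) _.
    rewrite ler_wpM2l //; move: h; rewrite /cc_path cc_dist_sym // /cc_dist.
    set u := cc_norm _ => uc; have u0 : 0 <= u by exact: cc_norm_ge0.
    have c1 : c <= 1 by rewrite ge_min lexx.
    have ce : c <= e / (2 * (B1 + 1)) by rewrite ge_min lexx orbT.
    apply: le_trans (_ : u <= _); last by apply: le_trans ce; exact: ltW.
    by rewrite -[leRHS]expr1; apply: ler_wiXn2l => //; apply: le_trans c1; exact: ltW.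
  apply: le_lt_trans (level_normB _ _ _) _.
  apply: le_lt_trans (lerD (small Y GZ h1) (small Y0 GY h2)) _.
  have -> : B1 * (e / (2 * (B1 + 1))) + B1 * (e / (2 * (B1 + 1))) = e * (B1 / (B1 + 1)).
    by field; rewrite gt_eqF // ltr_wpDl.
  by rewrite -[ltRHS]mulr1 ltr_pM2l // ltr_pdivrMr ?ltr_wpDl // mul1r ltrDl.
pose w t := v t - v 0.
have lw t : lin K (w t).
  have /andP[t0 tT] := clampP t T0'.
  rewrite /w -(vcl t); apply: (path_lin N0 HK (T := cl t) (w := v)) => // u _ e e0.
  by have [r r0 Hr] := cv u e e0; exists r => // s _; exact: Hr.
have YE t : 0 <= t <= T -> Y t = Y0 t + (w t + v 0).
  by move=> tT; rewrite /w subrK -{1}(clamp_id tT) Yv (clamp_id tT).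
exists w, (v 0); split=> //; split=> //.
- by move=> t; rewrite /w vcl.
- by rewrite /w subrr.
- move=> t e e0; have [r r0 Hr] := cv t e e0; exists r => // s /Hr.
  by rewrite /w opprB addrA subrK.
- rewrite -(energyE YE) //; first exact: level_integral HY N N0.
  by move=> t; exact: vanishB.
Qed.

Definition shift_gap (w w' : R -> A) s t : R := nm ((w s - w' s) - (w t - w' t)).

Lemma shift_gap_pmetric w w' : shift_adm w -> shift_adm w' -> pmetric (shift_gap w w').
Proof.
move=> aw aw'; split.
- by move=> s t; exact: level_norm_ge0.
- by move=> s t; exact: level_norm_distC.
- by move=> s t u; rewrite /shift_gap -[_ - (w u - w' u)](subrKA (w t - w' t)); exact: level_normD.
- by move=> t; rewrite /shift_gap subrr level_norm0.
- move=> t e e0; have e20 : 0 < e / 2 by rewrite divr_gt0.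
  have [r1 r10 H1] := shift_cont aw t e20; have [r2 r20 H2] := shift_cont aw' t e20.
  exists (Num.min r1 r2) => [|s]; first by rewrite lt_min r10.
  rewrite lt_min => /andP[/H1 h1 /H2 h2]; rewrite /shift_gap sub4.
  apply: le_lt_trans (level_normB _ _ _) _.
  lra.
Qed.

(** [cc_dist_fibre] bounds the distance in the group by the distance of the cosets,
    which are those of Y0, and the level-N component, whose energy is finite. *)
Lemma adm_admissible w : shift_adm w -> admissible K T alpha p X (fun t => Y0 t + w t).
Proof.
move=> aw; pose Z t := Y0 (cl t) + w t.
have ZE t : 0 <= t <= T -> Y0 t + w t = Z t by move=> tT; rewrite /Z clamp_id.
have GZ t : G (Z t) by exact: (G_addr N0 (GY t) (adm_logK t aw)).
have [C C0 HC] := cc_dist_fibre N0 HK.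
have key s t : cc_dist (Z s) (Z t) <= C * (cc_path Y0 s t + top_inc w (s, t) `^ N%:R^-1).
  apply: le_trans (HC _ _ (GZ s) (GZ t)) _; rewrite ler_wpM2l //; apply: lerD.
    rewrite !(coset_eq N0 HK) //; try exact: adm_logK.
    exact: (qd_le_cc N0 HK).
  by rewrite /top_inc /Z inc_shift //; exact: adm_van.
have Ni0 : 0 <= (N%:R : R)^-1 by rewrite invr_ge0.
split; last first.
  move=> t; rewrite in_itv /= => tT; rewrite (coset_eq N0 HK).
  - by rewrite -{1}(clamp_id tT) (lift_X HY0) clamp_id.
  - by rewrite -(clamp_id tT).
  - exact: adm_logK.
split.
- by move=> t; rewrite in_itv /= => tT; rewrite ZE.
- move=> t; rewrite in_itv /= => tT e e0.
  pose M := C * (1 + (B1 + 1) `^ N%:R^-1).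
  have M0 : 0 <= M by rewrite mulr_ge0 // addr_ge0 // powR_ge0.
  have M1 : 0 < M + 1 by rewrite ltr_wpDl.
  pose h := e / (M + 1); have h0 : 0 < h by rewrite divr_gt0.
  have [r1 r10 H1] := pm_cont (cc_path_pmetric HY0) t h0.
  have [r2 r20 H2] := shift_cont aw t (exprn_gt0 N h0).
  exists (Num.min r1 r2) => [|s]; first by rewrite lt_min r10.
  rewrite in_itv /= lt_min => sT /andP[/H1 h1 /H2 h2]; rewrite !ZE //.
  apply: le_lt_trans (key s t) _; apply: (@le_lt_trans _ _ (M * h)); last first.
    by rewrite /h mulrCA -[ltRHS]mulr1 ltr_pM2l // ltr_pdivrMr // mul1r ltrDl.
  rewrite /M -mulrA ler_wpM2l // mulrDl mul1r; apply: lerD; first exact: ltW.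
  have cc0 : 0 <= cc_path Y0 s t by exact: cc_norm_ge0.
  have hN : cc_path Y0 s t ^+ N <= h ^+ N by rewrite lerXn2r ?nnegrE // ltW.
  have UB : top_inc w (s, t) <= (B1 + 1) * h ^+ N.
    rewrite mulrDl mul1r; apply: le_trans (level_normD _ _ _) _; apply: lerD.
      apply: le_trans (level_norm_cc N (G_inc (GY s) (GY t))) _.
      by rewrite ler_wpM2l.
    by rewrite /= level_norm_distC ltW.
  apply: le_trans (ler_powR2 Ni0 (level_norm_ge0 _ _) UB) _.
  rewrite powRM ?exprn_ge0 ?addr_ge0 // ?(ltW h0) // powR_natK // ltW //.
pose c := C `^ p * 2 `^ p; have c0 : 0 <= c by rewrite mulr_ge0 ?powR_ge0.
apply: (@le_lt_trans _ _ (\int[mu2]_(z in Q) (c * density (cc_path Y0) p (a + 1) z + c * top_dens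
    w z)%:E)%E).
  apply: ge0_le_integralW => z Qz; first by rewrite lee_fin divr_ge0 ?powR_ge0.
  have [z1 z2] := inQ Qz; rewrite lee_fin !ZE // -mulrDr /density /top_dens -mulrDl mulrA.
  rewrite ler_wpM2r ?invr_ge0 ?powR_ge0 //.
  apply: le_trans (ler_powR2 (ltW p0) (cc_norm_ge0 _) (key z.1 z.2)) _.
  rewrite powRM ?addr_ge0 ?powR_ge0 ?cc_norm_ge0 // /c -mulrA ler_wpM2l ?powR_ge0 //.
  apply: le_trans (powRD_le (ltW p0) (cc_norm_ge0 _) (powR_ge0 _ _)) _.
  by rewrite -powRrM [_^-1 * p]mulrC -surjective_pairing.
rewrite integral_finD //; last 5 first.
- exact: measurable_Q.
- exact: measurable_density (cc_path_pmetric HY0).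
- exact: measurable_top_dens (adm_tmeas aw).
- exact: density_ge0.
- exact: top_dens_ge0.
have I0 : (0 <= \int[mu2]_(z in Q) (density (cc_path Y0) p (a + 1) z)%:E)%E.
  by apply: integral_ge0 => z _; rewrite lee_fin density_ge0.
apply: lte_add_pinfty; apply: lte_mul_pinfty => //; rewrite ?lee_fin ?c0 //.
- exact: cc_path_integral HY0.
- exact: shift_fin aw.
Qed.

Definition mid (w w' : R -> A) t : A := 2^-1 *: (w t + w' t).

Lemma top_inc_mid w w' z : top_inc (mid w w') z = nm (2^-1 *:
  ((tinv (Y0 (cl z.1)) * Y0 (cl z.2) + (w z.2 - w z.1)) +
   (tinv (Y0 (cl z.1)) * Y0 (cl z.2) + (w' z.2 - w' z.1)))).
Proof.
congr nm; rewrite /mid; move: (tinv _ * _) (w z.2) (w z.1) (w' z.2) (w' z.1) => g x1 x2 x3 x4.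
by apply: tensorP => s _; rewrite !(tcoefD, tcoefN, tcoefZ); field.
Qed.

Lemma shift_gap_top_inc w w' s t : shift_gap w w' s t = nm
  ((tinv (Y0 (cl s)) * Y0 (cl t) + (w t - w s)) - (tinv (Y0 (cl s)) * Y0 (cl t) + (w' t - w' s))).
Proof.
rewrite /shift_gap level_norm_distC; congr nm.
move: (tinv _ * _) (w t) (w s) (w' t) (w' s) => g x1 x2 x3 x4.
by apply: tensorP => u _; rewrite !(tcoefD, tcoefN); ring.
Qed.

Lemma gap_pointwise (eps : R) : 0 < eps -> exists2 C : R, 0 < C & forall w w' z,
  density (shift_gap w w') q (a + 1) z + C * top_dens (mid w w') z <= (eps + C / 2) * top_dens w
      z + (eps + C / 2) * top_dens w' z.
Proof.
move=> eps0; have [C C0 HC] := @nm_convex R d N q eps q1 eps0.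
exists C; first exact: C0.
move=> w w' z; have k0 : 0 <= (`|z.2 - z.1| `^ (a + 1))^-1 by rewrite invr_ge0 powR_ge0.
rewrite /density shift_gap_top_inc /top_dens top_inc_mid; set x := tinv _ * _ + _; set y := tinv
    _ * _ + _.
have := ler_wpM2r k0 (HC x y); rewrite -/(top_inc w z) -/(top_inc w' z).
move: (_^-1) (nm (x - y) `^ q) (nm (2^-1 *: (x + y)) `^ q) (top_inc w z `^ q) (top_inc w' z `^ q)
    => k k1 k2 k3 k4.
have -> : k1 * k + C * (k2 * k) = (k1 + C * k2) * k by ring.
by have -> : (eps + C / 2) * (k3 * k) + (eps + C / 2) * (k4 * k) = (eps + C / 2) * (k3 + k4) * k by ring.
Qed.

Lemma mid_pointwise w w' z : top_dens (mid w w') z <= 2^-1 * top_dens w z + 2^-1 * top_dens w' z.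
Proof.
have q00 : 0 <= q by exact: ltW.
have h : top_inc (mid w w') z <= (top_inc w z + top_inc w' z) / 2.
  rewrite top_inc_mid level_normZ ger0_norm ?invr_ge0 // mulrC; apply: ler_wpM2r; first by
      rewrite invr_ge0.
  exact: level_normD.
have h2 := le_trans (ler_powR2 q00 (level_norm_ge0 _ _) h)
  (powR_mid (ltW q1) (level_norm_ge0 _ _) (level_norm_ge0 _ _)).
have k0 : 0 <= (`|z.2 - z.1| `^ (a + 1))^-1 by rewrite invr_ge0 powR_ge0.
apply: le_trans (ler_wpM2r k0 h2) _.
rewrite /top_dens; move: (top_inc w z `^ q) (top_inc w' z `^ q) (`|z.2 - z.1| `^ (a + 1))^-1 => x y k.
by have -> : (x + y) / 2 * k = 2^-1 * (x * k) + 2^-1 * (y * k) by field.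
Qed.

Lemma adm_mid w w' : shift_adm w -> shift_adm w' -> shift_adm (mid w w').
Proof.
move=> aw aw'; split.
- by move=> t; apply: linZ; apply: (linD N0 HK); exact: shift_lin.
- by move=> t; rewrite /mid -(shift_clamp aw) -(shift_clamp aw').
- by rewrite /mid (shift_0 aw) (shift_0 aw') addr0 scaler0.
- move=> t e e0; have [r1 r10 H1] := shift_cont aw t e0; have [r2 r20 H2] := shift_cont aw' t e0.
  exists (Num.min r1 r2) => [|s]; first by rewrite lt_min r10.
  rewrite lt_min => /andP[/H1 h1 /H2 h2]; rewrite /mid -scalerBr opprD addrACA level_normZ.
  rewrite ger0_norm ?invr_ge0 //.
  have := level_normD N (w s - w t) (w' s - w' t); lra.
- apply: (@le_lt_trans _ _ (\int[mu2]_(z in Q) (2^-1 * top_dens w z + 2^-1 * top_dens w' z)%:E)%E).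
    apply: ge0_le_integralW => z _; first by rewrite lee_fin top_dens_ge0.
    by rewrite lee_fin mid_pointwise.
  rewrite integral_finD ?invr_ge0 //; last 5 first.
  + exact: measurable_Q.
  + exact: measurable_top_dens (adm_tmeas aw).
  + exact: measurable_top_dens (adm_tmeas aw').
  + exact: top_dens_ge0.
  + exact: top_dens_ge0.
  by apply: lte_add_pinfty; apply: lte_mul_pinfty => //; rewrite ?lee_fin ?invr_ge0 //; exact: shift_fin.
Qed.

(** The energy of the midpoint of w and w' is at least m, so the defect of
    convexity between them is at most e1. *)
Lemma energy_gap (eps : R) : 0 < eps -> exists2 C : R, 0 < C & forall w w' (m e1 : R),
  shift_adm w -> shift_adm w' -> (forall v, shift_adm v -> (m%:E <= top_energy v)%E) ->
  (top_energy w <= (m + e1)%:E)%E -> (top_energy w' <= (m + e1)%:E)%E ->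
  (\int[mu2]_(z in Q) (density (shift_gap w w') q (a + 1) z)%:E <= (2 * eps * (m + e1) + C * e1)%:E)%E.
Proof.
move=> eps0; have [C C0 HC] := gap_pointwise eps0; exists C; first exact: C0.
move=> w w' m e1 aw aw' Hm hw hw'.
have ec : 0 <= eps + C / 2 by rewrite addr_ge0 ?divr_ge0 // ltW.
have mF v : shift_adm v -> measurable_fun setT (top_dens v) by move=> av; exact:
    measurable_top_dens (adm_tmeas av).
have mpsi := measurable_density q (a + 1) (shift_gap_pmetric aw aw').
have am := adm_mid aw aw'.
have le1 : (\int[mu2]_(z in Q) (1 * density (shift_gap w w') q (a + 1) z + C * top_dens (mid w
    w') z)%:E <=
    \int[mu2]_(z in Q) ((eps + C / 2) * top_dens w z + (eps + C / 2) * top_dens w' z)%:E)%E.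
  apply: ge0_le_integralW => z _; rewrite lee_fin mul1r; last exact: HC.
  by rewrite addr_ge0 ?density_ge0 // mulr_ge0 ?top_dens_ge0 // ltW.
have E1 := integral_finD measurable_Q mpsi (mF _ am) ler01 (ltW C0) (density_ge0 _ _ _) (top_dens_ge0 _).
have E2 := integral_finD measurable_Q (mF _ aw) (mF _ aw') ec ec (top_dens_ge0 _) (top_dens_ge0 _).
pose I := (\int[mu2]_(z in Q) (density (shift_gap w w') q (a + 1) z)%:E)%E.
have le2 : (1%:E * I + C%:E * top_energy (mid w w') <= (eps + C / 2)%:E * top_energy w + (eps + C
    / 2)%:E * top_energy w')%E.
  exact: le_trans (eq_lee (esym E1)) (le_trans le1 (eq_lee E2)).
move: le2; rewrite (mul1e I) -/I; move: (I) => {}I le2.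
have h : (I + (C * m)%:E <= ((eps + C / 2) * (m + e1) + (eps + C / 2) * (m + e1))%:E)%E.
  apply: (@le_trans _ _ (I + C%:E * top_energy (mid w w'))%E).
    by apply: leeD2l; rewrite EFinM; apply: lee_wpmul2l; [rewrite lee_fin ltW|exact: Hm].
  have ecE : (0 <= (eps + C / 2)%:E)%E by rewrite lee_fin.
  have k1 := lee_wpmul2l ecE hw; have k2 := lee_wpmul2l ecE hw'.
  rewrite -EFinM in k1; rewrite -EFinM in k2.
  exact: le_trans le2 (leeD k1 k2).
rewrite -leeBrDr // in h; apply: le_trans h _; rewrite -EFinB lee_fin.
by rewrite le_eqVlt; apply/orP; left; apply/eqP; field.
Qed.

(** [grr] between time 0, where w and w' agree, and time t. *)
Lemma sup_bound : exists2 C : R, 0 <= C & forall w w' (V : R), shift_adm w -> shift_adm w' -> 0 < V ->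
  (\int[mu2]_(z in Q) (density (shift_gap w w') q (a + 1) z)%:E <= V%:E)%E ->
  forall t, nm (w t - w' t) <= C * V `^ q^-1.
Proof.
have [C C0 HC] := @grr R q a (ltW q1) a1.
exists (C * (T `^ (a - 1)) `^ q^-1); first by rewrite mulr_ge0 ?powR_ge0.
move=> w w' V aw aw' V0 IV t; have qi : 0 <= q^-1 by rewrite invr_ge0 ltW.
have /andP[t0 tT] := clampP t T0'; rewrite (shift_clamp aw) (shift_clamp aw'); set b := cl t in t0 tT *.
have [b0|b0] := eqVneq b 0.
  by rewrite b0 (shift_0 aw) (shift_0 aw') subrr level_norm0 !mulr_ge0 ?powR_ge0.
have bp : 0 < b by rewrite lt_neqAle eq_sym b0.
have pm := shift_gap_pmetric aw aw'.
have : (\int[mu2]_(z in `[0%R, b[ `*` `[0%R, b[) (density (shift_gap w w') q (a + 1) z)%:E <= V%:E)%E.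
  apply: le_trans IV; apply: ge0_subset_integral.
  - by apply: measurableX; exact: measurable_itv.
  - exact: measurable_Q.
  - by apply/measurable_EFinP; apply: measurable_funTS; exact: measurable_density.
  - by move=> z _; rewrite lee_fin density_ge0.
  - by apply: setSX => s /=; rewrite !in_itv /= => /andP[-> /= h]; apply/ltW/(lt_le_trans h).
move/(HC _ _ _ _ pm bp V0); rewrite subr0 {1}/shift_gap (shift_0 aw) (shift_0 aw') subrr sub0r
    level_normN.
have a10 : 0 <= a - 1 by rewrite subr_ge0 ltW.
have h2 := ler_powR2 qi (mulr_ge0 (powR_ge0 _ _) (ltW V0)) (ler_wpM2r (ltW V0) (ler_powR2 a10 t0 tT)).
rewrite (powRM q^-1 (powR_ge0 T (a - 1)) (ltW V0)) in h2.
have h3 := ler_wpM2l C0 h2.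
by move=> h; apply: le_trans h _; rewrite -[leRHS]mulrA.
Qed.

Lemma adm0 : shift_adm (fun _ => 0).
Proof.
split=> //.
- by move=> t; exact: lin0.
- by move=> t e e0; exists 1 => // s _; rewrite subrr level_norm0.
rewrite -(@energyE Y0 (fun _ => 0) 0); first exact: level_integral HY0 N N0.
- by move=> t _; rewrite !addr0.
- by move=> t s _ _; rewrite tcoef0.
- by move=> s _ _; rewrite tcoef0.
Qed.

(** All properties that make up [shift_adm], except finiteness of the energy, pass
    to uniform limits. *)
Lemma adm_limit (w : nat -> R -> A) : (forall n, shift_adm (w n)) ->
  (forall e : R, 0 < e -> exists M, forall n m, (M <= n)%N -> (M <= m)%N ->
     forall t, nm (w n t - w m t) < e) ->
  exists u : R -> A, [/\ forall t, lin K (u t), forall t, u t = u (cl t), u 0 = 0,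
    forall t (e : R), 0 < e -> exists2 r : R, 0 < r & forall s, `|s - t| < r -> nm (u s - u t) < e &
    forall e : R, 0 < e -> exists M, forall n, (M <= n)%N -> forall t, nm (u t - w n t) < e].
Proof.
move=> aw cw; have wN n t : lev N (w n t) = w n t.
  by apply: (logK_lev N0); exact: adm_logK.
have lim t : exists x, lev N x = x /\
    forall e : R, 0 < e -> exists M, forall n, (M <= n)%N -> nm (x - w n t) < e.
  have [e e0|x xN Hx] := tensor_complete (wN ^~ t); last by exists x.
  by have [M HM] := cw e e0; exists M => n m n1 m1; exact: HM.
have [x Hx] := choice lim; pose u t := x (cl t).
have unif (e : R) : 0 < e -> exists M, forall n, (M <= n)%N -> forall t, nm (u t - w n t) < e.
  move=> e0; have e20 : 0 < e / 2 by rewrite divr_gt0.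
  have [M HM] := cw _ e20; exists M => n Mn t.
  have [M2 HM2] := (Hx (cl t)).2 _ e20.
  have h1 := HM2 (maxn M M2) (leq_maxr _ _); have h2 := HM (maxn M M2) n (leq_maxl _ _) Mn (cl t).
  rewrite (shift_clamp (aw n)) -(subrKA (w (maxn M M2) (cl t))).
  by apply: le_lt_trans (level_normD _ _ _) _; rewrite /u; lra.
exists u; split=> //.
- move=> t; apply: (lin_closed N0 HK); first exact: (Hx (cl t)).1.
  move=> e e0; have [M HM] := unif e e0; exists (w M t); first exact: shift_lin (aw M) t.
  exact: HM.
- by move=> t; rewrite /u clcl.
- apply: nm_eq0; first exact: (Hx (cl 0)).1.
  apply/eqP; rewrite eq_le level_norm_ge0 andbT; apply/ler_addgt0Pr => e e0.
  have [M HM] := unif e e0; have := HM M (leqnn _) 0.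
  by rewrite (shift_0 (aw M)) subr0 add0r => /ltW.
- move=> t e e0; have e30 : 0 < e / 3 by rewrite divr_gt0.
  have [M HM] := unif _ e30; have [r r0 Hr] := shift_cont (aw M) t e30.
  exists r => // s /Hr h; have h1 := HM M (leqnn _) s; have h2 := HM M (leqnn _) t.
  rewrite -(subrKA (w M s)); apply: le_lt_trans (level_normD _ _ _) _.
  rewrite -(subrKA (w M t) (w M s)); have h3 := level_normD N (w M s - w M t) (w M t - u t).
  rewrite level_norm_distC in h2; lra.
Qed.

Lemma top_dens_lower (w : nat -> R -> A) (u : R -> A) z :
  (forall e : R, 0 < e -> exists M, forall n, (M <= n)%N -> forall t, nm (u t - w n t) < e) ->
  ((top_dens u z)%:E <= limn_einf (fun n => (top_dens (w n) z)%:E))%E.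
Proof.
move=> unif; apply: limn_einf_ge => c; rewrite lte_fin => cF.
have [c0|c0] := ltP c 0.
  by exists 0%N => n _; rewrite lee_fin; exact: le_trans (ltW c0) (top_dens_ge0 _ _).
move: cF; rewrite /top_dens; set k := `|_| `^ _ => cF.
have k0 : 0 < k.
  rewrite lt_neqAle powR_ge0 andbT eq_sym; apply/eqP => k0.
  by move: cF; rewrite k0 invr0 mulr0 ltNge c0.
have q00 : 0 <= q by exact: ltW.
have qi0 : 0 < q^-1 by rewrite invr_gt0.
have cU : c * k < top_inc u z `^ q by rewrite -ltr_pdivlMr.
have ck : 0 <= c * k by rewrite mulr_ge0 // ltW.
have cU' : (c * k) `^ q^-1 < top_inc u z.
  have := gt0_ltr_powR qi0 (_ : _ \in _) (_ : _ \in _) cU; rewrite !nnegrE => /(_ ck (powR_ge0 _ _)).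
  by rewrite -[_ `^ q `^ _]powRrM divff ?powRr1 // ?level_norm_ge0 // gt_eqF.
pose e := (top_inc u z - (c * k) `^ q^-1) / 2; have e0 : 0 < e by rewrite divr_gt0 // subr_gt0.
have [M HM] := unif e e0; exists M => n Mn; rewrite lee_fin (ler_pdivlMr _ _ k0).
have h : (c * k) `^ q^-1 <= top_inc (w n) z.
  have h1 := HM n Mn z.1; have h2 := HM n Mn z.2.
  have : top_inc u z <= top_inc (w n) z + (nm (u z.2 - w n z.2) + nm (u z.1 - w n z.1)).
    apply: le_trans (_ : top_inc (w n) z + nm ((u z.2 - w n z.2) - (u z.1 - w n z.1)) <= _); last first.
      by rewrite lerD2l; exact: level_normB.
    apply: le_trans (level_normD _ _ _); rewrite le_eqVlt; apply/orP; left; apply/eqP; congr nm.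
    move: (tinv _ * _) (u z.2) (u z.1) (w n z.2) (w n z.1) => g x1 x2 x3 x4.
    by apply: tensorP => s _; rewrite !(tcoefD, tcoefN); ring.
  rewrite /e in h1 h2; lra.
apply: le_trans (ler_powR2 q00 (powR_ge0 _ _) h).
by rewrite -powRrM mulVf ?powRr1 // gt_eqF.
Qed.

Lemma top_energy_fatou (w : nat -> R -> A) (u : R -> A) (m : R) : (forall n, shift_adm (w n)) ->
  (forall e : R, 0 < e -> exists M, forall n, (M <= n)%N -> forall t, nm (u t - w n t) < e) ->
  (forall e : R, 0 < e -> exists M, forall n, (M <= n)%N -> (top_energy (w n) <= (m + e)%:E)%E) ->
  (top_energy u <= m%:E)%E.
Proof.
move=> aw unif Ew; apply: (@le_trans _ _ (\int[mu2]_(z in Q) limn_einf (fun n => (top_dens (w n)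
    z)%:E))%E).
  apply: ge0_le_integralW => z _; first by rewrite lee_fin top_dens_ge0.
  exact: top_dens_lower.
have fat := fatou mu2 measurable_Q (f := fun n z => (top_dens (w n) z)%:E).
apply: le_trans (fat _ _) _.
- by move=> n; apply/measurable_EFinP; apply: measurable_funTS; exact: measurable_top_dens
    (adm_tmeas (aw n)).
- by move=> n z _; rewrite lee_fin top_dens_ge0.
exact: limn_einf_le Ew.
Qed.

(** [energy_gap] and [sup_bound] make a minimizing sequence uniformly Cauchy, and
    its limit is a minimizer by [top_energy_fatou]. *)
Lemma minimizer : exists u (m : R), [/\ shift_adm u, top_energy u = m%:E & forall v, shift_adm v
    -> (m%:E <= top_energy v)%E].
Proof.
pose S := [set x : R | exists2 v, shift_adm v & top_energy v = x%:E].
have S0 : S !=set0.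
  exists (fine (top_energy (fun=> 0))); exists (fun=> 0); first exact: adm0.
  by rewrite fineK // ge0_fin_numE ?top_energy_ge0 //; exact: shift_fin adm0.
have lbS : has_lbound S.
  by exists 0 => x [v _ vx]; rewrite -lee_fin -vx top_energy_ge0.
have iS : has_inf S by [].
pose m := inf S.
have mE v : shift_adm v -> (m%:E <= top_energy v)%E.
  move=> av; have vf : top_energy v \is a fin_num by rewrite ge0_fin_numE ?top_energy_ge0 //;
      exact: shift_fin av.
  by rewrite -(fineK vf) lee_fin; apply: ge_inf => //; exists v => //; rewrite fineK.
have m0 : 0 <= m by apply: lb_le_inf => // x [v _ vx]; rewrite -lee_fin -vx top_energy_ge0.
have seqn n : exists v, shift_adm v /\ (top_energy v <= (m + n.+1%:R^-1)%:E)%E.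
  have n0 : 0 < (n.+1%:R : R)^-1 by rewrite invr_gt0.
  have [x [v av vx] h] := inf_adherent n0 iS.
  by exists v; split=> //; rewrite vx lee_fin ltW.
have [w Hw] := choice seqn; have aw n := (Hw n).1.
have inv_small (e : R) : 0 < e -> exists M, forall n, (M <= n)%N -> (n.+1%:R : R)^-1 <= e.
  move=> e0; exists (Num.truncn e^-1) => n nM; rewrite -[leRHS]invrK lef_pV2 ?posrE ?invr_gt0 //.
  apply/ltW/(lt_le_trans (truncnS_gt _)); by rewrite ler_nat ltnS.
have [C C0 HC] := sup_bound.
have cw (e : R) : 0 < e -> exists M, forall n k, (M <= n)%N -> (M <= k)%N ->
    forall t, nm (w n t - w k t) < e.
  move=> e0; have C1 : 0 < C + 1 by rewrite ltr_wpDl.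
  pose V := (e / (C + 1)) `^ q; have ec : 0 < e / (C + 1) by rewrite divr_gt0.
  have V0 : 0 < V by rewrite powR_gt0.
  have m1 : 0 < m + 1 by rewrite ltr_wpDl.
  (* with e1 <= 1 the first term of the gap is at most V / 2 *)
  have [D D0 HD] := energy_gap (eps := V / (4 * (m + 1))) ltac:(by rewrite divr_gt0 // mulr_gt0).
  pose e1 := Num.min 1 (V / (2 * D)).
  have e10 : 0 < e1 by rewrite lt_min ltr01 divr_gt0 // mulr_gt0.
  have [M HM] := inv_small e1 e10; exists M => n k Mn Mk t.
  have up j : (M <= j)%N -> (top_energy (w j) <= (m + e1)%:E)%E.
    move=> Mj; apply: le_trans (Hw j).2 _; rewrite lee_fin lerD2l; exact: HM.
  have gapI := HD (w n) (w k) m e1 (aw n) (aw k) mE (up n Mn) (up k Mk).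
  have IV : 2 * (V / (4 * (m + 1))) * (m + e1) + D * e1 <= V.
    have h1 : e1 <= 1 by rewrite ge_min lexx.
    have h2 : D * e1 <= V / 2.
      have : e1 <= V / (2 * D) by rewrite ge_min lexx orbT.
      by rewrite ler_pdivlMr ?mulr_gt0 //; lra.
    have h3 : 2 * (V / (4 * (m + 1))) * (m + e1) <= 2 * (V / (4 * (m + 1))) * (m + 1).
      by rewrite ler_wpM2l ?lerD2l // mulr_ge0 // divr_ge0 ?mulr_ge0 // ltW.
    have h4 : 2 * (V / (4 * (m + 1))) * (m + 1) = V / 2 by field; rewrite gt_eqF.
    lra.
  have := HC (w n) (w k) V (aw n) (aw k) V0 (le_trans gapI _) t; rewrite lee_fin => /(_ IV) h.
  apply: le_lt_trans h _; rewrite /V -powRrM divff ?gt_eqF // powRr1 ?(ltW ec) //.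
  by rewrite mulrCA -[ltRHS]mulr1 ltr_pM2l // ltr_pdivrMr // mul1r ltrDl.
have [u [u1 u2 u3 u4 u5]] := adm_limit aw cw.
have Eu : (top_energy u <= m%:E)%E.
  apply: (top_energy_fatou aw u5) => e e0; have [M HM] := inv_small e e0; exists M => n Mn.
  by apply: le_trans (Hw n).2 _; rewrite lee_fin lerD2l; exact: HM.
have au : shift_adm u by split=> //; apply: le_lt_trans Eu _; exact: ltry.
by exists u, m; split=> //; apply/eqP; rewrite eq_le Eu mE.
Qed.

End Admissible.

(** * Minimal lifts *)

Section Minimal.
Context {R : realType} {d N : nat}.
Local Notation A := (tensor R d N).
Variables (K : set A) (T alpha p : R) (X : R -> set A).
Hypotheses (N0 : (0 < N)%N) (HK : closed_subgroup (expW N) K).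
Hypotheses (T0 : 0 < T) (p1 : 1 < p) (a1 : 1 < alpha * p) (aN : alpha * N%:R <= 1).
Local Notation a := (alpha * p).
Local Notation q := (p / N%:R).

Let T0' : 0 <= T := ltW T0.
Let p0 : 0 < p := lt_trans ltr01 p1.
Let q0 : 0 < q. Proof. by rewrite divr_gt0 // ltr0n. Qed.

Definition level_energy i (Y : R -> A) := double_integral T (a + 1)
  (fun s t => level_norm i (increment Y s t) `^ (p / i%:R)).

Lemma level_energy_ge0 i Y : (0 <= level_energy i Y)%E.
Proof. by apply: integral_ge0 => z _; rewrite lee_fin divr_ge0 ?powR_ge0. Qed.

(** The terms of the Sobolev norm that all lifts share. *)
Definition lower_norm Y := (\sum_(1 <= i < N) poweR (level_energy i Y) (i%:R / p))%E.

Lemma sobolev_normE Y : sobolev_norm T alpha p Y =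
  (lower_norm Y + poweR (level_energy N Y) (N%:R / p))%E.
Proof. by rewrite /sobolev_norm big_nat_recr. Qed.

Section FromLift.
Variable Y0 : R -> A.
Hypothesis HY0 : admissible K T alpha p X Y0.

Lemma lower_norm_fin : lower_norm Y0 \is a fin_num.
Proof.
apply/sum_fin_numP => i; rewrite mem_index_iota => /andP[i0 _] _; apply: fin_num_poweR.
rewrite ge0_fin_numE; last exact: level_energy_ge0.
exact: (level_integral T0 p1 HY0 i0).
Qed.

Lemma level_energyE i Y w k : (forall t, 0 <= t <= T -> Y t = Y0 t + (w t + k)) ->
  (forall t, vanish N (w t)) -> vanish N k -> (i < N)%N -> level_energy i Y = level_energy i Y0.
Proof.
move=> HY vw vk iN; apply: eq_integral => z; rewrite inE => /inQ[z1 z2].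
have c t : 0 <= t <= T -> tcoef (Y0 t) [::] = 1.
  by move=> tT; rewrite -(clamp_id tT); apply: G_coef0; exact: (lift_G T0 HY0 t).
have incE : level_norm i (increment Y z.1 z.2) = level_norm i (increment Y0 z.1 z.2).
  apply: level_norm_lev; rewrite /increment (HY _ z1) (HY _ z2).
  rewrite (inc_shift N0 (c _ z1) (c _ z2) (vanishD (vw _) vk) (vanishD (vw _) vk)) linearD /=.
  rewrite [X in _ + X](@lev_vanish _ _ _ _ N) ?addr0 //.
  by apply: vanishB; exact: vanishD.
by rewrite incE.
Qed.

Lemma lower_normE Y w k : (forall t, 0 <= t <= T -> Y t = Y0 t + (w t + k)) ->
  (forall t, vanish N (w t)) -> vanish N k -> lower_norm Y = lower_norm Y0.
Proof.
move=> HY vw vk; apply: eq_big_nat => i /andP[i0 iN].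
by rewrite (level_energyE HY vw vk iN).
Qed.

(** The Sobolev norm is an increasing function of the energy.  Two minimizers have
    equal energy m, and [energy_gap] with excess 0 leaves no distance between
    them, as its first term can be made arbitrarily small. *)
Lemma minimal_from_lift : unique_minimal_lift K T alpha p X.
Proof.
have [u [m [au Eu mE]]] := minimizer N0 HK T0 p1 a1 HY0 aN.
have Np : 0 < N%:R / p by rewrite divr_gt0 // ltr0n.
pose Y t := Y0 t + u t.
have aY : admissible K T alpha p X Y := adm_admissible N0 HK T0 p1 HY0 au.
have vu t : vanish N (u t) := adm_van N0 t au.
have v0 : vanish N (0 : A) by move=> s _ _; rewrite tcoef0.
have YE t : 0 <= t <= T -> Y t = Y0 t + (u t + 0) by rewrite addr0.
have sY : sobolev_norm T alpha p Y = (lower_norm Y0 + poweR m%:E (N%:R / p))%E.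
  have EY : level_energy N Y = top_energy T alpha p Y0 u := energyE N0 T0 HY0 YE vu v0.
  by rewrite sobolev_normE (lower_normE YE vu v0) EY Eu.
have sZ Z : admissible K T alpha p X Z -> exists w k, [/\ shift_adm K T alpha p Y0 w, logK K k,
    forall t, 0 <= t <= T -> Z t = Y0 t + (w t + k) &
    sobolev_norm T alpha p Z = (lower_norm Y0 + poweR (top_energy T alpha p Y0 w) (N%:R / p))%E].
  move=> aZ; have [w [k [aw Lk ZE]]] := lift_path N0 HK T0 p1 HY0 aZ.
  exists w, k; split=> //.
  have vw t : vanish N (w t) := adm_van N0 t aw; have vk := logK_van N0 Lk.
  have EZ : level_energy N Z = top_energy T alpha p Y0 w := energyE N0 T0 HY0 ZE vw vk.
  by rewrite sobolev_normE (lower_normE ZE vw vk) EZ.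
have m0 : 0 <= m by rewrite -lee_fin -Eu top_energy_ge0.
exists Y.
  split; first exact: aY.
  move=> Z /sZ[w [k [aw Lk ZE sobZ]]].
  rewrite sY sobZ.
  have := mE w aw; have := top_energy_ge0 T alpha p Y0 w; move: (top_energy T alpha p Y0 w) => e e0 me.
  apply: leeD2l; apply: (gt0_ler_poweR (ltW Np)) me.
    by rewrite in_itv /= leey andbT lee_fin.
  by rewrite in_itv /= leey andbT.
move=> Z [aZ minZ]; have [w [k [aw Lk ZE sobZ]]] := sZ Z aZ.
have := minZ Y aY; rewrite sY sobZ leeD2lE; last exact: lower_norm_fin.
have Ew : top_energy T alpha p Y0 w \is a fin_num by rewrite ge0_fin_numE ?top_energy_ge0 //;
    exact: shift_fin aw.
rewrite -(fineK Ew) !poweR_EFin lee_fin => pw.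
have Ewm : (top_energy T alpha p Y0 w <= (m + 0)%:E)%E.
  rewrite addr0 -(fineK Ew) lee_fin leNgt; apply/negP => mlt.
  have := gt0_ltr_powR Np _ _ mlt; rewrite !nnegrE => /(_ m0 (le_trans m0 (ltW mlt))).
  by rewrite ltNge pw.
have Eum : (top_energy T alpha p Y0 u <= (m + 0)%:E)%E by rewrite addr0 Eu.
have [C C0 HC] := sup_bound K N0 T0 p1 a1 Y0 aN.
have wu t : w t = u t.
  apply/eqP; rewrite -subr_eq0; apply/eqP; apply: nm_eq0.
    by rewrite linearB /= (logK_lev N0 (adm_logK t aw)) (logK_lev N0 (adm_logK t au)).
  apply/eqP; rewrite eq_le level_norm_ge0 andbT; apply/ler_addgt0Pr => e e0; rewrite add0r.
  have C1 : 0 < C + 1 by rewrite ltr_wpDl.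
  have ec : 0 < e / (C + 1) by rewrite divr_gt0.
  (* the bound of sup_bound is then C (e / (C + 1)) <= e *)
  pose V := (e / (C + 1)) `^ q; have V0 : 0 < V by rewrite powR_gt0.
  have m1 : 0 < m + 1 by rewrite ltr_wpDl.
  have eps0 : 0 < V / (2 * (m + 1)) by rewrite divr_gt0 // mulr_gt0.
  have [D D0 HD] := energy_gap N0 HK T0 p1 a1 HY0 aN eps0.
  have gapI := HD w u m 0 aw au mE Ewm Eum.
  have IV : 2 * (V / (2 * (m + 1))) * (m + 0) + D * 0 <= V.
    have -> : 2 * (V / (2 * (m + 1))) * (m + 0) + D * 0 = V * (m / (m + 1)) by field; rewrite gt_eqF.
    by rewrite -[leRHS]mulr1 ler_wpM2l ?(ltW V0) // ler_pdivrMr // mul1r lerDl.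
  have := HC w u V aw au V0 (le_trans gapI _) t; rewrite lee_fin => /(_ IV) h.
  apply: le_trans h _; rewrite /V -powRrM divff ?gt_eqF // powRr1 ?(ltW ec) //.
  by rewrite mulrCA -[leRHS]mulr1 ler_wpM2l ?(ltW e0) // ler_pdivrMr // mul1r lerDl.
move=> s t; rewrite !in_itv /= => sT tT.
have c r : 0 <= r <= T -> tcoef (Y0 r) [::] = 1.
  by move=> rT; rewrite -(clamp_id rT); apply: G_coef0; exact: (lift_G T0 HY0 r).
have vk := logK_van N0 Lk.
rewrite /increment /Y (ZE _ sT) (ZE _ tT) !wu.
rewrite (inc_shift N0 (c _ sT) (c _ tT) (vanishD (vu _) vk) (vanishD (vu _) vk)).
rewrite (inc_shift N0 (c _ sT) (c _ tT) (vu _) (vu _)).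
by rewrite opprD addrACA subrr addr0.
Qed.

End FromLift.
End Minimal.

(** * Lifts of Euclidean paths *)

Section EuclideanPaths.
Context {R : realType} {d : nat}.

Lemma expW_closed_subgroup N : (0 < N)%N -> closed_subgroup (@expW R d N N) (expW N).
Proof.
move=> N0; split=> //.
- by exists 0; [exact: mem0v|exact: texp0].
- move=> _ _ [u /= uW <-] [v /= vW <-]; exists (u + v); first exact: memvD.
  by rewrite !texp_WN ?memvD // top_mul1 //; exact: W_vanish.
- move=> _ [u /= uW <-]; exists (- u); first by rewrite /= rpredN.
  by rewrite !texp_WN ?rpredN // tinv_top //; exact: W_vanish.
Qed.

Lemma level1B N (x y : 'rV[R]_d) : level1 (x - y) = level1 x - level1 y :> tensor R d N.
Proof.
by rewrite /level1 -sumrB; apply: eq_bigr => j _; rewrite !mxE scalerBl.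
Qed.

Lemma G_level1 N (x : 'rV[R]_d) : Ggroup (texp (level1 x) : tensor R d N).
Proof.
exists (level1 x) => //=; apply: (@W_lie _ _ _ 1) => //.
apply: memv_suml => j _; apply: memvZ.
by apply: memv_span; apply: map_f; rewrite mem_enum.
Qed.

Local Notation A2 := (tensor R d 2).

(** Both sides have the same component y - x at level 1, and an element of G^2
    that is trivial up to level 1 lies in 1 + W_2. *)
Lemma step2_inc (x y : 'rV[R]_d) : exists2 w, w \in @W R d 2 2 &
  texp (level1 (y - x)) = tinv (texp (level1 x)) * texp (level1 y) + w.
Proof.
pose e z : A2 := texp (level1 z); have Ge z : Ggroup (e z) := G_level1 2 z.
have c z : tcoef (e z) [::] = 1 := G_coef0 (Ge z).
pose g := tinv (e x) * e y; have Gg : Ggroup g by exact: G_inc.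
pose r := tinv g * e (y - x); have Gr : Ggroup r by exact: G_inc.
have l1 z : lev 1 (e z) = level1 z.
  apply: tensorP => s sN; rewrite tcoef_lev // tcoef_texp_level1 // -[level1 z]expr1.
  by rewrite tcoef_level1_X //; case: eqP => [->|_]; rewrite ?mul0r // factS fact0 muln1 invr1.
have l0 h : Ggroup h -> lev 0 h = 1 :> A2.
  move=> Gh; apply: tensorP => s sN; rewrite tcoef_lev // tcoef_one // -size_eq0.
  by case: eqP => // /size0nil ->; exact: G_coef0.
have lM h k : Ggroup h -> Ggroup k -> lev 1 (h * k) = lev 1 h + lev 1 k :> A2.
  move=> Gh Gk; rewrite lev_mul big_ord_recl big_ord1 /= !l0 // mul1r mulr1.
  by rewrite addrC.
have lV h : Ggroup h -> lev 1 (tinv h) = - lev 1 h :> A2.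
  move=> Gh; apply/eqP; rewrite -addr_eq0 -lM //; last exact: G_inv.
  rewrite tmulVl ?G_coef0 //; apply/eqP/tensorP => s sN.
  by rewrite tcoef_lev // tcoef0 tcoef_one //; case: s {sN} => //= z s; case: ifP.
have vr : vanish 2 (r - 1).
  apply: vanish_lev => -[|[|i]] // _; rewrite linearB /=.
    by rewrite !l0 ?subrr //; exact: G_one.
  have -> : lev 1 (1 : A2) = 0.
    by apply: tensorP => s sN; rewrite tcoef_lev // tcoef0 tcoef_one //; case: s {sN} => //= z s;
        case: ifP.
  rewrite subr0 lM //; last exact: G_inv.
  rewrite lV // lM //; last exact: G_inv.
  by rewrite lV // !l1 level1B [- level1 x + _]addrC addNr.
have [w [wl vw] rw] := G_vanish Gr vr.
have wW : w \in @W R d 2 2.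
  have <- : lev 2 w = w; last exact: lev_lie.
  apply: tensorP => s sN; rewrite tcoef_lev //; case: eqP => // /eqP s2.
  by rewrite vw // ltn_neqAle s2.
exists w => //; rewrite -/(e _) -/g.
have -> : e (y - x) = g * r by rewrite /r mulrA tmulV ?mul1r // G_coef0.
by rewrite rw texp_top // mulrDr mulr1 top_mulr // G_coef0.
Qed.

(** The segment from 0 to y - x ends in the coset of exp(x)^-1 exp(y). *)
Lemma step2_dist (x y : 'rV[R]_d) :
  quotient_dist (coset (expW 2) (texp (level1 x : A2))) (coset (expW 2) (texp (level1 y : A2)))
    <= eucl_dist x y.
Proof.
have [w wW E] := step2_inc x y.
apply: le_trans (qd_le _ (expW_closed_subgroup _) (G_level1 2 x) (G_level1 2 y) (w := w) _) _ => //.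
  by split=> //; exists w => //; rewrite texp_WN.
by rewrite -E; apply: cc_norm_le; exact: reach_line.
Qed.

Lemma step2_sobolev (T alpha p : R) (X : R -> 'rV[R]_d) : 0 < p ->
  sobolev (@eucl_dist R d) setT T alpha p X ->
  sobolev (@quotient_dist R d 2) (quotient (expW 2)) T alpha p
    (fun t => coset (expW 2) (texp (level1 (X t)))).
Proof.
move=> p0 [_ cX fX]; have HK := @expW_closed_subgroup 2 isT; split.
- by move=> t _; exists (texp (level1 (X t))) => //; exact: G_level1.
- move=> t tT e e0; have [r r0 H] := cX t tT e e0; exists r => // s sT st.
  exact: le_lt_trans (step2_dist _ _) (H s sT st).
apply: le_lt_trans fX; apply: ge0_le_integralW => z _.
  by rewrite lee_fin divr_ge0 ?powR_ge0.
rewrite lee_fin; apply: ler_wpM2r; first by rewrite invr_ge0 powR_ge0.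
apply: ler_powR2; [exact: ltW|apply: qd_ge0 => //; exact: G_level1|exact: step2_dist].
Qed.

End EuclideanPaths.

Theorem proposition3p7 (R : realType) (d : nat) (T alpha p : R)
    (hT : 0 < T) (halpha : 0 < alpha < 1) (hp : 1 < p) (halphap : p^-1 < alpha) :
  (forall (K : set (tensor R d (Num.truncn alpha^-1)))
          (X : R -> set (tensor R d (Num.truncn alpha^-1))),
     closed_subgroup (expW (Num.truncn alpha^-1)) K ->
     sobolev (@quotient_dist R d _) (quotient K) T alpha p X ->
     (alpha^-1 \is a Num.nat -> exists Y, admissible K T alpha p X Y) ->
     unique_minimal_lift K T alpha p X)
  /\
  (3^-1 < alpha < 2^-1 ->
   forall X : R -> 'rV[R]_d,
     sobolev (@eucl_dist R d) setT T alpha p X ->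
     let K : set (tensor R d 2) := expW 2 in
     unique_minimal_lift K T alpha p
       (fun t => coset K (texp (level1 (X t))))).
Proof.
have [a0 a1] := andP halpha; have p0 : 0 < p := lt_trans ltr01 hp.
have ap : 1 < alpha * p by rewrite -ltr_pdivrMr // mul1r.
split=> [K X|/andP[_ a2] X SX K].
  have ia : 1 < alpha^-1 by rewrite invf_gt1.
  have tN : (Num.truncn alpha^-1)%:R <= alpha^-1 by rewrite truncn_le // ltW // invr_gt0.
  have N0 : (0 < Num.truncn alpha^-1)%N by rewrite truncn_gt0 ltW.
  have Nnat : (Num.truncn alpha^-1)%:R = alpha^-1 -> alpha^-1 \is a Num.nat by move=> <-.
  move: (Num.truncn alpha^-1) K X tN N0 Nnat => N K X tN N0 Nnat HK SX HY.
  have aN : alpha * N%:R <= 1 by rewrite mulrC -ler_pdivlMr // mul1r.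
  have [Y aY] : exists Y, admissible K T alpha p X Y.
    have [/Nnat//|ne] := eqVneq N%:R alpha^-1.
    apply: (lift_exists N0 HK hT hp ap _ SX).
    by rewrite mulrC -ltr_pdivlMr // mul1r lt_neqAle ne.
  exact: (minimal_from_lift N0 HK hT hp ap aN aY).
have HK := @expW_closed_subgroup R d 2 isT.
have aN : alpha * 2%:R < 1 by rewrite -ltr_pdivlMr // mul1r.
have [Y aY] := lift_exists (isT : (0 < 2)%N) HK hT hp ap aN (step2_sobolev p0 SX).
exact: (minimal_from_lift (isT : (0 < 2)%N) HK hT hp ap (ltW aN) aY).
Qed.
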